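(* Let $0<p<1$, $0<q<\infty$, and let $u,v,w$ be weights on $(0,\infty)$ with $\lim_{t\to\infty}\underline{v}(t,\infty)=0$. Assume that $u$ is such that $U$ is admissible and that the measure $w(t)\,dt$ is non-degenerate with respect to $U^{q/p}$. Consider the inequality $$\left(\int_0^{\infty}\left(\frac{1}{U(t)}\int_0^t\left(\int_s^{\infty}h(z)\,dz\right)^p u(s)\,ds\right)^{\frac{q}{p}}w(t)\,dt\right)^{\frac1q}\le c\int_0^\infty h(z)v(z)\,dz. \qquad ( * )$$ (i) Let $1\le q<\infty$. Then $( * )$ holds for every $h\in\mathcal M^+(0,\infty)$ (with some finite constant $c$ independent of $h$) if and only if $$I_1:=\sup_{x\in(0,\infty)}\left(\int_0^\infty \mathcal U(x,s)^{\frac qp}w(s)\,ds\right)^{\frac1q}\left(\int_{[0,\infty)}\mathcal U(t,x)^{\frac{p^*}{p}}\,d\left(-\underline v(t-,\infty)^{p^*}\right)\right)^{\frac1{p^*}}<\infty .$$ Moreover, the best constant $c$ in $( * )$ satisfies $c\approx I_1$. (ii) Let $0<q<1$. Then $( * )$ holds for every $h\in\mathcal M^+(0,\infty)$ (with some finite constant $c$ independent of $h$) if and only if $$I_2:=\left(\int_0^\infty\left(\int_0^\infty \mathcal U(x,s)^{\frac qp}w(s)\,ds\right)^{q^*}\left(\int_{[0,\infty)}\mathcal U(t,x)^{\frac{p^*}{p}}\,d\left(-\underline v(t-,\infty)^{p^*}\right)\right)^{\frac{q^*}{p^*}}w(x)\,dx\right)^{\frac1{q^*}}<\infty .$$ Moreover,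 the best constant $c$ in $( * )$ satisfies $c\approx I_2$.
   Context: A weight is a locally integrable non-negative function on $(0,\infty)$; $\mathcal M^+(0,\infty)$ is the set of non-negative measurable functions on $(0,\infty)$. Put $U(t)=\int_0^t u(s)\,ds$, with $U(t)>0$ for all $t>0$, and $\mathcal U(x,t)=\dfrac{U(x)}{U(t)+U(x)}$. $U$ is admissible if it is continuous and strictly increasing on $[0,\infty)$, $U(0)=0$ and $\lim_{t\to\infty}U(t)=\infty$. For $r>0$, the measure $w(t)\,dt$ is non-degenerate with respect to $U^{r}$ if $\int_0^\infty \frac{w(s)\,ds}{U(s)^r+U(t)^r}<\infty$ for all $t\in(0,\infty)$ and $\int_0^1\frac{w(s)}{U(s)^r}\,ds=\int_1^\infty w(s)\,ds=\infty$. For $0\le a<b\le\infty$, $\underline v(a,b)=\operatorname{ess\,sup}_{s\in(a,b)}v(s)^{-1}$, and $\underline v(t-,\infty)=\lim_{s\to t-}\underline v(s,\infty)$. For $p\in(0,1)$, $p^*=\frac{p}{1-p}$ (similarly $q^*=\frac q{1-q}$ for $q\in(0,1)$). $d(-\underline v(t-,\infty)^{p^*})$ denotes the Lebesgue–Stieltjes (Borel) measure generated by the non-decreasing function $t\mapsto-\underline v(t-,\infty)^{p^*}$, i.e. the measure giving $[\alpha,\beta)$, $0<\alpha<\beta<\infty$, the mass $\underline v(\alpha-,\infty)^{p^*}-\underline v(\beta-,\infty)^{p^*}$; the integrand $\mathcal U(t,x)^{p^*/p}$ vanishes at $t=0$, so the integral over $[0,\infty)$ equals that over $(0,\infty)$.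 If $\underline v(t,\infty)=\infty$ for some $t>0$, this integral is understood as $+\infty$. Conventions: $1/0=\infty$, $1/\infty=0$, $0\cdot\infty=0$, $0/0=0$, $\infty/\infty=0$. $a\approx b$ means $\lambda^{-1}a\le b\le\lambda a$ with $\lambda>0$ depending only on inessential parameters (here the exponents $p,q$). *)

(* Defs.v *)
From HB Require Import structures.
From mathcomp Require Import all_boot all_order all_algebra.
From mathcomp Require Import all_classical all_reals all_analysis.
From mathcomp Require Import measurable_realfun ess_sup_inf.

Set Implicit Arguments.
Unset Strict Implicit.
Unset Printing Implicit Defensive.

Import Order.TTheory GRing.Theory Num.Theory.
Import numFieldNormedType.Exports.

Local Open Scope classical_set_scope.
Local Open Scope ring_scope.

(* Lebesgue-Stieltjes measure on (0,oo) of a nondecreasing left-continuous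
   g : (0,oo) -> R, possibly unbounded near 0: see [left_stieltjes_itv].  The
   library's [lebesgue_stieltjes_measure] is for right-continuous functions on
   the whole of R, hence the transport along y |-> expR (- y). *)
Section left_stieltjes.
Context {R : realType}.
Implicit Types (g : R -> R) (a b : R).

Definition left_cumulative g : Prop :=
  {in `]0, +oo[ &, {homo g : x y / x <= y}} /\
  (forall t, 0 < t -> g s @[s --> t^'-] --> g t).

Definition exp_transport g (y : R) : R :=
  if `[< left_cumulative g >] then - g (expR (- y)) else 0.

Lemma exp_transport_nd g : nondecreasing (exp_transport g).
Proof.
move=> x y xy; rewrite /exp_transport; case: ifPn => // /asboolP[ndg _].
rewrite lerN2; apply: ndg; rewrite ?in_itv/= ?andbT ?expR_gt0//.
by rewrite ler_expR lerN2.
Qed.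

Lemma exp_transport_rc g : right_continuous (exp_transport g).
Proof.
move=> x; rewrite /exp_transport; case: ifPn => [/asboolP[_ lcg]|_]; last first.
  exact: cvg_cst.
apply: cvgN.
apply: (@cvg_comp _ _ _ (fun y => expR (- y)) g _ (at_left (expR (- x)))); last first.
  by apply: lcg; exact: expR_gt0.
move=> A [e /= e0 eA].
have : expR (- y) @[y --> x^'+] --> expR (- x).
  apply: cvg_at_right_filter.
  by apply: continuous_comp; [exact: opp_continuous|exact: continuous_expR].
move=> /cvgrPdist_lt /(_ e e0) H; near=> y.
apply: eA => /=.
  by near: y.
by rewrite ltr_expR ltrN2; near: y; exact: nbhs_right_gt.
Unshelve. all: by end_near. Qed.

HB.instance Definition _ g := isCumulative.Build R _ R (exp_transport g)
  (@exp_transport_nd g) (@exp_transport_rc g).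

Definition expRN (y : measurableTypeR R) : measurableTypeR R := expR (- y).

Lemma measurable_expRN : measurable_fun setT expRN.
Proof. exact: measurableT_comp. Qed.

Definition left_stieltjes g : set (measurableTypeR R) -> \bar R :=
  pushforward (lebesgue_stieltjes_measure (exp_transport g)) expRN.

Let left_stieltjes0 g : left_stieltjes g set0 = 0%E.
Proof. by rewrite /left_stieltjes /pushforward preimage_set0 measure0. Qed.

Let left_stieltjes_ge0 g A : (0 <= left_stieltjes g A)%E.
Proof. by rewrite /left_stieltjes /pushforward; exact: measure_ge0. Qed.

Let left_stieltjes_sigma_additive g : semi_sigma_additive (left_stieltjes g).
Proof.
move=> F mF tF mUF; rewrite /left_stieltjes /pushforward preimage_bigcup.
apply: measure_semi_sigma_additive.
- by move=> n; rewrite -[X in measurable X]setTI; exact: measurable_expRN.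
- apply/trivIsetP => /= i j _ _ ij; rewrite -preimage_setI.
  by move/trivIsetP : tF => /(_ _ _ _ _ ij) ->//; rewrite preimage_set0.
- by rewrite -preimage_bigcup -[X in measurable X]setTI; exact: measurable_expRN.
Qed.

HB.instance Definition _ g := isMeasure.Build _ _ _ (left_stieltjes g)
  (left_stieltjes0 g) (left_stieltjes_ge0 g) (@left_stieltjes_sigma_additive g).

Lemma left_stieltjes_itv g a b : left_cumulative g -> 0 < a -> a < b ->
  left_stieltjes g `[a, b[ = (g b - g a)%:E.
Proof.
move=> lcg a0 ab; have b0 := lt_trans a0 ab.
rewrite /left_stieltjes /pushforward.
have -> : expRN @^-1` `[a, b[ = `]- ln b, - ln a]%classic.
  apply/seteqP; split => y /=; rewrite !in_itv/= /expRN => /andP[h1 h2].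
    by rewrite lerNr -ler_expR lnK ?posrE// h1 ltrNl -ltr_expR lnK ?posrE// h2.
  by rewrite -[leLHS]lnK ?posrE// -[ltRHS]lnK ?posrE// ler_expR ltr_expR lerNr h2 ltrNl h1.
rewrite /lebesgue_stieltjes_measure /measure_extension measurable_mu_extE/=; last first.
  exact: is_ocitv.
rewrite wlength_itv_bnd; last by rewrite lerN2 ler_ln ?posrE// ltW.
rewrite /exp_transport; case: ifPn => [_|/asboolP//].
by rewrite !opprK !lnK ?posrE// addrC.
Qed.

End left_stieltjes.

(* Functions on (0,oo) are represented by functions on R of which only the
   values on (0,oo) matter. *)
Definition ray {R : realType} (s : R) : set R := `]s, +oo[.

Section weights.
Context {R : realType}.
Implicit Types (u v w : R -> R) (p q r s t x : R).
Notation mu := (@lebesgue_measure R).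

Definition weight u : Prop :=
  locally_integrable (ray 0) u /\ (forall t, 0 < t -> 0 <= u t).

(* A divergent integral would be sent to 0 here; this is ruled out by
   [admissible_prim], which makes U positive on (0,oo). *)
Definition Uint u t : R := \int[mu]_(s in `]0, t[) u s.

Definition Uker u x t : R := Uint u x / (Uint u t + Uint u x).

Definition admissible_prim (U : R -> R) : Prop :=
  [/\ {within `[0, +oo[, continuous U},
      {in `[0, +oo[ &, {homo U : x y / x < y}},
      U 0 = 0 & U t @[t --> +oo] --> +oo].

Definition nondegenerate_wrt (U : R -> R) r w : Prop :=
  [/\ forall t, 0 < t ->
        (\int[mu]_(s in ray 0) (w s / (U s `^ r + U t `^ r))%:E < +oo)%E,
      (\int[mu]_(s in `]0%R, 1%R[) (w s / U s `^ r)%:E = +oo)%E &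
      (\int[mu]_(s in ray 1) (w s)%:E = +oo)%E].

(* The inverse is taken in \bar R, where 0^-1 = +oo. *)
Definition vlow v (i : interval R) : \bar R :=
  ess_sup (mrestr mu (measurable_itv i)) (fun s => (v s)%:E^-1)%E.

Definition vlow_left v t : \bar R := lim (vlow v `]s, +oo[ @[s --> t^'-]).

Definition star p : R := p / (1 - p).

Lemma le_vlow v s t : s <= t -> (vlow v `]t, +oo[ <= vlow v `]s, +oo[)%E.
Proof.
move=> st; apply/ess_supP.
have /ess_supP [N [mN N0 NE]] := lexx (vlow v `]s, +oo[).
exists N; split => //.
apply/eqP; rewrite eq_le measure_ge0 andbT -N0 /mrestr.
apply: le_measure; rewrite ?inE; try exact: measurableI.
by apply: setIS => x /=; rewrite !in_itv/= !andbT; exact: le_lt_trans.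
Qed.

Lemma vlow_ge0 v s : (forall t, 0 < t -> 0 <= v t) -> 0 <= s ->
  (0 <= vlow v `]s, +oo[)%E.
Proof.
move=> v0 s0; apply: ess_sup_gee.
  rewrite /= /mrestr setTI.
  rewrite [X in (0 < X)%E](_ : _ = +oo%E)//.
  by rewrite lebesgue_measure_itv/= ltry.
exists `]-oo, s]%classic; split; first exact: measurable_itv.
  rewrite /= /mrestr (_ : _ `&` _ = set0) ?measure0//.
  apply/seteqP; split => // x /=; rewrite !in_itv/= andbT => -[xs sx].
  by move: (lt_le_trans sx xs); rewrite ltxx.
move=> x /= /negP; rewrite in_itv/= => H; rewrite leNgt; apply/negP => sx.
by move/negP: H; apply; rewrite inve_ge0 lee_fin v0// (le_lt_trans s0).
Qed.

Lemma cvg_vlow_left v t :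
  vlow v `]s, +oo[ @[s --> t^'-] --> vlow_left v t.
Proof.
suff : cvg ((fun s => vlow v `](- s), +oo[) s @[s --> (- t)^'+]).
  move=> /cvg_ex[/= l fal]; apply/cvg_ex; exists l.
  exact/(@cvg_at_leftNP _ _ (fun s => vlow v `]s, +oo[)).
apply: nondecreasing_at_right_is_cvge; near=> x => a b _ _ ab.
by apply: le_vlow; rewrite lerN2.
Unshelve. all: by end_near. Qed.

Lemma vlow_left_ge v s t : s < t ->
  (vlow_left v t <= vlow v `]s, +oo[)%E.
Proof.
move=> st; apply: lime_le; first exact: cvg_vlow_left.
near=> x; apply: le_vlow; near: x; exact: nbhs_left_ge.
Unshelve. all: by end_near. Qed.

Lemma vlow_le_left v t : (vlow v `]t, +oo[ <= vlow_left v t)%E.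
Proof.
apply: lime_ge; first exact: cvg_vlow_left.
near=> x; apply: le_vlow; near: x; exact: nbhs_left_le.
Unshelve. all: by end_near. Qed.

Lemma le_vlow_left v s t : s <= t -> (vlow_left v t <= vlow_left v s)%E.
Proof.
rewrite le_eqVlt => /predU1P[->//|st].
exact: le_trans (vlow_left_ge v st) (vlow_le_left v s).
Qed.

Lemma vlow_left_left_cvg v t : vlow_left v s @[s --> t^'-] --> vlow_left v t.
Proof.
apply: (@squeeze_cvge _ _ _ _ (cst (vlow_left v t)) _
         (fun s => vlow v `](s - (t - s)), +oo[)).
- near=> s; apply/andP; split.
    by apply: le_vlow_left; near: s; exact: nbhs_left_le.
  apply: vlow_left_ge; rewrite ltrBlDr ltrDl subr_gt0.
  by near: s; exact: nbhs_left_lt.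
- exact: cvg_cst.
- apply: (@cvg_comp _ _ _ (fun s => s - (t - s)) (fun s => vlow v `]s, +oo[)
           _ (at_left t)); last exact: cvg_vlow_left.
  move=> A [e /= e0 eA].
  have : s - (t - s) @[s --> t^'-] --> t - (t - t).
    apply: cvg_at_left_filter; apply: cvgB; first exact: cvg_id.
    by apply: cvgB; [exact: cvg_cst|exact: cvg_id].
  rewrite subrr subr0 => /cvgrPdist_lt /(_ e e0) H; near=> y.
  apply: eA => /=.
    by near: y.
  have yt : y < t by near: y; exact: nbhs_left_lt.
  by rewrite (lt_trans _ yt)// ltrBlDr ltrDl subr_gt0.
Unshelve. all: by end_near. Qed.

Lemma cvg_powR {F : set_system R} {FF : Filter F} (f : R -> R) (l r : R) :
  0 < r -> 0 <= l -> (\forall x \near F, 0 <= f x) -> f x @[x --> F] --> l ->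
  f x `^ r @[x --> F] --> l `^ r.
Proof.
move=> r0; rewrite le_eqVlt => /predU1P[<- f0 fl|l0 _ fl].
  rewrite powR0 ?gt_eqF//; apply/cvgrPdist_lt => e e0.
  move/cvgrPdist_lt : fl => /(_ (e `^ r^-1)) /(_ (powR_gt0 _ e0)) H.
  near=> x; have fx0 : 0 <= f x by near: x.
  have : `|0 - f x| < e `^ r^-1 by near: x.
  rewrite !sub0r !normrN !ger0_norm ?powR_ge0// => fxe.
  have -> : e = (e `^ r^-1) `^ r by rewrite -powRrM mulVf ?gt_eqF// powRr1// ltW.
  by apply: gt0_ltr_powR; rewrite // ?nnegrE ?powR_ge0.
apply: (@cvg_comp _ _ _ f (fun a => a `^ r) _ (nbhs l)) => //.
have : {for l, continuous (fun a : R^o => (a `^ r : R^o))}; last exact.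
apply: differentiable_continuous; apply/derivable1_diffP.
by apply: derivable_powR; rewrite in_itv/= l0.
Unshelve. all: by end_near. Qed.

Definition vlow_distr v r t : R := - (fine (vlow_left v t) `^ r).

Lemma vlow_left_fin v t : (forall t, 0 < t -> 0 <= v t) ->
  (forall t, 0 < t -> (vlow v `]t, +oo[ < +oo)%E) ->
  0 < t -> vlow_left v t \is a fin_num.
Proof.
move=> v0 voo t0; rewrite ge0_fin_numE.
  by rewrite (le_lt_trans (@vlow_left_ge v (t / 2) t _))// ?voo ?divr_gt0//
    ltr_pdivrMr// ltr_pMr// ltr1n.
by rewrite (le_trans _ (vlow_le_left v t))// vlow_ge0// ltW.
Qed.

Lemma vlow_left_ge0 v t : (forall t, 0 < t -> 0 <= v t) -> 0 < t ->
  (0 <= vlow_left v t)%E.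
Proof.
by move=> v0 t0; rewrite (le_trans _ (vlow_le_left v t))// vlow_ge0// ltW.
Qed.

Lemma left_cumulative_vlow_distr v r : 0 < r ->
  (forall t, 0 < t -> 0 <= v t) ->
  (forall t, 0 < t -> (vlow v `]t, +oo[ < +oo)%E) ->
  left_cumulative (vlow_distr v r).
Proof.
move=> r0 v0 voo; split => [x y|t t0].
  rewrite !in_itv/= !andbT => x0 y0 xy; rewrite lerN2.
  apply: ge0_ler_powR; rewrite ?nnegrE ?fine_ge0 ?vlow_left_ge0//; first exact: ltW.
  by rewrite fine_le ?vlow_left_fin// le_vlow_left.
apply: cvgN; apply: cvg_powR => //.
- by rewrite fine_ge0// vlow_left_ge0.
- by near=> s; rewrite fine_ge0// vlow_left_ge0.
- apply: fine_cvg; rewrite fineK ?vlow_left_fin//.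
  exact: vlow_left_left_cvg.
Unshelve. all: by end_near. Qed.

Lemma left_stieltjes_vlow v r a b : 0 < r ->
  (forall t, 0 < t -> 0 <= v t) ->
  (forall t, 0 < t -> (vlow v `]t, +oo[ < +oo)%E) ->
  0 < a -> a < b ->
  left_stieltjes (vlow_distr v r) `[a, b[ =
    (vlow_left v a `^ r - vlow_left v b `^ r)%E.
Proof.
move=> r0 v0 voo a0 ab.
rewrite left_stieltjes_itv//; last exact: left_cumulative_vlow_distr.
have b0 := lt_trans a0 ab.
rewrite -[in RHS](fineK (vlow_left_fin v0 voo a0)).
rewrite -[in RHS](fineK (vlow_left_fin v0 voo b0)) !poweR_EFin.
by rewrite /vlow_distr opprK addrC EFinB.
Qed.

(* [left_stieltjes] charges only (0,oo).  The integral is +oo by convention when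
   the essential supremum of 1/v over (t,oo) is infinite for some t > 0. *)
Definition vint p u v x : \bar R :=
  if `[< forall t, 0 < t -> (vlow v `]t, +oo[ < +oo)%E >] then
    (\int[left_stieltjes (vlow_distr v (star p))]_(t in `[0%R, +oo[%classic)
      (Uker u t x `^ (star p / p))%:E)%E
  else +oo%E.

Definition wint p q u w x : \bar R :=
  (\int[mu]_(s in ray 0) (Uker u x s `^ (q / p) * w s)%:E)%E.

Definition hardy_lhs p q u w (h : R -> \bar R) : \bar R :=
  ((\int[mu]_(t in ray 0)
     (((Uint u t)^-1%:E *
       \int[mu]_(s in `]0%R, t[%classic)
         ((\int[mu]_(z in ray s) h z) `^ p * (u s)%:E)) `^ (q / p) *
      (w t)%:E)) `^ q^-1)%E.

Definition hardy_ineq p q u v w (c : R) : Prop :=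
  forall h : R -> \bar R,
    measurable_fun (ray 0) h -> (forall z, 0 < z -> (0 <= h z)%E) ->
    (hardy_lhs p q u w h <= c%:E * \int[mu]_(z in ray 0) (h z * (v z)%:E))%E.

Definition best_constant p q u v w : \bar R :=
  ereal_inf [set c%:E | c in [set c : R | 0 <= c /\ hardy_ineq p q u v w c]].

Definition I1 p q u v w : \bar R :=
  ereal_sup [set (wint p q u w x `^ q^-1 * vint p u v x `^ (star p)^-1)%E
            | x in ray 0].

Definition I2 p q u v w : \bar R :=
  ((\int[mu]_(x in ray 0)
     (wint p q u w x `^ star q * vint p u v x `^ (star q / star p) *
      (w x)%:E)) `^ (star q)^-1)%E.

Definition approx_by (lambda : R) (a b : \bar R) : Prop :=
  ((lambda^-1)%:E * a <= b)%E /\ (b <= lambda%:E * a)%E.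

End weights.

(* Main.v *)
(* Write U for the primitive of u, V(t) for the essential supremum of 1/v on
   (t-,oo), r = p/(1-p) and psi(x) for the Stieltjes integral in the theorem, so
   that the conditions involve phi(x) = int (U(x)/(U(x)+U(s)))^(q/p) w(s) ds and
   psi^(1/r). The function psi^(1/r) is nonincreasing and U^(1/p) psi^(1/r) is
   nondecreasing.

   Core estimate. Let F(t) = U(t)^-1 int_0^t (int_s^oo h)^p u(s) ds. Splitting
   the inner integral at t bounds F by (int_t^oo h)^p plus
   U(t)^-1 int_0^t (int_s^t h)^p u(s) ds, and Hoelder's inequality in the second
   term, with an auxiliary weight built from the Stieltjes measure, gives
   int F^(1/p) a <= C int h/V <= C int h v for every a >= 0 such that
   int_(0,x] a <= psi(x)^(-1/r) and
   int_[x,oo) U^(-1/p) a <= U(x)^(-1/p) psi(x)^(-1/r) for all x.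

   Sufficiency. Take a = n w. For q >= 1, n is a power of a truncation of F, and
   the bound on phi psi^(q/r) verifies the two conditions on a; for q < 1,
   it comes from the finiteness of I_2, and Hoelder's inequality converts the
   bound on int F^(1/p) n w into one on int F^(q/p) w.

   Necessity. Sums of normalized indicators of sets on which 1/v is nearly
   maximal, one for each dyadic level of V and with extremal coefficients, give
   functions h with int h v <= 1 and F(x) >= psi(x)^(1-p) up to a constant, which
   settles q >= 1. For q < 1 these functions are superposed along dyadic level
   sets of psi^(1/r) and of U^(1/p) psi^(1/r), which are segments at 0 and at
   infinity, matching the two parts s < x and s > x of phi. *)
Require Import Defs.
From HB Require Import structures.
From mathcomp Require Import all_boot all_order all_algebra.
From mathcomp Require Import all_classical all_reals all_analysis.
From mathcomp Require Import measurable_realfun ess_sup_inf.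
From mathcomp Require Import ring lra.

Set Implicit Arguments.
Unset Strict Implicit.
Unset Printing Implicit Defensive.

Import Order.TTheory GRing.Theory Num.Theory.
Import numFieldNormedType.Exports.

Local Open Scope classical_set_scope.
Local Open Scope ring_scope.

(** The measure generated by V^r may have atoms, so integrals such as that of M^(-p) dM, with M =
    U^(1+r) psi, cannot be computed by parts. The substitute used throughout is a weak-type bound:
    if the segment ending at t has mass at most G(t) for every t, then the set where G <= s has mass
    at most s. Cutting along dyadic values of G then controls integrals of powers of G, for the
    Stieltjes measure as well as for u(s) ds and w(t) dt.

    The two conditions on a mirror the kernel of phi, which is comparable to 1 for s < x and to a
    power of U(x)/U(s) for s > x. The two ranges differ by the direction of the line, and a Boolean
    flag lets one lemma serve both.

    Several bounds end by absorption: a quantity is estimated by a constant times a smaller power of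
    itself. Dividing requires it to be finite beforehand, which is why truncations, or finitely many
    dyadic levels, come first and limits last.

    Finiteness of V and psi is a conclusion of the necessity part: test functions are built for
    every real number below psi(x), also when psi(x) or V is infinite. *)

Lemma powRDgt0 {R : realType} (x r s : R) : 0 < x -> x `^ (r + s) = x `^ r * x `^ s.
Proof. by move=> x0; apply: powRD; rewrite (gt_eqF x0) implybT. Qed.

Lemma powRV {R : realType} (x a : R) : 0 <= x -> x^-1 `^ a = (x `^ a)^-1.
Proof. by move=> x0; rewrite -powR_inv1// -powRrM mulN1r powRN. Qed.

(** * Measurability of monotone functions and basic integral inequalities *)

Section measurability.
Context {R : realType}.

Lemma nondecreasing_emeasurable (f : R -> \bar R) :
  {homo f : x y / x <= y >-> (x <= y)%E} -> measurable_fun setT f.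
Proof.
move=> fnd.
apply: (measurability (@ErealGenCInfty.G R)) => [|/= _ [_] [r] -> <-].
  exact: ErealGenCInfty.measurableE.
rewrite setTI; apply: is_interval_measurable => s t/= + _ u /andP[su _].
by rewrite !in_itv/= !andbT => fs; exact: le_trans fs (fnd _ _ su).
Qed.

Lemma nonincreasing_emeasurable (f : R -> \bar R) :
  {homo f : x y / x <= y >-> (y <= x)%E} -> measurable_fun setT f.
Proof.
move=> fni; rewrite (_ : f = (fun x => - (- f x))%E); last first.
  by apply/funext => x; rewrite oppeK.
apply: measurableT_comp => //; apply: nondecreasing_emeasurable => x y xy.
by rewrite leeN2 fni.
Qed.

End measurability.

Section integral_helpers.
Local Open Scope ereal_scope.
Context {d : measure_display} {T : measurableType d} {R : realType}.
Variable mu : {measure set T -> \bar R}.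
Implicit Types (D : set T) (f g : T -> \bar R) (G : T -> R).

(** Monotone convergence phrased for upper bounds: a bound proved on every truncation passes to the
    limit without a separate convergence argument. *)
Lemma integral_bigcup_le (F : (set T)^nat) f (K : \bar R) :
  nondecreasing_seq F -> (forall i, measurable (F i)) ->
  measurable_fun (\bigcup_i F i) f ->
  (forall x, (\bigcup_i F i) x -> 0 <= f x) ->
  (forall i, \int[mu]_(x in F i) f x <= K) ->
  \int[mu]_(x in \bigcup_i F i) f x <= K.
Proof.
move=> ndF mF mf f0 FK.
have mFf i : measurable_fun (F i) f.
  by apply: measurable_funS mf; [exact: bigcup_measurable|exact: bigcup_sup].
have H := @ge0_nondecreasing_set_cvg_integral _ _ _ F f mu ndF mF mFf.
have {}H : \int[mu]_(x in F i) f x @[i --> \oo] --> \int[mu]_(x in \bigcup_i F i) f x.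
  by apply: H => i x Fx; apply: f0; exists i.
rewrite -(cvg_lim _ H)//; apply: lime_le; first by apply/cvg_ex; eexists; exact: H.
by apply: nearW.
Qed.


(** Young's inequality for [x / A] and [y / B]. In [hoelder_interpolation] the numbers [A] and [B]
    are the two integrals, so that the bracket on the right integrates to a + (1 - a) = 1. *)
Lemma weighted_amgm (x y : \bar R) (a A B : R) : (0 < a < 1)%R -> (0 < A)%R ->
  (0 < B)%R -> 0 <= x -> 0 <= y ->
  x `^ a * y `^ (1 - a) <=
  (A `^ a * B `^ (1 - a))%:E * ((a / A)%:E * x + ((1 - a) / B)%:E * y).
Proof.
move=> /andP[a0 a1] A0 B0 x0 y0.
have b0 : (0 < 1 - a)%R by rewrite subr_gt0.
have AB0 : (0 < A `^ a * B `^ (1 - a))%R by rewrite mulr_gt0// powR_gt0.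
have aA : (0 < a / A)%R by rewrite divr_gt0.
have bB : (0 < (1 - a) / B)%R by rewrite divr_gt0.
case: x x0 => [x| |]// x0; case: y y0 => [y| |]// y0; last 3 first.
- by rewrite gt0_muley ?lte_fin// addey ?gt0_muley ?leey ?lte_fin.
- by rewrite gt0_muley ?lte_fin// addye ?gt0_muley ?leey ?lte_fin.
- by rewrite !gt0_muley ?lte_fin// leey.
rewrite !lee_fin in x0 y0 *.
have xA : ((x / A) `^ a * (y / B) `^ (1 - a) <= a * (x / A) + (1 - a) * (y / B))%R.
  have := @conjugate_powR R ((x / A) `^ a)%R ((y / B) `^ (1 - a))%R a^-1%R (1 - a)^-1%R
    (powR_ge0 _ _) (powR_ge0 _ _).
  rewrite !invr_gt0 a0 b0 !invrK addrC subrK -!powRrM !mulfV ?gt_eqF//.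
  rewrite !powRr1 ?divr_ge0 ?(ltW A0) ?(ltW B0)//.
  by rewrite ![(_ * a)%R]mulrC ![(_ * (1 - a))%R]mulrC; apply.
have -> : (x `^ a * y `^ (1 - a) = (A `^ a * B `^ (1 - a)) * ((x / A) `^ a * (y / B) `^ (1 - a)))%R.
  rewrite mulrACA -!powRM ?divr_ge0 ?(ltW A0) ?(ltW B0)//.
  by rewrite (mulrC A) (mulrC B) !divfK ?gt_eqF.
rewrite ler_pM2l// (le_trans xA)//.
by rewrite le_eqVlt; apply/orP; left; apply/eqP; ring.
Qed.

Lemma ge0_integral_eq0_ae D f : measurable D -> measurable_fun D f ->
  (forall x, D x -> 0 <= f x) -> \int[mu]_(x in D) f x = 0 ->
  {ae mu, forall x, D x -> f x = 0}.
Proof.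
move=> mD mf f0 If; apply/(ae_eq_integral_abs mu mD mf).
by rewrite -[RHS]If; apply: eq_integral => x; rewrite inE => Dx; rewrite gee0_abs ?f0.
Qed.

Lemma ae_eq0_ge0_integral D f : measurable D -> measurable_fun D f ->
  (forall x, D x -> 0 <= f x) ->
  {ae mu, forall x, D x -> f x = 0} -> \int[mu]_(x in D) f x = 0.
Proof.
move=> mD mf f0 /(ae_eq_integral_abs mu mD mf) <-.
by apply: eq_integral => x; rewrite inE => Dx; rewrite gee0_abs ?f0.
Qed.

Lemma measurable_fun_poweR D f (a : R) : measurable_fun D f ->
  measurable_fun D (fun x => f x `^ a).
Proof. by move=> mf; exact: (measurableT_comp (measurable_poweR _)). Qed.

(** Hoelder's inequality with exponents 1/a and 1/(1 - a), written for the functions themselves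
    rather than their norms. The endpoint [a = 1] is included because it is used with a = 1/q for
    every q >= 1. *)
Lemma hoelder_interpolation D f g (a : R) : measurable D ->
  measurable_fun D f -> measurable_fun D g ->
  (forall x, D x -> 0 <= f x) -> (forall x, D x -> 0 <= g x) ->
  (0 < a <= 1)%R ->
  \int[mu]_(x in D) (f x `^ a * g x `^ (1 - a)) <=
  (\int[mu]_(x in D) f x) `^ a * (\int[mu]_(x in D) g x) `^ (1 - a).
Proof.
move=> mD mf mg f0 g0 /andP[a0].
have mfg : measurable_fun D (fun x => f x `^ a * g x `^ (1 - a)).
  by apply: emeasurable_funM; exact: measurable_fun_poweR.
have fg0 x : D x -> 0 <= f x `^ a * g x `^ (1 - a).
  by move=> Dx; rewrite mule_ge0 ?poweR_ge0.
rewrite le_eqVlt => /predU1P[->|a1].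
  rewrite subrr !poweRe0 mule1 poweRe1; last exact: integral_ge0.
  rewrite (eq_integral f)// => x; rewrite inE => Dx.
  by rewrite poweRe0 mule1 poweRe1 ?f0.
have b0 : (0 < 1 - a)%R by rewrite subr_gt0.
have If0 : 0 <= \int[mu]_(x in D) f x by exact: integral_ge0.
have Ig0 : 0 <= \int[mu]_(x in D) g x by exact: integral_ge0.
(* If one integral is null the right side is 0 even when the other is infinite, and the left side
   has to vanish; the null cases therefore precede the infinite ones. *)
have [If|If] := eqVneq (\int[mu]_(x in D) f x) 0.
  rewrite If poweR0r ?gt_eqF// mul0e ae_eq0_ge0_integral//.
  have := ge0_integral_eq0_ae mD mf f0 If; apply: filterS => x + Dx => ->//.
  by rewrite poweR0r ?gt_eqF// mul0e.
have [Ig|Ig] := eqVneq (\int[mu]_(x in D) g x) 0.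
  rewrite Ig poweR0r ?gt_eqF// mule0 ae_eq0_ge0_integral//.
  have := ge0_integral_eq0_ae mD mg g0 Ig; apply: filterS => x + Dx => ->//.
  by rewrite poweR0r ?gt_eqF// mule0.
have {}If : 0 < \int[mu]_(x in D) f x by rewrite lt_def If.
have {}Ig : 0 < \int[mu]_(x in D) g x by rewrite lt_def Ig.
have [Ify|Ify] := eqVneq (\int[mu]_(x in D) f x) +oo.
  by rewrite Ify poweRyr ?gt_eqF// gt0_mulye ?leey// poweR_gt0.
have [Igy|Igy] := eqVneq (\int[mu]_(x in D) g x) +oo.
  by rewrite Igy poweRyr ?gt_eqF// gt0_muley ?leey// poweR_gt0.
have Iff : \int[mu]_(x in D) f x \is a fin_num by rewrite ge0_fin_numE// ltey.
have Igf : \int[mu]_(x in D) g x \is a fin_num by rewrite ge0_fin_numE// ltey.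
set A := fine (\int[mu]_(x in D) f x); set B := fine (\int[mu]_(x in D) g x).
have A0 : (0 < A)%R by rewrite fine_gt0// If ltey.
have B0 : (0 < B)%R by rewrite fine_gt0// Ig ltey.
have fA : \int[mu]_(x in D) f x = A%:E by rewrite fineK.
have gB : \int[mu]_(x in D) g x = B%:E by rewrite fineK.
have aA : (0 <= a / A)%R by rewrite divr_ge0 ?ltW.
have bB : (0 <= (1 - a) / B)%R by rewrite divr_ge0 ?ltW.
apply: (@le_trans _ _ (\int[mu]_(x in D) ((A `^ a * B `^ (1 - a))%:E *
    ((a / A)%:E * f x + ((1 - a) / B)%:E * g x)))).
  apply: ge0_le_integral => //.
    apply: emeasurable_funM => //; apply: emeasurable_funD; exact: emeasurable_funM.
  move=> x Dx; apply: weighted_amgm; rewrite ?a0 ?a1 ?f0 ?g0//.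
rewrite ge0_integralZl_EFin//; last 3 first.
- by move=> x Dx; rewrite adde_ge0// mule_ge0// ?lee_fin ?f0 ?g0.
- by apply: emeasurable_funD; exact: emeasurable_funM.
- by rewrite mulr_ge0// powR_ge0.
rewrite ge0_integralD//; last 4 first.
- by move=> x Dx; rewrite mule_ge0// ?lee_fin ?f0.
- exact: emeasurable_funM.
- by move=> x Dx; rewrite mule_ge0// ?lee_fin ?g0.
- exact: emeasurable_funM.
rewrite ge0_integralZl_EFin// ge0_integralZl_EFin// fA gB.
rewrite -(EFinM (a / A)) -(EFinM ((1 - a) / B)) -EFinD !divfK ?gt_eqF//.
by rewrite subrKC mule1 !poweR_EFin.
Qed.

End integral_helpers.

(** * Power integrals from a mass bound on sublevel sets *)

Section level_sets.
Local Open Scope ereal_scope.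
Context {d : measure_display} {T : measurableType d} {R : realType}.
Variable mu : {measure set T -> \bar R}.
Variables (D : set T) (f G : T -> R).
Hypotheses (mD : measurable D) (mf : measurable_fun setT f)
  (mG : measurable_fun setT G) (f0 : forall x, (0 <= f x)%R).
Hypothesis fG : forall s : R, (0 <= s)%R ->
  \int[mu]_(x in D `&` [set x | (G x <= s)%R]) (f x)%:E <= s%:E.

Lemma measurable_sublevel (s : R) : measurable (D `&` [set x | (G x <= s)%R]).
Proof.
apply: measurableI => //.
by rewrite -[X in measurable X]setTI; exact: measurable_fun_ler.
Qed.

Lemma measurable_superlevel (s : R) : measurable (D `&` [set x | (s < G x)%R]).
Proof.
apply: measurableI => //.
by rewrite -[X in measurable X]setTI; exact: measurable_fun_ltr.
Qed.

Let mfE A : measurable_fun A (EFin \o f).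
Proof. by apply/measurable_EFinP; exact: measurable_funTS. Qed.

(** At most N/2 of the mass lies where G <= N/2, so at least N/2 of it lies where G > N/2, and there
    G^k is at least (N/2)^k. This replaces the integral of G^k dG from 0 to N. *)
Lemma powR_le_integral_level (k N : R) : (0 <= k)%R -> (0 <= N)%R ->
  N%:E <= \int[mu]_(x in D) (f x)%:E ->
  ((N / 2) `^ (k + 1))%:E <= \int[mu]_(x in D) (G x `^ k * f x)%:E.
Proof.
move=> k0; rewrite le_eqVlt => /predU1P[<- _|N0 NI].
  rewrite mul0r powR0; last by rewrite gt_eqF// ltr_wpDl.
  by apply: integral_ge0 => x _; rewrite lee_fin mulr_ge0// powR_ge0.
have N20 : (0 < N / 2)%R by rewrite divr_gt0.
apply: (@le_trans _ _ (\int[mu]_(x in D `&` [set x | (N / 2 < G x)%R]) (G x `^ k * f x)%:E)); last first.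
  apply: ge0_subset_integral => //; first exact: measurable_superlevel.
  - apply/measurable_EFinP; apply: measurable_funM; last exact: measurable_funTS.
    by apply: (measurableT_comp (measurable_powR _)); exact: measurable_funTS.
  - by move=> x _; rewrite lee_fin mulr_ge0// powR_ge0.
have H : (N / 2)%:E <= \int[mu]_(x in D `&` [set x | (N / 2 < G x)%R]) (f x)%:E.
  have DU : D = (D `&` [set x | (G x <= N / 2)%R]) `|` (D `&` [set x | (N / 2 < G x)%R]).
    apply/seteqP; split => x /=; last by case=> -[].
    by move=> Dx; case: (leP (G x) (N / 2)%R) => ?; [left|right].
  have := NI; rewrite {1}DU ge0_integral_setU//; last 4 first.
  - exact: measurable_sublevel.
  - exact: measurable_superlevel.
  - by move=> x _; rewrite lee_fin.
  - apply/disj_setPS => x /= [[_ h1] [_]]; rewrite ltNge => /negP; exact.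
  move=> H; rewrite -(leeD2lE (x := (N / 2)%:E))// -EFinD -splitr.
  apply: le_trans H _; rewrite leeD2r// fG// ltW//.
apply: (@le_trans _ _ (\int[mu]_(x in D `&` [set x | (N / 2 < G x)%R]) (((N / 2) `^ k)%:E * (f x)%:E))).
  rewrite ge0_integralZl_EFin ?powR_ge0//; last 2 first.
  - exact: measurable_superlevel.
  - by move=> x _; rewrite lee_fin.
  by rewrite powRDgt0// powRr1 ?(ltW N20)// EFinM lee_wpmul2l// lee_fin powR_ge0.
apply: ge0_le_integral => //.
- exact: measurable_superlevel.
- by move=> x _; rewrite -EFinM lee_fin mulr_ge0// powR_ge0.
- apply: emeasurable_funM => //; exact: mfE.
- apply/measurable_EFinP; apply: measurable_funM; last exact: measurable_funTS.
  by apply: (measurableT_comp (measurable_powR _)); exact: measurable_funTS.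
- move=> x [_ /= Gx]; rewrite -EFinM lee_fin ler_wpM2r//.
  by rewrite ge0_ler_powR// ?nnegrE ?(ltW N20)// ltW// (lt_trans N20).
Qed.

(** The [1] accounts for the part where G exceeds N. The fraction sums a geometric series of ratio
    2^(e - 1): the layer s/2 < G <= s has mass at most s and contributes at most (s/2)^(-e) s = 2^e
    s^(1 - e). *)
Definition level_const (e : R) : R := (1 + 2 `^ e / (1 - 2 `^ (e - 1)))%R.

Lemma level_const_gt0 (e : R) : (e < 1)%R -> (0 < level_const e)%R.
Proof.
move=> e1; rewrite ltr_pwDl// divr_ge0 ?powR_ge0// subr_ge0.
rewrite -[leRHS](powRr0 2) ler_powR ?ler1n// subr_le0; exact: ltW.
Qed.

Hypothesis G0 : forall x, D x -> (0 < G x)%R.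

(* Split [D] along the dyadic level sets of [G]. *)
Lemma integral_powRN_le (e N : R) : (0 < e)%R -> (e < 1)%R -> (0 < N)%R ->
  \int[mu]_(x in D) (f x)%:E <= N%:E ->
  \int[mu]_(x in D) (G x `^ (- e) * f x)%:E <= (level_const e * N `^ (1 - e))%:E.
Proof.
move=> e0 e1 N0 DN.
pose l := (2 `^ (e - 1))%R : R.
have l0 : (0 < l)%R by rewrite powR_gt0.
have l1 : (l < 1)%R.
  rewrite /l -opprB powRN invf_lt1 ?powR_gt0//.
  have : (1 `^ (1 - e) < (2 : R) `^ (1 - e))%R.
    by apply: gt0_ltr_powR; rewrite ?nnegrE ?subr_gt0// ltr1n.
  by rewrite powR1.
have l1' : (0 < 1 - l)%R by rewrite subr_gt0.
pose s k := (N / 2 ^+ k)%R : R.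
have s0 k : (0 < s k)%R by rewrite divr_gt0// exprn_gt0.
have sS k : s k.+1 = (s k / 2)%R by rewrite /s exprS invfM [(2^-1 * _)%R]mulrC mulrA.
have spS k : (s k.+1 `^ (1 - e) = s k `^ (1 - e) * l)%R.
  rewrite sS powRM// ?(ltW (s0 k))//; congr (_ * _)%R.
  by rewrite /l -(powR_inv1 (ler0n R 2)) -powRrM mulN1r opprB.
have mGf A : measurable_fun A (EFin \o (fun x => G x `^ (- e) * f x)%R).
  apply/measurable_EFinP; apply: measurable_funM; last exact: measurable_funTS.
  by apply: (measurableT_comp (measurable_powR _)); exact: measurable_funTS.
have Gf0 x : (0 <= G x `^ (- e) * f x)%R by rewrite mulr_ge0// powR_ge0.
have bound A c K : measurable A -> A `<=` D -> (0 < c)%R ->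
    (forall x, A x -> (c <= G x)%R) -> \int[mu]_(x in A) (f x)%:E <= K%:E ->
    \int[mu]_(x in A) (G x `^ (- e) * f x)%:E <= (c `^ (- e) * K)%:E.
  move=> mA AD c0 cG AK.
  apply: (@le_trans _ _ (\int[mu]_(x in A) ((c `^ (- e))%:E * (f x)%:E))).
    apply: ge0_le_integral => //.
    - by move=> x _; rewrite lee_fin.
    - by apply: emeasurable_funM => //; exact: mfE.
    move=> x Ax; rewrite -EFinM lee_fin ler_wpM2r// !powRN.
    rewrite lef_pV2 ?posrE ?powR_gt0 ?G0//; last exact: AD.
    by apply: ge0_ler_powR; rewrite ?nnegrE ?(ltW e0) ?(ltW c0) ?cG// ltW// G0//; exact: AD.
  rewrite ge0_integralZl_EFin ?powR_ge0//; last by move=> x _; rewrite lee_fin.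
  by rewrite EFinM lee_wpmul2l// lee_fin powR_ge0.
have powN c : (0 < c)%R -> (c `^ (- e) * c = c `^ (1 - e))%R.
  by move=> c0; rewrite addrC powRDgt0// powRr1 ?(ltW c0).
(* The second summand is the partial sum of the geometric series over the first k layers, in the
   telescoped form that lets the induction close exactly. *)
have Ik k : \int[mu]_(x in D `&` [set x | (s k < G x)%R]) (G x `^ (- e) * f x)%:E <=
    (N `^ (1 - e) + 2 `^ e / (1 - l) * (N `^ (1 - e) - s k `^ (1 - e)))%:E.
  elim: k => [|k IH].
    rewrite /s expr0 divr1 subrr mulr0 addr0 -(powN N N0).
    apply: bound => //; first exact: measurable_superlevel.
    - by move=> x [_ /= /ltW].
    - apply: le_trans DN; apply: ge0_subset_integral => //.
      + exact: measurable_superlevel.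
      + by move=> x _; rewrite lee_fin.
  have -> : D `&` [set x | (s k.+1 < G x)%R] = (D `&` [set x | (s k < G x)%R]) `|`
      ((D `&` [set x | (G x <= s k)%R]) `&` (D `&` [set x | (s k.+1 < G x)%R])).
    apply/seteqP; split => x /=.
      by move=> [Dx sx]; case: (ltP (s k) (G x)) => h; [left|right].
    case=> [[Dx sx]|[_ []]//]; split=> //; apply: lt_trans sx.
    by rewrite sS ltr_pdivrMr// ltr_pMr ?ltr1n.
  rewrite ge0_integral_setU//; last 4 first.
  - exact: measurable_superlevel.
  - by apply: measurableI; [exact: measurable_sublevel|exact: measurable_superlevel].
  - by move=> x _; rewrite lee_fin.
  - apply/disj_setPS => x /= [[_ h1] [[_]]]; rewrite leNgt h1//.
  have -> : (N `^ (1 - e) + 2 `^ e / (1 - l) * (N `^ (1 - e) - s k.+1 `^ (1 - e)) =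
     (N `^ (1 - e) + 2 `^ e / (1 - l) * (N `^ (1 - e) - s k `^ (1 - e))) + 2 `^ e * s k `^ (1 - e))%R.
    by rewrite spS; field; rewrite gt_eqF.
  rewrite EFinD leeD//.
  have -> : (2 `^ e * s k `^ (1 - e) = s k.+1 `^ (- e) * s k)%R.
    rewrite -(powN _ (s0 k)) mulrA; congr (_ * _)%R.
    by rewrite sS powRM ?(ltW (s0 k))// -(powR_inv1 (ler0n R 2)) -powRrM mulN1r opprK mulrC.
  apply: bound => //.
  - by apply: measurableI; [exact: measurable_sublevel|exact: measurable_superlevel].
  - by move=> x [[]].
  - by move=> x [_ [_ /= /ltW]].
  - apply: (le_trans _ (fG (ltW (s0 k)))); apply: ge0_subset_integral => //.
    + by apply: measurableI; [exact: measurable_sublevel|exact: measurable_superlevel].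
    + exact: measurable_sublevel.
    + by move=> x _; rewrite lee_fin.
have DE : D = \bigcup_k (D `&` [set x | (s k < G x)%R]).
  apply/seteqP; split => [x Dx|x [k _] []//].
  have [k kP] : exists k, (s k < G x)%R.
    have NG : (0 <= N / G x)%R by rewrite divr_ge0 ?(ltW N0)// ltW// G0.
    exists (Num.truncn (N / G x)).+1; rewrite /s ltr_pdivrMr ?exprn_gt0//.
    rewrite mulrC -ltr_pdivrMr ?G0//; have /andP[_ h] := truncn_itv NG.
    apply: (lt_le_trans h); rewrite -natrX ler_nat ltnW// ltn_expl//.
  by exists k.
rewrite DE; apply: integral_bigcup_le => //.
- apply/nondecreasing_seqP => k; apply/subsetPset => x /= [Dx sx]; split => //.
  by apply: lt_trans sx; rewrite sS ltr_pdivrMr// ltr_pMr ?ltr1n.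
- by move=> k; exact: measurable_superlevel.
- by move=> x _; rewrite lee_fin.
- move=> k; apply: (le_trans (Ik k)); rewrite lee_fin /level_const mulrDl mul1r lerD2l -/l.
  by rewrite ler_wpM2l ?divr_ge0 ?powR_ge0 ?(ltW l1')// lerBlDr lerDl powR_ge0.
Qed.

End level_sets.

(** * Segment densities *)

Section order.
Context {R : realType}.
Implicit Types (b : bool) (x y t : R).

(** The flag chooses a direction on the line: segments at 0 for [true], segments at infinity for
    [false]. Both occur in every estimate below and share their proofs. *)
Definition ord b x y := if b then x <= y else y <= x.

Lemma ord_refl b x : ord b x x. Proof. by case: b => /=. Qed.

Lemma ord_trans b x y z : ord b x y -> ord b y z -> ord b x z.
Proof. by case: b => /= xy yz; [exact: le_trans yz|exact: le_trans xy]. Qed.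

Lemma ord_total b x y : ord b x y \/ ord b y x.
Proof. by case: b => /=; case/orP : (le_total x y) => ->; [left|right|right|left]. Qed.

Definition segment b t : set (measurableTypeR R) := [set x | ord b x t].

Lemma measurable_segment b t : measurable (segment b t).
Proof.
case: b.
  by rewrite (_ : segment _ _ = `]-oo, t]%classic)//; apply/seteqP; split => x; rewrite /= in_itv.
by rewrite (_ : segment _ _ = `[t, +oo[%classic)//; apply/seteqP; split => x; rewrite /= in_itv/= andbT.
Qed.

(** Endpoints are chosen inside [E] because only there is the hypothesis of [integral_sublevel_le]
    useful; the extremum of [E] need not be attained. The three cases are: a maximum, a finite
    supremum that is not attained, no upper bound. *)
Lemma ord_cofinal b (E : set R) : E !=set0 -> exists t : nat -> R,
  (forall n, E (t n)) /\ (forall x, E x -> exists n, ord b x (t n)).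
Proof.
wlog : b E / b = true.
  move=> H; case: b => E0; first exact: H.
  have [] := H true (-%R @` E) erefl; first by case: E0 => x Ex; exists (- x); exists x.
  move=> t [tE tP]; exists (fun n => - t n); split.
    by move=> n; have [x Ex <-] := tE n; rewrite opprK.
  move=> x Ex; have [n xn] := tP (- x) (ex_intro2 _ _ _ Ex erefl).
  by exists n; rewrite /= -[leRHS]opprK lerN2.
move=> -> [x0 Ex0]; have [[m [Em mE]]|nomax] := pselect (exists m, E m /\ forall x, E x -> x <= m).
  by exists (fun=> m); split => // x Ex; exists 0%N; exact: mE.
have gtE m : E m -> exists2 x, E x & m < x.
  move=> Em; apply: contrapT => H; apply: nomax; exists m; split => // x Ex.
  by rewrite leNgt; apply/negP => mx; apply: H; exists x.
have [[M ME]|nub] := pselect (has_ubound E).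
  have hs : has_sup E by split; [exists x0|exists M].
  have P n : exists x, E x /\ sup E - n.+1%:R^-1 < x.
    have n0 : 0 < n.+1%:R^-1 :> R by rewrite invr_gt0.
    by have [x Ex xs] := sup_adherent n0 hs; exists x.
  have /choice[t tP] := P; exists t; split=> [n|x Ex]; first by case: (tP n).
  have [y Ey xy] := gtE _ Ex; have ys : y <= sup E by apply: ub_le_sup => //; exists M.
  have yx : 0 < y - x by rewrite subr_gt0.
  exists (Num.truncn (y - x)^-1); case: (tP (Num.truncn (y - x)^-1)) => _ h.
  apply: ltW; apply: lt_trans h.
  have yx' : 0 <= (y - x)^-1 by rewrite invr_ge0 ltW.
  have /andP[_ h2] := truncn_itv yx'.
  have {}h2 : (Num.truncn (y - x)^-1).+1%:R^-1 < y - x.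
    by rewrite -[ltRHS]invrK ltf_pV2 ?posrE ?invr_gt0// h2// invr_gt0.
  by rewrite ltrBrDr -ltrBrDl (lt_le_trans h2)// lerB.
have P (n : nat) : exists x, E x /\ n%:R <= x.
  apply: contrapT => H; apply: nub; exists n%:R => x Ex.
  by rewrite leNgt; apply/negP => nx; apply: H; exists x; split => //; exact: ltW.
have /choice[t tP] := P; exists t; split=> [n|x Ex]; first by case: (tP n).
exists (Num.truncn `|x|).+1; case: (tP (Num.truncn `|x|).+1) => _; apply: le_trans.
have /andP[_ h2] := truncn_itv (normr_ge0 x).
by rewrite (le_trans (ler_norm x))// ltW.
Qed.

End order.

Section sublevel_segments.
Context {R : realType}.
Local Notation TR := (measurableTypeR R).
Variable mu : {measure set (measurableTypeR R) -> \bar R}.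

(** The sublevel set is exhausted by segments whose endpoints lie in it, and such a segment has mass
    at most the value of [G] at its endpoint, hence at most [s]. The argument is insensitive to
    jumps of the cumulative mass. *)
Lemma integral_sublevel_le b (D : set TR) (f G : TR -> R) (s : R) :
  measurable D -> measurable_fun setT f -> measurable_fun setT G ->
  (forall x, 0 <= f x) -> 0 <= s ->
  (forall t, D t -> (\int[mu]_(x in D `&` segment b t) (f x)%:E <= (G t)%:E)%E) ->
  (\int[mu]_(x in D `&` [set x | (G x <= s)%R]) (f x)%:E <= s%:E)%E.
Proof.
move=> mD mf mG f0 s0 H; set E := D `&` _.
have mE : measurable E by exact: measurable_sublevel.
have [->|/set0P E0] := eqVneq E set0; first by rewrite integral_set0 lee_fin.
have [t [tE tP]] := ord_cofinal b E0.
have mF n : measurable (E `&` \big[setU/set0]_(i < n.+1) segment b (t i)).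
  by apply: measurableI => //; apply: bigsetU_measurable => i _; exact: measurable_segment.
have EE : E = \bigcup_n (E `&` \big[setU/set0]_(i < n.+1) segment b (t i)).
  apply/seteqP; split => [x Ex|x [n _] []//].
  have [n xn] := tP _ Ex; exists n => //; split => //.
  by rewrite -(bigcup_mkord n.+1 (fun i => segment b (t i))); exists n => /=.
rewrite EE; apply: integral_bigcup_le => //.
- apply/nondecreasing_seqP => n; apply/subsetPset => x /= [Ex]; split => //.
  by rewrite big_ord_recr/=; left.
- by apply/measurable_EFinP; exact: measurable_funTS.
- by move=> x _; rewrite lee_fin.
- move=> n.
  (* Among finitely many endpoints one comes last, and its segment contains all the others; it still
     lies in [E], so that [G m <= s]. *)
  have [m [Em mP]] : exists m, E m /\ forall i, (i < n.+1)%N -> ord b (t i) m.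
    elim: n {mF EE} => [|n [m [Em mP]]].
      by exists (t 0%N); split => // -[|//] _; exact: ord_refl.
    case: (ord_total b m (t n.+1)) => h.
      exists (t n.+1); split => // i; rewrite ltnS leq_eqVlt => /predU1P[->|/mP]; first exact: ord_refl.
      by move/ord_trans; apply.
    by exists m; split => // i; rewrite ltnS leq_eqVlt => /predU1P[->//|/mP].
  case: Em => Dm /= Gms; apply: (@le_trans _ _ (G m)%:E); last by rewrite lee_fin.
  apply: le_trans (H _ Dm); apply: ge0_subset_integral => //.
  + exact: mF.
  + by apply: measurableI => //; exact: measurable_segment.
  + by apply/measurable_EFinP; exact: measurable_funTS.
  + by move=> x _; rewrite lee_fin.
  + move=> x [[Dx _]]; rewrite -(bigcup_mkord n.+1 (fun i => segment b (t i))) => -[i /= ilt xi]; split => //=.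
    by move: xi => /=; rewrite /segment/= => /ord_trans; apply; exact: mP.
Qed.

End sublevel_segments.

(** * Tonelli's theorem over a measurable relation *)

Section tonelli.
Context {R : realType} {d1 d2 : measure_display}.
Context {T1 : measurableType d1} {T2 : measurableType d2}.
Variable m1 : {sigma_finite_measure set T1 -> \bar R}.
Variable m2 : {sigma_finite_measure set T2 -> \bar R}.
Variables (E : set (T1 * T2)) (mE : measurable E).

Let mE1 x : measurable [set y | E (x, y)].
Proof. by rewrite (_ : [set y | _] = xsection E x); [exact: measurable_xsection|rewrite xsectionE]. Qed.

Let mE2 y : measurable [set x | E (x, y)].
Proof. by rewrite (_ : [set x | _] = ysection E y); [exact: measurable_ysection|rewrite ysectionE]. Qed.

Lemma tonelli_rel (f : T1 -> \bar R) (g : T2 -> \bar R) :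
  measurable_fun setT f -> measurable_fun setT g ->
  (forall x, 0 <= f x)%E -> (forall x, 0 <= g x)%E ->
  (\int[m1]_x (f x * \int[m2]_(y in [set y | E (x, y)]) g y) =
   \int[m2]_y (g y * \int[m1]_(x in [set x | E (x, y)]) f x))%E.
Proof.
move=> mf mg f0 g0.
pose h z := (f z.1 * g z.2 * (\1_E z)%:E)%E.
have mh : measurable_fun setT h.
  apply: emeasurable_funM; last by apply/measurable_EFinP; exact/measurable_indicP.
  by apply: emeasurable_funM; exact: measurableT_comp.
have h0 z : (0 <= h z)%E by rewrite !mule_ge0// lee_fin.
have := fubini_tonelli (m1 := m1) (m2 := m2) h mh h0.
congr (_ = _).
  apply: eq_integral => x _.
  rewrite (integral_mkcond [set y | E (x, y)]) -ge0_integralZl//; last 2 first.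
  - by apply/(measurable_restrictT _ _).1 => //; exact: measurable_funTS.
  - by move=> y _; rewrite patchE; case: ifPn.
  apply: eq_integral => y _; rewrite /h/= patchE indicE.
  have -> : (y \in [set y | E (x, y)]) = ((x, y) \in E) by apply/idP/idP; rewrite !inE.
  by case: ifPn; rewrite ?mule1 ?mule0.
apply: eq_integral => y _.
rewrite (integral_mkcond [set x | E (x, y)]) -ge0_integralZl//; last 2 first.
- by apply/(measurable_restrictT _ _).1 => //; exact: measurable_funTS.
- by move=> x _; rewrite patchE; case: ifPn.
apply: eq_integral => x _; rewrite /h/= patchE indicE.
have -> : (x \in [set x | E (x, y)]) = ((x, y) \in E) by apply/idP/idP; rewrite !inE.
by case: ifPn; rewrite ?mule1 ?mule0// (muleC (f x)).
Qed.

Lemma measurable_integral_rel (g : T2 -> \bar R) :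
  measurable_fun setT g -> (forall x, 0 <= g x)%E ->
  measurable_fun setT (fun x => \int[m2]_(y in [set y | E (x, y)]) g y)%E.
Proof.
move=> mg g0.
pose h (z : T1 * T2) := (g z.2 * (\1_E z)%:E)%E.
have mh : measurable_fun setT h.
  apply: emeasurable_funM; last by apply/measurable_EFinP; exact/measurable_indicP.
  exact: measurableT_comp.
have h0 z : (0 <= h z)%E by rewrite !mule_ge0// lee_fin.
apply: eq_measurable_fun (measurable_fun_fubini_tonelli_F (m2 := m2) h mh h0).
move=> x _; rewrite /fubini_F [RHS](integral_mkcond [set y | E (x, y)]).
apply: eq_integral => y _; rewrite /h/= patchE indicE.
have -> : (y \in [set y | E (x, y)]) = ((x, y) \in E) by apply/idP/idP; rewrite !inE.
by case: ifPn; rewrite ?mule1 ?mule0.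
Qed.

End tonelli.

(* [segment_density] is Hoelder's inequality run backwards: a finite
   [\int (L g)^k f] produces a weight [n] with controlled [\int n^-k f] whose
   mass on each segment is at most a multiple of [1 / g]. *)
Section weighted_segment_density.
Context {R : realType}.
Local Notation TR := (measurableTypeR R).
Variable mu : {sigma_finite_measure set TR -> \bar R}.
Variables (b : bool) (D : set TR) (f g : TR -> R) (k : R).
Hypotheses (mD : measurable D) (mf : measurable_fun setT f) (mg : measurable_fun setT g).
Hypotheses (f0 : forall x, 0 <= f x) (k0 : 0 < k).
Hypothesis g0 : forall x, D x -> 0 < g x.
Hypothesis gmono : forall x y, D x -> D y -> ord b x y -> g y <= g x.
Let L (x : TR) := fine (\int[mu]_(y in D `&` segment b x) (f y)%:E)%E.
Hypothesis Lfin : forall x, D x -> (\int[mu]_(y in D `&` segment b x) (f y)%:E < +oo)%E.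

Let mDS x : measurable (D `&` segment b x).
Proof. by apply: measurableI => //; exact: measurable_segment. Qed.

Let mfE A : measurable_fun A (EFin \o f).
Proof. by apply/measurable_EFinP; exact: measurable_funTS. Qed.

Lemma segment_massE x : D x -> (\int[mu]_(y in D `&` segment b x) (f y)%:E = (L x)%:E)%E.
Proof.
move=> Dx; rewrite fineK// ge0_fin_numE ?Lfin//.
by apply: integral_ge0 => y _; rewrite lee_fin.
Qed.

Lemma segment_mass_ge0 x : 0 <= L x.
Proof. by apply: fine_ge0; apply: integral_ge0 => y _; rewrite lee_fin. Qed.

Lemma segment_mass_mono x y : D x -> D y -> ord b x y -> L x <= L y.
Proof.
move=> Dx Dy xy; rewrite -lee_fin -!segment_massE//; apply: ge0_subset_integral => //.
  by move=> z _; rewrite lee_fin.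
by move=> z [Dz zx]; split => //; exact: ord_trans xy.
Qed.

Lemma measurable_segment_mass : measurable_fun setT L.
Proof.
apply: measurableT_comp => //.
pose E := [set z : TR * TR | ord b z.2 z.1].
have mE : measurable E.
  rewrite -[X in measurable X]setTI /E; case: b => /=; by apply: measurable_fun_ler.
have mfD : measurable_fun setT ((EFin \o f) \_ D).
  by apply/(measurable_restrictT _ _).1.
have fD0 x : (0 <= ((EFin \o f) \_ D) x)%E by rewrite patchE; case: ifPn; rewrite ?lee_fin.
apply: eq_measurable_fun (measurable_integral_rel mu mE mfD fD0) => x _.
by rewrite setIC [RHS]integral_mkcondr.
Qed.


Lemma segment_sublevel s : 0 <= s ->
  (\int[mu]_(x in D `&` [set x | (L x <= s)%R]) (f x)%:E <= s%:E)%E.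
Proof.
move=> s0; apply: (integral_sublevel_le (b := b)) => //; first exact: measurable_segment_mass.
by move=> t Dt; rewrite segment_massE.
Qed.

(** A computable substitute for the supremum of (L g)^k over the points after [s]. It dominates that
    supremum up to a factor ([segment_weight_ge]), yet integrates against [f] to only twice the
    integral of (L g)^k ([integral_segment_weight]). The density sought is W^(-1/k). *)
Let W (s : TR) := ((((L s * g s) `^ k)%:E) +
  \int[mu]_(y in D `&` [set y | ord b s y]) (g y `^ k * L y `^ (k - 1) * f y)%:E)%E.

Let gf0 y : 0 <= g y `^ k * L y `^ (k - 1) * f y.
Proof. by rewrite !mulr_ge0 ?powR_ge0. Qed.

Let mgf A : measurable_fun A (fun y => (g y `^ k * L y `^ (k - 1) * f y)%:E).
Proof.
apply/measurable_EFinP; apply: measurable_funM; last exact: measurable_funTS.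
apply: measurable_funM; apply: (measurableT_comp (measurable_powR _)).
  exact: measurable_funTS.
by apply: measurable_funTS; exact: measurable_segment_mass.
Qed.

Let mord x : measurable (D `&` [set y | ord b x y]).
Proof.
apply: measurableI => //; rewrite (_ : [set y | _] = segment (~~ b) x); first exact: measurable_segment.
by apply/seteqP; split => y; case: b.
Qed.

(** If [L x <= 2 * L s], the first summand of [W] suffices because [g] decreases along the order.
    Otherwise at least half of the mass of the segment of [x] sits where L > L x / 2; such points
    come after [s], and on them the integrand g^k L^(k-1) is at least (L x g x / 2)^k / L x. *)
Lemma segment_weight_ge s x : D s -> D x -> ord b s x ->
  (((L x * g x) `^ k / 2 `^ (k + 1))%:E <= W s)%E.
Proof.
move=> Ds Dx sx.
have L0 := segment_mass_ge0; have gx0 := ltW (g0 Dx).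
case: (leP (L x) (2 * L s)) => [Lx|Lx].
  apply: (@le_trans _ _ ((L s * g s) `^ k)%:E); last first.
    by apply: leeDl; apply: integral_ge0 => y _; rewrite lee_fin.
  rewrite lee_fin ler_pdivrMr ?powR_gt0//.
  rewrite powRDgt0// powRr1// mulrA -powRM// ?mulr_ge0 ?L0 ?(ltW (g0 _))//.
  apply: (@le_trans _ _ ((L s * g s * 2) `^ k)).
    apply: ge0_ler_powR; rewrite ?nnegrE ?mulr_ge0 ?L0 ?(ltW (g0 _)) ?(ltW k0)//.
    rewrite mulrAC [_ * 2]mulrC; apply: ler_pM; rewrite ?L0 ?gmono//.
  by rewrite ler_peMr ?powR_ge0// ler1n.
have Lx0 : 0 < L x by rewrite (le_lt_trans _ Lx)// mulr_ge0 ?L0.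
apply: (@le_trans _ _ (\int[mu]_(y in D `&` [set y | ord b s y]) (g y `^ k * L y `^ (k - 1) * f y)%:E)%E); last first.
  by apply: leeDr; rewrite lee_fin powR_ge0.
pose B := (D `&` segment b x) `&` [set y | L x / 2 < L y].
have mB : measurable B.
  apply: measurableI; first exact: mDS.
  by rewrite -[X in measurable X]setTI; apply: measurable_fun_ltr => //; exact: measurable_segment_mass.
(* A point before [s] would have mass at most L s < L x / 2. *)
have BD : B `<=` D `&` [set y | ord b s y].
  move=> y [[Dy yx] /= Ly]; split => //=; case: (ord_total b s y) => // ys.
  by have := segment_mass_mono Dy Ds ys; rewrite leNgt -(ltr_pM2l (x := 2))// => /negP[]; lra.
have IB : ((L x / 2)%:E <= \int[mu]_(y in B) (f y)%:E)%E.
  have DU : D `&` segment b x = ((D `&` segment b x) `&` [set y | L y <= L x / 2]) `|` B.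
    apply/seteqP; split => y /=; last by case=> -[].
    by move=> Dy; case: (leP (L y) (L x / 2)) => ?; [left|right].
  have := segment_massE Dx; rewrite {1}DU ge0_integral_setU//; last 3 first.
  - apply: measurableI; first exact: mDS.
    by rewrite -[X in measurable X]setTI; apply: measurable_fun_ler => //; exact: measurable_segment_mass.
  - by move=> y _; rewrite lee_fin.
  - by apply/disj_setPS => y /= [[_ h1] [_]] /=; rewrite ltNge h1.
  move=> H; rewrite -(leeD2lE (x := (L x / 2)%:E))// -EFinD -splitr -H leeD2r//.
  apply: (@le_trans _ _ (\int[mu]_(y in D `&` [set y | (L y <= L x / 2)%R]) (f y)%:E)%E).
    apply: ge0_subset_integral => //.
    + apply: measurableI; first exact: mDS.
      by rewrite -[X in measurable X]setTI; apply: measurable_fun_ler => //; exact: measurable_segment_mass.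
    + by apply: measurable_sublevel => //; exact: measurable_segment_mass.
    + by move=> y _; rewrite lee_fin.
    + by move=> y [[Dy _]].
  by apply: segment_sublevel; rewrite divr_ge0 ?ltW.
apply: (@le_trans _ _ (\int[mu]_(y in B) (((L x * g x / 2) `^ k / L x)%:E * (f y)%:E))%E).
  rewrite ge0_integralZl_EFin ?divr_ge0 ?powR_ge0 ?L0//; last by move=> y _; rewrite lee_fin.
  apply: (@le_trans _ _ (((L x * g x / 2) `^ k / L x)%:E * (L x / 2)%:E)%E); last first.
    by rewrite lee_wpmul2l// lee_fin divr_ge0 ?powR_ge0 ?L0.
  rewrite -EFinM lee_fin mulrA divfK ?gt_eqF//.
  rewrite powRDgt0// powRr1// invfM mulrA ler_pM2r ?invr_gt0//.
  rewrite [in leRHS]powRM ?mulr_ge0 ?L0 ?invr_ge0//.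
  by rewrite -(powR_inv1 (ler0n R 2)) -powRrM mulN1r powRN.
apply: (@le_trans _ _ (\int[mu]_(y in B) (g y `^ k * L y `^ (k - 1) * f y)%:E)%E); last first.
  by apply: ge0_subset_integral => // y _; rewrite lee_fin.
apply: ge0_le_integral => //.
- by move=> y _; rewrite -EFinM lee_fin mulr_ge0// divr_ge0 ?powR_ge0 ?L0.
- by apply: emeasurable_funM => //; exact: mfE.
move=> y [[Dy yx] /= Ly]; rewrite -EFinM lee_fin ler_wpM2r//.
have Ly0 : 0 < L y by apply: le_lt_trans Ly; rewrite divr_ge0 ?L0.
(* The sign of k - 1 is unknown, so L^(k-1) is split as L^k / L and the two factors are bounded
   separately, the first with L y > L x / 2 and the second with L y <= L x. *)
rewrite (powRDgt0 _ _ Ly0) powR_inv1 ?L0// mulrA -powRM ?L0 ?(ltW (g0 _))//.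
apply: ler_pM; rewrite ?powR_ge0 ?invr_ge0 ?L0//.
  apply: ge0_ler_powR; rewrite ?nnegrE ?mulr_ge0 ?divr_ge0 ?mulr_ge0 ?L0 ?(ltW (g0 _)) ?(ltW k0)//.
  by rewrite mulrAC mulrC ler_pM ?divr_ge0 ?L0 ?gmono ?(ltW Ly).
by rewrite lef_pV2 ?posrE// segment_mass_mono.
Qed.

Let mW : measurable_fun setT W.
Proof.
apply: emeasurable_funD.
  apply/measurable_EFinP; apply: (measurableT_comp (measurable_powR _)).
  by apply: measurable_funM => //; exact: measurable_segment_mass.
pose E := [set z : TR * TR | ord b z.1 z.2].
have mE : measurable E.
  rewrite -[X in measurable X]setTI /E; case: b => /=; by apply: measurable_fun_ler.
have mgfD : measurable_fun setT ((fun y => (g y `^ k * L y `^ (k - 1) * f y)%:E) \_ D).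
  by apply/(measurable_restrictT _ _).1.
have gfD0 x : (0 <= ((fun y => (g y `^ k * L y `^ (k - 1) * f y)%:E) \_ D) x)%E.
  by rewrite patchE; case: ifPn; rewrite ?lee_fin.
apply: eq_measurable_fun (measurable_integral_rel mu mE mgfD gfD0) => x _.
by rewrite setIC [RHS]integral_mkcondr.
Qed.

Let mLgf A : measurable_fun A (fun y => ((L y * g y) `^ k * f y)%:E).
Proof.
apply/measurable_EFinP; apply: measurable_funM; last exact: measurable_funTS.
apply: (measurableT_comp (measurable_powR _)).
by apply: measurable_funTS; apply: measurable_funM => //; exact: measurable_segment_mass.
Qed.

Let W0 s : (0 <= W s)%E.
Proof. by rewrite adde_ge0 ?lee_fin ?powR_ge0//; apply: integral_ge0 => y _; rewrite lee_fin. Qed.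

(** After exchanging the integrals, the points [s] before [y] carry total mass [L y], which restores
    the missing factor in L^(k-1). Hence the second summand of [W] contributes exactly as much as
    the first. *)
Lemma integral_segment_weight : (\int[mu]_(s in D) (W s * (f s)%:E) =
  2%:E * \int[mu]_(s in D) ((L s * g s) `^ k * f s)%:E)%E.
Proof.
have L0 := segment_mass_ge0.
pose J s := (\int[mu]_(y in D `&` [set y | ord b s y]) (g y `^ k * L y `^ (k - 1) * f y)%:E)%E.
have J0 s : (0 <= J s)%E by apply: integral_ge0 => y _; rewrite lee_fin.
pose E := [set z : TR * TR | ord b z.1 z.2].
have mE : measurable E.
  by rewrite -[X in measurable X]setTI /E; case: b => /=; apply: measurable_fun_ler.
pose G := (fun y => (g y `^ k * L y `^ (k - 1) * f y)%:E) \_ D.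
have mG : measurable_fun setT G by apply/(measurable_restrictT _ _).1.
have G0 x : (0 <= G x)%E by rewrite /G patchE; case: ifPn; rewrite ?lee_fin.
have JE s : J s = (\int[mu]_(y in [set y | E (s, y)]) G y)%E.
  by rewrite /J setIC [LHS]integral_mkcondr.
pose F := (EFin \o f) \_ D.
have mF : measurable_fun setT F by apply/(measurable_restrictT _ _).1.
have F0 x : (0 <= F x)%E by rewrite /F patchE; case: ifPn; rewrite ?lee_fin.
have mJ : measurable_fun setT J.
  by apply: eq_measurable_fun (measurable_integral_rel mu mE mG G0) => x _; rewrite JE.
have H : (\int[mu]_(s in D) (J s * (f s)%:E) = \int[mu]_(s in D) ((L s * g s) `^ k * f s)%:E)%E.
  rewrite integral_mkcond (eq_integral (fun s => F s * \int[mu]_(y in [set y | E (s, y)]) G y)%E); last first.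
    by move=> s _; rewrite -JE /F !patchE; case: ifPn => _; rewrite ?mul0e//= muleC.
  rewrite tonelli_rel// [RHS]integral_mkcond; apply: eq_integral => y _.
  have -> : (\int[mu]_(x in [set x | E (x, y)]) F x = \int[mu]_(x in D `&` segment b y) (f x)%:E)%E.
    by rewrite setIC [RHS]integral_mkcondr.
  rewrite /G !patchE; case: ifPn => [/[!inE] Dy|_]; last by rewrite mul0e.
  rewrite segment_massE//= -EFinM; congr EFin.
  rewrite powRM ?L0 ?(ltW (g0 Dy))// -(mulr_powRB1 (L0 y) k0).
  by rewrite -/(L y); ring.
rewrite (eq_integral (fun s => ((L s * g s) `^ k * f s)%:E + J s * (f s)%:E)%E); last first.
  by move=> s _; rewrite -/(J s) EFinM -ge0_muleDl ?lee_fin ?powR_ge0.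
rewrite ge0_integralD//.
- by rewrite H -mule2n mule_natl.
- by move=> y _; rewrite lee_fin mulr_ge0 ?powR_ge0.
- by move=> y _; rewrite mule_ge0 ?lee_fin.
- by apply: emeasurable_funM => //; exact: measurable_funTS.
Qed.

Lemma segment_density :
  (\int[mu]_(s in D) ((L s * g s) `^ k * f s)%:E < +oo)%E ->
  exists n : TR -> R, [/\ measurable_fun setT n, forall x, 0 < n x,
    forall x, D x -> (\int[mu]_(y in D `&` segment b x) (n y * f y)%:E <=
      ((2 `^ (k + 1)) `^ k^-1 / g x)%:E)%E &
    (\int[mu]_(s in D) (n s `^ (- k) * f s)%:E <=
      2%:E * \int[mu]_(s in D) ((L s * g s) `^ k * f s)%:E)%E].
Proof.
move=> Ioo; have L0 := segment_mass_ge0.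
(* The value 1 is a default where [W] is 0 or infinite ([fine] sends infinity to 0). Almost
   everywhere in [D] where [f] is positive, [W] is finite because W f is integrable, and positive
   because [L] is. *)
pose n s := if fine (W s) == 0 then 1 else fine (W s) `^ (- k^-1).
have mfW : measurable_fun setT (fine \o W) by exact: measurableT_comp.
have mn : measurable_fun setT n.
  apply: measurable_fun_ifT => //; first by apply: measurable_fun_eqr.
  exact: (measurableT_comp (measurable_powR _)).
have fW0 s : 0 <= fine (W s) by rewrite fine_ge0.
have n0 s : 0 < n s.
  by rewrite /n; case: eqVneq => // h; rewrite powR_gt0// lt_def h fW0.
have mWf : measurable_fun D (fun s => W s * (f s)%:E)%E.
  by apply: emeasurable_funM => //; exact: measurable_funTS.
have Wf0 s : (0 <= W s * (f s)%:E)%E by rewrite mule_ge0 ?lee_fin.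
have IW : mu.-integrable D (fun s => W s * (f s)%:E)%E.
  apply/integrableP; split => //.
  under eq_integral => s _ do rewrite gee0_abs//.
  by rewrite integral_segment_weight lte_mul_pinfty// ?lee_fin// ge0_fin_numE.
have aeW := integrable_ae mD IW.
have mnf A : measurable_fun A (fun y => (n y * f y)%:E).
  by apply/measurable_EFinP; apply: measurable_funM; exact: measurable_funTS.
exists n; split => //.
  move=> x Dx; have [Lx0|Lx0] := eqVneq (L x) 0.
    have If : {ae mu, forall y, (D `&` segment b x) y -> (f y)%:E = 0%E}.
      apply: ge0_integral_eq0_ae => //; last by rewrite segment_massE// Lx0.
      by move=> y _; rewrite lee_fin.
    rewrite ae_eq0_ge0_integral ?lee_fin ?divr_ge0 ?powR_ge0 ?(ltW (g0 Dx))//.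
    - by move=> y _; rewrite lee_fin mulr_ge0 ?(ltW (n0 y)).
    by apply: filterS If => y + Dy => /(_ Dy); rewrite EFinM => ->; rewrite mule0.
  have {}Lx0 : 0 < L x by rewrite lt_def Lx0 L0.
  pose c := ((2 `^ (k + 1)) `^ k^-1 / (L x * g x))%R.
  have Lg0 : 0 < L x * g x by rewrite mulr_gt0// g0.
  have c0 : 0 <= c by rewrite divr_ge0 ?powR_ge0 ?ltW.
  apply: (@le_trans _ _ (\int[mu]_(y in D `&` segment b x) (c%:E * (f y)%:E))%E).
    apply: ae_ge0_le_integral => //.
    - by move=> y _; rewrite lee_fin mulr_ge0 ?(ltW (n0 y)).
    - by move=> y _; rewrite -EFinM lee_fin mulr_ge0.
    - by apply: emeasurable_funM => //; exact: mfE.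
    apply: filterS aeW => y yfin [Dy yx].
    have [->|fy0] := eqVneq (f y) 0; first by rewrite mulr0 mule0.
    have {}fy0 : 0 < f y by rewrite lt_def fy0 f0.
    rewrite -EFinM lee_fin ler_pM2r//.
    have Wy := segment_weight_ge Dy Dx yx.
    have Wyoo : W y \is a fin_num.
      by have := yfin Dy; case: (W y) (W0 y) => [r| |]// _; rewrite gt0_mulye ?lte_fin.
    have Wpos : 0 < fine (W y).
      rewrite -lte_fin fineK//; apply: lt_le_trans Wy.
      by rewrite lte_fin divr_gt0 ?powR_gt0.
    rewrite /n gt_eqF// powRN /c -[leRHS]invrK lef_pV2 ?posrE ?powR_gt0 ?invr_gt0 ?divr_gt0 ?powR_gt0//.
    rewrite invf_div.
    have -> : (L x * g x / (2 `^ (k + 1)) `^ k^-1 = ((L x * g x) `^ k / 2 `^ (k + 1)) `^ k^-1)%R.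
      rewrite powRM ?invr_ge0 ?powR_ge0// -[in RHS]powRrM mulfV ?gt_eqF// powRr1 ?(ltW Lg0)//.
      by rewrite powRV ?powR_ge0.
    apply: ge0_ler_powR; rewrite ?invr_ge0 ?(ltW k0) ?nnegrE ?divr_ge0 ?powR_ge0//.
    by rewrite -lee_fin fineK.
  rewrite ge0_integralZl_EFin//; last by move=> y _; rewrite lee_fin.
  rewrite segment_massE// -EFinM lee_fin /c le_eqVlt; apply/orP; left; apply/eqP.
  by field; rewrite (gt_eqF Lx0) (gt_eqF (g0 Dx)).
rewrite -integral_segment_weight.
apply: ae_ge0_le_integral => //.
- by move=> y _; rewrite lee_fin mulr_ge0 ?powR_ge0.
- apply/measurable_EFinP; apply: measurable_funM; last exact: measurable_funTS.
  by apply: measurable_funTS; exact: (measurableT_comp (measurable_powR _)).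
(* The sublevel bound at height 0: [f] vanishes almost everywhere on the set where [L] does, so the
   default value of [n] is harmless there. *)
have L00 : {ae mu, forall y, (D `&` [set y | L y <= 0]) y -> (f y)%:E = 0%E}.
  apply: ge0_integral_eq0_ae => //.
  - by apply: measurable_sublevel => //; exact: measurable_segment_mass.
  - by move=> y _; rewrite lee_fin.
  - apply/eqP; rewrite eq_le segment_sublevel//=.
    by apply: integral_ge0 => y _; rewrite lee_fin.
apply: filterS2 aeW L00 => y yfin yL Dy.
have [->|fy0] := eqVneq (f y) 0; first by rewrite mulr0 mule0.
have {}fy0 : 0 < f y by rewrite lt_def fy0 f0.
have Ly0 : 0 < L y.
  rewrite ltNge; apply/negP => Ly; have := yL (conj Dy Ly).
  by move=> [] /eqP; rewrite gt_eqF.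
have Wyoo : W y \is a fin_num.
  by have := yfin Dy; case: (W y) (W0 y) => [r| |]// _; rewrite gt0_mulye ?lte_fin.
have Wpos : 0 < fine (W y).
  rewrite -lte_fin fineK//; apply: lt_le_trans (segment_weight_ge Dy Dy (ord_refl b y)).
  by rewrite lte_fin divr_gt0 ?powR_gt0// mulr_gt0// g0.
rewrite -(fineK Wyoo) -EFinM lee_fin /n gt_eqF// -powRrM mulrNN mulVf ?gt_eqF// powRr1//.
Qed.

End weighted_segment_density.

(** * Dyadic level sets *)

Section dyadic_floor.
Context {R : realType}.
Implicit Types (l x k : R) (n : nat).

(** Rounding down to the scale l 2^i with i < n, and to 0 below [l]. It replaces [g] by a function
    with finitely many values, so that the superpositions in [level_test] are finite sums. *)
Fixpoint dyadic_floor l n x : R :=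
  if n is n'.+1 then (if l * 2 ^+ n' <= x then l * 2 ^+ n' else dyadic_floor l n' x)
  else 0.

Lemma dyadic_floor_ge0 l n x : 0 < l -> 0 <= dyadic_floor l n x.
Proof. by move=> l0; elim: n => //= n IH; case: ifP => // _; rewrite mulr_ge0 ?exprn_ge0 ?ltW. Qed.

Lemma dyadic_floorP l n x : dyadic_floor l n x = 0 \/
  exists2 i, (i < n)%N & l * 2 ^+ i <= x /\ dyadic_floor l n x = l * 2 ^+ i.
Proof.
elim: n => [|n IH] /=; first by left.
case: ifPn => h; first by right; exists n.
case: IH => [->|[i ilt [h1 h2]]]; first by left.
by right; exists i => //; exact: leqW.
Qed.

Lemma dyadic_floor_gt l n x : l <= x -> x < l * 2 ^+ n -> x < 2 * dyadic_floor l n x.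
Proof.
move=> lx; elim: n => [|n IH] /=; first by rewrite expr0 mulr1 ltNge lx.
case: (leP (l * 2 ^+ n) x) => h; last by move=> _; exact: IH.
by rewrite exprS mulrCA.
Qed.

Lemma dyadic_floor_le l n x : 0 < l -> 0 <= x -> dyadic_floor l n x <= l * 2 ^+ n.
Proof.
move=> l0 x0; case: (dyadic_floorP l n x) => [->|[i ilt [_ ->]]].
  by rewrite mulr_ge0 ?exprn_ge0 ?ltW.
by rewrite ler_pM2l// ler_eXn2l ?ltr1n// ltnW.
Qed.

Lemma dyadic_floor_gt0 l n x : 0 < l -> 0 < dyadic_floor l n x -> l <= x.
Proof.
move=> l0; case: (dyadic_floorP l n x) => [->|[i ilt [h _]] _]; first by rewrite ltxx.
by apply: le_trans h; rewrite ler_peMr ?(ltW l0)// exprn_ege1// ler1n.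
Qed.

Lemma measurable_dyadic_floor l n : measurable_fun setT (dyadic_floor l n).
Proof.
elim: n => [|n IH] /=; first exact: measurable_cst.
by apply: measurable_fun_ifT => //; apply: measurable_fun_ler.
Qed.

Lemma powR2_gt1 k : 0 < k -> 1 < (2 : R) `^ k.
Proof.
move=> k0; have : ((1 : R) `^ k < 2 `^ k).
  by apply: gt0_ltr_powR; rewrite ?nnegrE// ltr1n.
by rewrite powR1.
Qed.

Lemma sum_dyadic_powR l k n : 0 < l -> 0 < k ->
  \sum_(i < n) (l * 2 ^+ i) `^ k <= (l * 2 ^+ n) `^ k / (2 `^ k - 1).
Proof.
move=> l0 k0; have k1 := powR2_gt1 k0.
have k2 : 0 < 2 `^ k - 1 :> R by rewrite subr_gt0.
elim: n => [|n IH]; first by rewrite big_ord0 divr_ge0 ?powR_ge0 ?(ltW k2).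
rewrite big_ord_recr/=; apply: (le_trans (lerD IH (lexx _))).
rewrite exprS mulrCA [in leRHS]powRM ?mulr_ge0 ?exprn_ge0 ?(ltW l0)//.
rewrite le_eqVlt; apply/orP; left; apply/eqP; field; rewrite gt_eqF//.
Qed.

(** A geometric sum is comparable to its largest term, which here is the power of the rounded
    value. *)
Lemma sum_dyadic_le l k n x : 0 < l -> 0 < k ->
  \sum_(i < n) (l * 2 ^+ i) `^ k * (l * 2 ^+ i <= x)%R%:R <=
  2 `^ k / (2 `^ k - 1) * dyadic_floor l n x `^ k.
Proof.
move=> l0 k0; have k1 := powR2_gt1 k0.
have k2 : 0 < 2 `^ k - 1 :> R by rewrite subr_gt0.
elim: n => [|n IH] /=; first by rewrite big_ord0 mulr_ge0 ?divr_ge0 ?powR_ge0 ?(ltW k2).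
rewrite big_ord_recr/=; case: ifPn => h; last by rewrite mulr0 addr0.
rewrite mulr1.
have S1 : \sum_(i < n) (l * 2 ^+ i) `^ k * (l * 2 ^+ i <= x)%R%:R <=
    \sum_(i < n) (l * 2 ^+ i) `^ k.
  by apply: ler_sum => i _; rewrite ler_piMr ?powR_ge0// lern1 leq_b1.
apply: (le_trans (lerD (le_trans S1 (sum_dyadic_powR n l0 k0)) (lexx _))).
rewrite le_eqVlt; apply/orP; left; apply/eqP; field; rewrite gt_eqF//.
Qed.

End dyadic_floor.

(* An abstract form of the test-function argument: [C] plays the role of the
   constant in the inequality and [lev l] is a superlevel set of [g]. *)
Section level_test.
Context {d : measure_display} {T : measurableType d} {R : realType}.
Variable mu : {measure set T -> \bar R}.
Variables (D : set T) (f g L : T -> R) (q C : R).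
Hypotheses (mD : measurable D) (mf : measurable_fun setT f)
  (mg : measurable_fun setT g) (mL : measurable_fun setT L).
Hypotheses (f0 : forall x, 0 <= f x) (g0 : forall x, D x -> 0 < g x)
  (L0 : forall x, 0 <= L x) (q0 : 0 < q) (q1 : q < 1) (C0 : 0 <= C).
Let lev l := D `&` [set x | l <= g x].
Hypothesis sub : forall s : R, 0 <= s ->
  (\int[mu]_(x in D `&` [set x | (L x <= s)%R]) (f x)%:E <= s%:E)%E.
Hypothesis lev_fin : forall l, 0 < l -> (\int[mu]_(x in lev l) (f x)%:E < +oo)%E.
Hypothesis lev_L : forall l x, 0 < l -> lev l x ->
  ((L x)%:E <= \int[mu]_(y in lev l) (f y)%:E)%E.
Hypothesis test : forall (N : nat) (l e : nat -> R) (m : T -> R),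
  (forall i, 0 < l i) -> (forall i, 0 <= e i) -> measurable_fun setT m ->
  (forall x, 0 <= m x) ->
  (forall x, D x -> m x = 0 \/ exists2 i, (i < N)%N & lev (l i) x /\ m x <= e i * l i) ->
  (\int[mu]_(x in D) (m x `^ q * f x)%:E <= ((C * \sum_(i < N) e i) `^ q)%:E)%E.

Let k := star q.

Let k0 : 0 < k. Proof. by rewrite divr_gt0 ?subr_gt0. Qed.

Let qk : (k + 1) * q = k.
Proof. by rewrite /k /star; field; rewrite subr_eq0 gt_eqF. Qed.

Let mlev l : measurable (lev l).
Proof.
apply: measurableI => //; rewrite -[X in measurable X]setTI.
exact: measurable_fun_ler.
Qed.

Let mfE A : measurable_fun A (EFin \o f).
Proof. by apply/measurable_EFinP; exact: measurable_funTS. Qed.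

Let nu l := fine (\int[mu]_(x in lev l) (f x)%:E)%E.

Let nu_ge0 l : 0 <= nu l.
Proof. by apply: fine_ge0; apply: integral_ge0 => x _; rewrite lee_fin. Qed.

Let nuE l : 0 < l -> (\int[mu]_(x in lev l) (f x)%:E)%E = (nu l)%:E.
Proof.
move=> l0; rewrite fineK// ge0_fin_numE ?lev_fin//.
by apply: integral_ge0 => x _; rewrite lee_fin.
Qed.

Let mpow (a : T -> R) (e : R) A : measurable_fun setT a ->
  measurable_fun A (fun x => a x `^ e).
Proof. by move=> ma; apply: (measurableT_comp (measurable_powR _)); exact: measurable_funTS. Qed.

Let mpowf (a : T -> R) (e : R) A : measurable_fun setT a ->
  measurable_fun A (fun x => (a x `^ e * f x)%:E).
Proof.
move=> ma; apply/measurable_EFinP; apply: measurable_funM; first exact: mpow.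
exact: measurable_funTS.
Qed.

Let A := 2 `^ k / (2 `^ k - 1) : R.
Let B := 2 `^ (k + 1) * A : R.

Let A0 : 0 <= A.
Proof. by rewrite divr_ge0 ?powR_ge0// subr_ge0 ltW// powR2_gt1. Qed.

Let B0 : 0 <= B. Proof. by rewrite mulr_ge0 ?powR_ge0. Qed.

(** By [powR_le_integral_level], nu^(k+1) is at most 2^(k+1) times the integral of L^k f over the
    level set. Under the integral sign, the factors (l 2^i)^k that remain at [x] belong to the
    levels below g x and add up to a multiple of the power of the rounded value. *)
Lemma level_cost l N : 0 < l ->
  ((\sum_(i < N) nu (l * 2 ^+ i) `^ (k + 1) * (l * 2 ^+ i) `^ k)%:E <=
   B%:E * \int[mu]_(x in D) ((L x * dyadic_floor l N (g x)) `^ k * f x)%:E)%E.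
Proof.
move=> l0; have li0 i : 0 < l * 2 ^+ i by rewrite mulr_gt0 ?exprn_gt0.
have mLk X : measurable_fun X (fun x => (L x `^ k * f x)%:E) by exact: mpowf.
have step i : ((nu (l * 2 ^+ i) `^ (k + 1) * (l * 2 ^+ i) `^ k)%:E <=
    (2 `^ (k + 1))%:E * \int[mu]_(x in D)
      ((l * 2 ^+ i) `^ k * (l * 2 ^+ i <= g x)%R%:R * (L x `^ k * f x))%:E)%E.
  have : (((nu (l * 2 ^+ i) / 2) `^ (k + 1))%:E <= \int[mu]_(x in lev (l * 2 ^+ i)%R) (L x `^ k * f x)%:E)%E.
    apply: powR_le_integral_level => //; first by move=> s s0; apply: le_trans (sub s0);
        apply: ge0_subset_integral => //; [by apply: measurable_sublevel|by apply: measurable_sublevel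
        |by move=> x _; rewrite lee_fin|by move=> x [[]]].
      exact: ltW.
    by rewrite nuE.
  move=> H.
  have -> : (\int[mu]_(x in D) ((l * 2 ^+ i) `^ k * (l * 2 ^+ i <= g x)%R%:R * (L x `^ k * f x))%:E =
      ((l * 2 ^+ i) `^ k)%:E * \int[mu]_(x in lev (l * 2 ^+ i)%R) (L x `^ k * f x)%:E)%E.
    rewrite -ge0_integralZl_EFin ?powR_ge0//; last by move=> x _; rewrite lee_fin mulr_ge0 ?powR_ge0.
    rewrite [RHS]integral_mkcondr; apply: eq_integral => x _; rewrite patchE.
    case: ifPn; rewrite ?notin_setE ?inE /= => h; last move/negP/negbTE: h => h.
      by rewrite h mulr1 EFinM.
    by rewrite h; rewrite ?mulr1 ?mulr0 ?mul0r// EFinM.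
  rewrite muleCA EFinM muleC lee_wpmul2l ?lee_fin ?powR_ge0//.
  apply: le_trans (lee_wpmul2l _ H); rewrite ?lee_fin ?powR_ge0//.
  by rewrite -(powRM _ (ler0n R 2) (divr_ge0 (nu_ge0 _) (ler0n R 2))) [2 * _]mulrC divfK.
rewrite -sumEFin.
have step' (i : 'I_N) : xpredT i -> _ := fun _ => step i.
apply: (le_trans (lee_sum _ step')).
rewrite -ge0_sume_distrr; last by move=> i _; apply: integral_ge0 => x _; rewrite lee_fin !mulr_ge0 ?powR_ge0.
rewrite /B EFinM -muleA lee_wpmul2l ?lee_fin ?powR_ge0//.
rewrite -ge0_integral_sum//; last 2 first.
- move=> i; apply/measurable_EFinP; apply: measurable_funM; last first.
    apply: measurable_funM; first exact: mpow.
    exact: measurable_funTS.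
  apply: measurable_funM => //.
  rewrite (_ : (fun _ => _) = (fun x => if l * 2 ^+ i <= g x then 1 else 0)); last first.
    by apply/funext => x; case: ifP.
  apply: measurable_funTS; apply: measurable_fun_ifT => //.
  exact: measurable_fun_ler.
- by move=> i x _; rewrite lee_fin !mulr_ge0 ?powR_ge0.
rewrite -ge0_integralZl_EFin//; last 2 first.
- by move=> x _; rewrite lee_fin mulr_ge0 ?powR_ge0.
- apply: mpowf; apply: measurable_funM => //.
  by apply: (measurableT_comp (measurable_dyadic_floor _ _)).
apply: ge0_le_integral => //.
- by move=> x _; apply: sume_ge0 => i _; rewrite lee_fin !mulr_ge0 ?powR_ge0.
- apply: emeasurable_sum => i; apply/measurable_EFinP; apply: measurable_funM; last first.
    apply: measurable_funM; first exact: mpow.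
    exact: measurable_funTS.
  apply: measurable_funM => //.
  rewrite (_ : (fun _ => _) = (fun x => if l * 2 ^+ i <= g x then 1 else 0)); last first.
    by apply/funext => x; case: ifP.
  apply: measurable_funTS; apply: measurable_fun_ifT => //.
  exact: measurable_fun_ler.
- apply: emeasurable_funM => //; apply: mpowf; apply: measurable_funM => //.
  by apply: (measurableT_comp (measurable_dyadic_floor _ _)).
move=> x Dx; rewrite sumEFin lee_fin -mulr_suml.
rewrite powRM ?dyadic_floor_ge0//.
rewrite [L x `^ k * _ `^ k]mulrC -(mulrA (_ `^ k) (L x `^ k)) [leRHS]mulrA.
by rewrite ler_wpM2r ?mulr_ge0 ?powR_ge0// sum_dyadic_le.
Qed.

(** Testing with m = (L ghat)^(k+1), where ghat is [g] rounded down, reproduces the integral J on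
    the left because (k+1) q = k, while by [level_cost] the coefficients cost at most B J. Hence J
    <= (C B J)^q, and q < 1 allows J to be absorbed. *)
Lemma level_bound l N : 0 < l ->
  (\int[mu]_(x in D) ((L x * dyadic_floor l N (g x)) `^ k * f x)%:E <= ((C * B) `^ k)%:E)%E.
Proof.
move=> l0; have li0 i : 0 < l * 2 ^+ i by rewrite mulr_gt0 ?exprn_gt0.
set J := (\int[mu]_(x in D) _)%E.
pose gh x := dyadic_floor l N (g x).
have gh0 x : 0 <= gh x by rewrite dyadic_floor_ge0.
have mgh : measurable_fun setT gh by apply: (measurableT_comp (measurable_dyadic_floor _ _)).
have mLgh : measurable_fun setT (fun x => L x * gh x) by exact: measurable_funM.
have J0 : (0 <= J)%E by apply: integral_ge0 => x _; rewrite lee_fin mulr_ge0 ?powR_ge0.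
(* Finiteness is needed for the absorption. It comes from the rounding: the integrand vanishes off
   [lev l], a set of finite mass, and L ghat is bounded on it. *)
have Joo : (J < +oo)%E.
  apply: (@le_lt_trans _ _ (\int[mu]_(x in lev l) (((nu l * (l * 2 ^+ N)) `^ k)%:E * (f x)%:E))%E); last first.
    rewrite ge0_integralZl_EFin ?powR_ge0//; last by move=> x _; rewrite lee_fin.
    by rewrite nuE// -EFinM ltry.
  rewrite /lev [leRHS]integral_mkcondr; apply: ge0_le_integral => //.
  - by move=> x _; rewrite lee_fin mulr_ge0 ?powR_ge0.
  - exact: mpowf.
  - apply/(measurable_restrict _ _ _).1 => //.
      by rewrite -[X in measurable X]setTI; exact: measurable_fun_ler.
    by apply: emeasurable_funM => //; exact: measurable_funTS.
  move=> x Dx; rewrite patchE; case: ifPn; rewrite ?notin_setE ?inE /= => h.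
    rewrite -EFinM lee_fin ler_wpM2r//; apply: ge0_ler_powR; rewrite ?(ltW k0) ?nnegrE ?mulr_ge0 ?exprn_ge0 ?dyadic_floor_ge0 ?(ltW l0)//.
    apply: ler_pM => //; [exact: dyadic_floor_ge0|by rewrite -lee_fin -nuE// lev_L|].
    by rewrite dyadic_floor_le// ltW// g0.
  have -> : dyadic_floor l N (g x) = 0.
    apply/eqP; rewrite eq_le dyadic_floor_ge0// andbT leNgt; apply/negP => h'; apply: h.
    exact: dyadic_floor_gt0 h'.
  by rewrite mulr0 powR0 ?gt_eqF// mul0r.
have Jf : J \is a fin_num by rewrite ge0_fin_numE.
have := @test N (fun i => l * 2 ^+ i) (fun i => nu (l * 2 ^+ i) `^ (k + 1) * (l * 2 ^+ i) `^ k)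
   (fun x => (L x * gh x) `^ (k + 1)).
move=> /(_ li0) H.
have {}H : (J <= ((C * \sum_(i < N) nu (l * 2 ^+ i) `^ (k + 1) * (l * 2 ^+ i) `^ k) `^ q)%:E)%E.
  have -> : J = (\int[mu]_(x in D) (((L x * gh x) `^ (k + 1)) `^ q * f x)%:E)%E.
    by apply: eq_integral => x _; rewrite -powRrM qk.
  apply: H => //.
  - by move=> i; rewrite mulr_ge0 ?powR_ge0.
  - exact: mpow.
  - by move=> x; rewrite powR_ge0.
  - move=> x Dx; rewrite /gh; case: (dyadic_floorP l N (g x)) => [->|[i ilt [h ->]]].
      by left; rewrite mulr0 powR0// gt_eqF// addr_gt0.
    right; exists i => //; split => //=.
    rewrite -mulrA (_ : (l * 2 ^+ i) `^ k * (l * 2 ^+ i) = (l * 2 ^+ i) `^ (k + 1)); last first.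
      by rewrite powRDgt0// [_ `^ 1]powRr1// ltW.
    rewrite -powRM// ?(ltW (li0 i))//.
    apply: ge0_ler_powR; rewrite ?nnegrE ?addr_ge0 ?(ltW k0) ?mulr_ge0 ?exprn_ge0 ?(ltW l0)//.
    by rewrite ler_pM2r// -lee_fin -nuE// lev_L.
have {}H : fine J <= (C * (B * fine J)) `^ q.
  rewrite -lee_fin fineK//; apply: (le_trans H); rewrite lee_fin.
  have S0 : 0 <= \sum_(i < N) nu (l * 2 ^+ i) `^ (k + 1) * (l * 2 ^+ i) `^ k.
    by apply: sumr_ge0 => i _; rewrite mulr_ge0 ?powR_ge0.
  have BJ0 : 0 <= B * fine J by exact: mulr_ge0 B0 (fine_ge0 J0).
  apply: ge0_ler_powR; rewrite ?nnegrE ?(ltW q0)//; [exact: mulr_ge0|exact: mulr_ge0|].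
  by rewrite ler_wpM2l// -lee_fin EFinM fineK// level_cost.
rewrite -(fineK Jf) lee_fin.
have [J00|J00] := eqVneq (fine J) 0; first by rewrite J00 powR_ge0.
have {}J00 : 0 < fine J by rewrite lt_def J00 fine_ge0.
(* Division by J^q leaves J^(1-q) <= (C B)^q; raising to the power 1/(1 - q) produces the exponent k
   = q/(1 - q). *)
move: H; rewrite mulrA (powRM _ (mulr_ge0 C0 B0) (ltW J00)) -ler_pdivrMr ?powR_gt0//.
rewrite -{1}[fine J](powRr1 (ltW J00)) -powRB; last by rewrite gt_eqF ?implybT.
move=> H; have iq0 : 0 < (1 - q)^-1 by rewrite invr_gt0 subr_gt0.
have := @ge0_ler_powR R _ (ltW iq0) _ _ (powR_ge0 _ _) (powR_ge0 _ _) H.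
by rewrite -!powRrM mulfV ?subr_eq0 ?gt_eqF// powRr1 ?(ltW J00).
Qed.

Lemma level_test : (\int[mu]_(x in D) ((L x * g x) `^ k * f x)%:E <= ((2 * (C * B)) `^ k)%:E)%E.
Proof.
have mLg : measurable_fun setT (fun x => L x * g x) by exact: measurable_funM.
(* On [F n] the rounding with l = 2^(-n) and 2n levels loses at most a factor 2, and the bound of
   [level_bound] depends neither on [l] nor on the number of levels. *)
pose F n := D `&` [set x | (2 ^+ n)^-1 <= g x < 2 ^+ n].
have mF n : measurable (F n).
  rewrite (_ : F n = lev (2 ^+ n)^-1 `&` [set x | g x < 2 ^+ n]); last first.
    apply/seteqP; split => x /=.
      by move=> [Dx /andP[h1 h2]]; do 2 split => //.
    by move=> [[Dx h1] h2]; split => //; apply/andP.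
  apply: measurableI => //; rewrite -[X in measurable X]setTI.
  exact: measurable_fun_ltr.
have DE : D = \bigcup_n F n.
  apply/seteqP; split => [x Dx|x [n _] []//]; have gx0 := g0 Dx.
  pose n := (maxn (Num.truncn (g x)).+1 (Num.truncn (g x)^-1).+1).
  have lt2n (y : R) m : 0 < y -> ((Num.truncn y).+1 <= m)%N -> y < 2 ^+ m.
    move=> y0 ym; have /andP[_ h] := truncn_itv (ltW y0).
    apply: (lt_le_trans h); rewrite -natrX ler_nat (leq_trans ym)// ltnW// ltn_expl//.
  exists n => //; split => //=; apply/andP; split; last by apply: lt2n => //; rewrite leq_maxl.
  rewrite -[leRHS]invrK lef_pV2 ?posrE ?exprn_gt0 ?invr_gt0//.
  by apply: ltW; apply: lt2n; rewrite ?invr_gt0// leq_maxr.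
rewrite DE; apply: integral_bigcup_le => //.
- apply/nondecreasing_seqP => n; apply/subsetPset => x [Dx /= /andP[h1 h2]]; split => //=.
  apply/andP; split.
    by apply: le_trans h1; rewrite lef_pV2 ?posrE ?exprn_gt0// ler_eXn2l ?ltr1n.
  by apply: (lt_le_trans h2); rewrite ler_eXn2l ?ltr1n.
- exact: mpowf.
- by move=> x _; rewrite lee_fin mulr_ge0 ?powR_ge0.
move=> n; have l0 : 0 < (2 ^+ n)^-1 :> R by rewrite invr_gt0 exprn_gt0.
have mLgh : measurable_fun setT (fun x => L x * dyadic_floor (2 ^+ n)^-1 (n + n) (g x)).
  by apply: measurable_funM => //; apply: (measurableT_comp (measurable_dyadic_floor _ _)).
rewrite (powRM _ (ler0n R 2) (mulr_ge0 C0 B0)) EFinM; apply: le_trans (lee_wpmul2l _ (level_bound (n + n) l0)); last first.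
  by rewrite lee_fin powR_ge0.
rewrite -ge0_integralZl_EFin ?powR_ge0//; last 2 first.
- by move=> x _; rewrite lee_fin mulr_ge0 ?powR_ge0.
- exact: mpowf.
apply: (@le_trans _ _ (\int[mu]_(x in F n) ((2 `^ k)%:E * ((L x * dyadic_floor (2 ^+ n)^-1 (n + n) (g x)) `^ k * f x)%:E))%E); last first.
  apply: ge0_subset_integral => //.
  - by apply: emeasurable_funM => //; exact: mpowf.
  - by move=> x _; rewrite -EFinM lee_fin !mulr_ge0 ?powR_ge0.
  - by move=> x [].
apply: ge0_le_integral => //.
- by move=> x _; rewrite lee_fin mulr_ge0 ?powR_ge0.
- exact: mpowf.
- by apply: emeasurable_funM => //; exact: mpowf.
move=> x [Dx /= /andP[h1 h2]]; rewrite -EFinM lee_fin mulrA ler_wpM2r//.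
rewrite -powRM ?mulr_ge0 ?dyadic_floor_ge0//.
apply: ge0_ler_powR; rewrite ?(ltW k0) ?nnegrE ?mulr_ge0 ?dyadic_floor_ge0 ?(ltW (g0 Dx))//.
rewrite mulrCA ler_wpM2l// ltW// dyadic_floor_gt// exprD mulrA mulVf ?mul1r// gt_eqF// exprn_gt0.
Qed.

End level_test.

(** * The core estimate *)

Section ereal_power.
Context {R : realType}.
Local Open Scope ereal_scope.
Implicit Types (x y : \bar R) (e : R).

Lemma le_poweR x y e : (0 <= e)%R -> 0 <= x -> x <= y -> x `^ e <= y `^ e.
Proof.
move=> e0 x0 xy; apply: gt0_ler_poweR => //.
- by rewrite in_itv/= x0 leey.
- by rewrite in_itv/= (le_trans x0 xy) leey.
Qed.

Lemma poweRD_le x y e : (0 < e)%R -> 0 <= x -> 0 <= y ->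
  (x + y) `^ e <= (2 `^ e)%:E * (x `^ e + y `^ e).
Proof.
wlog xy : x y / x <= y.
  by move=> H e0 x0 y0; case: (leP x y) => xy; [exact: H|rewrite addeC (addeC (_ `^ _)); apply: H => //; exact: ltW].
move=> e0 x0 y0.
apply: (@le_trans _ _ ((2%:E * y) `^ e)).
  apply: le_poweR; rewrite ?(ltW e0) ?adde_ge0// mule_natl mule2n.
  exact: leeD2r.
rewrite poweRM// ?lee_fin// poweR_EFin lee_wpmul2l ?lee_fin ?powR_ge0//.
by rewrite leeDr ?poweR_ge0.
Qed.

Lemma poweRK x e : (e != 0)%R -> 0 <= x -> (x `^ e) `^ e^-1 = x.
Proof. by move=> e0 x0; rewrite -poweRrM mulfV// poweRe1. Qed.

Lemma poweRVK x e : (e != 0)%R -> 0 <= x -> (x `^ e^-1) `^ e = x.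
Proof. by move=> e0 x0; rewrite -poweRrM mulVf// poweRe1. Qed.

End ereal_power.

Lemma powR_ge1 {R : realType} (x e : R) : 1 <= x -> 0 <= e -> 1 <= x `^ e.
Proof. by move=> x1 e0; rewrite -(powRr0 x) ler_powR. Qed.

Lemma ge0_measurable_funV {d} {T : measurableType d} {R : realType} (D : set T) (f : T -> R) :
  measurable D -> (forall x, D x -> 0 <= f x) -> measurable_fun D f ->
  measurable_fun D (fun x => (f x)^-1).
Proof.
move=> mD f0 mf; apply: (eq_measurable_fun (fun x => f x `^ (-1))).
  by move=> x /[!inE] Dx; rewrite powR_inv1// f0.
exact: (measurableT_comp (measurable_powR _)).
Qed.

Section tonelli_on.
Context {R : realType} {d1 d2 : measure_display}.
Context {T1 : measurableType d1} {T2 : measurableType d2}.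
Variable m1 : {sigma_finite_measure set T1 -> \bar R}.
Variable m2 : {sigma_finite_measure set T2 -> \bar R}.

Lemma tonelli_on (E : set (T1 * T2)) (D1 : set T1) (D2 : set T2)
    (f : T1 -> \bar R) (g : T2 -> \bar R) :
  measurable E -> measurable D1 -> measurable D2 ->
  measurable_fun D1 f -> measurable_fun D2 g ->
  (forall x, D1 x -> 0 <= f x)%E -> (forall x, D2 x -> 0 <= g x)%E ->
  (\int[m1]_(x in D1) (f x * \int[m2]_(y in D2 `&` [set y | E (x, y)]) g y) =
   \int[m2]_(y in D2) (g y * \int[m1]_(x in D1 `&` [set x | E (x, y)]) f x))%E.
Proof.
move=> mE mD1 mD2 mf mg f0 g0.
have mF : measurable_fun setT (f \_ D1) by apply/(measurable_restrictT _ _).1.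
have mG : measurable_fun setT (g \_ D2) by apply/(measurable_restrictT _ _).1.
have F0 x : (0 <= (f \_ D1) x)%E by rewrite patchE; case: ifPn => // /[!inE]; exact: f0.
have G0 x : (0 <= (g \_ D2) x)%E by rewrite patchE; case: ifPn => // /[!inE]; exact: g0.
have := tonelli_rel m1 m2 mE mF mG F0 G0; congr (_ = _).
- rewrite [RHS]integral_mkcond; apply: eq_integral => x _; rewrite !patchE.
  case: ifPn => _; last by rewrite mul0e.
  by congr (_ * _)%E; rewrite setIC [RHS]integral_mkcondr.
- rewrite [RHS]integral_mkcond; apply: eq_integral => x _; rewrite !patchE.
  case: ifPn => _; last by rewrite mul0e.
  by congr (_ * _)%E; rewrite setIC [RHS]integral_mkcondr.
Qed.

Lemma measurable_integral_on (E : set (T1 * T2)) (D2 : set T2) (g : T2 -> \bar R) :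
  measurable E -> measurable D2 -> measurable_fun D2 g ->
  (forall x, D2 x -> 0 <= g x)%E ->
  measurable_fun setT (fun x => \int[m2]_(y in D2 `&` [set y | E (x, y)]) g y)%E.
Proof.
move=> mE mD2 mg g0.
have mG : measurable_fun setT (g \_ D2) by apply/(measurable_restrictT _ _).1.
have G0 x : (0 <= (g \_ D2) x)%E by rewrite patchE; case: ifPn => // /[!inE]; exact: g0.
apply: eq_measurable_fun (measurable_integral_rel m2 mE mG G0) => x _.
by rewrite setIC [RHS]integral_mkcondr.
Qed.

End tonelli_on.

Section ge0_integral_shortcuts.
Local Open Scope ereal_scope.
Context {d : measure_display} {T : measurableType d} {R : realType}.
Variable mu : {measure set T -> \bar R}.

Lemma le_integralT (D : set T) (f g : T -> \bar R) : measurable D ->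
  measurable_fun setT f -> measurable_fun setT g -> (forall x, 0 <= f x) ->
  (forall x, D x -> f x <= g x) -> \int[mu]_(x in D) f x <= \int[mu]_(x in D) g x.
Proof.
by move=> mD mf mg f0 fg; apply: ge0_le_integral => //; exact: measurable_funTS.
Qed.

Lemma integralZT (D : set T) (f : T -> \bar R) (k : R) : measurable D ->
  measurable_fun setT f -> (forall x, 0 <= f x) -> (0 <= k)%R ->
  \int[mu]_(x in D) (k%:E * f x) = k%:E * \int[mu]_(x in D) f x.
Proof. by move=> mD mf f0 k0; apply: ge0_integralZl_EFin => //; exact: measurable_funTS. Qed.

Lemma integralDT (D : set T) (f g : T -> \bar R) : measurable D ->
  measurable_fun setT f -> measurable_fun setT g -> (forall x, 0 <= f x) -> (forall x, 0 <= g x) ->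
  \int[mu]_(x in D) (f x + g x) = \int[mu]_(x in D) f x + \int[mu]_(x in D) g x.
Proof.
by move=> mD mf mg f0 g0; apply: ge0_integralD => //; exact: measurable_funTS.
Qed.

Lemma subset_integralT (A B : set T) (f : T -> \bar R) : measurable A -> measurable B ->
  measurable_fun setT f -> (forall x, 0 <= f x) -> A `<=` B ->
  \int[mu]_(x in A) f x <= \int[mu]_(x in B) f x.
Proof.
by move=> mA mB mf f0 AB; apply: ge0_subset_integral => //; exact: measurable_funTS.
Qed.

End ge0_integral_shortcuts.

(** The factor 2 is (2^p)^(1/p) and 2^(1/p) comes from adding two terms under the power 1/p. In the
    bracket, the first summand is the constant of [core_tail_part] and the second that of
    [core_inner_part]. *)
Definition core_const {R : realType} (p : R) : R :=
  2 * 2 `^ p^-1 * ((2 `^ (1 + star p)) `^ (star p)^-1 +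
    ((level_const p + 1) * 2 `^ (1 + star p)) `^ (star p)^-1 * level_const (1 - p)).

Section core.
Context {R : realType}.
Local Notation TR := (measurableTypeR R).
Local Notation mu := (@lebesgue_measure R).
Variables (p : R) (u U V psi : TR -> R).
Variable sg : {sigma_finite_measure set TR -> \bar R}.
Let r := star p.
Hypotheses (p0 : 0 < p) (p1 : p < 1).
Hypotheses (mu_ : measurable_fun setT u) (u0 : forall x, 0 <= u x).
Hypotheses (mU : measurable_fun setT U) (U0 : forall x : R, 0 < x -> 0 < U x).
Hypothesis ndU : forall x y : R, 0 < x -> x <= y -> U x <= U y.
Hypothesis UE : forall x : R, 0 < x -> (\int[mu]_(s in `]0%R, x[) (u s)%:E = (U x)%:E)%E.
Hypotheses (mV : measurable_fun setT V) (V0 : forall x : R, 0 < x -> 0 < V x).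
Hypothesis VE : forall x : R, 0 < x -> sg `[x, +oo[%classic = ((V x) `^ r)%:E.
Hypothesis mpsi : measurable_fun setT psi.
Hypothesis psi0 : forall x : R, 0 < x -> 0 < psi x.
Hypothesis psiE : forall x : R, 0 < x ->
  (\int[sg]_(t in ray 0%R) ((U t / (U x + U t)) `^ (1 + r))%:E = (psi x)%:E)%E.

Let r0 : 0 < r. Proof. by rewrite divr_gt0 ?subr_gt0. Qed.
Let r10 : 0 < 1 + r. Proof. by rewrite addr_gt0. Qed.
Let pN0 : 1 - p != 0. Proof. by rewrite subr_eq0 gt_eqF. Qed.
Let prE : p / r = 1 - p.
Proof. by rewrite /r /star; field; rewrite pN0 gt_eqF. Qed.
Let rpE : (1 + r) * p = r.
Proof. by rewrite /r /star; field. Qed.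
Let rqE : (1 + r) * (1 - p) = 1.
Proof. by rewrite /r /star; field. Qed.

Let mray (x : R) : measurable (ray x : set TR).
Proof. exact: measurable_itv. Qed.

Let mitv (i : interval R) : measurable ([set` i] : set TR).
Proof. exact: measurable_itv. Qed.

Let K2 := 2 `^ (1 + r) : R.
Let K20 : 0 < K2. Proof. exact: powR_gt0. Qed.

Let mker (x : R) : 0 < x ->
  measurable_fun (ray 0%R : set TR) (fun t : TR => ((U t / (U x + U t)) `^ (1 + r))%:E).
Proof.
move=> x0; apply/measurable_EFinP; apply: (measurableT_comp (measurable_powR _)).
apply: measurable_funM; first exact: measurable_funTS.
apply: ge0_measurable_funV => //.
  by move=> t; rewrite /ray/= in_itv/= andbT => t0; rewrite addr_ge0 ?ltW ?U0.
by apply: measurable_funTS; exact: measurable_funD.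
Qed.

Let ker0 (x t : R) : (0 <= ((U t / (U x + U t)) `^ (1 + r))%:E)%E.
Proof. by rewrite lee_fin powR_ge0. Qed.

(** This is the integral of (U x U t / (U x + U t))^(1+r), a power of half the harmonic mean of U x
    and U t, hence nondecreasing in [x] although [psi] is nonincreasing. Its power 1/r is U^(1/p)
    psi^(1/r), since (1+r)/r = 1/p. *)
Let M (x : TR) := U x `^ (1 + r) * psi x.

Let M0 (x : R) : 0 < x -> 0 < M x.
Proof. by move=> x0; rewrite mulr_gt0 ?powR_gt0 ?U0 ?psi0. Qed.

Let mM : measurable_fun setT M.
Proof. by apply: measurable_funM => //; exact: (measurableT_comp (measurable_powR _)). Qed.

(** For t >= x the ratio U t / (U x + U t) is at least 1/2, so [psi x] contains a fixed fraction of
    the mass V(x)^r of the tail. *)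
Lemma core_V_psi (x : R) : 0 < x -> V x `^ r <= K2 * psi x.
Proof.
move=> x0; rewrite -lee_fin EFinM -VE// -psiE//.
rewrite -ge0_integralZl_EFin ?(ltW K20)//; last exact: mker.
have -> : (sg `[x, +oo[%classic = \int[sg]_(t in `[x, +oo[) cst 1 t)%E.
  by rewrite integral_cst// mul1e.
apply: (@le_trans _ _ (\int[sg]_(t in `[x, +oo[) (K2%:E * ((U t / (U x + U t)) `^ (1 + r))%:E))%E).
  have xr : `[x, +oo[ `<=` ray 0%R by move=> t; rewrite /ray/= !in_itv/= !andbT; exact: lt_le_trans.
  apply: ge0_le_integral => //.
  - by apply: emeasurable_funM => //; apply: measurable_funS (mker x0).
  move=> t; rewrite /= in_itv/= andbT => xt; have t0 := lt_le_trans x0 xt.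
  rewrite -EFinM lee_fin /K2 -powRM ?divr_ge0 ?addr_ge0 ?(ltW (U0 _))//.
  apply: powR_ge1; last exact: ltW.
  rewrite mulrA ler_pdivlMr ?addr_gt0 ?U0// mul1r mulr_natl mulr2n lerD2r ndU//.
by apply: ge0_subset_integral => //; [apply: emeasurable_funM => //; exact: mker
  |by move=> t _; rewrite mule_ge0// lee_fin ltW|move=> t; rewrite /ray/= !in_itv/= !andbT; exact: lt_le_trans].
Qed.

(** For t <= x one has U t <= 2 U x U t / (U x + U t). This makes a multiple of [M] an upper bound
    for the cumulative mass of U^(1+r) against [sg], the input required by the sublevel lemma. *)
Lemma core_mass (x : R) : 0 < x ->
  (\int[sg]_(t in `]0%R, x]) (U t `^ (1 + r))%:E <= (K2 * M x)%:E)%E.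
Proof.
move=> x0; have xr : `]0%R, x] `<=` ray 0%R by move=> t; rewrite /ray/= !in_itv/= => /andP[->].
rewrite /M mulrA EFinM -psiE// -ge0_integralZl_EFin ?mulr_ge0 ?powR_ge0//; last exact: mker.
apply: (@le_trans _ _ (\int[sg]_(t in `]0%R, x]) ((K2 * U x `^ (1 + r))%:E * ((U t / (U x + U t)) `^ (1 + r))%:E))%E); last first.
  apply: ge0_subset_integral => //; first by apply: emeasurable_funM => //; exact: mker.
  by move=> t _; rewrite mule_ge0// lee_fin mulr_ge0 ?powR_ge0.
apply: ge0_le_integral => //.
- by move=> t _; rewrite lee_fin powR_ge0.
- by apply/measurable_EFinP; apply: (measurableT_comp (measurable_powR _)); exact: measurable_funTS.
- by apply: emeasurable_funM => //; apply: measurable_funS (mker x0).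
move=> t; rewrite /= in_itv/= => /andP[t0 tx].
have Ut := U0 t0; have Ux := U0 x0.
rewrite -EFinM lee_fin /K2 -!powRM ?mulr_ge0 ?invr_ge0 ?addr_ge0 ?(ltW Ut) ?(ltW Ux)//.
apply: ge0_ler_powR; rewrite ?(ltW r10) ?nnegrE ?mulr_ge0 ?invr_ge0 ?addr_ge0 ?(ltW Ut) ?(ltW Ux)//.
rewrite mulrA ler_pdivlMr ?addr_gt0// mulrC ler_pM2r// mulr_natl mulr2n lerD2l ndU//.
Qed.

Lemma core_psi_noninc (x y : R) : 0 < x -> x <= y -> psi y <= psi x.
Proof.
move=> x0 xy; have y0 := lt_le_trans x0 xy.
rewrite -lee_fin -(psiE x0) -(psiE y0).
apply: ge0_le_integral; [exact: mray|by move=> t _; exact: ker0|exact: mker|exact: mker|].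
move=> t; rewrite /ray/= in_itv/= andbT => t0.
have Ut := U0 t0; have Ux := U0 x0; have Uy := U0 y0.
rewrite lee_fin; apply: ge0_ler_powR; rewrite ?(ltW r10) ?nnegrE ?mulr_ge0 ?invr_ge0 ?addr_ge0 ?(ltW Ut) ?(ltW Ux) ?(ltW Uy)//.
by rewrite ler_pM2l// lef_pV2 ?posrE ?addr_gt0// lerD2r ndU.
Qed.

Lemma core_M_nondec (x y : R) : 0 < x -> x <= y -> M x <= M y.
Proof.
move=> x0 xy; have y0 := lt_le_trans x0 xy.
have ME (z : R) : 0 < z -> (M z)%:E = (\int[sg]_(t in ray 0%R) ((U z `^ (1 + r))%:E * ((U t / (U z + U t)) `^ (1 + r))%:E))%E.
  move=> z0; rewrite ge0_integralZl_EFin ?powR_ge0//; last exact: mker.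
  by rewrite psiE.
rewrite -lee_fin (ME x x0) (ME y y0).
apply: ge0_le_integral => //.
- by move=> t _; rewrite mule_ge0// lee_fin powR_ge0.
- by apply: emeasurable_funM => //; exact: mker.
- by apply: emeasurable_funM => //; exact: mker.
move=> t; rewrite /ray/= in_itv/= andbT => t0.
have Ut := U0 t0; have Ux := U0 x0; have Uy := U0 y0.
rewrite -!EFinM lee_fin -!powRM ?mulr_ge0 ?invr_ge0 ?addr_ge0 ?(ltW Ut) ?(ltW Ux) ?(ltW Uy)//.
apply: ge0_ler_powR; rewrite ?(ltW r10) ?nnegrE ?mulr_ge0 ?invr_ge0 ?addr_ge0 ?(ltW Ut) ?(ltW Ux) ?(ltW Uy)//.
suff H (a b c : R) : 0 < a -> 0 < b -> b <= c -> b * (a / (b + a)) <= c * (a / (c + a)).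
  by apply: H => //; exact: ndU.
move=> a0 b0 bc; have c0 := lt_le_trans b0 bc.
rewrite mulrA [leRHS]mulrA ler_pdivlMr ?addr_gt0// mulrAC ler_pdivrMr ?addr_gt0//; nra.
Qed.

(** Since (1+r) p = r, the integrand is M^(-p) U^(1+r), and U^(1+r) has cumulative mass at most K2
    M; so this is the discrete form of the integral of M^(-p) dM. The result M^(1-p) equals U
    psi^(1-p) because (1+r)(1-p) = 1. *)
Lemma core_mass_pow (t : R) : 0 < t ->
  (\int[sg]_(y in `]0%R, t[) (psi y `^ (- p) * U y)%:E <=
   (level_const p * K2 * (U t * psi t `^ (1 - p)))%:E)%E.
Proof.
move=> t0; have Ut := U0 t0.
have -> : U t * psi t `^ (1 - p) = M t `^ (1 - p).
  by rewrite /M powRM ?powR_ge0 ?(ltW (psi0 _))// -powRrM rqE powRr1// ltW.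
have K2M : 0 < K2 * M t by rewrite mulr_gt0 ?M0.
have mUr : measurable_fun setT (fun y => U y `^ (1 + r)).
  exact: (measurableT_comp (measurable_powR _)).
have H := @integral_powRN_le _ TR R sg `]0%R, t[%classic (fun y => U y `^ (1 + r)) (fun y => K2 * M y)
  (mitv _) mUr (measurable_funM (measurable_cst _) mM) (fun y => powR_ge0 _ _).
have {}H : (\int[sg]_(x in `]0%R, t[) ((K2 * M x) `^ (- p) * U x `^ (1 + r))%:E <=
   (level_const p * (K2 * M t) `^ (1 - p))%:E)%E.
  apply: H => //.
  - move=> s s0; apply: (integral_sublevel_le (b := true)) => //.
    - exact: measurable_funM.
    - by move=> y; rewrite powR_ge0.
    move=> y; rewrite /= in_itv/= => /andP[y0 yt]; apply: le_trans (core_mass y0).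
    apply: ge0_subset_integral => //.
    + by apply: measurableI => //; exact: measurable_segment.
    + by apply/measurable_EFinP; exact: measurable_funTS.
    + by move=> x _; rewrite lee_fin powR_ge0.
    + by move=> x [/=]; rewrite !in_itv/= => /andP[-> _].
  - by move=> y; rewrite /= in_itv/= => /andP[y0 _]; rewrite mulr_gt0 ?M0.
  - apply: le_trans (core_mass t0); apply: ge0_subset_integral => //.
    + by apply/measurable_EFinP; exact: measurable_funTS.
    + by move=> x _; rewrite lee_fin powR_ge0.
    + by move=> x /=; rewrite !in_itv/= => /andP[-> /ltW].
have mint : measurable_fun setT (fun x => ((K2 * M x) `^ (- p) * U x `^ (1 + r))%:E).
  apply/measurable_EFinP; apply: measurable_funM => //.
  by apply: (measurableT_comp (measurable_powR _)); exact: measurable_funM.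
apply: (@le_trans _ _ ((K2 `^ p)%:E * \int[sg]_(x in `]0%R, t[) ((K2 * M x) `^ (- p) * U x `^ (1 + r))%:E)%E).
  rewrite -integralZT ?powR_ge0//; last by move=> x; rewrite lee_fin mulr_ge0 ?powR_ge0.
  rewrite le_eqVlt; apply/orP; left; apply/eqP; apply: eq_integral => y.
  rewrite inE /= in_itv/= => /andP[y0 _]; have Uy := U0 y0; have py := psi0 y0.
  rewrite -EFinM; congr EFin.
  rewrite powRM ?(ltW K20) ?(ltW (M0 y0))// !mulrA -powRDgt0// subrr powRr0 mul1r.
  rewrite /M powRM ?powR_ge0 ?(ltW py)// -powRrM mulrN rpE mulrAC -powRDgt0//.
  have -> : - r + (1 + r) = 1 by ring.
  by rewrite powRr1 ?(ltW Uy)// mulrC.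
apply: (le_trans (lee_wpmul2l _ H)); first by rewrite lee_fin powR_ge0.
rewrite -EFinM lee_fin powRM ?(ltW K20) ?(ltW (M0 t0))//.
rewrite le_eqVlt; apply/orP; left; apply/eqP.
have KK : K2 `^ p * K2 `^ (1 - p) = K2 by rewrite -powRDgt0// addrC subrK powRr1 ?(ltW K20).
transitivity (level_const p * (K2 `^ p * K2 `^ (1 - p)) * M t `^ (1 - p)); first by ring.
by rewrite KK.
Qed.

(* The auxiliary Hoelder weight: at [s] it is at least
   [psi s ^ -p * V s ^ r], which is what [core_om_inv] needs, while integrating
   against [sg] keeps its mass [core_om_mass] under control. *)
Let Om (t s : R) := (\int[sg]_(y in `]0%R, t[ `&` [set y | (s <= y)%R]) (psi y `^ (- p))%:E +
  (psi t `^ (- p) * V t `^ r)%:E)%E.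

Let mpsip A : measurable_fun A (fun y : TR => (psi y `^ (- p))%:E).
Proof.
apply/measurable_EFinP; apply: (measurableT_comp (measurable_powR _)).
exact: measurable_funTS.
Qed.

Let psip_le (x y : R) : 0 < x -> x <= y -> psi x `^ (- p) <= psi y `^ (- p).
Proof.
move=> x0 xy; have y0 := lt_le_trans x0 xy.
rewrite !powRN lef_pV2 ?posrE ?powR_gt0 ?psi0//.
by apply: ge0_ler_powR; rewrite ?nnegrE ?(ltW p0) ?(ltW (psi0 _))// core_psi_noninc.
Qed.

Let mle (s : R) : measurable [set y : TR | s <= y].
Proof.
by rewrite (_ : [set y | _] = `[s, +oo[%classic)//; apply/seteqP; split => y; rewrite /= in_itv/= andbT.
Qed.

Let setE (s t : R) : 0 < s -> s < t -> (`]0%R, t[%classic `&` [set y | s <= y]) = `[s, t[%classic :> set TR.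
Proof.
move=> s0 st; apply/seteqP; split => y /=; rewrite !in_itv/=.
  by move=> [/andP[_ ->] ->].
by move=> /andP[sy ->]; rewrite (lt_le_trans s0 sy).
Qed.

Let sgco (s t : R) : 0 < s -> s < t -> (sg `[s, t[%classic + (V t `^ r)%:E = (V s `^ r)%:E)%E.
Proof.
move=> s0 st; rewrite -!VE ?(lt_trans s0 st)// -measureU//.
  by rewrite -itv_bndbnd_setU// bnd_simp ltW.
apply/seteqP; split => y //=; rewrite !in_itv/= => -[/andP[_ yt]].
by rewrite andbT leNgt yt.
Qed.

Let Om_ge (t s : R) : 0 < s -> s < t -> ((psi s `^ (- p) * V s `^ r)%:E <= Om t s)%E.
Proof.
move=> s0 st; have t0 := lt_trans s0 st.
rewrite EFinM -(sgco s0 st) ge0_muleDr ?lee_fin ?powR_ge0//.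
apply: leeD; last by rewrite -EFinM lee_fin ler_wpM2r ?powR_ge0// psip_le// ltW.
rewrite setE// -[sg _]mul1e -integral_cst// -integralZT ?powR_ge0//.
apply: ge0_le_integral => //.
- by move=> y _; rewrite mule1 lee_fin powR_ge0.
- by move=> y; rewrite /= in_itv/= mule1 lee_fin => /andP[sy _]; rewrite psip_le.
Qed.

Let Om_le (t s : R) : 0 < s -> s < t -> (Om t s <= (psi t `^ (- p) * V s `^ r)%:E)%E.
Proof.
move=> s0 st; have t0 := lt_trans s0 st.
rewrite [leRHS]EFinM -(sgco s0 st) ge0_muleDr ?lee_fin ?powR_ge0//.
apply: leeD; last by rewrite -EFinM.
rewrite setE// -[sg _]mul1e -integral_cst// -integralZT ?powR_ge0//.
apply: ge0_le_integral => //.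
- by move=> y _; rewrite lee_fin powR_ge0.
- by move=> y; rewrite /= in_itv/= mule1 lee_fin => /andP[sy yt]; rewrite psip_le ?(lt_le_trans s0 sy)// ltW.
Qed.

Let Om_mono (t s s' : R) : s <= s' -> (Om t s' <= Om t s)%E.
Proof.
move=> ss'; rewrite leeD2r//; apply: ge0_subset_integral => //.
- by apply: measurableI => //; exact: mle.
- by apply: measurableI => //; exact: mle.
- by move=> y _; rewrite lee_fin powR_ge0.
- by move=> y [yt /= s'y]; split => //=; exact: le_trans s'y.
Qed.

Let Om0 (t s : R) : (0 <= Om t s)%E.
Proof.
apply: adde_ge0; last by rewrite lee_fin mulr_ge0 ?powR_ge0.
by apply: integral_ge0 => y _; rewrite lee_fin powR_ge0.
Qed.

Let om (t s : R) := fine (Om t s).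

Let omE (t s : R) : 0 < s -> s < t -> Om t s = (om t s)%:E.
Proof.
move=> s0 st; rewrite fineK// ge0_fin_numE//.
by apply: le_lt_trans (Om_le s0 st) _; rewrite ltry.
Qed.

Let om_ge (t s : R) : 0 < s -> s < t -> psi s `^ (- p) * V s `^ r <= om t s.
Proof. by move=> s0 st; rewrite -lee_fin -omE// Om_ge. Qed.

Let om_gt0 (t s : R) : 0 < s -> s < t -> 0 < om t s.
Proof.
move=> s0 st; apply: lt_le_trans (om_ge s0 st).
by rewrite mulr_gt0 ?powR_gt0 ?psi0 ?V0.
Qed.

Let om_ge0 (t s : R) : 0 <= om t s. Proof. exact: fine_ge0. Qed.

Let mOm (t : R) : measurable_fun setT (Om t : TR -> \bar R).
Proof. by apply: nonincreasing_emeasurable => x y; exact: Om_mono. Qed.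

Let mom (t : R) : measurable_fun setT (om t : TR -> R).
Proof. exact: measurableT_comp. Qed.

Let mfu A : measurable_fun A (fun x : TR => (u x)%:E).
Proof. by apply/measurable_EFinP; exact: measurable_funTS. Qed.

Let UcE (x : R) : 0 < x -> (\int[mu]_(s in `]0%R, x]) (u s)%:E = (U x)%:E)%E.
Proof.
move=> x0; have <- := @integral_itv_bndo_bndc R (BRight 0) x (EFin \o u) (@mfu _).
exact: UE.
Qed.

Let C2 := (level_const p + 1) * K2.

Let C20 : 0 < C2. Proof. by apply: mulr_gt0 => //; rewrite addr_gt0// level_const_gt0. Qed.

(** Tonelli turns the integral part of the weight into [core_mass_pow]; the boundary term at [t] is
    bounded by [core_V_psi] and is responsible for the [+ 1] in [C2]. *)
Lemma core_om_mass (t : R) : 0 < t ->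
  (\int[mu]_(s in `]0%R, t[) (om t s * u s)%:E <= (C2 * (U t * psi t `^ (1 - p)))%:E)%E.
Proof.
move=> t0; pose J s := (\int[sg]_(y in `]0%R, t[ `&` [set y | (s <= y)%R]) (psi y `^ (- p))%:E)%E.
have J0 s : (0 <= J s)%E by apply: integral_ge0 => y _; rewrite lee_fin powR_ge0.
pose c := psi t `^ (- p) * V t `^ r; have c0 : 0 <= c by rewrite mulr_ge0 ?powR_ge0.
have mJ : measurable_fun setT (J : TR -> \bar R).
  apply: nonincreasing_emeasurable => s s' ss'; apply: ge0_subset_integral => //.
  - by apply: measurableI => //; exact: mle.
  - by apply: measurableI => //; exact: mle.
  - by move=> y _; rewrite lee_fin powR_ge0.
  - by move=> y [yt /= s'y]; split => //=; exact: le_trans s'y.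
rewrite (eq_integral (fun s => (u s)%:E * J s + c%:E * (u s)%:E)%E); last first.
  move=> s; rewrite inE/= in_itv/= => /andP[s0 st].
  by rewrite EFinM -omE// /Om -/(J s) -/c ge0_muleDl// muleC.
rewrite ge0_integralD//; last 4 first.
- by move=> s _; rewrite mule_ge0 ?lee_fin.
- by apply: emeasurable_funM; [exact: mfu|exact: measurable_funTS].
- by move=> s _; rewrite mule_ge0 ?lee_fin.
- by apply: emeasurable_funM => //; exact: mfu.
rewrite /C2 mulrDl mulrDl EFinD; apply: leeD.
  apply: le_trans (core_mass_pow t0).
  pose E := [set z : TR * TR | z.1 <= z.2].
  have mE : measurable E.
    by rewrite -[X in measurable X]setTI; apply: measurable_fun_ler.
  have := tonelli_on mu sg mE (mitv `]0, t[) (mitv `]0, t[) (@mfu _) (@mpsip _).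
  move=> -> //; last 2 first.
  - by move=> x _; rewrite lee_fin.
  - by move=> x _; rewrite lee_fin powR_ge0.
  rewrite le_eqVlt; apply/orP; left; apply/eqP; apply: eq_integral => y.
  rewrite inE/= in_itv/= => /andP[y0 yt].
  have -> : (`]0%R, t[%classic `&` [set x | E (x, y)]) = `]0, y]%classic.
    apply/seteqP; split => x /=; rewrite !in_itv/=; first by move=> [/andP[-> _]].
    by move=> /andP[-> xy]; rewrite (le_lt_trans xy yt).
  by rewrite UcE// EFinM.
rewrite integralZT// UE// -EFinM lee_fin mul1r /c; apply: (@le_trans _ _ (psi t `^ (- p) * (K2 * psi t) * U t)).
  by rewrite ler_pM2r ?U0// ler_wpM2l ?powR_ge0// core_V_psi.
rewrite le_eqVlt; apply/orP; left; apply/eqP.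
rewrite [1 - p]addrC powRDgt0 ?psi0// powRr1 ?(ltW (psi0 _))//; ring.
Qed.

(** The lower bound for the weight at [z] extends to all s < z because [om] is nonincreasing in [s].
    The product of psi^(-p) and V^r, one factor nondecreasing and the other nonincreasing, has no
    such monotonicity; [Om] is a monotone majorant of it. *)
Lemma core_om_inv (t z : R) : 0 < z -> z < t ->
  (\int[mu]_(s in `]0%R, z[) (om t s `^ (- r^-1) * u s)%:E <= (U z * psi z `^ (1 - p) / V z)%:E)%E.
Proof.
move=> z0 zt; pose c := psi z `^ (1 - p) / V z.
have c0 : 0 <= c by rewrite divr_ge0 ?powR_ge0// ltW// V0.
apply: (@le_trans _ _ (\int[mu]_(s in `]0%R, z[) (c%:E * (u s)%:E))%E); last first.
  by rewrite integralZT// UE// -EFinM lee_fin /c mulrC mulrA.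
apply: ge0_le_integral => //.
- by move=> s _; rewrite lee_fin mulr_ge0 ?powR_ge0.
- apply/measurable_EFinP; apply: measurable_funM; last exact: measurable_funTS.
  by apply: (measurableT_comp (measurable_powR _)); exact: measurable_funTS.
- by apply: emeasurable_funM => //; exact: mfu.
move=> s; rewrite /= in_itv/= => /andP[s0 sz]; have st := lt_trans sz zt.
rewrite -EFinM lee_fin ler_wpM2r//.
have H : psi z `^ (- p) * V z `^ r <= om t s.
  apply: (le_trans (om_ge z0 zt)).
  by rewrite -lee_fin -!omE// Om_mono// ltW.
have pV : 0 < psi z `^ (- p) * V z `^ r by rewrite mulr_gt0 ?powR_gt0 ?psi0 ?V0.
apply: (@le_trans _ _ ((psi z `^ (- p) * V z `^ r) `^ (- r^-1))).
  rewrite !(powRN _ r^-1) lef_pV2 ?posrE ?powR_gt0 ?om_gt0//.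
  by apply: ge0_ler_powR; rewrite ?invr_ge0 ?(ltW r0) ?nnegrE ?(ltW pV).
rewrite powRM ?powR_ge0// -!powRrM mulrNN prE mulrN mulfV ?gt_eqF//.
by rewrite powR_inv1 ?(ltW (V0 _)).
Qed.

Variable h : TR -> \bar R.
Hypotheses (mh : measurable_fun setT h) (h0 : forall x, (0 <= h x)%E).

Let mhA A : measurable_fun A h. Proof. exact: measurable_funTS. Qed.

Let G (t s : R) := (\int[mu]_(z in `]s, t[) h z)%E.

Let G0 (t s : R) : (0 <= G t s)%E. Proof. exact: integral_ge0. Qed.

Let mG (t : R) : measurable_fun setT (G t : TR -> \bar R).
Proof.
apply: nonincreasing_emeasurable => x y xy; apply: ge0_subset_integral => //.
by move=> z /=; rewrite !in_itv/= => /andP[yz ->]; rewrite (le_lt_trans xy yz).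
Qed.

Definition core_inner (t : R) := (\int[mu]_(s in `]0%R, t[) (G t s `^ p * (u s)%:E))%E.

Let mGu (t : R) : measurable_fun setT (fun s : TR => G t s `^ p * (u s)%:E)%E.
Proof. by apply: emeasurable_funM => //; exact: measurable_fun_poweR. Qed.

Lemma core_inner_ge0 (t : R) : (0 <= core_inner t)%E.
Proof. by apply: integral_ge0 => s _; rewrite mule_ge0 ?poweR_ge0 ?lee_fin. Qed.

Lemma measurable_core_inner : measurable_fun setT (core_inner : TR -> \bar R).
Proof.
apply: nondecreasing_emeasurable => x y xy.
apply: (@le_trans _ _ (\int[mu]_(s in `]0%R, x[) (G y s `^ p * (u s)%:E))%E).
  apply: le_integralT => //; first by move=> s; rewrite mule_ge0 ?poweR_ge0 ?lee_fin.
  move=> s _; rewrite lee_wpmul2r ?lee_fin//; apply: le_poweR; rewrite ?(ltW p0)//.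
  apply: ge0_subset_integral => //.
  by move=> z /=; rewrite !in_itv/= => /andP[-> zx]; rewrite (lt_le_trans zx).
apply: subset_integralT => //; first by move=> s; rewrite mule_ge0 ?poweR_ge0 ?lee_fin.
by move=> z /=; rewrite !in_itv/= => /andP[-> zx]; rewrite (lt_le_trans zx).
Qed.

Let b (z : R) := U z * psi z `^ (1 - p) / V z.

Let b0 (z : R) : 0 < z -> 0 <= b z.
Proof.
by move=> z0; rewrite !mulr_ge0 ?powR_ge0 ?invr_ge0 ?(ltW (U0 z0)) ?(ltW (V0 z0)).
Qed.

Let mb : measurable_fun (ray 0%R : set TR) (b : TR -> R).
Proof.
apply: measurable_funM.
  apply: measurable_funM; first exact: measurable_funTS.
  by apply: measurable_funTS; exact: (measurableT_comp (measurable_powR _)).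
apply: ge0_measurable_funV => //; last exact: measurable_funTS.
by move=> x; rewrite /ray/= in_itv/= andbT => /V0/ltW.
Qed.

(** Hoelder with exponents 1/p and 1/(1-p): as p/r = 1 - p, G^p u is the product of (G om^(-1/r)
    u)^p and (om u)^(1-p). The first integral is linear in [h], so Tonelli and [core_om_inv] give
    the weight [b]; the second is [core_om_mass]. *)
Lemma core_inner_le (t : R) : 0 < t ->
  (core_inner t <= (\int[mu]_(z in `]0%R, t[) (h z * (b z)%:E)) `^ p *
    ((C2 * (U t * psi t `^ (1 - p))) `^ (1 - p))%:E)%E.
Proof.
move=> t0.
pose f s := (G t s * (om t s `^ (- r^-1) * u s)%:E)%E.
pose g s := (om t s * u s)%:E.
have mou : measurable_fun setT (fun s : TR => (om t s `^ (- r^-1) * u s)%:E).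
  apply/measurable_EFinP; apply: measurable_funM => //.
  exact: (measurableT_comp (measurable_powR _)).
have ou0 s : (0 <= (om t s `^ (- r^-1) * u s)%:E)%E by rewrite lee_fin mulr_ge0 ?powR_ge0.
have mf : measurable_fun setT (f : TR -> \bar R) by exact: emeasurable_funM.
have mg : measurable_fun setT (g : TR -> \bar R).
  by apply/measurable_EFinP; exact: measurable_funM.
have f0 s : (0 <= f s)%E by rewrite mule_ge0.
have g0 s : (0 <= g s)%E by rewrite lee_fin mulr_ge0.
have -> : core_inner t = (\int[mu]_(s in `]0%R, t[) (f s `^ p * g s `^ (1 - p)))%E.
  apply: eq_integral => s; rewrite inE/= in_itv/= => /andP[s0 st].
  have o0 := om_gt0 s0 st.
  rewrite /f poweRM// -muleA !poweR_EFin -EFinM; congr (_ * _%:E)%E.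
  rewrite !powRM ?powR_ge0// mulrACA -powRrM mulNr [r^-1 * p]mulrC prE.
  rewrite -powRDgt0// addNr powRr0 mul1r.
  have [->|us] := eqVneq (u s) 0; first by rewrite powR0 ?mul0r// gt_eqF.
  by rewrite -powRDgt0 ?lt_def ?us ?u0// addrC subrK powRr1.
have p01 : 0 < p <= 1 by rewrite p0 ltW.
have := @hoelder_interpolation _ TR R mu _ _ _ _ (mitv `]0, t[) (measurable_funTS mf) (measurable_funTS mg)
  (fun x _ => f0 x) (fun x _ => g0 x) p01.
move=> /le_trans; apply.
apply: lee_pmul; rewrite ?poweR_ge0//; last first.
  rewrite -poweR_EFin; apply: le_poweR; rewrite ?subr_ge0 ?(ltW p1)//; last exact: core_om_mass.
  exact: integral_ge0.
apply: le_poweR; rewrite ?(ltW p0)//; first exact: integral_ge0.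
pose E := [set z : TR * TR | z.1 < z.2].
have mE : measurable E.
  by rewrite -[X in measurable X]setTI; apply: measurable_fun_ltr.
rewrite (eq_integral (fun s : TR => (om t s `^ (- r^-1) * u s)%:E *
    \int[mu]_(z in `]0%R, t[ `&` [set z | E (s, z)]) h z)%E); last first.
  move=> s; rewrite inE/= in_itv/= => /andP[s0 st]; rewrite /f muleC; congr (_ * _)%E.
  rewrite /G; congr (integral _ _ _); apply/seteqP; split => z /=; rewrite !in_itv/=.
    by move=> /andP[sz ->]; rewrite (lt_trans s0 sz).
  by move=> [/andP[_ ->] ->].
have := tonelli_on mu mu mE (mitv `]0, t[) (mitv `]0, t[) (measurable_funTS mou) (@mhA _).
move=> -> //.
have mhb : measurable_fun (`]0%R, t[%classic : set TR) (fun z : TR => h z * (b z)%:E)%E.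
  apply: emeasurable_funM; first exact: mhA.
  apply/measurable_EFinP; apply: measurable_funS mb => // z /=.
  by rewrite /ray/= !in_itv/= => /andP[->].
apply: ge0_le_integral => //.
- by move=> z _; rewrite mule_ge0//; apply: integral_ge0.
- apply: emeasurable_funM; first exact: mhA.
  apply: measurable_funTS.
  pose E' := [set z : TR * TR | z.2 < z.1].
  have mE' : measurable E'.
    by rewrite -[X in measurable X]setTI; apply: measurable_fun_ltr.
  exact: (measurable_integral_on mu mE' (mitv `]0, t[) (measurable_funTS mou)).
move=> z; rewrite /= in_itv/= => /andP[z0 zt]; rewrite lee_wpmul2l//.
have -> : (`]0%R, t[%classic `&` [set x | E (x, z)]) = `]0, z[%classic.
  apply/seteqP; split => x /=; rewrite !in_itv/=; first by move=> [/andP[-> _]].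
  by move=> /andP[-> xz]; rewrite (lt_trans xz zt).
exact: core_om_inv.
Qed.

Let H (s : R) := (\int[mu]_(z in ray s) h z)%E.
Let K (t : R) := (\int[mu]_(z in `[t, +oo[) h z)%E.

Let H0 (s : R) : (0 <= H s)%E. Proof. exact: integral_ge0. Qed.
Let K0 (s : R) : (0 <= K s)%E. Proof. exact: integral_ge0. Qed.

Let mH : measurable_fun setT (H : TR -> \bar R).
Proof.
apply: nonincreasing_emeasurable => x y xy; apply: subset_integralT => //.
by move=> z /=; rewrite /ray/= !in_itv/= !andbT; exact: le_lt_trans.
Qed.

Let mK : measurable_fun setT (K : TR -> \bar R).
Proof.
apply: nonincreasing_emeasurable => x y xy; apply: subset_integralT => //.
by move=> z /=; rewrite !in_itv/= !andbT; exact: le_trans.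
Qed.

Let HE (s t : R) : s < t -> H s = (G t s + K t)%E.
Proof.
move=> st; rewrite /H /G /K -ge0_integral_setU//.
- by congr (integral _ _ _); rewrite /ray -itv_bndbnd_setU// bnd_simp// ltW.
- apply/disj_setPS => z /=; rewrite !in_itv/= => -[/andP[_ zt]].
  by rewrite andbT leNgt zt.
Qed.

Definition core_avg (t : R) : \bar R :=
  ((U t)^-1%:E * \int[mu]_(s in `]0%R, t[) (H s `^ p * (u s)%:E))%E.

Lemma core_avg_ge0 (t : R) : 0 < t -> (0 <= core_avg t)%E.
Proof.
move=> t0; rewrite mule_ge0 ?lee_fin ?invr_ge0 ?(ltW (U0 _))//.
by apply: integral_ge0 => s _; rewrite mule_ge0 ?poweR_ge0 ?lee_fin.
Qed.

(** The integral of [h] over (s, oo) splits at [t]. The tail [K t] does not depend on [s], so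
    averaging it against [u] over (0, t) returns it unchanged. *)
Lemma core_avg_le (t : R) : 0 < t ->
  (core_avg t <= (2 `^ p)%:E * ((U t)^-1%:E * core_inner t + K t `^ p))%E.
Proof.
move=> t0; have Ut := U0 t0.
have mGp : measurable_fun setT (fun s : TR => G t s `^ p)%E by exact: measurable_fun_poweR.
have -> : (K t `^ p = (U t)^-1%:E * \int[mu]_(s in `]0%R, t[) (K t `^ p * (u s)%:E))%E.
  rewrite ge0_integralZl ?poweR_ge0//; last by move=> s _; rewrite lee_fin.
  by rewrite UE// muleCA -EFinM mulVf ?mule1// gt_eqF.
rewrite -ge0_muleDr; last 2 first.
- exact: core_inner_ge0.
- by apply: integral_ge0 => s _; rewrite mule_ge0 ?poweR_ge0 ?lee_fin.
rewrite muleCA lee_wpmul2l ?lee_fin ?invr_ge0 ?(ltW Ut)//.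
have mKu : measurable_fun setT (fun s : TR => K t `^ p * (u s)%:E)%E.
  by apply: emeasurable_funM => //; exact: mfu.
have Ku0 s : (0 <= K t `^ p * (u s)%:E)%E by rewrite mule_ge0 ?poweR_ge0 ?lee_fin.
have Gu0 s : (0 <= G t s `^ p * (u s)%:E)%E by rewrite mule_ge0 ?poweR_ge0 ?lee_fin.
rewrite /core_inner -integralDT// -integralZT ?powR_ge0//; last 2 first.
- by apply: emeasurable_funD.
- by move=> s; rewrite adde_ge0.
apply: le_integralT; first exact: mitv.
- by apply: emeasurable_funM; [exact: measurable_fun_poweR|exact: mfu].
- by apply: emeasurable_funM; [exact: measurable_cst|exact: emeasurable_funD].
- by move=> s; rewrite mule_ge0 ?poweR_ge0 ?lee_fin.
move=> s; rewrite /= in_itv/= => /andP[s0 st].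
rewrite (HE st) -ge0_muleDl ?poweR_ge0// muleA lee_wpmul2r ?lee_fin//.
exact: poweRD_le.
Qed.

Variable a : TR -> R.
Hypotheses (ma : measurable_fun setT a) (a0 : forall x, 0 <= a x).
(** This is M^(-1/r), the size allowed for the tails of U^(-1/p) a. *)
Let Ginv (x : TR) := U x `^ (- p^-1) * psi x `^ (- r^-1).
Hypothesis a_left : forall x : R, 0 < x ->
  (\int[mu]_(t in `]0%R, x]) (a t)%:E <= (psi x `^ (- r^-1))%:E)%E.
Hypothesis a_right : forall x : R, 0 < x ->
  (\int[mu]_(t in `[x, +oo[) (U t `^ (- p^-1) * a t)%:E <= (Ginv x)%:E)%E.

Let mhV : measurable_fun (ray 0%R : set TR) (fun z : TR => h z * (V z)^-1%:E)%E.
Proof.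
apply: emeasurable_funM; first exact: mhA.
apply/measurable_EFinP; apply: ge0_measurable_funV => //; last exact: measurable_funTS.
by move=> x; rewrite /ray/= in_itv/= andbT => /V0/ltW.
Qed.

Let hV0 (z : R) : ray 0 z -> (0 <= h z * (V z)^-1%:E)%E.
Proof.
by rewrite /ray/= in_itv/= andbT => z0; rewrite mule_ge0// lee_fin invr_ge0 ltW// V0.
Qed.

Let mEa A : measurable_fun A (fun x : TR => (a x)%:E).
Proof. by apply/measurable_EFinP; exact: measurable_funTS. Qed.

(** By Tonelli [h z] is multiplied by the mass of [a] on (0, z], at most psi(z)^(-1/r), which is at
    most a multiple of 1/V by [core_V_psi]. *)
Lemma core_tail_part : (\int[mu]_(t in ray 0%R) (K t * (a t)%:E) <=
  (K2 `^ r^-1)%:E * \int[mu]_(z in ray 0%R) (h z * (V z)^-1%:E))%E.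
Proof.
pose E := [set z : TR * TR | z.1 <= z.2].
have mE : measurable E by rewrite -[X in measurable X]setTI; apply: measurable_fun_ler.
rewrite (eq_integral (fun t : TR => (a t)%:E *
    \int[mu]_(z in ray 0%R `&` [set z | E (t, z)]) h z)%E); last first.
  move=> t; rewrite inE/= /ray/= in_itv/= andbT => t0; rewrite muleC; congr (_ * _)%E.
  congr (integral _ _ _); apply/seteqP; split => z /=; rewrite !in_itv/= !andbT.
    by move=> tz; rewrite (lt_le_trans t0 tz).
  by move=> [].
have := tonelli_on mu mu mE (mray 0) (mray 0) (@mEa _) (@mhA _).
move=> -> //; last by move=> x _; rewrite lee_fin.
rewrite -ge0_integralZl_EFin ?powR_ge0//.
apply: ge0_le_integral => //.
- by move=> z _; rewrite mule_ge0//; apply: integral_ge0 => t _; rewrite lee_fin.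
- apply: emeasurable_funM; first exact: mhA.
  apply: measurable_funTS.
  pose E' := [set z : TR * TR | z.2 <= z.1].
  have mE' : measurable E' by rewrite -[X in measurable X]setTI; apply: measurable_fun_ler.
  by apply: (measurable_integral_on mu mE' (mray 0) (@mEa _)) => t _; rewrite lee_fin.
- by apply: emeasurable_funM.
move=> z z0; have z0' : 0 < z by move: z0; rewrite /ray/= in_itv/= andbT.
rewrite muleCA lee_wpmul2l//.
have -> : ray 0 `&` [set x | E (x, z)] = `]0, z]%classic.
  apply/seteqP; split => x /=; rewrite /ray /E/= !in_itv/= ?andbT.
    by move=> [-> ->].
  by move=> /andP[-> ->].
apply: (le_trans (a_left z0')); rewrite -EFinM lee_fin powRN -[leLHS]mul1r.
have psiz := psi0 z0'.
rewrite ler_pdivrMr ?powR_gt0// mulrAC ler_pdivlMr ?V0// mul1r.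
rewrite -powRM ?(ltW K20) ?(ltW psiz)//.
rewrite -[leLHS](powRr1 (ltW (V0 z0'))) -[X in _ `^ X](@mulfV _ r) ?gt_eqF// powRrM.
apply: ge0_ler_powR; rewrite ?invr_ge0 ?(ltW r0) ?nnegrE ?powR_ge0 ?core_V_psi//.
by rewrite mulr_ge0 ?(ltW K20) ?(ltW psiz).
Qed.

Let mGinv : measurable_fun setT Ginv.
Proof. by apply: measurable_funM; exact: (measurableT_comp (measurable_powR _)). Qed.

Let Ginv0 (x : R) : 0 < x -> 0 < Ginv x.
Proof. by move=> x0; rewrite mulr_gt0 ?powR_gt0 ?U0 ?psi0. Qed.

Let mUa : measurable_fun setT (fun t => U t `^ (- p^-1) * a t).
Proof. by apply: measurable_funM => //; exact: (measurableT_comp (measurable_powR _)). Qed.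

Let Ua0 t : 0 <= U t `^ (- p^-1) * a t.
Proof. by rewrite mulr_ge0 ?powR_ge0. Qed.

(** [a_right] says that the tails of U^(-1/p) a are dominated by [Ginv]; the level-set lemma with
    exponent 1 - p, for segments at infinity, integrates the negative power. *)
Lemma core_a_pow (z : R) : 0 < z ->
  (\int[mu]_(t in `[z, +oo[) (Ginv t `^ (- (1 - p)) * (U t `^ (- p^-1) * a t))%:E <=
   (level_const (1 - p) * Ginv z `^ p)%:E)%E.
Proof.
move=> z0.
have e0 : 0 < 1 - p by rewrite subr_gt0.
have e1 : 1 - p < 1 by rewrite ltrBlDr ltrDl.
have := @integral_powRN_le _ TR R mu `[z, +oo[%classic _ Ginv (mitv _) mUa mGinv Ua0.
rewrite -[X in _ `^ X](subKr 1 p); apply => //.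
- move=> s s0; apply: (integral_sublevel_le (b := false)) => //.
  move=> t; rewrite /= in_itv/= andbT => zt.
  apply: le_trans (a_right (lt_le_trans z0 zt)).
  apply: subset_integralT => //.
  + by apply: measurableI => //; exact: measurable_segment.
  + by apply/measurable_EFinP.
  + by move=> x [/= _]; rewrite /segment/= in_itv/= andbT.
- by move=> t; rewrite /= in_itv/= andbT => zt; rewrite Ginv0// (lt_le_trans z0 zt).
- exact: Ginv0.
- exact: a_right.
Qed.

Let alpha (t : TR) := Ginv t `^ (- (1 - p)) * (U t `^ (- p^-1) * a t).

Let malpha A : measurable_fun A (EFin \o alpha).
Proof.
apply/measurable_EFinP; apply: measurable_funTS; apply: measurable_funM => //.
exact: (measurableT_comp (measurable_powR _)).
Qed.

Let alpha0 (t : TR) : 0 <= alpha t. Proof. by rewrite mulr_ge0 ?powR_ge0. Qed.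

Let f1 (t : R) := (\int[mu]_(z in `]0%R, t[) (h z * (b z)%:E))%E.

Let mhb : measurable_fun (ray 0%R : set TR) (fun z : TR => h z * (b z)%:E)%E.
Proof. by apply: emeasurable_funM; [exact: mhA|apply/measurable_EFinP]. Qed.

Let f10 (t : R) : (0 <= f1 t)%E.
Proof.
apply: integral_ge0 => z; rewrite /= in_itv/= => /andP[z0 _].
by rewrite mule_ge0 ?lee_fin ?b0.
Qed.

Let inner_pointwise (t : R) : 0 < t ->
  (((U t)^-1%:E * core_inner t) `^ p^-1 * (a t)%:E <=
   (C2 `^ r^-1)%:E * (f1 t * (alpha t)%:E))%E.
Proof.
move=> t0; have Ut := U0 t0; have pt := psi0 t0.
have X0 : 0 < U t * psi t `^ (1 - p) by rewrite mulr_gt0 ?powR_gt0.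
rewrite poweRM ?lee_fin ?invr_ge0 ?(ltW Ut) ?core_inner_ge0//.
apply: (@le_trans _ _ (((U t)^-1)%:E `^ p^-1 * (f1 t * ((C2 * (U t * psi t `^ (1 - p))) `^ r^-1)%:E) * (a t)%:E)%E).
  rewrite lee_wpmul2r ?lee_fin// lee_wpmul2l ?poweR_ge0//.
  apply: (@le_trans _ _ ((f1 t `^ p * ((C2 * (U t * psi t `^ (1 - p))) `^ (1 - p))%:E) `^ p^-1)%E).
    by apply: le_poweR; rewrite ?invr_ge0 ?(ltW p0) ?core_inner_ge0// core_inner_le.
  rewrite poweRM ?poweR_ge0 ?lee_fin ?powR_ge0// poweRK ?gt_eqF// poweR_EFin -powRrM.
  have -> // : (1 - p) / p = r^-1.
  by rewrite /r /star invf_div.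
rewrite poweR_EFin muleCA muleAC -!muleA -!EFinM [leRHS]muleCA; apply: lee_wpmul2l => //.
rewrite -EFinM lee_fin /alpha.
have GE : Ginv t `^ (- (1 - p)) = (U t * psi t `^ (1 - p)) `^ r^-1.
  rewrite /Ginv (powRM _ (powR_ge0 _ _) (powR_ge0 _ _)) (powRM _ (ltW Ut) (powR_ge0 _ _)) -!powRrM.
  congr (_ `^ _ * _ `^ _).
    by rewrite /r /star invf_div mulrNN mulrC.
  by rewrite mulrNN mulrC.
rewrite GE (powRM _ (ltW C20) (ltW X0)) (powRV _ (ltW Ut)) -powRN.
suff E (A B C D : R) : D * (A * (B * C)) = B * (C * (A * D)) by rewrite E.
ring.
Qed.

(** After Tonelli, [h z] is multiplied by [b z] and by the tail integral of [alpha], at most a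
    multiple of Ginv(z)^p. The factor U psi^(1-p) in [b] is exactly the reciprocal of Ginv^p, so
    that 1/V remains. *)
Lemma core_inner_part :
  (\int[mu]_(t in ray 0%R) (((U t)^-1%:E * core_inner t) `^ p^-1 * (a t)%:E) <=
  (C2 `^ r^-1 * level_const (1 - p))%:E * \int[mu]_(z in ray 0%R) (h z * (V z)^-1%:E))%E.
Proof.
have mUV : measurable_fun (ray 0%R : set TR) (fun t : TR => (U t)^-1).
  apply: ge0_measurable_funV => //; last exact: measurable_funTS.
  by move=> x; rewrite /ray/= in_itv/= andbT => /U0/ltW.
have mf1 : measurable_fun setT (f1 : TR -> \bar R).
  apply: nondecreasing_emeasurable => x y xy; apply: ge0_subset_integral => //.
  - by apply: measurable_funS mhb => // z; rewrite /ray/= !in_itv/= => /andP[->].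
  - by move=> z; rewrite /= in_itv/= => /andP[z0 _]; rewrite mule_ge0 ?lee_fin ?b0.
  - by move=> z /=; rewrite !in_itv/= => /andP[-> zx]; rewrite (lt_le_trans zx).
apply: (@le_trans _ _ (\int[mu]_(t in ray 0%R) ((C2 `^ r^-1)%:E * (f1 t * (alpha t)%:E)))%E).
  apply: ge0_le_integral => //.
  - by move=> t _; rewrite mule_ge0 ?poweR_ge0 ?lee_fin.
  - apply: emeasurable_funM; last exact: mEa.
    apply: measurable_fun_poweR; apply: emeasurable_funM; first exact/measurable_EFinP.
    by apply: measurable_funTS; exact: measurable_core_inner.
  - apply: emeasurable_funM => //; apply: emeasurable_funM; last exact: malpha.
    exact: measurable_funTS.
  - move=> t; rewrite /ray/= in_itv/= andbT => t0; exact: inner_pointwise.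
rewrite ge0_integralZl_EFin ?powR_ge0//; last 2 first.
- by move=> t _; rewrite mule_ge0 ?lee_fin.
- by apply: emeasurable_funM; [exact: measurable_funTS|exact: malpha].
rewrite EFinM -muleA lee_wpmul2l ?lee_fin ?powR_ge0//.
pose E := [set z : TR * TR | z.2 < z.1].
have mE : measurable E by rewrite -[X in measurable X]setTI; apply: measurable_fun_ltr.
rewrite (eq_integral (fun t : TR => (alpha t)%:E *
    \int[mu]_(z in ray 0%R `&` [set z | E (t, z)]) (h z * (b z)%:E))%E); last first.
  move=> t _; rewrite muleC; congr (_ * _)%E.
  congr (integral _ _ _); apply/seteqP; split => z /=; rewrite /ray /E/= !in_itv/= ?andbT.
    by move=> /andP[-> ->].
  by move=> [-> ->].
have := tonelli_on mu mu mE (mray 0) (mray 0) (@malpha _) mhb.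
move=> -> //; last 2 first.
- by move=> x _; rewrite lee_fin.
- by move=> z; rewrite /ray/= in_itv/= andbT => z0; rewrite mule_ge0 ?lee_fin ?b0.
have lc0 : 0 <= level_const (1 - p) by rewrite ltW// level_const_gt0// ltrBlDr ltrDl.
rewrite -ge0_integralZl_EFin//.
apply: ge0_le_integral => //.
- move=> z; rewrite /ray/= in_itv/= andbT => z0; rewrite !mule_ge0 ?lee_fin ?b0//.
  by apply: integral_ge0 => t _; rewrite lee_fin.
- apply: emeasurable_funM => //; apply: measurable_funTS.
  pose E' := [set z : TR * TR | z.1 < z.2].
  have mE' : measurable E' by rewrite -[X in measurable X]setTI; apply: measurable_fun_ltr.
  by apply: (measurable_integral_on mu mE' (mray 0) (@malpha _)) => t _; rewrite lee_fin.
- by apply: emeasurable_funM.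
move=> z; rewrite /ray/= in_itv/= andbT => z0.
have Uz := U0 z0; have pz := psi0 z0; have Vz := V0 z0.
rewrite -muleA [leRHS]muleCA; apply: (lee_wpmul2l (h0 z)).
rewrite -EFinM; apply: (@le_trans _ _ ((b z)%:E * (level_const (1 - p) * Ginv z `^ p)%:E)%E).
  rewrite lee_wpmul2l ?lee_fin ?b0//; apply: le_trans (core_a_pow z0).
  apply: ge0_subset_integral => //.
  - by apply: measurableI => //; rewrite (_ : [set x | _] = ray z)//; apply/seteqP; split => x; rewrite /ray/= in_itv/= andbT.
  - by move=> t _; rewrite lee_fin.
  - by move=> t [_]; rewrite /E/= in_itv/= andbT => /ltW.
rewrite -!EFinM lee_fin /b /Ginv powRM ?powR_ge0// -!powRrM.
have -> : - p^-1 * p = -1 by rewrite mulNr mulVf ?gt_eqF.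
have -> : - r^-1 * p = - (1 - p) by rewrite -prE; ring.
rewrite powR_inv1 ?(ltW Uz)// [psi z `^ (- (1 - p))]powRN.
have pz' : psi z `^ (1 - p) != 0 by rewrite gt_eqF// powR_gt0.
rewrite le_eqVlt; apply/orP; left; apply/eqP; field.
by rewrite pz' !gt_eqF.
Qed.

Lemma core_bound :
  (\int[mu]_(t in ray 0%R) (core_avg t `^ p^-1 * (a t)%:E) <=
  (core_const p)%:E * \int[mu]_(z in ray 0%R) (h z * (V z)^-1%:E))%E.
Proof.
have mUV : measurable_fun (ray 0%R : set TR) (fun t : TR => (U t)^-1).
  apply: ge0_measurable_funV => //; last exact: measurable_funTS.
  by move=> x; rewrite /ray/= in_itv/= andbT => /U0/ltW.
have mHu : measurable_fun setT (fun s : TR => H s `^ p * (u s)%:E)%E.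
  by apply: emeasurable_funM; [exact: measurable_fun_poweR|exact: mfu].
have Hu0 s : (0 <= H s `^ p * (u s)%:E)%E by rewrite mule_ge0 ?poweR_ge0 ?lee_fin.
have mavg : measurable_fun (ray 0%R : set TR) (core_avg : TR -> \bar R).
  apply: emeasurable_funM; first exact/measurable_EFinP.
  apply: measurable_funTS; apply: nondecreasing_emeasurable => x y xy.
  apply: subset_integralT => //.
  by move=> z /=; rewrite !in_itv/= => /andP[-> zx]; rewrite (lt_le_trans zx).
have k0 : 0 <= 2 * 2 `^ p^-1 :> R by rewrite mulr_ge0 ?powR_ge0.
have mA : measurable_fun (ray 0%R : set TR) (fun t : TR => ((U t)^-1%:E * core_inner t) `^ p^-1 * (a t)%:E)%E.
  apply: emeasurable_funM; last exact: mEa.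
  apply: measurable_fun_poweR; apply: emeasurable_funM; first exact/measurable_EFinP.
  by apply: measurable_funTS; exact: measurable_core_inner.
have mB : measurable_fun (ray 0%R : set TR) (fun t : TR => K t * (a t)%:E)%E.
  by apply: emeasurable_funM; [exact: measurable_funTS|exact: mEa].
have A0 t : (0 <= ((U t)^-1%:E * core_inner t) `^ p^-1 * (a t)%:E)%E.
  by rewrite mule_ge0 ?poweR_ge0 ?lee_fin.
have B0 t : (0 <= K t * (a t)%:E)%E by rewrite mule_ge0 ?lee_fin.
apply: (@le_trans _ _ (\int[mu]_(t in ray 0%R) ((2 * 2 `^ p^-1)%:E *
    (((U t)^-1%:E * core_inner t) `^ p^-1 * (a t)%:E + K t * (a t)%:E)))%E).
  apply: (@ge0_le_integral _ TR R mu _ (mray 0)).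
  - by move=> t _; rewrite mule_ge0 ?poweR_ge0 ?lee_fin.
  - by apply: emeasurable_funM; [exact: measurable_fun_poweR|exact: mEa].
  - by apply: emeasurable_funM; [exact: measurable_cst|exact: emeasurable_funD].
  move=> t; rewrite /ray/= in_itv/= andbT => t0; have Ut := U0 t0.
  rewrite -ge0_muleDl ?poweR_ge0// muleA lee_wpmul2r ?lee_fin//.
  have Ug0 : (0 <= (U t)^-1%:E * core_inner t)%E.
    by rewrite mule_ge0 ?core_inner_ge0 ?lee_fin ?invr_ge0 ?(ltW Ut).
  apply: (@le_trans _ _ (((2 `^ p)%:E * ((U t)^-1%:E * core_inner t + K t `^ p)) `^ p^-1)%E).
    by apply: le_poweR; rewrite ?invr_ge0 ?(ltW p0) ?core_avg_ge0// core_avg_le.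
  rewrite poweRM ?lee_fin ?powR_ge0 ?adde_ge0 ?poweR_ge0// poweR_EFin -powRrM mulfV ?gt_eqF// powRr1//.
  rewrite EFinM -muleA lee_wpmul2l ?lee_fin//.
  have := @poweRD_le R ((U t)^-1%:E * core_inner t)%E (K t `^ p)%E p^-1.
  by rewrite poweRK ?gt_eqF//; apply; rewrite ?invr_gt0 ?poweR_ge0.
rewrite ge0_integralZl_EFin//; last 2 first.
- by move=> t _; rewrite adde_ge0.
- exact: emeasurable_funD.
rewrite ge0_integralD// /core_const [in leRHS]EFinM -muleA lee_wpmul2l ?lee_fin//.
have lc0 : 0 <= level_const (1 - p) by rewrite ltW// level_const_gt0// ltrBlDr ltrDl.
rewrite EFinD ge0_muleDl ?lee_fin ?powR_ge0 ?mulr_ge0 ?powR_ge0// addeC.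
by apply: leeD; [exact: core_tail_part|exact: core_inner_part].
Qed.

End core.

(** * The Stieltjes measure of the tail essential supremum *)

Section left_stieltjes_extra.
Context {R : realType}.
Local Notation TR := (measurableTypeR R).
Implicit Types (g : R -> R).

Lemma left_stieltjes_npos g : left_stieltjes g `]-oo, 0]%classic = 0%E.
Proof.
rewrite /left_stieltjes /pushforward (_ : _ @^-1` _ = set0) ?measure0//.
apply/seteqP; split => y //=; rewrite in_itv/= /Defs.expRN => /(lt_le_trans (expR_gt0 _)).
by rewrite ltxx.
Qed.

(** Stated for every [g] because the sigma-finite instance below has to cover every [g], including
    those for which [exp_transport] takes its default value 0. *)
Lemma left_stieltjes_itv_lty g (a b : R) : 0 < a -> a < b -> (left_stieltjes g `[a, b[%classic < +oo)%E.
Proof.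
move=> a0 ab; have b0 := lt_trans a0 ab.
rewrite /left_stieltjes /pushforward.
have -> : @Defs.expRN R @^-1` `[a, b[ = `]- ln b, - ln a]%classic.
  apply/seteqP; split => y /=; rewrite !in_itv/= /Defs.expRN => /andP[h1 h2].
    by rewrite lerNr -ler_expR lnK ?posrE// h1 ltrNl -ltr_expR lnK ?posrE// h2.
  by rewrite -[leLHS]lnK ?posrE// -[ltRHS]lnK ?posrE// ler_expR ltr_expR lerNr h2 ltrNl h1.
rewrite /lebesgue_stieltjes_measure /measure_extension measurable_mu_extE/=; last exact: is_ocitv.
by rewrite wlength_itv_bnd ?ltry// lerN2 ler_ln ?posrE// ltW.
Qed.

Lemma left_stieltjes_sigma_finite g : sigma_finite setT (left_stieltjes g).
Proof.
(* The nonpositive half-line is null and is added so that the union is the whole line. With [n.+2]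
   the interval is nondegenerate already for n = 0. *)
pose F n := `]-oo, 0%R]%classic `|` `[n.+2%:R^-1, n.+2%:R[%classic : set TR.
have n1 n : n.+2%:R^-1 < n.+2%:R :> R.
  apply: (@lt_trans _ _ 1); last by rewrite ltr1n.
  by rewrite invf_lt1 ?ltr0n// ltr1n.
exists F; last first.
  move=> n; split; first by apply: measurableU; exact: measurable_itv.
  apply: (@le_lt_trans _ _ (left_stieltjes g `]-oo, 0%R]%classic + left_stieltjes g `[(n.+2%:R^-1)%R, n.+2%:R%R[%classic)%E).
    by apply: measureU2; exact: measurable_itv.
  by rewrite left_stieltjes_npos add0e left_stieltjes_itv_lty// invr_gt0 ltr0n.
apply/esym/seteqP; split => // x _.
have [x0|x0] := leP x 0; first by exists 0%N => //; left; rewrite /= in_itv/=.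
pose n := maxn (Num.truncn x) (Num.truncn x^-1).
have tr (y : R) m : 0 < y -> (Num.truncn y <= m)%N -> y < m.+2%:R.
  move=> y0 ym; have /andP[_ h] := truncn_itv (ltW y0).
  by apply: (lt_le_trans h); rewrite ler_nat ltnS (leq_trans ym).
exists n => //; right; rewrite /= in_itv/=; apply/andP; split; last by apply: tr; rewrite ?leq_maxl.
rewrite -[leRHS]invrK lef_pV2 ?posrE ?ltr0n ?invr_gt0//.
by apply: ltW; apply: tr; rewrite ?invr_gt0// leq_maxr.
Qed.

HB.instance Definition _ g := @Measure_isSigmaFinite.Build _ _ _ (left_stieltjes g)
  (left_stieltjes_sigma_finite g).

End left_stieltjes_extra.

Section vlow_extra.
Context {R : realType}.
Local Notation TR := (measurableTypeR R).
Local Notation mu := (@lebesgue_measure R).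
Variable v : R -> R.
Hypotheses (mv : measurable_fun (ray 0%R : set TR) v) (v0 : forall t, 0 < t -> 0 <= v t).

Let mray (x : R) : measurable (ray x : set TR).
Proof. exact: measurable_itv. Qed.

(** The condition 1/v > k is written v k < 1 from here on: this stays correct where [v] vanishes and
    its extended inverse is infinite. *)
Let lt_inve (k x : R) : 0 <= k -> 0 <= x -> (k%:E < x%:E^-1)%E = (x * k < 1).
Proof.
move=> k0; rewrite le_eqVlt => /predU1P[<-|x0].
  by rewrite inver eqxx ltry mul0r ltr01.
by rewrite inver gt_eqF// lte_fin mulrC -[x^-1]mul1r ltr_pdivlMr.
Qed.

Let mlow (s k : R) : 0 <= s -> measurable (ray s `&` [set z : TR | v z * k < 1]).
Proof.
move=> s0.
have sub : (ray s : set TR) `<=` ray 0.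
  by move=> z /=; rewrite /ray/= !in_itv/= !andbT; exact: le_lt_trans.
have mvs : measurable_fun (ray s : set TR) (fun z : TR => v z * k).
  by apply: measurable_funM => //; exact: measurable_funS mv.
have H : measurable_fun (ray s : set TR) (fun z : TR => v z * k < 1).
  exact: measurable_fun_ltr.
by have := H (mray s) [set true]; apply.
Qed.

Lemma vlow_gt_measure (s k : R) : 0 <= s -> 0 <= k -> (k%:E < vlow v (`]s, +oo[))%E ->
  (0 < mu (ray s `&` [set z | (v z * k < 1)%R]))%E.
Proof.
move=> s0 k0 kv; rewrite lt_def measure_ge0 andbT; apply/eqP => mu0.
move: kv; apply/negP; rewrite -leNgt; apply/ess_supP.
exists ((ray s `&` [set z | v z * k < 1]) `|` ~` ray s); split.
- by apply: measurableU; [exact: mlow|exact: measurableC].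
- rewrite /= /mrestr setIUl setICl setU0; apply/eqP; rewrite eq_le measure_ge0 andbT -[leRHS]mu0.
  apply: le_measure; rewrite ?inE//; [apply: measurableI => //|]; exact: mlow.
- move=> z /= /negP; rewrite -ltNge => kz.
  have [zs|zs] := pselect (ray s z); last by right.
  left; split => //=; rewrite -lt_inve// v0//.
  by move: zs; rewrite /ray/= in_itv/= andbT; exact: le_lt_trans.
Qed.

(** The essential supremum over (s, oo) bounds 1/v outside a null set that depends on [s]. Taking
    rational [s] leaves countably many null sets, and [s] then increases to [z]. *)
Lemma ae_inv_le_vlow_left :
  {ae mu, forall z, 0 < z -> ((v z)%:E^-1 <= vlow_left v z)%E}.
Proof.
(* Rationals are enumerated through [unpickle], so that [ae_foralln] applies. *)
have H (n : nat) : {ae mu, forall z : TR, forall q : rat, unpickle n = Some q -> 0 <= ratr q :> R ->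
    ratr q < z -> ((v z)%:E^-1 <= vlow v (`]ratr q, +oo[))%E}.
  case E : (unpickle n : option rat) => [q|]; last by apply: aeW => z q.
  have [q0|q0] := leP 0 (ratr q : R); last first.
    by apply: aeW => z q' [<-]; rewrite leNgt q0.
  have := ess_sup_ge (mrestr mu (measurable_itv `](ratr q : R), +oo[)) (fun s => (v s)%:E^-1)%E.
  move=> [N [mN N0 NP]].
  exists (N `&` ray (ratr q)); split.
  - exact: measurableI.
  - exact: N0.
  - move=> z /= /existsNP[q' /not_implyP[[<-] /not_implyP[_ /not_implyP[qz h]]]].
    by split; [exact: NP|rewrite /ray/= in_itv/= andbT].
have /ae_foralln := H; apply: filterS => z Hz z0.
apply: lime_ge; first exact: cvg_vlow_left.
near=> s.
have s0 : 0 < s by near: s; exact: nbhs_left_gt.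
have sz : s < z by near: s; exact: nbhs_left_lt.
have [q /[!in_itv]/= /andP[sq qz]] := rat_in_itvoo sz.
apply: le_trans (le_vlow v (ltW sq)).
by apply: (Hz (pickle q) q); rewrite ?pickleK// ltW// (lt_trans s0).
Unshelve. all: by end_near. Qed.

(** [v] takes finite values, so 1/v is strictly positive everywhere, and a half-line is not null. *)
Lemma vlow_pos (s : R) : 0 <= s -> (0 < vlow v (`]s, +oo[))%E.
Proof.
move=> s0; rewrite lt_def vlow_ge0// andbT; apply/eqP => vs0.
have [N [mN N0 NP]] := ess_sup_ge (mrestr mu (measurable_itv `]s, +oo[)) (fun s => (v s)%:E^-1)%E.
have : (mu (ray s) <= 0)%E.
  rewrite -N0 /= /mrestr; apply: le_measure; rewrite ?inE//; first exact: measurableI.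
  move=> z zs; split => //; apply: NP => /=.
  rewrite -/(vlow v (`]s, +oo[)) vs0; apply/negP; rewrite -ltNge.
  suff vz0 : 0 <= v z by have := lt_inve (lexx 0) vz0; rewrite mulr0 ltr01.
  by apply: v0; move: zs; rewrite /ray/= in_itv/= andbT; exact: le_lt_trans.
by rewrite /ray lebesgue_measure_itv/= ltry.
Qed.

Lemma vlow_left_pos (t : R) : 0 < t -> (0 < vlow_left v t)%E.
Proof. by move=> t0; apply: lt_le_trans (vlow_le_left v t); exact/vlow_pos/ltW. Qed.

Hypothesis vlim : vlow v (`]t, +oo[) @[t --> +oo] --> 0%E.
Hypothesis voo : forall t, 0 < t -> (vlow v (`]t, +oo[) < +oo)%E.

Lemma vlow_small (e : R) : 0 < e -> exists2 B, 0 < B & forall t, B < t -> (vlow_left v t < e%:E)%E.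
Proof.
move=> e0.
have : \forall t \near +oo, (vlow v (`]t, +oo[) < e%:E)%E.
  have e0' : (0 < e%:E)%E by rewrite lte_fin.
  exact: vlim (open_ereal_lt' e0').
move=> [B [Br HB]].
exists (Num.max 1 (B + 1)); first by rewrite lt_max ltr01.
move=> t; rewrite gt_max => /andP[_ Bt].
have h : B < B + 1 by rewrite ltrDl.
exact: le_lt_trans (vlow_left_ge v Bt) (HB _ h).
Qed.

End vlow_extra.

(** * Sufficiency *)

Lemma core_const_ge0 {R : realType} (p : R) : 0 < p < 1 -> 0 <= core_const p.
Proof.
move=> /andP[p0 p1]; rewrite /core_const !mulr_ge0 ?powR_ge0 ?addr_ge0 ?mulr_ge0 ?powR_ge0//.
by rewrite ltW// level_const_gt0// ltrBlDr ltrDl.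
Qed.

Section truncation.
Context {d : measure_display} {T : measurableType d} {R : realType}.
Variable mu : {measure set T -> \bar R}.

(** The truncation at height [j] is real valued, hence admissible where an extended-real function is
    not. *)
Lemma integral_truncation_le (D : set T) (G : T -> \bar R) (f : T -> R) (B : \bar R) :
  measurable D -> measurable_fun D G -> measurable_fun D f ->
  (forall x, D x -> (0 <= G x)%E) -> (forall x, D x -> 0 <= f x) ->
  (forall j : nat, (\int[mu]_(x in D) (fine (Order.min (G x) j%:R%:E) * f x)%:E <= B)%E) ->
  (\int[mu]_(x in D) (G x * (f x)%:E) <= B)%E.
Proof.
move=> mD mG mf G0 f0 H.
pose g (j : nat) (x : T) : \bar R := (Order.min (G x) j%:R%:E * (f x)%:E)%E.
have gE j x : D x -> g j x = (fine (Order.min (G x) j%:R%:E) * f x)%:E.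
  move=> Dx; rewrite /g EFinM fineK//; apply/fin_numP; split; rewrite minEle; case: ifPn => //.
    by move=> _; move: (G0 x Dx); case: (G x).
  by case: (G x).
have mg j : measurable_fun D (g j).
  apply: emeasurable_funM; last exact/measurable_EFinP.
  exact: measurable_mine.
have g0 j x : D x -> (0 <= g j x)%E.
  move=> Dx; rewrite mule_ge0 ?lee_fin ?f0// le_min G0//= lee_fin//.
have gnd x : D x -> nondecreasing_seq (g^~ x).
  move=> Dx i j ij; rewrite /g; apply: lee_wpmul2r; first by rewrite lee_fin f0.
  rewrite le_min ge_min lexx/= ge_min lee_fin ler_nat ij orbT//.
have gc x : D x -> g j x @[j --> \oo] --> (G x * (f x)%:E)%E.
  move=> Dx; case GE : (G x) (G0 x Dx) => [y| |]// y0.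
    apply: cvg_near_cst; near=> j; rewrite /g GE minEle ifT// lee_fin.
    by near: j; exact: nbhs_infty_ger.
  have [fx0|fx0] := eqVneq (f x) 0.
    by apply: cvg_near_cst; near=> j; rewrite /g fx0 !mule0.
  have {}fx0 : 0 < f x by rewrite lt_def fx0 f0.
  have -> : (+oo * (f x)%:E = +oo)%E by rewrite gt0_mulye ?lte_fin.
  apply/cvgeyPge => A; near=> j.
  rewrite /g GE minEle /= -EFinM lee_fin -ler_pdivrMr//.
  by near: j; exact: nbhs_infty_ger.
have H2 := @cvg_monotone_convergence _ _ _ mu D mD g mg g0 gnd.
rewrite (eq_integral (fun x => limn (g^~ x))); last first.
  by move=> x /[!inE] Dx; rewrite (cvg_lim _ (gc x Dx)).
rewrite -(cvg_lim _ H2)//; apply: lime_le; first by apply/cvg_ex; eexists; exact: H2.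
apply: nearW => j; rewrite (eq_integral (fun x => (fine (Order.min (G x) j%:R%:E) * f x)%:E))//.
by move=> x /[!inE] Dx; exact: gE.
Unshelve. all: by end_near. Qed.

End truncation.

Section sufficiency.
Context {R : realType}.
Local Notation TR := (measurableTypeR R).
Local Notation mu := (@lebesgue_measure R).
Variables (p q : R) (u U V psi w phi : TR -> R).
Variable sg : {sigma_finite_measure set TR -> \bar R}.
Let r := star p.
Hypotheses (p0 : 0 < p) (p1 : p < 1) (q0 : 0 < q).
Hypotheses (mu_ : measurable_fun setT u) (u0 : forall x, 0 <= u x).
Hypotheses (mU : measurable_fun setT U) (U0 : forall x : R, 0 < x -> 0 < U x).
Hypothesis ndU : forall x y : R, 0 < x -> x <= y -> U x <= U y.
Hypothesis UE : forall x : R, 0 < x -> (\int[mu]_(s in `]0%R, x[) (u s)%:E = (U x)%:E)%E.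
Hypotheses (mV : measurable_fun setT V) (V0 : forall x : R, 0 < x -> 0 < V x).
Hypothesis VE : forall x : R, 0 < x -> sg `[x, +oo[%classic = ((V x) `^ r)%:E.
Hypothesis mpsi : measurable_fun setT psi.
Hypothesis psi0 : forall x : R, 0 < x -> 0 < psi x.
Hypothesis psiE : forall x : R, 0 < x ->
  (\int[sg]_(t in ray 0%R) ((U t / (U x + U t)) `^ (1 + r))%:E = (psi x)%:E)%E.
Hypotheses (mw : measurable_fun setT w) (w0 : forall x, 0 <= w x).
Hypothesis phiE : forall x : R, 0 < x ->
  (\int[mu]_(s in ray 0%R) ((U x / (U s + U x)) `^ (q / p) * w s)%:E = (phi x)%:E)%E.

Let r0 : 0 < r. Proof. by rewrite divr_gt0 ?subr_gt0. Qed.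
Let qp0 : 0 < q / p. Proof. exact: divr_gt0. Qed.
Let mray (x : R) : measurable (ray x : set TR).
Proof. exact: measurable_itv. Qed.
Let mitv (i : interval R) : measurable ([set` i] : set TR).
Proof. exact: measurable_itv. Qed.

Let phi0 (x : R) : 0 < x -> 0 <= phi x.
Proof.
by move=> x0; rewrite -lee_fin -phiE//; apply: integral_ge0 => s _; rewrite lee_fin mulr_ge0 ?powR_ge0.
Qed.

Let mker (x : R) : 0 < x ->
  measurable_fun (ray 0%R : set TR) (fun s : TR => ((U x / (U s + U x)) `^ (q / p) * w s)%:E).
Proof.
move=> x0; apply/measurable_EFinP; apply: measurable_funM; last exact: measurable_funTS.
apply: (measurableT_comp (measurable_powR _)).
apply: measurable_funM => //.
apply: ge0_measurable_funV => //.
  by move=> t; rewrite /ray/= in_itv/= andbT => t0; rewrite addr_ge0 ?ltW ?U0.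
by apply: measurable_funTS; exact: measurable_funD.
Qed.

Let mwA A : measurable_fun A (fun t : TR => (w t)%:E).
Proof. by apply/measurable_EFinP; exact: measurable_funTS. Qed.

Let mUwA A : measurable_fun A (fun t : TR => (U t `^ (- (q / p)) * w t)%:E).
Proof.
apply/measurable_EFinP; apply: measurable_funTS; apply: measurable_funM => //.
exact: (measurableT_comp (measurable_powR _)).
Qed.

(** For t <= x the kernel of [phi] is at least 2^(-q/p). In [right_mass_le], for t >= x, it is at
    least (U x / (2 U t))^(q/p). Together these say that [phi] controls one segment at 0 and one at
    infinity. *)
Lemma left_mass_le (x : R) : 0 < x ->
  (\int[mu]_(t in `]0%R, x]) (w t)%:E <= (2 `^ (q / p) * phi x)%:E)%E.
Proof.
move=> x0; rewrite EFinM -phiE// -ge0_integralZl_EFin ?powR_ge0//; last 2 first.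
- by move=> s _; rewrite lee_fin mulr_ge0 ?powR_ge0.
- exact: mker.
have xr : `]0%R, x] `<=` ray 0%R by move=> t; rewrite /ray/= !in_itv/= andbT => /andP[].
apply: (@le_trans _ _ (\int[mu]_(t in `]0%R, x])
   ((2 `^ (q / p))%:E * ((U x / (U t + U x)) `^ (q / p) * w t)%:E))%E); last first.
  apply: ge0_subset_integral => //; first by apply: emeasurable_funM => //; exact: mker.
  by move=> t _; rewrite -EFinM lee_fin !mulr_ge0 ?powR_ge0.
apply: ge0_le_integral => //.
- by move=> t _; rewrite lee_fin.
- by apply: emeasurable_funM => //; exact: measurable_funS (mker x0).
move=> t; rewrite /= in_itv/= => /andP[t0 tx].
rewrite -EFinM lee_fin mulrA ler_peMl//.
rewrite -powRM ?divr_ge0 ?addr_ge0 ?(ltW (U0 _))//.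
apply: powR_ge1; last exact: ltW.
by rewrite mulrA ler_pdivlMr ?addr_gt0 ?U0// mul1r mulr_natl mulr2n lerD2r ndU.
Qed.

Lemma right_mass_le (x : R) : 0 < x ->
  (\int[mu]_(t in `[x, +oo[) (U t `^ (- (q / p)) * w t)%:E <=
    (2 `^ (q / p) * (U x `^ (- (q / p)) * phi x))%:E)%E.
Proof.
move=> x0; have Ux := U0 x0; rewrite mulrA EFinM -phiE// -ge0_integralZl_EFin ?mulr_ge0 ?powR_ge0//; last 2 first.
- by move=> s _; rewrite lee_fin mulr_ge0 ?powR_ge0.
- exact: mker.
have xr : `[x, +oo[ `<=` ray 0%R by move=> t; rewrite /ray/= !in_itv/= !andbT; exact: lt_le_trans.
apply: (@le_trans _ _ (\int[mu]_(t in `[x, +oo[)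
   ((2 `^ (q / p) * U x `^ (- (q / p)))%:E * ((U x / (U t + U x)) `^ (q / p) * w t)%:E))%E); last first.
  apply: ge0_subset_integral => //; first by apply: emeasurable_funM => //; exact: mker.
  by move=> t _; rewrite -EFinM lee_fin !mulr_ge0 ?powR_ge0.
apply: ge0_le_integral => //.
- by move=> t _; rewrite lee_fin mulr_ge0 ?powR_ge0.
- by apply: emeasurable_funM => //; exact: measurable_funS (mker x0).
move=> t; rewrite /= in_itv/= andbT => xt; have t0 := lt_le_trans x0 xt; have Ut := U0 t0.
rewrite -EFinM lee_fin mulrA ler_wpM2r//.
rewrite !powRN -!powRV ?(ltW Ux) ?(ltW Ut)// -!powRM ?mulr_ge0 ?invr_ge0 ?addr_ge0 ?(ltW Ux) ?(ltW Ut)//.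
apply: ge0_ler_powR; rewrite ?nnegrE ?mulr_ge0 ?invr_ge0 ?addr_ge0 ?(ltW Ux) ?(ltW Ut) ?(ltW p0) ?(ltW q0)//.
rewrite (_ : 2 / U x * (U x / (U t + U x)) = 2 / (U t + U x)); last by rewrite mulrA divfK ?gt_eqF.
rewrite ler_pdivlMr ?addr_gt0// mulrC ler_pdivrMr//.
by rewrite mulr_natl mulr2n lerD2l ndU.
Qed.

Variable h : TR -> \bar R.
Hypotheses (mh : measurable_fun setT h) (h0 : forall x, (0 <= h x)%E).

Let A (t : TR) := core_avg p u U h t.

Let mA : measurable_fun (ray 0%R : set TR) A.
Proof.
apply: emeasurable_funM.
  apply/measurable_EFinP; apply: ge0_measurable_funV => //; last exact: measurable_funTS.
  by move=> x; rewrite /ray/= in_itv/= andbT => /U0/ltW.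
have mH : measurable_fun setT (fun s : TR => \int[mu]_(z in ray s) h z)%E.
  apply: nonincreasing_emeasurable => x y xy; apply: subset_integralT => //.
  by move=> t; rewrite /ray/= !in_itv/= !andbT; exact: le_lt_trans.
apply: measurable_funTS; apply: nondecreasing_emeasurable => x y xy.
apply: subset_integralT => //.
- apply: emeasurable_funM; first exact: measurable_fun_poweR.
  exact/measurable_EFinP.
- by move=> s; rewrite mule_ge0 ?poweR_ge0 ?lee_fin.
- by move=> t; rewrite /= !in_itv/= => /andP[->] /lt_le_trans; exact.
Qed.

Let A0 (t : R) : 0 < t -> (0 <= A t)%E.
Proof.
move=> t0; rewrite mule_ge0 ?lee_fin ?invr_ge0 ?(ltW (U0 _))//.
by apply: integral_ge0 => s _; rewrite mule_ge0 ?poweR_ge0 ?lee_fin.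
Qed.

Let X := (\int[mu]_(z in ray 0%R) (h z * (V z)^-1%:E))%E.

Let X0 : (0 <= X)%E.
Proof.
apply: integral_ge0 => z; rewrite /ray/= in_itv/= andbT => z0.
by rewrite mule_ge0 ?h0// lee_fin invr_ge0 ltW ?V0.
Qed.

Section truncated.
Hypothesis q1 : 1 <= q.
Variables (N : TR -> R) (y : R).
Hypotheses (mN : measurable_fun setT N) (N0 : forall t, 0 <= N t).
Hypothesis NY : (\int[mu]_(t in ray 0%R) (N t * w t)%:E = y%:E)%E.

(** Used with f = w and with f = U^(-q/p) w: the integrand is then the density n = N^(1-1/q) w,
    respectively U^(-1/p) n, whose segment masses must be bounded to make n admissible in
    [core_bound]. *)
Lemma hoelder_truncated (D : set TR) (f : TR -> R) (M : R) :
  measurable D -> D `<=` ray 0%R -> measurable_fun setT f -> (forall t, 0 <= f t) -> 0 <= M ->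
  (\int[mu]_(t in D) (f t)%:E <= M%:E)%E ->
  (\int[mu]_(t in D) (f t `^ q^-1 * (N t * w t) `^ (1 - q^-1))%:E <=
    (M `^ q^-1 * y `^ (1 - q^-1))%:E)%E.
Proof.
move=> mD Dr mf f0 M0 fM.
have mfD : measurable_fun D (EFin \o f) by apply/measurable_EFinP; exact: measurable_funTS.
have mNw A' : measurable_fun A' (fun t : TR => (N t * w t)%:E).
  by apply/measurable_EFinP; apply: measurable_funTS; exact: measurable_funM.
have Nw0 t : (0 <= (N t * w t)%:E)%E by rewrite lee_fin mulr_ge0.
have qi1 : 0 <= 1 - q^-1 by rewrite subr_ge0 invf_le1.
have H : (\int[mu]_(t in D) ((f t)%:E `^ q^-1 * (N t * w t)%:E `^ (1 - q^-1)) <=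
   (\int[mu]_(t in D) (f t)%:E) `^ q^-1 * (\int[mu]_(t in D) (N t * w t)%:E) `^ (1 - q^-1))%E.
  apply: hoelder_interpolation => //; first by move=> t _; rewrite lee_fin.
  by rewrite invr_gt0 q0/= invf_le1.
apply: (le_trans H); rewrite EFinM -!poweR_EFin; apply: lee_pmul; rewrite ?poweR_ge0//.
  by apply: le_poweR; rewrite ?invr_ge0 ?(ltW q0)//; apply: integral_ge0 => t _; rewrite lee_fin.
apply: le_poweR => //; first exact: integral_ge0.
by rewrite -NY; apply: ge0_subset_integral.
Qed.

(** The density n = N^(1-1/q) w satisfies N w = N^(1/q) n, and N^(1/q) <= A^(1/p), so [core_bound]
    applied to a multiple of n bounds [y] by y^(1-1/q) times the desired quantity. Since [y] is a
    real number, that power can be cancelled. *)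
Lemma truncated_bound (I : R) : 0 < I ->
  (forall x : R, 0 < x -> phi x `^ q^-1 * psi x `^ r^-1 <= I) ->
  (forall t : R, 0 < t -> ((N t)%:E <= A t `^ (q / p))%E) ->
  (y%:E <= ((core_const p * 2 `^ p^-1 * I)%:E * X) `^ q)%E.
Proof.
move=> I0 phipsi NA.
have y0 : 0 <= y by rewrite -lee_fin -NY; apply: integral_ge0 => t _; rewrite lee_fin mulr_ge0.
move: y0; rewrite le_eqVlt => /predU1P[<-|y0]; first exact: poweR_ge0.
(* 2^(1/p) is the power 1/q of the constant 2^(q/p) of the mass bounds, [I] the bound on phi^(1/q)
   psi^(1/r), and the power of [y] comes from [hoelder_truncated]. *)
pose K := 2 `^ p^-1 * I * y `^ (1 - q^-1).
have K0 : 0 < K by rewrite !mulr_gt0 ?powR_gt0.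
pose n t := N t `^ (1 - q^-1) * w t.
have mn : measurable_fun setT n by apply: measurable_funM => //; exact: (measurableT_comp (measurable_powR _)).
have n0 t : 0 <= n t by rewrite mulr_ge0 ?powR_ge0.
pose a t := K^-1 * n t.
have ma : measurable_fun setT a by exact: measurable_funM.
have a0 t : 0 <= a t by rewrite mulr_ge0 ?invr_ge0 ?(ltW K0).
have q1E : q^-1 + (1 - q^-1) = 1 by rewrite addrC subrK.
have wE t : w t `^ q^-1 * (N t * w t) `^ (1 - q^-1) = n t.
  rewrite /n powRM// mulrCA -powRD; first by rewrite q1E powRr1.
  by rewrite q1E oner_eq0.
have pq : q / p * q^-1 = p^-1 by rewrite mulrAC mulfV ?gt_eqF// mul1r.
have pq' : - (q / p) * q^-1 = - p^-1 by rewrite mulNr pq.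
have key (x : R) : 0 < x -> 2 `^ p^-1 * phi x `^ q^-1 * y `^ (1 - q^-1) <= K * psi x `^ (- r^-1).
  move=> x0; rewrite /K [leRHS]mulrAC; apply: ler_wpM2r; first exact: powR_ge0.
  rewrite -!mulrA; apply: ler_wpM2l; first exact: powR_ge0.
  by rewrite powRN ler_pdivlMr ?powR_gt0 ?psi0// phipsi.
have aL (x : R) : 0 < x -> (\int[mu]_(t in `]0%R, x]) (a t)%:E <= (psi x `^ (- r^-1))%:E)%E.
  move=> x0; rewrite (eq_integral (fun t => (K^-1)%:E * (n t)%:E)%E); last by move=> t _; rewrite EFinM.
  rewrite integralZT//; [|exact/measurable_EFinP|by rewrite invr_ge0 ltW].
  rewrite lee_pdivrMl// -EFinM.
  apply: (@le_trans _ _ (2 `^ p^-1 * phi x `^ q^-1 * y `^ (1 - q^-1))%:E); last by rewrite lee_fin key.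
  rewrite (eq_integral (fun t => (w t `^ q^-1 * (N t * w t) `^ (1 - q^-1))%:E)); last by move=> t _; rewrite wE.
  rewrite -pq powRrM -powRM ?powR_ge0 ?phi0//.
  apply: hoelder_truncated => //; first by move=> t; rewrite /ray/= !in_itv/= andbT => /andP[].
    by rewrite mulr_ge0 ?powR_ge0 ?phi0.
  exact: left_mass_le.
have aR (x : R) : 0 < x -> (\int[mu]_(t in `[x, +oo[) (U t `^ (- p^-1) * a t)%:E <=
    (U x `^ (- p^-1) * psi x `^ (- r^-1))%:E)%E.
  move=> x0; have xr : `[x, +oo[ `<=` ray 0%R by move=> t; rewrite /ray/= !in_itv/= !andbT; exact: lt_le_trans.
  have mUn : measurable_fun setT (fun t : TR => (U t `^ (- p^-1) * n t)%:E).
    by apply/measurable_EFinP; apply: measurable_funM => //; exact: (measurableT_comp (measurable_powR _)).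
  rewrite (eq_integral (fun t => (K^-1)%:E * (U t `^ (- p^-1) * n t)%:E)%E); last first.
    by move=> t _; rewrite -EFinM /a mulrCA.
  rewrite integralZT//; [|by move=> t; rewrite lee_fin mulr_ge0 ?powR_ge0|by rewrite invr_ge0 ltW].
  rewrite lee_pdivrMl// -EFinM.
  apply: (@le_trans _ _ (U x `^ (- p^-1) * (2 `^ p^-1 * phi x `^ q^-1 * y `^ (1 - q^-1)))%:E); last first.
    by rewrite lee_fin (mulrCA K); apply: ler_wpM2l; [exact: powR_ge0|exact: key].
  rewrite (eq_integral (fun t => ((U t `^ (- (q / p)) * w t) `^ q^-1 * (N t * w t) `^ (1 - q^-1))%:E)); last first.
    by move=> t _; rewrite powRM ?powR_ge0// -powRrM pq' -mulrA wE.
  rewrite (_ : U x `^ _ * _ = (2 `^ (q / p) * (U x `^ (- (q / p)) * phi x)) `^ q^-1 * y `^ (1 - q^-1)); last first.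
    rewrite !powRM ?mulr_ge0 ?powR_ge0 ?phi0// -!powRrM pq pq'.
    by rewrite !mulrA (mulrC (U x `^ _)).
  apply: hoelder_truncated => //.
  - by apply: measurable_funM => //; exact: (measurableT_comp (measurable_powR _)).
  - by move=> t; rewrite mulr_ge0 ?powR_ge0.
  - by rewrite !mulr_ge0 ?powR_ge0 ?phi0.
  - exact: right_mass_le.
have cb := core_bound p0 p1 mu_ u0 mU U0 ndU UE mV V0 VE mpsi psi0 psiE mh h0 ma a0 aL aR.
rewrite -/X -/A in cb.
have mAp e : measurable_fun (ray 0%R : set TR) (fun t => A t `^ e)%E by exact: measurable_fun_poweR.
have Y1 : (y%:E <= K%:E * \int[mu]_(t in ray 0%R) (A t `^ p^-1 * (a t)%:E))%E.
  rewrite -NY -ge0_integralZl_EFin ?(ltW K0)//; last 2 first.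
  - by move=> t _; rewrite mule_ge0 ?poweR_ge0 ?lee_fin.
  - by apply: emeasurable_funM => //; apply/measurable_EFinP; exact: measurable_funTS.
  apply: ge0_le_integral => //.
  - by move=> t _; rewrite lee_fin mulr_ge0.
  - by apply/measurable_EFinP; apply: measurable_funTS; exact: measurable_funM.
  - apply: emeasurable_funM => //.
    by apply: emeasurable_funM => //; apply/measurable_EFinP; exact: measurable_funTS.
  move=> t; rewrite /ray/= in_itv/= andbT => t0.
  have -> : (K%:E * (A t `^ p^-1 * (a t)%:E) = A t `^ p^-1 * (n t)%:E)%E.
    by rewrite muleCA -EFinM mulrA mulfV ?gt_eqF// mul1r.
  have -> : N t * w t = N t `^ q^-1 * n t.
    rewrite /n mulrA -powRD; first by rewrite q1E powRr1.
    by rewrite q1E oner_eq0.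
  rewrite EFinM; apply: lee_wpmul2r; first by rewrite lee_fin.
  rewrite -poweR_EFin -pq poweRrM; apply: le_poweR; rewrite ?invr_ge0 ?(ltW q0) ?lee_fin//.
  exact: NA.
have Y2 : (y%:E <= (y `^ (1 - q^-1))%:E * ((core_const p * 2 `^ p^-1 * I)%:E * X))%E.
  apply: (le_trans Y1); apply: (@le_trans _ _ (K%:E * ((core_const p)%:E * X))%E).
    by apply: lee_wpmul2l => //; rewrite lee_fin ltW.
  by rewrite !muleA -!EFinM /K; apply: lee_wpmul2r => //; rewrite lee_fin le_eqVlt; apply/orP; left; apply/eqP; ring.
have c0 : 0 <= core_const p * 2 `^ p^-1 * I.
  by rewrite (mulr_ge0 (mulr_ge0 (core_const_ge0 _) (powR_ge0 _ _)) (ltW I0))// p0.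
move: Y2; set Z := (_%:E * X)%E => Y2.
have Z0 : (0 <= Z)%E by rewrite mule_ge0 ?lee_fin.
case: Z Z0 Y2 => [z| |]// z0 Y2; last by rewrite poweRyr ?gt_eqF ?leey.
rewrite poweR_EFin lee_fin; move: Y2 z0; rewrite -EFinM !lee_fin => Y2 z0.
have -> : y = (y `^ q^-1) `^ q by rewrite -powRrM mulVf ?gt_eqF// powRr1// ltW.
apply: ge0_ler_powR; rewrite ?nnegrE ?powR_ge0 ?(ltW q0)//.
rewrite -(ler_pM2l (powR_gt0 (1 - q^-1) y0)) -powRD; first by rewrite subrK powRr1// ltW.
by rewrite subrK oner_eq0.
Qed.

End truncated.

Lemma sufficiency_ge1 (I : R) : 1 <= q -> 0 < I ->
  (forall x : R, 0 < x -> phi x `^ q^-1 * psi x `^ r^-1 <= I) ->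
  ((\int[mu]_(t in ray 0%R) (A t `^ (q / p) * (w t)%:E)) `^ q^-1 <=
    (core_const p * 2 `^ p^-1 * I)%:E * X)%E.
Proof.
move=> q1 I0 phipsi; set Z := (_%:E * X)%E.
have Z0 : (0 <= Z)%E.
  rewrite mule_ge0 ?lee_fin//.
  by rewrite (mulr_ge0 (mulr_ge0 (core_const_ge0 _) (powR_ge0 _ _)) (ltW I0))// p0.
have mAp e : measurable_fun (ray 0%R : set TR) (fun t => A t `^ e)%E by exact: measurable_fun_poweR.
have qi0 : q^-1 != 0 by rewrite invr_eq0 gt_eqF.
suff H : (\int[mu]_(t in ray 0%R) (A t `^ (q / p) * (w t)%:E) <= Z `^ q)%E.
  rewrite -[leRHS](poweRK _ Z0 (e:=q)) ?gt_eqF//; apply: le_poweR; rewrite ?invr_ge0 ?(ltW q0)//.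
  by apply: integral_ge0 => t _; rewrite mule_ge0 ?poweR_ge0 ?lee_fin.
(* Two truncations make [y] finite: the compact interval, on which [w] has finite mass by
   [left_mass_le], and the height [j] for [A]. Both limits are taken after the bound, which depends
   on neither. *)
pose F (i : nat) : set TR := `[(i.+1%:R^-1)%R, i.+1%:R]%classic.
have F0 i t : F i t -> 0 < t.
  by rewrite /F/= in_itv/= => /andP[+ _]; apply: lt_le_trans; rewrite invr_gt0 ltr0n.
have Fr i : F i `<=` ray 0%R by move=> t /F0; rewrite /ray/= in_itv/= andbT.
have rayE : ray 0%R = \bigcup_i F i.
  apply/seteqP; split => [x|x [i _ /Fr]]//; rewrite /ray/= in_itv/= andbT => x0.
  exists (maxn (Num.truncn x) (Num.truncn x^-1)) => //; rewrite /F/= in_itv/=.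
  have tr (z : R) m : 0 < z -> (Num.truncn z <= m)%N -> z <= m.+1%:R.
    move=> z0 zm; have /andP[_ h'] := truncn_itv (ltW z0).
    by apply/ltW/(lt_le_trans h'); rewrite ler_nat ltnS.
  apply/andP; split; last by apply: tr; rewrite ?leq_maxl.
  rewrite -[leRHS]invrK lef_pV2 ?posrE ?ltr0n ?invr_gt0//.
  by apply: tr; rewrite ?invr_gt0// leq_maxr.
have mAw : measurable_fun (ray 0%R : set TR) (fun t => A t `^ (q / p) * (w t)%:E)%E.
  by apply: emeasurable_funM.
rewrite rayE; apply: integral_bigcup_le.
- move=> i j ij; apply/subsetPset => t; rewrite /F/= !in_itv/= => /andP[h1 h2].
  apply/andP; split; last by apply: (le_trans h2); rewrite ler_nat.
  by apply: le_trans h1; rewrite lef_pV2 ?posrE ?ltr0n// ler_nat.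
- by move=> i; exact: mitv.
- by rewrite -rayE.
- by move=> t _; rewrite mule_ge0 ?poweR_ge0 ?lee_fin.
move=> i; apply: integral_truncation_le => //.
- exact: mitv.
- exact: measurable_funS (mAp _).
- exact: measurable_funTS.
- by move=> t _; exact: poweR_ge0.
move=> j.
pose N0 t := fine (Order.min (A t `^ (q / p)) j%:R%:E)%E.
have min0 t : (0 <= Order.min (A t `^ (q / p)) j%:R%:E)%E by rewrite le_min poweR_ge0/= lee_fin ler0n.
have minj t : (Order.min (A t `^ (q / p)) j%:R%:E <= j%:R%:E)%E by rewrite ge_min lexx orbT.
have minfin t : (Order.min (A t `^ (q / p)) j%:R%:E)%E \is a fin_num.
  by rewrite ge0_fin_numE//; exact: le_lt_trans (minj t) (ltry _).
have N00 t : 0 <= N0 t by rewrite fine_ge0.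
have N0j t : N0 t <= j%:R.
  by rewrite -[leRHS]/(fine j%:R%:E) fine_le.
have N0A t : ((N0 t)%:E <= A t `^ (q / p))%E by rewrite /N0 fineK// ge_min lexx.
have mN0 : measurable_fun (F i) N0.
  apply: measurableT_comp => //; apply: measurable_mine => //.
  by apply: measurable_funS (mAp _).
pose N := N0 \_ (F i).
have mN : measurable_fun setT N by apply/(measurable_restrictT _ _).1 => //; exact: mitv.
have NN0 t : 0 <= N t by rewrite /N patchE; case: ifPn.
have NE : (\int[mu]_(t in F i) (N0 t * w t)%:E = \int[mu]_(t in ray 0%R) (N t * w t)%:E)%E.
  rewrite -(setIidr (@Fr i)) integral_mkcondr; apply: eq_integral => t _.
  by rewrite /N !patchE; case: ifPn => //; rewrite mul0r.
have i0 : (0 < i.+1%:R :> R) by rewrite ltr0n.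
have Yoo : (\int[mu]_(t in ray 0%R) (N t * w t)%:E < +oo)%E.
  rewrite -NE; apply: (@le_lt_trans _ _ (j%:R%:E * \int[mu]_(t in `]0%R, i.+1%:R]) (w t)%:E)%E); last first.
    apply: lte_mul_pinfty; rewrite ?lee_fin//.
    exact: le_lt_trans (left_mass_le i0) (ltry _).
  rewrite -integralZT//.
  apply: (@le_trans _ _ (\int[mu]_(t in F i) (j%:R%:E * (w t)%:E))%E).
    apply: ge0_le_integral => //; first exact: mitv.
    - by move=> t _; rewrite lee_fin mulr_ge0.
    - by apply/measurable_EFinP; apply: measurable_funM => //; exact: measurable_funTS.
    - by apply: emeasurable_funM.
    by move=> t _; rewrite -EFinM lee_fin ler_wpM2r.
  apply: subset_integralT => //; first exact: mitv.
  - by apply: emeasurable_funM => //; exact: mwA.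
  - by move=> t; rewrite mule_ge0 ?lee_fin.
  by move=> t Ft; have := F0 _ _ Ft; move: Ft; rewrite /F/= !in_itv/= => /andP[_ ->] ->.
have Y0 : (0 <= \int[mu]_(t in ray 0%R) (N t * w t)%:E)%E.
  by apply: integral_ge0 => t _; rewrite lee_fin mulr_ge0.
rewrite NE -(@fineK _ (\int[mu]_(t in ray 0%R) (N t * w t)%:E)%E) ?ge0_fin_numE//.
apply: (@truncated_bound q1 N) => //; first by rewrite fineK ?ge0_fin_numE.
move=> t _; rewrite /N patchE; case: ifPn => // _; exact: poweR_ge0.
Qed.

(** The first factor is the constant of [segment_density]. In the last one, 4 = 2 + 2 comes from the
    two densities, 2^k (k = [star q]) from adding under the power k, and (2^(q/p))^k from the mass
    bounds; the outer power 1/k is that of Hoelder's inequality. *)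
Definition suf_const : R := (2 `^ (star q + 1)) `^ (star q)^-1 * core_const p *
  (4 * 2 `^ star q * (2 `^ (q / p)) `^ star q) `^ (star q)^-1.

(** The finiteness of the integral is used twice through [segment_density]: with w and psi^(1/r) on
    segments at 0, and with U^(-q/p) w and U^(1/p) psi^(1/r) on segments at infinity. The two
    densities are the two conditions on [a] separately and are then merged into one. *)
Lemma sufficiency_lt1 (I : R) : q < 1 -> 0 < I -> measurable_fun setT phi ->
  (\int[mu]_(x in ray 0%R) ((phi x * psi x `^ r^-1) `^ star q * w x)%:E <= (I `^ star q)%:E)%E ->
  ((\int[mu]_(t in ray 0%R) (A t `^ (q / p) * (w t)%:E)) `^ q^-1 <=
    (suf_const * I)%:E * X)%E.
Proof.
move=> q1 I0 mphi HI.
pose k := star q.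
have k0 : 0 < k by rewrite divr_gt0 ?subr_gt0.
have kq : k * (1 - q) = q by rewrite /k /star divfK// subr_eq0 gt_eqF.
pose Ps (x : TR) := psi x `^ r^-1.
pose m (x : TR) := U x `^ p^-1 * psi x `^ r^-1.
have mPs : measurable_fun setT Ps by exact: (measurableT_comp (measurable_powR _)).
have mUe e : measurable_fun setT (fun x : TR => U x `^ e) by exact: (measurableT_comp (measurable_powR _)).
have mm : measurable_fun setT m by exact: measurable_funM.
have ray0E (x : R) : ray 0%R x -> 0 < x by rewrite /ray/= in_itv/= andbT.
have Ps0 x : ray 0%R x -> 0 < Ps x by move=> /ray0E x0; rewrite powR_gt0 ?psi0.
have m0 x : ray 0%R x -> 0 < m x by move=> /ray0E x0; rewrite mulr_gt0 ?powR_gt0 ?psi0 ?U0.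
have Psmono x y : ray 0%R x -> ray 0%R y -> ord true x y -> Ps y <= Ps x.
  move=> /ray0E x0 /ray0E y0 /= xy.
  apply: ge0_ler_powR; rewrite ?nnegrE ?(ltW (psi0 _)) ?invr_ge0 ?(ltW r0)//.
  exact: (core_psi_noninc p0 p1 mU U0 ndU psiE).
have mE (x : R) : 0 < x -> m x = (U x `^ (1 + r) * psi x) `^ r^-1.
  move=> x0; rewrite /m powRM ?powR_ge0 ?(ltW (psi0 _))// -powRrM; congr (_ `^ _ * _).
  by rewrite /r /star; field; rewrite subr_eq0 !gt_eqF.
have mmono x y : ray 0%R x -> ray 0%R y -> ord false x y -> m y <= m x.
  move=> /ray0E x0 /ray0E y0 /= yx; rewrite !mE//.
  apply: ge0_ler_powR; rewrite ?nnegrE ?mulr_ge0 ?powR_ge0 ?(ltW (psi0 _)) ?invr_ge0 ?(ltW r0)//.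
  exact: (core_M_nondec p0 p1 mU U0 ndU psiE).
have segL (x : R) : 0 < x -> ray 0%R `&` segment true x = `]0%R, x]%classic.
  move=> x0; apply/seteqP; split => t; rewrite /ray/= !in_itv/= ?andbT.
    by move=> [-> tx]; rewrite andTb.
  by move=> /andP[-> tx].
have segR (x : R) : 0 < x -> ray 0%R `&` segment false x = `[x, +oo[%classic.
  move=> x0; apply/seteqP; split => t; rewrite /ray/= !in_itv/= ?andbT.
    by move=> [].
  by move=> xt; split => //; exact: lt_le_trans xt.
pose f2 (t : TR) := U t `^ (- (q / p)) * w t.
have mf2 : measurable_fun setT f2 by apply: measurable_funM.
have f20 t : 0 <= f2 t by rewrite mulr_ge0 ?powR_ge0.
pose L1 (x : TR) := fine (\int[mu]_(y in ray 0%R `&` segment true x) (w y)%:E)%E.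
pose L2 (x : TR) := fine (\int[mu]_(y in ray 0%R `&` segment false x) (f2 y)%:E)%E.
have fin1 x : ray 0%R x -> (\int[mu]_(y in ray 0%R `&` segment true x) (w y)%:E < +oo)%E.
  by move=> /ray0E x0; rewrite segL//; exact: le_lt_trans (left_mass_le x0) (ltry _).
have fin2 x : ray 0%R x -> (\int[mu]_(y in ray 0%R `&` segment false x) (f2 y)%:E < +oo)%E.
  by move=> /ray0E x0; rewrite segR//; exact: le_lt_trans (right_mass_le x0) (ltry _).
have L10 x : 0 <= L1 x by apply: segment_mass_ge0.
have L20 x : 0 <= L2 x by apply: segment_mass_ge0.
have mL1 : measurable_fun setT L1 by exact: measurable_segment_mass.
have mL2 : measurable_fun setT L2 by exact: measurable_segment_mass.
have L1le (x : R) : 0 < x -> L1 x <= 2 `^ (q / p) * phi x.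
  move=> x0; rewrite -lee_fin /L1 fineK; first by rewrite segL// left_mass_le.
  rewrite ge0_fin_numE ?fin1 ?/ray//= ?in_itv/= ?x0//.
  by apply: integral_ge0 => t _; rewrite lee_fin.
have L2le (x : R) : 0 < x -> L2 x <= 2 `^ (q / p) * (U x `^ (- (q / p)) * phi x).
  move=> x0; rewrite -lee_fin /L2 fineK; first by rewrite segR// right_mass_le.
  rewrite ge0_fin_numE ?fin2 ?/ray//= ?in_itv/= ?x0//.
  by apply: integral_ge0 => t _; rewrite lee_fin.
pose S := (2 `^ (q / p)) `^ k * I `^ k.
have S0 : 0 < S by rewrite mulr_gt0 ?powR_gt0.
have mJ : measurable_fun (ray 0%R : set TR) (fun x : TR => ((phi x * psi x `^ r^-1) `^ k * w x)%:E).
  apply/measurable_EFinP; apply: measurable_funTS; apply: measurable_funM => //.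
  by apply: (measurableT_comp (measurable_powR _)); exact: measurable_funM.
have Jb (G : TR -> R) : measurable_fun setT G -> (forall t, 0 <= G t) ->
    (forall t : R, 0 < t -> G t <= (2 `^ (q / p)) `^ k * ((phi t * psi t `^ r^-1) `^ k * w t)) ->
    (\int[mu]_(t in ray 0%R) (G t)%:E <= S%:E)%E.
  move=> mG G0 GH; apply: (@le_trans _ _ (((2 `^ (q / p)) `^ k)%:E *
     \int[mu]_(x in ray 0%R) ((phi x * psi x `^ r^-1) `^ k * w x)%:E)%E); last first.
    by rewrite /S EFinM; apply: lee_wpmul2l => //; rewrite lee_fin powR_ge0.
  rewrite -ge0_integralZl_EFin ?powR_ge0//; last by move=> t _; rewrite lee_fin mulr_ge0 ?powR_ge0.
  apply: ge0_le_integral => //.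
  - by move=> t _; rewrite lee_fin.
  - by apply/measurable_EFinP; exact: measurable_funTS.
  - by apply: emeasurable_funM.
  by move=> t /ray0E t0; rewrite -EFinM lee_fin GH.
have Ja : (\int[mu]_(t in ray 0%R) ((L1 t * Ps t) `^ k * w t)%:E <= S%:E)%E.
  apply: Jb.
  - by apply: measurable_funM => //; apply: (measurableT_comp (measurable_powR _)); exact: measurable_funM.
  - by move=> t; rewrite mulr_ge0 ?powR_ge0.
  move=> t t0; rewrite mulrA ler_wpM2r//.
  rewrite -powRM ?powR_ge0 ?mulr_ge0 ?powR_ge0 ?phi0//.
  apply: ge0_ler_powR; rewrite ?(ltW k0) ?nnegrE ?mulr_ge0 ?powR_ge0 ?phi0//.
  by rewrite mulrA ler_wpM2r ?powR_ge0// L1le.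
(* The powers of U cancel, because ((1 - q)/p) k = q/p with k = q/(1 - q). *)
have JB : (\int[mu]_(t in ray 0%R) ((L2 t * m t) `^ k * f2 t)%:E <= S%:E)%E.
  apply: Jb.
  - by apply: measurable_funM => //; apply: (measurableT_comp (measurable_powR _)); exact: measurable_funM.
  - by move=> t; rewrite mulr_ge0 ?powR_ge0.
  move=> t t0; have Ut := U0 t0.
  apply: (@le_trans _ _ ((2 `^ (q / p) * (U t `^ (- (q / p)) * phi t) * m t) `^ k * f2 t)).
    apply: ler_wpM2r => //; apply: ge0_ler_powR; rewrite ?(ltW k0) ?nnegrE ?mulr_ge0 ?powR_ge0 ?phi0//.
    by apply: ler_wpM2r; [rewrite mulr_ge0 ?powR_ge0|exact: L2le].
  rewrite le_eqVlt; apply/orP; left; apply/eqP.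
  rewrite /m /f2 (_ : _ * _ * _ = U t `^ (- (q / p) + p^-1) * (2 `^ (q / p) * (phi t * psi t `^ r^-1))); last first.
    by rewrite powRDgt0//; ring.
  rewrite powRM ?powR_ge0 ?mulr_ge0 ?powR_ge0 ?phi0// (powRM _ (powR_ge0 _ _)) ?mulr_ge0 ?powR_ge0 ?phi0//.
  rewrite -powRrM mulrACA -powRDgt0// (_ : _ + _ = 0) ?powRr0 ?mul1r ?mulrA//.
  by rewrite /k /star; field; rewrite subr_eq0 !gt_eqF.
have [n1 [mn1 n10 n1w n1k]] := @segment_density R mu true (ray 0%R) w Ps k (mray 0) mw mPs w0 k0 Ps0 Psmono fin1
   (le_lt_trans Ja (ltry _)).
have [n2 [mn2 n20 n2w n2k]] := @segment_density R mu false (ray 0%R) f2 m k (mray 0) mf2 mm f20 k0 m0 mmono fin2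
   (le_lt_trans JB (ltry _)).
pose c := (2 `^ (k + 1)) `^ k^-1 : R.
have c0 : 0 < c by rewrite /c !powR_gt0.
have n1i t : 0 < (n1 t)^-1 by rewrite invr_gt0.
have n2i t : 0 < (n2 t)^-1 by rewrite invr_gt0.
(* The density must lie below [n1] and below U^((1-q)/p) [n2]. Adding the reciprocals gives a
   function comparable to the minimum, and keeps the power -k of the result bounded by the sum of
   the two controlled powers. *)
pose om t := (n1 t)^-1 + U t `^ (- ((1 - q) / p)) * (n2 t)^-1.
have om0 t : 0 < om t by apply: ltr_pwDl => //; rewrite mulr_ge0 ?powR_ge0// ltW.
have mom : measurable_fun setT om.
  apply: measurable_funD; [|apply: measurable_funM => //];
    by apply: ge0_measurable_funV => // t _; rewrite ltW.
pose n t := (om t)^-1.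
have n0 t : 0 < n t by rewrite invr_gt0.
have mn : measurable_fun setT n by apply: ge0_measurable_funV => // t _; rewrite ltW.
have nn1 t : n t <= n1 t.
  rewrite -[leRHS]invrK lef_pV2 ?posrE//.
  by rewrite /om lerDl mulr_ge0 ?powR_ge0// ltW.
have nn2 (t : R) : 0 < t -> U t `^ (- p^-1) * n t <= n2 t * U t `^ (- (q / p)).
  move=> t0; have Ut := U0 t0.
  rewrite /n ler_pdivrMr//; apply: (@le_trans _ _ (n2 t * U t `^ (- (q / p)) * (U t `^ (- ((1 - q) / p)) * (n2 t)^-1))).
    rewrite (_ : - p^-1 = - (q / p) + - ((1 - q) / p)); last by field; rewrite gt_eqF.
    by rewrite powRDgt0// (mulrC (n2 t)) -mulrA (mulrCA (n2 t)) mulfV ?gt_eqF// mulr1.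
  by apply: ler_wpM2l; rewrite ?mulr_ge0 ?powR_ge0 ?(ltW (n20 _))// /om lerDr ltW.
pose a t := c^-1 * (n t * w t).
have ci0 : 0 <= c^-1 by rewrite invr_ge0 ltW.
have nw0 t : 0 <= n t * w t by rewrite mulr_ge0// ltW.
have mnw : measurable_fun setT (fun t => n t * w t) by exact: measurable_funM.
have ma : measurable_fun setT a by exact: measurable_funM.
have a0 t : 0 <= a t by rewrite mulr_ge0.
have aL (x : R) : 0 < x -> (\int[mu]_(t in `]0%R, x]) (a t)%:E <= (psi x `^ (- r^-1))%:E)%E.
  move=> x0; rewrite (eq_integral (fun t => (c^-1)%:E * (n t * w t)%:E)%E); last by move=> t _; rewrite EFinM.
  rewrite integralZT//; [|exact/measurable_EFinP].
  rewrite lee_pdivrMl// -EFinM -segL//.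
  apply: (@le_trans _ _ (\int[mu]_(t in ray 0%R `&` segment true x) (n1 t * w t)%:E)%E).
    apply: le_integralT.
    - by rewrite segL.
    - exact/measurable_EFinP.
    - by apply/measurable_EFinP; exact: measurable_funM.
    - by move=> t; rewrite lee_fin.
    - by move=> t _; rewrite lee_fin ler_wpM2r.
  by rewrite powRN; apply: n1w; rewrite /ray/= in_itv/= x0.
have aR (x : R) : 0 < x -> (\int[mu]_(t in `[x, +oo[) (U t `^ (- p^-1) * a t)%:E <=
    (U x `^ (- p^-1) * psi x `^ (- r^-1))%:E)%E.
  move=> x0; rewrite (eq_integral (fun t => (c^-1)%:E * (U t `^ (- p^-1) * (n t * w t))%:E)%E); last first.
    by move=> t _; rewrite -EFinM /a mulrCA.
  have mUn : measurable_fun setT (fun t : TR => U t `^ (- p^-1) * (n t * w t)) by exact: measurable_funM.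
  have Un0 t : 0 <= U t `^ (- p^-1) * (n t * w t) by rewrite mulr_ge0 ?powR_ge0.
  rewrite integralZT//; [|exact/measurable_EFinP].
  rewrite lee_pdivrMl// -EFinM -segR//.
  apply: (@le_trans _ _ (\int[mu]_(t in ray 0%R `&` segment false x) (n2 t * f2 t)%:E)%E).
    apply: le_integralT.
    - by rewrite segR.
    - exact/measurable_EFinP.
    - by apply/measurable_EFinP; exact: measurable_funM.
    - by move=> t; rewrite lee_fin.
    - by move=> t [/ray0E t0 _]; rewrite lee_fin /f2 !mulrA ler_wpM2r// nn2.
  rewrite !powRN -invfM; apply: n2w; rewrite /ray/= in_itv/= x0//.
have cb := core_bound p0 p1 mu_ u0 mU U0 ndU UE mV V0 VE mpsi psi0 psiE mh h0 ma a0 aL aR.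
rewrite -/X -/A in cb.
have mAp e : measurable_fun (ray 0%R : set TR) (fun t => A t `^ e)%E by exact: measurable_fun_poweR.
have mE' (g : TR -> R) : measurable_fun setT g -> measurable_fun (ray 0%R : set TR) (fun t => (g t)%:E).
  by move=> mg; apply/measurable_EFinP; exact: measurable_funTS.
have fa : (\int[mu]_(t in ray 0%R) (A t `^ p^-1 * (n t * w t)%:E) <= c%:E * ((core_const p)%:E * X))%E.
  rewrite (eq_integral (fun t => c%:E * (A t `^ p^-1 * (a t)%:E))%E); last first.
    by move=> t _; rewrite [RHS]muleCA -EFinM /a mulVKf ?gt_eqF.
  rewrite ge0_integralZl_EFin ?(ltW c0)//.
  - by apply: lee_wpmul2l => //; rewrite lee_fin ltW.
  - by move=> t _; rewrite mule_ge0 ?poweR_ge0 ?lee_fin.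
  - by apply: emeasurable_funM => //; exact: mE'.
pose g (t : TR) := om t `^ k * w t.
have mg : measurable_fun setT g.
  by apply: measurable_funM => //; exact: (measurableT_comp (measurable_powR _)).
have g0 t : 0 <= g t by rewrite mulr_ge0 ?powR_ge0.
have fg : (\int[mu]_(t in ray 0%R) (g t)%:E <= (4 * 2 `^ k * S)%:E)%E.
  pose g1 (t : TR) := n1 t `^ (- k) * w t.
  pose g2 (t : TR) := n2 t `^ (- k) * f2 t.
  have mg1 : measurable_fun setT g1 by apply: measurable_funM => //; exact: (measurableT_comp (measurable_powR _)).
  have mg2 : measurable_fun setT g2 by apply: measurable_funM => //; exact: (measurableT_comp (measurable_powR _)).
  have g10 t : 0 <= g1 t by rewrite mulr_ge0 ?powR_ge0.
  have g20 t : 0 <= g2 t by rewrite mulr_ge0 ?powR_ge0.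
  apply: (@le_trans _ _ (\int[mu]_(t in ray 0%R) ((2 `^ k)%:E * ((g1 t)%:E + (g2 t)%:E)))%E).
    apply: ge0_le_integral => //.
    - by move=> t _; rewrite lee_fin.
    - exact: mE'.
    - by apply: emeasurable_funM => //; apply: emeasurable_funD; exact: mE'.
    move=> t /ray0E t0; have Ut := U0 t0.
    rewrite -EFinD -EFinM lee_fin /g /om.
    have := @poweRD_le _ (n1 t)^-1%:E (U t `^ (- ((1 - q) / p)) * (n2 t)^-1)%:E k k0.
    rewrite -EFinD !poweR_EFin -EFinD -EFinM !lee_fin => /(_ (ltW (n1i t))) H.
    have {}H := H (mulr_ge0 (powR_ge0 _ _) (ltW (n2i t))).
    apply: (le_trans (ler_wpM2r (w0 t) H)); rewrite -mulrA ler_wpM2l ?powR_ge0//.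
    rewrite mulrDl le_eqVlt; apply/orP; left; apply/eqP; congr (_ + _).
      by rewrite /g1 powRN powRV// ltW.
    rewrite /g2 /f2 powRM ?powR_ge0 ?invr_ge0 ?(ltW (n20 _))// -powRrM.
    rewrite [n2 t `^ _]powRN -(powRV _ (ltW (n20 t))) (_ : - ((1 - q) / p) * k = - (q / p)); first by ring.
    by rewrite /k /star; field; rewrite subr_eq0 !gt_eqF.
  rewrite ge0_integralZl_EFin ?powR_ge0//; last 2 first.
  - by move=> t _; rewrite -EFinD lee_fin addr_ge0.
  - by apply: emeasurable_funD; exact: mE'.
  rewrite ge0_integralD//; [|by move=> t _; rewrite lee_fin|exact: mE'|by move=> t _; rewrite lee_fin|exact: mE'].
  have -> : 4 * 2 `^ k * S = 2 `^ k * (2 * S + 2 * S) by ring.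
  rewrite [leRHS]EFinM; apply: lee_wpmul2l; first by rewrite lee_fin powR_ge0.
  rewrite EFinD; apply: leeD.
    by apply: (le_trans n1k); rewrite EFinM lee_wpmul2l.
  by apply: (le_trans n2k); rewrite EFinM lee_wpmul2l.
(* The factors of [n] cancel since k (1 - q) = q; Hoelder with exponents 1/q and 1/(1-q) then
   separates the core integral from that of n^(-k) w. *)
have ei : (\int[mu]_(t in ray 0%R) (A t `^ (q / p) * (w t)%:E) =
   \int[mu]_(t in ray 0%R) ((A t `^ p^-1 * (n t * w t)%:E) `^ q * (g t)%:E `^ (1 - q)))%E.
  apply: eq_integral => t _.
  rewrite poweRM ?poweR_ge0 ?lee_fin// !poweR_EFin -poweRrM (mulrC _ q) -muleA -EFinM; congr (_ * _%:E)%E.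
  rewrite powRM ?(ltW (n0 _))// /g powRM ?powR_ge0// -powRrM kq mulrACA.
  rewrite /n powRV ?(ltW (om0 _))// mulVf ?gt_eqF ?powR_gt0// mul1r -powRD.
    by rewrite addrC subrK powRr1.
  by rewrite addrC subrK oner_eq0.
have q01 : 0 < q <= 1 by rewrite q0 ltW.
have HH : (\int[mu]_(t in ray 0%R) ((A t `^ p^-1 * (n t * w t)%:E) `^ q * (g t)%:E `^ (1 - q)) <=
  (\int[mu]_(t in ray 0%R) (A t `^ p^-1 * (n t * w t)%:E)) `^ q *
  (\int[mu]_(t in ray 0%R) (g t)%:E) `^ (1 - q))%E.
  apply: hoelder_interpolation => //.
  - by apply: emeasurable_funM => //; exact: mE'.
  - exact: mE'.
  - by move=> t _; rewrite mule_ge0 ?poweR_ge0 ?lee_fin.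
  - by move=> t _; rewrite lee_fin.
have int0 : (0 <= \int[mu]_(t in ray 0%R) (A t `^ p^-1 * (n t * w t)%:E))%E.
  by apply: integral_ge0 => t _; rewrite mule_ge0 ?poweR_ge0 ?lee_fin.
have intg0 : (0 <= \int[mu]_(t in ray 0%R) (g t)%:E)%E.
  by apply: integral_ge0 => t _; rewrite lee_fin.
have cX0 : (0 <= c%:E * ((core_const p)%:E * X))%E.
  by rewrite !mule_ge0// lee_fin ?(ltW c0)// core_const_ge0// p0.
rewrite ei; apply: (@le_trans _ _ (((c%:E * ((core_const p)%:E * X)) `^ q * (4 * 2 `^ k * S)%:E `^ (1 - q)) `^ q^-1)%E).
  apply: le_poweR; rewrite ?invr_ge0 ?(ltW q0)//.
    by apply: integral_ge0 => t _; rewrite mule_ge0 ?poweR_ge0.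
  apply: (le_trans HH); apply: lee_pmul; rewrite ?poweR_ge0//.
    by apply: le_poweR => //; exact: ltW.
  by apply: le_poweR => //; rewrite subr_ge0 ltW.
have S40 : 0 <= 4 * 2 `^ k * S by rewrite !mulr_ge0 ?powR_ge0.
rewrite poweRM ?poweR_ge0// poweRK ?gt_eqF// !poweR_EFin -powRrM.
have -> : (1 - q) * q^-1 = k^-1 by rewrite /k /star invf_div.
rewrite [in X in (_ * X)%E]/S mulrA powRM ?mulr_ge0 ?powR_ge0//.
rewrite -[(I `^ k) `^ _]powRrM mulfV ?gt_eqF// powRr1 ?(ltW I0)//.
rewrite /suf_const -/k -/c muleA -EFinM muleAC -EFinM.
by apply: lee_wpmul2r => //; rewrite lee_fin mulrA.
Qed.

End sufficiency.

(** * Test functions *)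

Section dyadic.
Context {R : realType}.

(** The dyadic powers grow geometrically, so the largest index satisfying [P] controls the sum
    whatever the smaller ones are. *)
Lemma sum_dyadic_pred (l k : R) n (P : pred nat) : 0 < l -> 0 < k ->
  \sum_(i < n) (l * 2 ^+ i) `^ k * (P i)%:R = 0 \/
  exists2 j, (j < n)%N & P j /\ \sum_(i < n) (l * 2 ^+ i) `^ k * (P i)%:R <=
    2 `^ k / (2 `^ k - 1) * (l * 2 ^+ j) `^ k.
Proof.
move=> l0 k0; have k1 := @powR2_gt1 R k k0.
have k2 : 0 < 2 `^ k - 1 :> R by rewrite subr_gt0.
elim: n => [|n IH]; first by left; rewrite big_ord0.
rewrite big_ord_recr/=; have [Pn|Pn] := boolP (P n); last first.
  rewrite mulr0 addr0; case: IH => [->|[j jn [Pj H]]]; first by left.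
  by right; exists j => //; exact: leqW.
right; exists n => //; split => //; rewrite mulr1.
have S1 : \sum_(i < n) (l * 2 ^+ i) `^ k * (P i)%:R <= \sum_(i < n) (l * 2 ^+ i) `^ k.
  by apply: ler_sum => i _; rewrite ler_piMr ?powR_ge0// lern1 leq_b1.
apply: (le_trans (lerD (le_trans S1 (sum_dyadic_powR n l0 k0)) (lexx _))).
rewrite le_eqVlt; apply/orP; left; apply/eqP; field; rewrite gt_eqF//.
Qed.

Lemma dyadic_cover (l a : R) n : l < a -> a <= l * 2 ^+ n ->
  exists2 i, (i < n)%N & l * 2 ^+ i < a <= 2 * (l * 2 ^+ i).
Proof.
move=> la; elim: n => [|n IH]; first by rewrite expr0 mulr1 leNgt la.
rewrite exprS mulrCA => an; have [h|h] := leP a (l * 2 ^+ n).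
  by have [i ilt H] := IH h; exists i => //; exact: leqW.
by exists n => //; rewrite h.
Qed.

End dyadic.

(** The first factor is paid for replacing the Stieltjes integral by a dyadic sum, the second for
    the halved [u]-mass and the geometric sum in the lower bound for the average. *)
Definition test_const {R : realType} (p : R) : R :=
  (2 `^ (1 + star p) * 2 `^ star p) `^ (1 - p) *
  (2 * (2 `^ star p * (2 `^ star p / (2 `^ star p - 1)))).

Section test_function.
Context {R : realType}.
Local Notation TR := (measurableTypeR R).
Local Notation mu := (@lebesgue_measure R).
Variables (p : R) (u U V v : TR -> R).
Variable sg : {sigma_finite_measure set TR -> \bar R}.
Let r := star p.
Hypotheses (p0 : 0 < p) (p1 : p < 1).
Hypotheses (mu_ : measurable_fun setT u) (u0 : forall x, 0 <= u x).
Hypotheses (mU : measurable_fun setT U) (U0 : forall x : R, 0 < x -> 0 < U x).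
Hypothesis ndU : forall x y : R, 0 < x -> x <= y -> U x <= U y.
Hypothesis UE : forall x : R, 0 < x -> (\int[mu]_(s in `]0%R, x[) (u s)%:E = (U x)%:E)%E.
Hypothesis Uhalf : forall x : R, 0 < x -> exists2 s : R, 0 < s < x & U x <= 2 * U s.
Hypotheses (mV : measurable_fun setT V) (V0 : forall x : R, 0 < x -> 0 < V x).
Hypothesis VE : forall x : R, 0 < x -> sg `[x, +oo[%classic = ((V x) `^ r)%:E.
Hypothesis Vsmall : forall e : R, 0 < e -> exists2 B : R, 0 < B & forall t, B < t -> V t < e.
Hypotheses (mv : measurable_fun setT v) (v0 : forall x, 0 <= v x).
Hypothesis bump : forall s t k : R, 0 < s -> s < t -> 0 < k -> k < V t ->
  exists g : TR -> R, [/\ measurable_fun setT g, forall z, 0 <= g z,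
    (\int[mu]_(z in ray 0%R) (g z * v z)%:E <= (k^-1)%:E)%E &
    (1 <= \int[mu]_(z in ray s) (g z)%:E)%E].

Let r0 : 0 < r. Proof. by rewrite divr_gt0 ?subr_gt0. Qed.
Let r10 : 0 < 1 + r. Proof. by rewrite addr_gt0. Qed.
Let rpE : (1 + r) * p = r.
Proof. by rewrite /r /star; field; rewrite subr_eq0 gt_eqF. Qed.
Let rqE : (1 + r) * (1 - p) = 1.
Proof. by rewrite /r /star; field; rewrite subr_eq0 gt_eqF. Qed.
Let mray (x : R) : measurable (ray x : set TR).
Proof. exact: measurable_itv. Qed.
Let mitv (i : interval R) : measurable ([set` i] : set TR).
Proof. exact: measurable_itv. Qed.
Let mfE (f : TR -> R) A : measurable_fun setT f -> measurable_fun A (fun t => (f t)%:E).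
Proof. by move=> mf; apply/measurable_EFinP; exact: measurable_funTS. Qed.

(** The set where V > k is bounded because V tends to 0, and a bump placed beyond a point [s] close
    to its supremum costs at most 1/k. The triple collects [s], the capped value of U at [s], and
    the bump, so that [choice] can be applied once; the value 0 marks an empty level set. *)
Lemma level_bump (x k : R) : 0 < x -> 0 < k ->
  exists z : R * R * (TR -> R),
  [/\ 0 < z.1.1, z.1.2 = 0 \/ z.1.2 = Num.min (U z.1.1) (U x),
      forall t : R, 0 < t -> k < V t -> Num.min (U t) (U x) <= 2 * z.1.2,
      measurable_fun setT z.2 /\ (forall t, 0 <= z.2 t) &
      (\int[mu]_(t in ray 0%R) (z.2 t * v t)%:E <= (k^-1)%:E)%E /\
      (z.1.2 != 0 -> (1 <= \int[mu]_(t in ray z.1.1) (z.2 t)%:E)%E)].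
Proof.
move=> x0 k0.
have [[t1 [t10 kt1]]|no] := pselect (exists t : R, 0 < t /\ k < V t); last first.
  exists (1, 0, cst 0); split => //=.
  - by left.
  - by move=> t t0 kt; exfalso; apply: no; exists t.
  - split; last by rewrite eqxx.
    under eq_integral do rewrite mul0r.
    by rewrite integral0 lee_fin invr_ge0 ltW.
pose S := [set t : R | 0 < t /\ k < V t].
have hS : has_sup S.
  split; first by exists t1.
  have [B B0 HB] := Vsmall k0; exists B => t [t0 kt].
  by rewrite leNgt; apply/negP => /HB; rewrite ltNge (ltW kt).
have T0 : 0 < sup S by apply: (lt_le_trans t10); apply: ub_le_sup => //; case: hS.
(* The supremum may not be attained, so [s] is taken strictly before it, where U is still at least
   half as large; a point of the set beyond [s] then authorizes the bump. *)
have [s /andP[s0 sT] Us] := Uhalf T0.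
have [|t [t0 kt] st] := @sup_adherent _ S (sup S - s) _ hS; first by rewrite subr_gt0.
rewrite subKr in st.
have [g [mg g0 gv g1]] := bump s0 st k0 kt.
exists (s, Num.min (U s) (U x), g); split => //=.
- by right.
- move=> t' t'0 kt'; have Ut' : U t' <= 2 * U s.
    by apply: le_trans Us; apply: ndU => //; apply: ub_le_sup => //; case: hS.
  rewrite ge_min; case: (leP (U s) (U x)) => _; first by rewrite Ut'.
  by rewrite orbC mulr_natl mulr2n lerDl ltW ?U0.
Qed.

(** The sublevel lemma for the constant function 1 and segments at infinity, whose masses are the
    powers V^r. *)
Lemma level_mass (k : R) : 0 < k ->
  (sg (ray 0%R `&` [set t : TR | (V t <= k)%R]) <= (k `^ r)%:E)%E.
Proof.
move=> k0; have := @integral_sublevel_le _ sg false (ray 0%R) (cst 1) (fun t => V t `^ r) (k `^ r) (mray 0)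
  (measurable_cst _) (measurableT_comp (measurable_powR _) mV) (fun _ => ler01) (powR_ge0 _ _).
have -> : ray 0%R `&` [set t : TR | (V t `^ r <= k `^ r)%R] = ray 0%R `&` [set t : TR | (V t <= k)%R].
  apply/seteqP; split => t [+ h]; rewrite /ray/= in_itv/= andbT => t0; split; rewrite /= ?in_itv/= ?t0//.
    rewrite leNgt; apply/negP => kt; move: h => /=; apply/negP; rewrite -ltNge.
    by apply: gt0_ltr_powR; rewrite ?nnegrE ?(ltW k0) ?(ltW (V0 _)).
  by apply: ge0_ler_powR; rewrite ?nnegrE ?(ltW k0) ?(ltW (V0 _)) ?(ltW r0).
have mE := @measurable_sublevel _ TR R (ray 0%R) V (mray 0) mV k.
have c1 (A : set TR) : measurable A -> (\int[sg]_(x in A) (cst 1 x)%:E = sg A)%E.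
  by move=> mA; rewrite -[RHS]mul1e -(integral_cst sg mA 1%E).
rewrite c1//; apply => t; rewrite /ray/= in_itv/= andbT => t0.
rewrite -VE// c1; last by apply: measurableI => //; exact: measurable_segment.
apply: le_measure; rewrite ?inE//; first by apply: measurableI => //; exact: measurable_segment.
by move=> z [_]; rewrite /= in_itv/= andbT.
Qed.

(** The total [u]-mass before min(s, x) is [b], and the part where U <= b/2 has mass at most b/2 by
    the sublevel lemma. Keeping only the rest makes U t and [b] comparable. *)
Lemma left_mass_half (s x b : R) : 0 < s -> 0 < x -> b = Num.min (U s) (U x) ->
  (b%:E <= 2%:E * \int[mu]_(t in `]0%R, x[ `&` [set t : TR | ((t < s) && (b < 2 * U t))%R]) (u t)%:E)%E.
Proof.
move=> s0 x0 bE; pose m := Num.min s x.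
have m0 : 0 < m by rewrite lt_min s0.
have bm : b = U m.
  rewrite bE /m; case: (leP s x) => h; first by rewrite min_l// ndU.
  by rewrite min_r// ndU// ltW.
have b0 : 0 < b by rewrite bm U0.
have xm : `]0%R, m[%classic = `]0%R, x[%classic `&` [set t : TR | t < s].
  apply/seteqP; split => t /=; rewrite !in_itv/= lt_min.
    by move=> /and3P[-> -> ->].
  by move=> [/andP[-> ->] ->].
pose E1 := `]0%R, m[%classic `&` [set t : TR | (U t <= b / 2)%R].
pose E2 := `]0%R, x[%classic `&` [set t : TR | (t < s) && (b < 2 * U t)].
have mE1 : measurable (E1 : set TR) by exact: (@measurable_sublevel _ TR R `]0%R, m[%classic U (mitv _) mU (b / 2)).
have E2E : E2 = `]0%R, m[%classic `\` E1.
  apply/seteqP; split => t.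
    move=> [tx /andP[ts bt]]; split; first by rewrite xm.
    by move=> [_ /=]; rewrite ler_pdivlMr// mulrC leNgt bt.
  rewrite xm => -[[tx ts] nE]; split => //; rewrite /= in ts *.
  rewrite ts/= ltNge; apply/negP => h; apply: nE; split; first by rewrite xm.
  by rewrite /= ler_pdivlMr// mulrC.
have mE2 : measurable (E2 : set TR) by rewrite E2E; apply: measurableD.
have h1 : (\int[mu]_(t in E1) (u t)%:E <= (b / 2)%:E)%E.
  apply: (@integral_sublevel_le _ mu true) => //; first by rewrite divr_ge0 ?(ltW b0).
  move=> t; rewrite /= in_itv/= => /andP[t0 tm]; rewrite -UE//.
  have -> := @integral_itv_bndo_bndc R (BRight 0) t (EFin \o u) (@mfE u _ mu_).
  apply: subset_integralT => //.
  - by apply: measurableI => //; exact: measurable_segment.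
  - exact: mfE.
  by move=> z []; rewrite /= !in_itv/= => /andP[z0 _] zt; apply/andP; split.
have tot : (b%:E = \int[mu]_(t in E1) (u t)%:E + \int[mu]_(t in E2) (u t)%:E)%E.
  rewrite bm -UE// -ge0_integral_setU//.
  - by rewrite E2E setDUK// => t [].
  - exact: mfE.
  - by move=> z _; rewrite lee_fin.
  - by apply/disj_set2P/seteqP; split => // t [h2]; rewrite E2E => -[_].
have e2 : (0 <= \int[mu]_(t in E2) (u t)%:E)%E by apply: integral_ge0 => t _; rewrite lee_fin.
move: tot; rewrite -/E2; move: e2; case: (\int[mu]_(t in E2) _)%E => [e| |] // _.
  move=> tot; move: h1; have -> : (\int[mu]_(t in E1) (u t)%:E = (b - e)%:E)%E.
    by rewrite EFinB tot addeK.
  by rewrite !lee_fin => h; lra.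
by move=> _; rewrite gt0_muley ?leey// lte_fin.
Qed.

(** The statement asks for a real [y] strictly below the integral, so it is meaningful before the
    integral is known to be finite and also yields finitely many relevant levels of V. *)
Lemma exists_test_function (x y : R) : 0 < x -> 0 < y ->
  (y%:E < \int[sg]_(t in ray 0%R) ((U t / (U x + U t)) `^ (1 + r))%:E)%E ->
  exists h : TR -> R, [/\ measurable_fun setT h, forall z, 0 <= h z,
    (\int[mu]_(z in ray 0%R) (h z * v z)%:E <= 1)%E &
    ((y `^ (1 - p))%:E <= (test_const p)%:E * ((U x)^-1%:E *
      \int[mu]_(s in `]0%R, x[) ((\int[mu]_(z in ray s) (h z)%:E) `^ p * (u s)%:E)))%E].
Proof.
move=> x0 y0 yx; have Ux := U0 x0.
pose B (t : TR) := Num.min (U t) (U x).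
have mB : measurable_fun setT B by exact: measurable_minr.
have B0 (t : R) : 0 < t -> 0 <= B t by move=> t0; rewrite le_min !ltW ?U0.
have mBr e : measurable_fun setT (fun t => B t `^ e) by exact: (measurableT_comp (measurable_powR _)).
(* U x times the ratio U t / (U x + U t) is at most the minimum of U t and U x, which is easier to
   discretize. *)
have yB : ((y * U x `^ (1 + r))%:E < \int[sg]_(t in ray 0%R) (B t `^ (1 + r))%:E)%E.
  have Ur0 : 0 < U x `^ (1 + r) by rewrite powR_gt0.
  rewrite EFinM -lte_pdivlMr//; apply: (lt_le_trans yx).
  rewrite muleC (lee_pdivlMl _ _ Ur0).
  have mk : measurable_fun (ray 0%R : set TR) (fun t : TR => ((U t / (U x + U t)) `^ (1 + r))%:E).
    apply/measurable_EFinP; apply: (measurableT_comp (measurable_powR _)).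
    apply: measurable_funM; first exact: measurable_funTS.
    apply: ge0_measurable_funV => //.
      by move=> t; rewrite /ray/= in_itv/= andbT => t0; rewrite addr_ge0 ?ltW ?U0.
    by apply: measurable_funTS; exact: measurable_funD.
  have k0 (t : TR) : ray 0%R t -> (0 <= ((U t / (U x + U t)) `^ (1 + r))%:E)%E by rewrite lee_fin powR_ge0.
  rewrite -(ge0_integralZl_EFin sg (mray 0) k0 mk (ltW Ur0)).
  apply: ge0_le_integral => //.
  - by move=> t _; rewrite mule_ge0 ?lee_fin ?powR_ge0.
  - by apply: emeasurable_funM.
  - exact: mfE.
  move=> t; rewrite /ray/= in_itv/= andbT => t0; have Ut := U0 t0.
  have Ut0 : 0 <= U t / (U x + U t) by rewrite divr_ge0 ?addr_ge0 ?(ltW Ut) ?(ltW Ux).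
  rewrite -EFinM lee_fin -powRM ?(ltW Ux)//.
  apply: ge0_ler_powR; rewrite ?nnegrE ?(ltW r10) ?B0 ?(mulr_ge0 (ltW Ux) Ut0)//.
  rewrite le_min mulrA; apply/andP; split.
    by rewrite ler_pdivrMr ?addr_gt0// mulrC ler_wpM2l ?(ltW Ut)// lerDl ltW.
  by rewrite -mulrA ler_piMr ?(ltW Ux)// ler_pdivrMr ?addr_gt0// mul1r lerDr ltW.
(* The strict inequality survives on a set where V takes values in finitely many dyadic levels. *)
pose F (n : nat) := ray 0%R `&` [set t : TR | ((2 ^+ n)^-1 < V t <= 2 ^+ n)%R].
have mF n : measurable (F n : set TR).
  apply: measurableI => //.
  rewrite (_ : [set t | _] = [set t : TR | (2 ^+ n)^-1 < V t] `&` [set t : TR | V t <= 2 ^+ n]); last first.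
    by apply/seteqP; split => t /=; [move=> /andP[]|move=> [-> ->]].
  apply: measurableI; rewrite -[X in measurable X]setTI; first exact: measurable_fun_ltr.
  exact: measurable_fun_ler.
have [n Fn] : exists n, ((y * U x `^ (1 + r))%:E < \int[sg]_(t in F n) (B t `^ (1 + r))%:E)%E.
  apply/not_existsP => H; move: yB; apply/negP; rewrite -leNgt.
  have -> : ray 0%R = \bigcup_n F n.
    apply/seteqP; split => [t|t [n _ []]]//; rewrite /ray/= in_itv/= andbT => t0.
    have Vt := V0 t0.
    have tr (z : R) k : 0 < z -> (Num.truncn z <= k)%N -> z < 2 ^+ k.
      move=> z0 zk; have /andP[_ h'] := truncn_itv (ltW z0).
      apply: (lt_le_trans h'); rewrite -natrX ler_nat.
      by apply: (leq_ltn_trans zk); exact: ltn_expl.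
    exists (maxn (Num.truncn (V t)) (Num.truncn (V t)^-1)) => //; split; first by rewrite /ray/= in_itv/= t0.
    rewrite /=; apply/andP; split; last by apply/ltW/tr; rewrite ?leq_maxl.
    rewrite -[ltRHS]invrK ltf_pV2 ?posrE ?exprn_gt0 ?invr_gt0//.
    by apply: tr; rewrite ?invr_gt0// leq_maxr.
  apply: integral_bigcup_le => //.
  - move=> i j ij; apply/subsetPset => t [t0 /= /andP[h1 h2]]; split => //=.
    apply/andP; split; last by apply: (le_trans h2); rewrite ler_eXn2l ?ltr1n.
    by apply: le_lt_trans h1; rewrite lef_pV2 ?posrE ?exprn_gt0// ler_eXn2l ?ltr1n.
  - exact: mfE.
  - by move=> t _; rewrite lee_fin powR_ge0.
  - by move=> i; rewrite leNgt; apply/negP; exact: H.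
pose l := ((2 ^+ n)^-1 : R); pose N := (n + n)%N.
have l0 : 0 < l by rewrite invr_gt0 exprn_gt0.
have lN : l * 2 ^+ N = 2 ^+ n by rewrite /l /N exprD mulKf// expf_eq0 pnatr_eq0 andbF.
pose lev (i : nat) := l * 2 ^+ i.
have lev0 i : 0 < lev i by rewrite mulr_gt0// exprn_gt0.
have [z Hz] := choice (fun i => level_bump x0 (lev0 i)).
pose s i := (z i).1.1; pose b i := (z i).1.2; pose g i := (z i).2.
have s0 i : 0 < s i by case: (Hz i).
have bE i : b i = 0 \/ b i = Num.min (U (s i)) (U x) by case: (Hz i).
have Bb i (t : R) : 0 < t -> lev i < V t -> B t <= 2 * b i.
  by move=> t0 lt; case: (Hz i) => _ _ H _ _; exact: H.
have mg i : measurable_fun setT (g i) by case: (Hz i) => _ _ _ [].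
have g0 i t : 0 <= g i t by case: (Hz i) => _ _ _ [_ H _]; exact: H.
have gv i : (\int[mu]_(t in ray 0%R) (g i t * v t)%:E <= ((lev i)^-1)%:E)%E by case: (Hz i) => _ _ _ _ [].
have g1 i : b i != 0 -> (1 <= \int[mu]_(t in ray (s i)) (g i t)%:E)%E by case: (Hz i) => _ _ _ _ [].
clear Hz.
have b0 i : 0 <= b i by case: (bE i) => ->//; rewrite le_min !ltW ?U0.
(* If lev i < V t <= 2 lev i, then B t <= 2 b i, and the set where V <= 2 lev i has mass at most (2
   lev i)^r. The sum on the right is c1 D, with [D] and [c1] introduced below. *)
have H3 : (\int[sg]_(t in F n) (B t `^ (1 + r))%:E <=
   (\sum_(i < N) (2 * b i) `^ (1 + r) * (2 * lev i) `^ r)%:E)%E.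
  pose Q i := ray 0%R `&` [set t : TR | (V t <= 2 * lev i)%R].
  have mQ i : measurable (Q i : set TR) by exact: (@measurable_sublevel _ TR R (ray 0%R) V (mray 0) mV).
  apply: (@le_trans _ _ (\int[sg]_(t in ray 0%R) \sum_(i < N) (((2 * b i) `^ (1 + r))%:E * (\1_(Q i) t)%:E))%E).
    have mS : measurable_fun (ray 0%R : set TR) (fun t => \sum_(i < N) (((2 * b i) `^ (1 + r))%:E * (\1_(Q i) t)%:E))%E.
      by apply: emeasurable_sum => i _; apply: emeasurable_funM => //; apply/measurable_EFinP; exact: measurable_indic.
    have S0 t : (0 <= \sum_(i < N) (((2 * b i) `^ (1 + r))%:E * (\1_(Q i) t)%:E))%E.
      by apply: sume_ge0 => i _; rewrite mule_ge0 ?lee_fin ?powR_ge0.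
    apply: (@le_trans _ _ (\int[sg]_(t in F n) \sum_(i < N) (((2 * b i) `^ (1 + r))%:E * (\1_(Q i) t)%:E))%E); last first.
      by apply: ge0_subset_integral => // t [].
    apply: ge0_le_integral => //.
    - by move=> t _; rewrite lee_fin powR_ge0.
    - exact: mfE.
    - by apply: measurable_funS mS => // t [].
    move=> t [t0' /= /andP[h1 h2]]; have t0 : 0 < t by move: t0'; rewrite /ray/= in_itv/= andbT.
    have [i iN /andP[i1 i2]] := dyadic_cover h1 (eq_ind_r (fun z => V t <= z) h2 lN).
    rewrite (bigD1 (Ordinal iN))//= -[leLHS]adde0; apply: leeD; last first.
      by apply: sume_ge0 => j _; rewrite mule_ge0 ?lee_fin ?powR_ge0.
    rewrite indicE mem_set ?mule1; last by split.
    rewrite lee_fin; apply: ge0_ler_powR; rewrite ?nnegrE ?(ltW r10) ?B0 ?mulr_ge0//.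
    exact: Bb.
  rewrite ge0_integral_sum//; last 2 first.
  - by move=> i; apply: emeasurable_funM => //; apply/measurable_EFinP; exact: measurable_indic.
  - by move=> i t _; rewrite mule_ge0 ?lee_fin ?powR_ge0.
  rewrite -sumEFin; apply: lee_sum => i _.
  rewrite ge0_integralZl_EFin ?powR_ge0//; last first.
    by apply/measurable_EFinP; exact: measurable_indic.
  rewrite integral_indic// EFinM; apply: lee_wpmul2l; first by rewrite lee_fin powR_ge0.
  by rewrite setIidl; [apply: level_mass; rewrite mulr_gt0|move=> t []].
pose D := \sum_(i < N) lev i `^ r * b i `^ (1 + r).
pose c1 := 2 `^ (1 + r) * 2 `^ r : R.
have c10 : 0 < c1 by rewrite mulr_gt0 ?powR_gt0.
have yD : y * U x `^ (1 + r) < c1 * D.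
  rewrite -lte_fin; apply: (lt_le_trans Fn); apply: (le_trans H3); rewrite lee_fin mulr_sumr.
  apply: ler_sum => i _; rewrite (powRM _ (ler0n _ 2) (b0 i)) (powRM _ (ler0n _ 2) (ltW (lev0 i))).
  by rewrite mulrACA (mulrC (b i `^ _)).
have D0 : 0 < D by rewrite -(pmulr_rgt0 _ c10); apply: le_lt_trans yD; rewrite mulr_ge0 ?powR_ge0 ?(ltW y0).
(* These weights give [\sum_i c i / lev i = 1], and [(D * c i) ^ p = (lev i * b i) ^ r]
   grows geometrically with [i], so that [D ^ p * H ^ p] controls a whole sum of
   such terms by its last one. *)
pose c i := (lev i * b i) `^ (1 + r) / D.
have c0 i : 0 <= c i by rewrite divr_ge0 ?powR_ge0 ?(ltW D0).
pose h t := \sum_(i < N) c i * g i t.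
have mh : measurable_fun setT h by apply: measurable_sum => i; exact: measurable_funM.
have h0 t : 0 <= h t by apply: sumr_ge0 => i _; rewrite mulr_ge0.
exists h; split => //.
  have hvE t : ((h t * v t)%:E = \sum_(i < N) ((c i)%:E * (g i t * v t)%:E))%E.
    rewrite /h mulr_suml -sumEFin; apply: eq_bigr => i _; by rewrite -EFinM mulrA.
  under eq_integral do rewrite hvE.
  rewrite ge0_integral_sum//; last 2 first.
  - by move=> i; apply: emeasurable_funM => //; apply: mfE; exact: measurable_funM.
  - by move=> i t _; rewrite mule_ge0 ?lee_fin ?c0 ?(mulr_ge0 (g0 _ _) (v0 _)).
  apply: (@le_trans _ _ (\sum_(i < N) ((c i)%:E * ((lev i)^-1)%:E))%E).
    apply: lee_sum => i _; rewrite ge0_integralZl_EFin//.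
    - by apply: lee_wpmul2l; rewrite ?lee_fin.
    - by move=> t _; rewrite lee_fin (mulr_ge0 (g0 _ _) (v0 _)).
    - by apply: mfE; exact: measurable_funM.
  rewrite (eq_bigr (fun i : 'I_N => (D^-1 * (lev i `^ r * b i `^ (1 + r)))%:E)); last first.
    move=> i _; rewrite -EFinM; congr EFin; rewrite /c powRM ?(ltW (lev0 _))// powRDgt0// powRr1 ?(ltW (lev0 _))//.
    by field; rewrite !gt_eqF.
  by rewrite sumEFin -mulr_sumr mulVf ?gt_eqF.
pose H t := (\int[mu]_(w in ray t) (h w)%:E)%E.
have H0 t : (0 <= H t)%E by apply: integral_ge0 => w _; rewrite lee_fin.
have mH : measurable_fun setT (H : TR -> \bar R).
  apply: nonincreasing_emeasurable => t t' tt'; apply: subset_integralT => //; first exact: mfE.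
  by move=> w; rewrite /ray/= !in_itv/= !andbT; exact: le_lt_trans.
have Hc i t : (i < N)%N -> b i != 0 -> t < s i -> ((c i)%:E <= H t)%E.
  move=> iN bi ts.
  apply: (@le_trans _ _ ((c i)%:E * \int[mu]_(w in ray t) (g i w)%:E)%E).
    rewrite -[leLHS]mule1; apply: lee_wpmul2l; first by rewrite lee_fin.
    apply: (le_trans (g1 _ bi)); apply: subset_integralT => //; first exact: mfE.
      by move=> w; rewrite lee_fin.
    by move=> w; rewrite /ray/= !in_itv/= !andbT; exact: lt_trans.
  rewrite -integralZT; [|exact: mray|exact: mfE|by move=> w; rewrite lee_fin|exact: c0].
  apply: le_integralT; first exact: mray.
  - by apply: emeasurable_funM => //; exact: mfE.
  - exact: mfE.
  - by move=> w; rewrite mule_ge0 ?lee_fin ?c0.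
  move=> w _; rewrite -EFinM lee_fin /h (bigD1 (Ordinal iN))//= lerDl.
  by apply: sumr_ge0 => j _; exact: mulr_ge0 (c0 _) (g0 _ _).
pose c2 := 2 * (2 `^ r * (2 `^ r / (2 `^ r - 1))) : R.
have c20 : 0 <= c2.
  by rewrite /c2 !mulr_ge0 ?powR_ge0// invr_ge0 subr_ge0 ltW// powR2_gt1.
pose P (t : TR) i := [&& b i != 0, t < s i & b i < 2 * U t].
(* On the indices selected by [P t] all [b i] are comparable to U t: b i < 2 U t by definition, and
   U t <= b i since t precedes both [s i] and [x]. The sum is therefore geometric in [lev i], and
   its last term is (D c j)^p, at most D^p H^p. *)
have key (t : R) : 0 < t -> t < x ->
    ((\sum_(i < N) 2 * (lev i * b i) `^ r * (P t i)%:R)%:E <= (c2 * D `^ p)%:E * H t `^ p)%E.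
  move=> t0 tx; have Ut := U0 t0.
  have st : \sum_(i < N) 2 * (lev i * b i) `^ r * (P t i)%:R <=
     2 * (2 * U t) `^ r * \sum_(i < N) (l * 2 ^+ i) `^ r * (P t i)%:R.
    rewrite mulr_sumr; apply: ler_sum => i _; case: (boolP (P t i)) => [/and3P[_ _ h']|]; last by rewrite !mulr0.
    have lb : 0 <= lev i * b i := mulr_ge0 (ltW (lev0 i)) (b0 i).
    have U2 : 0 <= 2 * U t by rewrite mulr_ge0// ltW.
    rewrite !mulr1 -mulrA; apply: ler_wpM2l => //.
    rewrite -[l * 2 ^+ i]/(lev i) -(powRM _ U2 (ltW (lev0 i))).
    apply: ge0_ler_powR; rewrite ?nnegrE ?(ltW r0) ?lb ?(mulr_ge0 U2 (ltW (lev0 i)))//.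
    by rewrite (mulrC (lev i)); apply: ler_wpM2r; [exact/ltW|exact/ltW].
  case: (sum_dyadic_pred N (P t) l0 r0) => [S0|[j jN [/and3P[bj tj ub] Sj]]].
    apply: (@le_trans _ _ 0%E); first by rewrite lee_fin (le_trans st)// S0 mulr0.
    by rewrite mule_ge0 ?poweR_ge0// lee_fin mulr_ge0 ?powR_ge0.
  have Ub : U t <= b j.
    by case: (bE j) => [bj0|->]; [rewrite bj0 eqxx in bj|rewrite le_min !ndU// ltW].
  apply: (@le_trans _ _ (c2 * (lev j * b j) `^ r)%:E).
    rewrite lee_fin; apply: (le_trans st).
    apply: (@le_trans _ _ (2 * (2 * U t) `^ r * (2 `^ r / (2 `^ r - 1) * (l * 2 ^+ j) `^ r))).
      by apply: ler_wpM2l => //; rewrite mulr_ge0 ?powR_ge0.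
    have -> : 2 * (2 * U t) `^ r * (2 `^ r / (2 `^ r - 1) * (l * 2 ^+ j) `^ r) = c2 * (lev j * U t) `^ r.
      by rewrite (powRM _ (ler0n _ _) (ltW Ut)) (powRM _ (ltW (lev0 j)) (ltW Ut)) /c2 /lev; ring.
    have lU := mulr_ge0 (ltW (lev0 j)) (ltW Ut); have lb := mulr_ge0 (ltW (lev0 j)) (b0 j).
    apply: ler_wpM2l => //; apply: ge0_ler_powR; rewrite ?nnegrE ?(ltW r0) ?lU ?lb//.
    by apply: ler_wpM2l => //; exact/ltW.
  rewrite (EFinM c2) (EFinM c2 (D `^ p)) -muleA; apply: lee_wpmul2l; first by rewrite lee_fin.
  have -> : (lev j * b j) `^ r = (D * c j) `^ p.
    by rewrite /c (mulrC D) divfK ?gt_eqF// -powRrM rpE.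
  rewrite (powRM _ (ltW D0) (c0 j)) EFinM; apply: lee_wpmul2l; first by rewrite lee_fin powR_ge0.
  by rewrite -poweR_EFin; apply: le_poweR; rewrite ?(ltW p0) ?lee_fin//; exact: Hc.
pose IH := (\int[mu]_(t in `]0%R, x[) (H t `^ p * (u t)%:E))%E.
have IH0 : (0 <= IH)%E by apply: integral_ge0 => t _; rewrite mule_ge0 ?poweR_ge0 ?lee_fin.
have mHu A : measurable_fun A (fun t : TR => H t `^ p * (u t)%:E)%E.
  apply: measurable_funTS; apply: emeasurable_funM; first exact: measurable_fun_poweR.
  exact: mfE.
(* By [left_mass_half] each term of [D] is a constant times an integral against [u]; summing under
   the integral and using [key] bounds [D] by a multiple of D^p times the average, and D^p is then
   cancelled. *)
have DH : (D%:E <= (c2 * D `^ p)%:E * IH)%E.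
  have mP i : measurable ([set t : TR | P t i] : set TR).
    rewrite /P; case: (b i != 0); last by rewrite (_ : [set _ | _] = set0)//; apply/seteqP; split.
    rewrite (_ : [set _ | _] = [set t : TR | t < s i] `&` [set t : TR | b i < 2 * U t]); last first.
      by apply/seteqP; split => t /=; [move=> /andP|move=> [-> ->]].
    apply: measurableI; rewrite -[X in measurable X]setTI; apply: measurable_fun_ltr => //.
    exact: measurable_funM.
  have PE i t : (P t i)%:R = \1_[set t : TR | P t i] t :> R.
    by rewrite indicE; case: (boolP (P t i)) => Pti; [rewrite mem_set|rewrite memNset//=; exact/negP].
  have mPi i : measurable_fun setT (fun t : TR => (P t i)%:R : R).
    rewrite (_ : (fun _ => _) = \1_[set t : TR | P t i]); first exact: measurable_indic.
    by apply/funext => t; exact: PE.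
  pose f i t := 2 * (lev i * b i) `^ r * (P t i)%:R.
  have f0 i t : 0 <= f i t by rewrite !mulr_ge0 ?powR_ge0.
  have mf i : measurable_fun setT (f i) by exact: measurable_funM.
  have e1 : (D%:E <= \int[mu]_(t in `]0%R, x[) ((\sum_(i < N) f i t)%:E * (u t)%:E))%E.
    have eqf t : ((\sum_(i < N) f i t)%:E * (u t)%:E = \sum_(i < N) (f i t * u t)%:E)%E.
      by rewrite sumEFin -EFinM mulr_suml.
    under eq_integral do rewrite eqf.
    rewrite ge0_integral_sum//; last 2 first.
    - by move=> i; apply: mfE; exact: measurable_funM.
    - by move=> i t _; rewrite lee_fin mulr_ge0.
    rewrite /D -sumEFin; apply: lee_sum => i _.
    have [bi0|bi0] := eqVneq (b i) 0.
      rewrite bi0 powR0 ?gt_eqF// mulr0; apply: integral_ge0 => t _.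
      by rewrite lee_fin mulr_ge0.
    have bi : b i = Num.min (U (s i)) (U x) by case: (bE i) => // bi; rewrite bi eqxx in bi0.
    have L := left_mass_half (s0 i) x0 bi.
    have -> : lev i `^ r * b i `^ (1 + r) = (lev i * b i) `^ r * b i.
      rewrite (addrC 1 r) powRM ?(ltW (lev0 i))// [X in _ * X = _]powRD ?bi0 ?implybT// powRr1//.
      by rewrite mulrA.
    rewrite EFinM; apply: (le_trans (lee_wpmul2l _ L)); first by rewrite lee_fin powR_ge0.
    rewrite muleA -EFinM (mulrC _ 2).
    have -> : [set t : TR | (t < s i) && (b i < 2 * U t)] = [set t : TR | P t i].
      by apply/seteqP; split => t /=; rewrite /P bi0.
    rewrite integral_mkcondr -integralZT//; last 3 first.
    - apply/(measurable_restrictT _ _).1; [exact: mP|exact: mfE].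
    - by move=> t; rewrite patchE; case: ifPn => _; rewrite lee_fin.
    - by rewrite mulr_ge0 ?powR_ge0.
    rewrite le_eqVlt; apply/orP; left; apply/eqP; apply: eq_integral => t _.
    rewrite patchE /f; case: ifPn; rewrite ?inE/=.
      by move=> ->; rewrite mulr1 EFinM.
    by rewrite notin_setE /= => /negP/negbTE ->; rewrite mulr0 mul0r mule0.
  apply: (le_trans e1).
  have mS : measurable_fun setT (fun t => \sum_(i < N) f i t) by apply: measurable_sum.
  rewrite /IH -integralZT; [|exact: mitv|exact: mHu|by move=> t; rewrite mule_ge0 ?poweR_ge0 ?lee_fin|exact: (mulr_ge0 c20 (powR_ge0 _ _))].
  apply: ge0_le_integral => //.
  - by move=> t _; rewrite mule_ge0 ?lee_fin// sumr_ge0.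
  - by apply: emeasurable_funM; exact: mfE.
  - by apply: emeasurable_funM => //; exact: mHu.
  move=> t; rewrite /= in_itv/= => /andP[t0 tx]; rewrite muleA; apply: lee_wpmul2r; first by rewrite lee_fin.
  exact: key.
have [IHoo|IHfin] := eqVneq IH +oo%E.
  rewrite -/IH IHoo gt0_muley ?lte_fin ?invr_gt0// gt0_muley ?leey// lte_fin /test_const -/r.
  by rewrite !mulr_gt0 ?powR_gt0// ?invr_gt0 ?subr_gt0 ?powR2_gt1// mulr_gt0 ?powR_gt0.
rewrite -/IH; move: DH IH0 IHfin; case: IH => [j| |]// DH j0 _.
move: DH j0; rewrite -!EFinM !lee_fin => DH j0.
have p10 : 0 < 1 - p by rewrite subr_gt0.
have D1 : D `^ (1 - p) <= c2 * j.
  have Dp : 0 < D `^ p by rewrite powR_gt0.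
  rewrite -(ler_pM2l Dp) -powRDgt0// addrC subrK powRr1 ?(ltW D0)//.
  by apply: (le_trans DH); rewrite mulrCA mulrA.
have y1 : y `^ (1 - p) * U x <= c1 `^ (1 - p) * D `^ (1 - p).
  rewrite -powRM ?(ltW c10) ?(ltW D0)//.
  have -> : y `^ (1 - p) * U x = (y * U x `^ (1 + r)) `^ (1 - p).
    by rewrite powRM ?(ltW y0) ?powR_ge0// -powRrM rqE powRr1 ?(ltW Ux).
  apply: ge0_ler_powR; rewrite ?(ltW p10) ?nnegrE ?(mulr_ge0 (ltW c10) (ltW D0)) ?(ltW yD)//.
  by rewrite mulr_ge0 ?powR_ge0 ?(ltW y0).
rewrite mulrCA ler_pdivlMl// mulrC; apply: (le_trans y1).
rewrite /test_const -/r -/c1 -/c2 -mulrA; apply: ler_wpM2l => //; exact: powR_ge0.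
Qed.

End test_function.

(** * Necessity *)

Lemma integralZeT {d} {T : measurableType d} {R : realType} (mu : {measure set T -> \bar R})
    (D : set T) (f : T -> \bar R) (k : \bar R) : measurable D ->
  measurable_fun D f -> (forall x, 0 <= f x)%E -> (0 <= k)%E ->
  (\int[mu]_(x in D) (k * f x) = k * \int[mu]_(x in D) f x)%E.
Proof. by move=> mD mf f0 k0; apply: ge0_integralZl. Qed.

Lemma powRD_le {R : realType} (x y e : R) : 0 < e -> 0 <= x -> 0 <= y ->
  (x + y) `^ e <= 2 `^ e * (x `^ e + y `^ e).
Proof.
move=> e0 x0 y0; have := @poweRD_le _ x%:E y%:E e e0.
by rewrite -EFinD !poweR_EFin -EFinD -EFinM !lee_fin; apply.
Qed.

Lemma integral_le_sum {d} {T : measurableType d} {R : realType} (mu : {measure set T -> \bar R})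
    (D : set T) (f a b : T -> R) (k A B : R) : measurable D ->
  measurable_fun setT f -> measurable_fun setT a -> measurable_fun setT b ->
  (forall x, 0 <= f x) -> (forall x, 0 <= a x) -> (forall x, 0 <= b x) -> 0 <= k ->
  (forall x, D x -> f x <= k * (a x + b x)) ->
  (\int[mu]_(x in D) (a x)%:E <= A%:E)%E -> (\int[mu]_(x in D) (b x)%:E <= B%:E)%E ->
  (\int[mu]_(x in D) (f x)%:E <= (k * (A + B))%:E)%E.
Proof.
move=> mD mf ma mb f0 a0 b0 k0 fab aA bB.
have mE (g : T -> R) : measurable_fun setT g -> measurable_fun setT (fun x => (g x)%:E).
  by move=> mg; exact/measurable_EFinP.
apply: (@le_trans _ _ (\int[mu]_(x in D) (k%:E * ((a x)%:E + (b x)%:E)))%E).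
  apply: le_integralT; [exact: mD|exact: mE| |by move=> x; rewrite lee_fin|].
    by apply: emeasurable_funM => //; apply: emeasurable_funD; exact: mE.
  by move=> x Dx; rewrite -EFinD -EFinM lee_fin fab.
rewrite integralZT; [|exact: mD|by apply: emeasurable_funD; exact: mE|by move=> x; rewrite -EFinD lee_fin addr_ge0|exact: k0].
rewrite integralDT; [|exact: mD|exact: mE|exact: mE|by move=> x; rewrite lee_fin|by move=> x; rewrite lee_fin].
by rewrite EFinM EFinD; apply: lee_wpmul2l; [rewrite lee_fin|exact: leeD].
Qed.

Section necessity.
Context {R : realType}.
Local Notation TR := (measurableTypeR R).
Local Notation mu := (@lebesgue_measure R).
Variables (p q c C3 : R) (u U v w phi : TR -> R).
Let r := star p.
Hypotheses (p0 : 0 < p) (p1 : p < 1) (q0 : 0 < q) (c0 : 0 <= c) (C30 : 0 < C3).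
Hypotheses (mu_ : measurable_fun setT u) (u0 : forall x, 0 <= u x).
Hypotheses (mU : measurable_fun setT U) (U0 : forall x : R, 0 < x -> 0 < U x).
Hypothesis ndU : forall x y : R, 0 < x -> x <= y -> U x <= U y.
Hypothesis UE : forall x : R, 0 < x -> (\int[mu]_(s in `]0%R, x[) (u s)%:E = (U x)%:E)%E.
Hypotheses (mv : measurable_fun setT v) (v0 : forall x, 0 <= v x).
Hypotheses (mw : measurable_fun setT w) (w0 : forall x, 0 <= w x).
Hypothesis phi0 : forall x : R, 0 < x -> 0 < phi x.
Hypothesis phiE : forall x : R, 0 < x ->
  (\int[mu]_(s in ray 0%R) ((U x / (U s + U x)) `^ (q / p) * w s)%:E = (phi x)%:E)%E.
Let F (h : TR -> R) (t : R) := core_avg p u U (EFin \o h) t.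
Hypothesis hardy : forall h : TR -> R, measurable_fun setT h -> (forall z, 0 <= h z) ->
  ((\int[mu]_(t in ray 0%R) (F h t `^ (q / p) * (w t)%:E)) `^ q^-1 <=
    c%:E * \int[mu]_(z in ray 0%R) (h z * v z)%:E)%E.

Let r0 : 0 < r. Proof. by rewrite divr_gt0 ?subr_gt0. Qed.
Let mray (x : R) : measurable (ray x : set TR).
Proof. exact: measurable_itv. Qed.
Let mitv (i : interval R) : measurable ([set` i] : set TR).
Proof. exact: measurable_itv. Qed.
Let mfE (f : TR -> R) A : measurable_fun setT f -> measurable_fun A (fun t => (f t)%:E).
Proof. by move=> mf; apply/measurable_EFinP; exact: measurable_funTS. Qed.
Let qp0 : 0 < q / p. Proof. exact: divr_gt0. Qed.
Let pN0 : 1 - p != 0. Proof. by rewrite subr_eq0 gt_eqF. Qed.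

Section average.
Variable h : TR -> R.
Hypotheses (mh : measurable_fun setT h) (h0 : forall z, 0 <= h z).
Let H (s : TR) := (\int[mu]_(z in ray s) (EFin \o h) z)%E.

Let H0 s : (0 <= H s)%E. Proof. by apply: integral_ge0 => z _; rewrite lee_fin. Qed.

Let Hni (s t : R) : s <= t -> (H t <= H s)%E.
Proof.
move=> st; apply: subset_integralT => //; first exact: mfE.
by move=> z; rewrite /ray/= !in_itv/= !andbT; exact: le_lt_trans.
Qed.

Let mHu A : measurable_fun A (fun s : TR => H s `^ p * (u s)%:E)%E.
Proof.
apply: measurable_funTS; apply: emeasurable_funM; last exact: mfE.
have mH : measurable_fun setT H by apply: nonincreasing_emeasurable => x y xy; exact: Hni.
exact: measurable_fun_poweR.
Qed.

Let Hu0 s : (0 <= H s `^ p * (u s)%:E)%E. Proof. by rewrite mule_ge0 ?poweR_ge0 ?lee_fin. Qed.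

Let G (t : R) := (\int[mu]_(s in `]0%R, t[) (H s `^ p * (u s)%:E))%E.

Let G0 t : (0 <= G t)%E. Proof. exact: integral_ge0. Qed.

Lemma average_ge0 (t : R) : 0 < t -> (0 <= F h t)%E.
Proof. by move=> t0; apply: mule_ge0; [rewrite lee_fin invr_ge0 ltW// U0|exact: (G0 t)]. Qed.

Lemma measurable_average : measurable_fun (ray 0%R : set TR) (F h : TR -> \bar R).
Proof.
apply: emeasurable_funM.
  apply/measurable_EFinP; apply: ge0_measurable_funV => //; last exact: measurable_funTS.
  by move=> x; rewrite /ray/= in_itv/= andbT => /U0/ltW.
apply: measurable_funTS; apply: nondecreasing_emeasurable => x y xy.
apply: subset_integralT; [exact: mitv|exact: mitv|exact: mHu|exact: Hu0|].
by move=> t; rewrite /= !in_itv/= => /andP[->] /lt_le_trans; exact.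
Qed.

Lemma average_right (x t : R) : 0 < x -> x <= t -> ((U x / U t)%:E * F h x <= F h t)%E.
Proof.
move=> x0 xt; have t0 := lt_le_trans x0 xt; have Ux := U0 x0; have Ut := U0 t0.
rewrite /F /core_avg -/(G x) -/(G t) muleA -EFinM mulrAC mulfV ?gt_eqF// mul1r.
apply: lee_wpmul2l; first by rewrite lee_fin invr_ge0 ltW.
apply: subset_integralT; [exact: mitv|exact: mitv|exact: mHu|exact: Hu0|].
by move=> s; rewrite /= !in_itv/= => /andP[->] /lt_le_trans; exact.
Qed.

(* [F h] is the mean of a nonincreasing function. *)
Lemma average_left (x t : R) : 0 < t -> t <= x -> (F h x <= F h t)%E.
Proof.
move=> t0 tx; have x0 := lt_le_trans t0 tx; have Ux := U0 x0; have Ut := U0 t0.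
have Utx := ndU t0 tx.
have e1 : (H t `^ p * (U t)%:E <= G t)%E.
  rewrite -UE// -integralZeT; [|exact: mitv|exact: mfE|by move=> s; rewrite lee_fin|exact: poweR_ge0].
  apply: ge0_le_integral; [exact: mitv|by move=> s _; rewrite mule_ge0 ?poweR_ge0 ?lee_fin| |exact: mHu|].
    by apply: emeasurable_funM; [exact: measurable_cst|exact: mfE].
  move=> s; rewrite /= in_itv/= => /andP[_ st]; apply: lee_wpmul2r; first by rewrite lee_fin.
  by apply: le_poweR; rewrite ?(ltW p0)// Hni// ltW.
have sp : `]0%R, x[%classic = `]0%R, t[%classic `|` `[t, x[%classic :> set TR.
  apply/seteqP; split => s /=; rewrite !in_itv/=.
    by move=> /andP[s0 sx]; case: (ltP s t) => st; [left; rewrite s0|right].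
  by move=> [/andP[-> st]|/andP[ts ->]]; [rewrite (lt_le_trans st)|rewrite (lt_le_trans t0)].
have dj : [disjoint `]0%R, t[%classic & `[t, x[%classic].
  apply/disj_set2P/seteqP; split => // s []; rewrite /= !in_itv/= => /andP[_ st] /andP[ts _].
  by move: (lt_le_trans st ts); rewrite ltxx.
have Gx : (G x = G t + \int[mu]_(s in `[t, x[) (H s `^ p * (u s)%:E))%E.
  by rewrite /G sp ge0_integral_setU.
have Ud : (\int[mu]_(s in `[t, x[) (u s)%:E = (U x - U t)%:E)%E.
  have := UE x0; rewrite sp ge0_integral_setU//; [|exact: mfE|by move=> s _; rewrite lee_fin].
  by rewrite UE// => e; rewrite EFinB -e [X in (X - _)%E]addeC addeK.
have e2 : (\int[mu]_(s in `[t, x[) (H s `^ p * (u s)%:E) <= H t `^ p * (U x - U t)%:E)%E.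
  rewrite -Ud -integralZeT; [|exact: mitv|exact: mfE|by move=> s; rewrite lee_fin|exact: poweR_ge0].
  apply: ge0_le_integral; [exact: mitv|by move=> s _; exact: Hu0|exact: mHu| |].
    by apply: emeasurable_funM; [exact: measurable_cst|exact: mfE].
  move=> s; rewrite /= in_itv/= => /andP[ts _]; apply: lee_wpmul2r; first by rewrite lee_fin.
  by apply: le_poweR; rewrite ?(ltW p0)// Hni.
rewrite /F /core_avg -/(G x) -/(G t) lee_pdivrMl// Gx.
apply: (le_trans (leeD (lexx _) e2)).
have e3 : (H t `^ p * (U x - U t)%:E <= ((U x - U t) / U t)%:E * G t)%E.
  have -> : U x - U t = ((U x - U t) / U t) * U t by rewrite divfK ?gt_eqF.
  rewrite EFinM muleCA; apply: (@le_trans _ _ (((U x - U t) / U t)%:E * G t)%E).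
    by apply: lee_wpmul2l => //; rewrite lee_fin divr_ge0 ?subr_ge0 ?(ltW Ut).
  by rewrite divfK ?gt_eqF.
apply: (le_trans (leeD (lexx _) e3)).
rewrite -{1}(mul1e (G t)) -ge0_muleDl ?lee_fin ?divr_ge0 ?subr_ge0 ?(ltW Ut)//.
rewrite muleA -EFinM -EFinD; apply: lee_wpmul2r => //.
by rewrite lee_fin mulrBl mulfV ?gt_eqF// addrC subrK.
Qed.

(** F decreases while U F increases, so a lower bound at one point spreads over the half-line. As U
    x / (U t + U x) is at most this minimum, the loss is precisely the kernel of [phi]. *)
Lemma average_min (x t : R) : 0 < x -> 0 < t -> ((Num.min 1 (U x / U t))%:E * F h x <= F h t)%E.
Proof.
move=> x0 t0; have [xt|tx] := leP x t.
  apply: le_trans (average_right x0 xt); apply: lee_wpmul2r; first exact: average_ge0.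
  by rewrite lee_fin ge_min lexx orbT.
apply: le_trans (average_left t0 (ltW tx)); rewrite -[leRHS]mul1e.
apply: lee_wpmul2r; first exact: average_ge0.
by rewrite lee_fin ge_min lexx.
Qed.

End average.

Variable psie : R -> \bar R.
Hypothesis test : forall x y : R, 0 < x -> 0 < y -> (y%:E < psie x)%E ->
  exists h : TR -> R, [/\ measurable_fun setT h, forall z, 0 <= h z,
    (\int[mu]_(z in ray 0%R) (h z * v z)%:E <= 1)%E &
    ((y `^ (1 - p))%:E <= C3%:E * F h x)%E].

(** [psie] is extended-real because its finiteness is concluded here: if the bound failed, a real
    [y] strictly between it and [psie x] would have a test function violating the inequality. *)
Lemma pointwise_necessity (x : R) : 0 < x ->
  (psie x <= ((C3 `^ p^-1 * c / phi x `^ q^-1) `^ r)%:E)%E.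
Proof.
move=> x0; rewrite leNgt; apply/negP => lt1.
have ph := phi0 x0; have ph' : 0 < phi x `^ q^-1 by rewrite powR_gt0.
have b0 : 0 <= C3 `^ p^-1 * c / phi x `^ q^-1.
  by rewrite divr_ge0 ?mulr_ge0 ?powR_ge0.
have [y [y1 y2]] : exists y : R, (C3 `^ p^-1 * c / phi x `^ q^-1) `^ r < y /\ (y%:E < psie x)%E.
  move: lt1; set z := (_ `^ r); case: (psie x) => [a| |]//.
    rewrite lte_fin => za; exists ((z + a) / 2); rewrite lte_fin; split; lra.
  by move=> _; exists (z + 1); split; rewrite ?ltry// ltrDl.
have y0 : 0 < y := le_lt_trans (powR_ge0 _ _) y1.
have [h [mh h0 hv hx]] := test x0 y0 y2.
have F0 (t : R) : 0 < t -> (0 <= F h t)%E by exact: average_ge0.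
have mF := measurable_average mh h0.
have H1 : ((F h x `^ (q / p) * (phi x)%:E) `^ q^-1 <= c%:E)%E.
  apply: (@le_trans _ _ (c%:E * \int[mu]_(z in ray 0%R) (h z * v z)%:E)%E); last first.
    by rewrite -[leRHS]mule1; apply: lee_wpmul2l.
  apply: le_trans (hardy mh h0); apply: le_poweR; rewrite ?invr_ge0 ?(ltW q0)//.
    by apply: mule_ge0; rewrite ?poweR_ge0 ?lee_fin ?(ltW ph).
  have mk : measurable_fun (ray 0%R : set TR) (fun s : TR => ((U x / (U s + U x)) `^ (q / p) * w s)%:E).
    apply/measurable_EFinP; apply: measurable_funM; last exact: measurable_funTS.
    apply: (measurableT_comp (measurable_powR _)); apply: measurable_funM => //.
    apply: ge0_measurable_funV => //.
      by move=> t; rewrite /ray/= in_itv/= andbT => t0; rewrite addr_ge0 ?ltW ?U0.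
    by apply: measurable_funTS; exact: measurable_funD.
  have k0 (s : TR) : (0 <= ((U x / (U s + U x)) `^ (q / p) * w s)%:E)%E by rewrite lee_fin mulr_ge0 ?powR_ge0.
  rewrite -phiE// -integralZeT; [|exact: mray|exact: mk|exact: k0|exact: poweR_ge0].
  apply: ge0_le_integral => //.
  - by move=> s _; rewrite mule_ge0 ?poweR_ge0.
  - by apply: emeasurable_funM.
  - by apply: emeasurable_funM; [exact: measurable_fun_poweR|exact: mfE].
  move=> t; rewrite /ray/= in_itv/= andbT => t0; have Ut := U0 t0; have Ux := U0 x0.
  rewrite EFinM muleA; apply: lee_wpmul2r; first by rewrite lee_fin.
  have k1 : 0 <= U x / (U t + U x) by rewrite divr_ge0 ?addr_ge0 ?(ltW Ut) ?(ltW Ux).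
  rewrite -poweR_EFin -(poweRM _ (F0 x x0)) ?lee_fin//.
  have Fk : (0 <= F h x * (U x / (U t + U x))%:E)%E by apply: mule_ge0; [exact: F0|rewrite lee_fin].
  apply: le_poweR; rewrite ?(ltW qp0)//.
  apply: le_trans (average_min mh h0 x0 t0); rewrite muleC; apply: lee_wpmul2r; first exact: F0.
  rewrite lee_fin le_min; apply/andP; split.
    by rewrite ler_pdivrMr ?addr_gt0// mul1r lerDr ltW.
  by apply: ler_wpM2l; rewrite ?(ltW Ux)// lef_pV2 ?posrE ?addr_gt0// lerDl ltW.
have H2 : (((y `^ (1 - p) / C3) `^ p^-1 * phi x `^ q^-1)%:E <= c%:E)%E.
  apply: le_trans H1.
  have -> : ((y `^ (1 - p) / C3) `^ p^-1 * phi x `^ q^-1)%:E =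
     (((y `^ (1 - p) / C3)%:E `^ (q / p) * (phi x)%:E) `^ q^-1)%E.
    rewrite (poweR_EFin (y `^ (1 - p) / C3)) -EFinM (poweR_EFin (_ * _)) (powRM _ (powR_ge0 _ _) (ltW ph)) -powRrM; congr ((_ `^ _ * _)%:E).
    by rewrite mulrAC mulfV ?gt_eqF// mul1r.
  have yC : 0 <= y `^ (1 - p) / C3 by rewrite divr_ge0 ?powR_ge0 ?(ltW C30).
  apply: le_poweR; rewrite ?invr_ge0 ?(ltW q0) ?mule_ge0 ?poweR_ge0 ?lee_fin ?(ltW ph)//.
  apply: lee_wpmul2r; first by rewrite lee_fin ltW.
  apply: le_poweR; rewrite ?(ltW qp0) ?lee_fin//.
  by rewrite mulrC EFinM lee_pdivrMl.
have H3 : y `^ r^-1 <= C3 `^ p^-1 * c / phi x `^ q^-1.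
  rewrite ler_pdivlMr// mulrC -ler_pdivrMl ?powR_gt0//.
  move: H2; rewrite lee_fin; apply: le_trans; rewrite le_eqVlt; apply/orP; left; apply/eqP.
  rewrite powRM ?powR_ge0 ?invr_ge0 ?(ltW C30)// powRV ?(ltW C30)// -powRrM.
  rewrite (_ : (1 - p) * p^-1 = r^-1); last by rewrite /r /star invf_div.
  by ring.
move: y1; apply/negP; rewrite -leNgt.
have -> : y = (y `^ r^-1) `^ r by rewrite -powRrM mulVf ?gt_eqF// powRr1// ltW.
by apply: ge0_ler_powR; rewrite ?nnegrE ?(ltW r0) ?powR_ge0.
Qed.

Section level_necessity.
Hypothesis q1 : q < 1.
Variables (b : bool) (kap g : TR -> R) (K cc : R).
Hypotheses (mkap : measurable_fun setT kap) (kap0 : forall x, 0 <= kap x).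
Hypotheses (mg : measurable_fun setT g) (g0 : forall x : R, 0 < x -> 0 < g x).
Hypothesis gmono : forall x y : R, 0 < x -> 0 < y -> ord b x y -> g y <= g x.
Let f (x : TR) := kap x `^ q * w x.
Hypothesis Lfin : forall x : R, 0 < x ->
  (\int[mu]_(y in ray 0%R `&` segment b x) (f y)%:E < +oo)%E.
Let L (x : TR) := fine (\int[mu]_(y in ray 0%R `&` segment b x) (f y)%:E)%E.
Hypothesis Lg : forall x : R, 0 < x -> L x * g x `^ q <= K.
Hypothesis cc0 : 0 <= cc.
Hypothesis sel : forall l : R, 0 < l -> (exists x : R, 0 < x /\ l <= g x) ->
  exists h : TR -> R, [/\ measurable_fun setT h, forall z, 0 <= h z,
    (\int[mu]_(z in ray 0%R) (h z * v z)%:E <= 1)%E &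
    forall t : R, 0 < t -> l <= g t -> ((kap t * l)%:E <= cc%:E * F h t `^ p^-1)%E].

Let mf : measurable_fun setT f.
Proof. by apply: measurable_funM => //; exact: (measurableT_comp (measurable_powR _)). Qed.
Let f0 x : 0 <= f x. Proof. by rewrite mulr_ge0 ?powR_ge0. Qed.
Let ray0E (x : R) : ray 0%R x -> 0 < x. Proof. by rewrite /ray/= in_itv/= andbT. Qed.

(** The test hypothesis of [level_test] is verified by superposing one function per level. Costs add
    up, whereas F^(1/p) of the sum is at least that of each summand; no constant depending on the
    number of levels appears. [kap] is 1 for segments at 0 and U^(-1/p) for segments at infinity. *)
Lemma level_necessity :
  (\int[mu]_(x in ray 0%R) ((L x * g x) `^ star q * f x)%:E <=
   ((2 * (cc * c * (2 `^ (star q + 1) * (2 `^ star q / (2 `^ star q - 1))))) `^ star q)%:E)%E.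
Proof.
have L0 x : 0 <= L x by exact: segment_mass_ge0.
have mL : measurable_fun setT L by exact: measurable_segment_mass.
have mseg x : measurable (ray 0%R `&` segment b x : set TR).
  by apply: measurableI => //; exact: measurable_segment.
have LE (x : R) : 0 < x -> (\int[mu]_(y in ray 0%R `&` segment b x) (f y)%:E = (L x)%:E)%E.
  move=> x0; rewrite /L fineK// ge0_fin_numE ?Lfin//.
  by apply: integral_ge0 => y _; rewrite lee_fin.
have sub (s : R) : 0 <= s -> (\int[mu]_(x in ray 0%R `&` [set x | (L x <= s)%R]) (f x)%:E <= s%:E)%E.
  move=> s0; apply: (@integral_sublevel_le _ mu b) => //.
  by move=> t /ray0E t0; rewrite LE.
have mlev l : measurable (ray 0%R `&` [set x : TR | (l <= g x)%R] : set TR).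
  by apply: measurableI => //; rewrite -[X in measurable X]setTI; exact: measurable_fun_ler.
apply: (@level_test _ TR R mu (ray 0%R) f g L q (cc * c)) => //.
- by move=> x /ray0E; exact: g0.
- exact: mulr_ge0.
(* On this level set L is at most K / l^q, so its mass is finite by the sublevel bound. The absolute
   value spares an assumption on the sign of [K]. *)
- move=> l l0; have lq : 0 < l `^ q by rewrite powR_gt0.
  have K0 : 0 <= `|K| / l `^ q by rewrite divr_ge0 ?powR_ge0.
  apply: (@le_lt_trans _ _ (`|K| / l `^ q)%:E); last exact: ltry.
  apply: le_trans (sub _ K0); apply: subset_integralT => //.
  + exact: (@measurable_sublevel _ TR R (ray 0%R) L (mray 0) mL).
  + exact: mfE.
  move=> x [x0 lx]; split => //=; rewrite ler_pdivlMr//.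
  apply: (@le_trans _ _ (L x * g x `^ q)).
    apply: ler_wpM2l => //; apply: ge0_ler_powR; rewrite ?nnegrE ?(ltW l0) ?(ltW q0)//.
    exact: ltW (g0 (ray0E x0)).
  by apply: (le_trans (Lg (ray0E x0))); exact: ler_norm.
- move=> l x l0 [x0 lx]; rewrite -(LE _ (ray0E x0)); apply: subset_integralT => //; first exact: mfE.
  move=> y [y0 yx]; split => //=; apply: (le_trans lx); apply: gmono => //; exact: ray0E.
move=> N l e m l0 e0 mm m0 Hm.
have /choice[H HH] : forall i : nat, exists h : TR -> R, [/\ measurable_fun setT h, forall z, 0 <= h z,
    (\int[mu]_(z in ray 0%R) (h z * v z)%:E <= 1)%E &
    forall t : R, 0 < t -> l i <= g t -> ((kap t * l i)%:E <= cc%:E * F h t `^ p^-1)%E].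
  move=> i; have [ex|no] := pselect (exists x : R, 0 < x /\ l i <= g x); first exact: sel.
  exists (cst 0); split => //.
    by under eq_integral do rewrite mul0r; rewrite integral0.
  by move=> t t0 lt; exfalso; apply: no; exists t.
have mH i : measurable_fun setT (H i) by case: (HH i).
have H0 i z : 0 <= H i z by case: (HH i).
have Hv i : (\int[mu]_(z in ray 0%R) (H i z * v z)%:E <= 1)%E by case: (HH i).
have Hl i (t : R) : 0 < t -> l i <= g t -> ((kap t * l i)%:E <= cc%:E * F (H i) t `^ p^-1)%E.
  by case: (HH i) => _ _ _; apply.
clear HH.
pose h z := \sum_(i < N) e i * H i z.
have mh : measurable_fun setT h by apply: measurable_sum => i; exact: measurable_funM.
have h0 z : 0 <= h z by apply: sumr_ge0 => i _; exact: mulr_ge0.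
have hv : (\int[mu]_(z in ray 0%R) (h z * v z)%:E <= (\sum_(i < N) e i)%:E)%E.
  have hvE t : ((h t * v t)%:E = \sum_(i < N) ((e i)%:E * (H i t * v t)%:E))%E.
    by rewrite /h mulr_suml -sumEFin; apply: eq_bigr => i _; rewrite -EFinM mulrA.
  under eq_integral do rewrite hvE.
  rewrite ge0_integral_sum//; last 2 first.
  - by move=> i; apply: emeasurable_funM => //; apply: mfE; exact: measurable_funM.
  - by move=> i t _; rewrite mule_ge0 ?lee_fin ?e0 ?(mulr_ge0 (H0 _ _) (v0 _)).
  rewrite -sumEFin; apply: lee_sum => i _; rewrite ge0_integralZl_EFin//.
  - by rewrite -[leRHS]mule1; apply: lee_wpmul2l; rewrite ?lee_fin.
  - by move=> t _; rewrite lee_fin (mulr_ge0 (H0 _ _) (v0 _)).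
  - by apply: mfE; exact: measurable_funM.
have S0 : 0 <= \sum_(i < N) e i by apply: sumr_ge0.
have F0 (t : R) : 0 < t -> (0 <= F h t)%E by exact: average_ge0.
have mF := measurable_average mh h0.
(* F is homogeneous of degree p and monotone in the nonnegative function, so one summand e i H i
   already gives this bound. *)
have Fi i (t : R) : (i < N)%N -> 0 < t -> ((e i)%:E * F (H i) t `^ p^-1 <= F h t `^ p^-1)%E.
  move=> iN t0.
  have FH0 : (0 <= F (H i) t)%E by exact: average_ge0.
  have -> : ((e i)%:E * F (H i) t `^ p^-1 = ((e i `^ p)%:E * F (H i) t) `^ p^-1)%E.
    by rewrite poweRM ?lee_fin ?powR_ge0// poweR_EFin -powRrM mulfV ?gt_eqF// powRr1.
  have eF0 : (0 <= (e i `^ p)%:E * F (H i) t)%E by apply: mule_ge0 => //; rewrite lee_fin powR_ge0.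
  apply: (le_poweR _ eF0); first by rewrite invr_ge0 ltW.
  rewrite /F /core_avg muleCA; apply: lee_wpmul2l; first by rewrite lee_fin invr_ge0 ltW// U0.
  have mHi (h' : TR -> R) : measurable_fun setT h' -> (forall z, 0 <= h' z) ->
      measurable_fun setT (fun s : TR => (\int[mu]_(z in ray s) (EFin \o h') z) `^ p * (u s)%:E)%E.
    move=> mh' h'0; apply: emeasurable_funM; last exact: mfE.
    apply: measurable_fun_poweR; apply: nonincreasing_emeasurable => x y xy.
    apply: subset_integralT => //; first exact: mfE.
    by move=> z; rewrite /ray/= !in_itv/= !andbT; exact: le_lt_trans.
  rewrite -integralZT; [|exact: mitv|exact: mHi|by move=> s; rewrite mule_ge0 ?poweR_ge0 ?lee_fin|exact: powR_ge0].
  apply: le_integralT; first exact: mitv.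
  - by apply: emeasurable_funM => //; exact: mHi.
  - exact: mHi.
  - by move=> s; rewrite !mule_ge0 ?poweR_ge0 ?lee_fin ?powR_ge0.
  move=> s _; rewrite muleA; apply: lee_wpmul2r; first by rewrite lee_fin.
  have Hi0 : (0 <= \int[mu]_(z in ray s) (EFin \o H i) z)%E by apply: integral_ge0 => z _; rewrite lee_fin.
  rewrite -poweR_EFin -poweRM ?lee_fin//.
  apply: le_poweR; [exact: ltW|by rewrite mule_ge0 ?lee_fin|].
  rewrite -integralZT; [|exact: mray|exact: mfE|by move=> z; rewrite lee_fin|exact: e0].
  apply: le_integralT; first exact: mray.
  - by apply: emeasurable_funM => //; exact: mfE.
  - exact: mfE.
  - by move=> z; rewrite mule_ge0 ?lee_fin.
  move=> z _; rewrite -EFinM lee_fin /h (bigD1 (Ordinal iN))//= lerDl.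
  by apply: sumr_ge0 => j _; exact: mulr_ge0.
have key : (\int[mu]_(x in ray 0%R) (m x `^ q * f x)%:E <=
   (cc `^ q)%:E * \int[mu]_(t in ray 0%R) (F h t `^ (q / p) * (w t)%:E))%E.
  have mFw : measurable_fun (ray 0%R : set TR) (fun t => F h t `^ (q / p) * (w t)%:E)%E.
    by apply: emeasurable_funM; [exact: measurable_fun_poweR|exact: mfE].
  rewrite -ge0_integralZl_EFin ?powR_ge0//; last by move=> t _; rewrite mule_ge0 ?poweR_ge0 ?lee_fin.
  apply: ge0_le_integral => //.
  - by move=> x _; rewrite lee_fin mulr_ge0 ?powR_ge0.
  - by apply: mfE; apply: measurable_funM => //; exact: (measurableT_comp (measurable_powR _)).
  - by apply: emeasurable_funM.
  move=> t rt; have t0 := ray0E rt.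
  rewrite /f mulrA -powRM// EFinM muleA; apply: lee_wpmul2r; first by rewrite lee_fin.
  have qE : q / p = p^-1 * q by rewrite mulrC.
  rewrite qE poweRrM -!poweR_EFin -poweRM ?poweR_ge0 ?lee_fin//.
  apply: le_poweR; rewrite ?(ltW q0) ?lee_fin ?mulr_ge0//.
  case: (Hm t rt) => [->|[i iN [[_ /= li] mi]]].
    by rewrite mul0r mule_ge0 ?poweR_ge0 ?lee_fin.
  apply: (@le_trans _ _ ((e i)%:E * (kap t * l i)%:E)%E).
    by rewrite -EFinM lee_fin mulrC mulrCA; apply: ler_wpM2l.
  apply: (@le_trans _ _ ((e i)%:E * (cc%:E * F (H i) t `^ p^-1))%E).
    by apply: lee_wpmul2l; rewrite ?lee_fin//; exact: Hl.
  by rewrite muleCA; apply: lee_wpmul2l; rewrite ?lee_fin//; exact: Fi.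
apply: (le_trans key).
have I0 : (0 <= \int[mu]_(t in ray 0%R) (F h t `^ (q / p) * (w t)%:E))%E.
  by apply: integral_ge0 => t _; rewrite mule_ge0 ?poweR_ge0 ?lee_fin.
rewrite -mulrA (powRM _ cc0) ?mulr_ge0// EFinM; apply: lee_wpmul2l; first by rewrite lee_fin powR_ge0.
rewrite -[leLHS](poweRVK _ I0 (e:=q)) ?gt_eqF// -poweR_EFin.
apply: le_poweR; rewrite ?(ltW q0) ?poweR_ge0//.
apply: (le_trans (hardy mh h0)); rewrite EFinM; apply: lee_wpmul2l; rewrite ?lee_fin//.
Qed.

End level_necessity.

(* The level sets of [psi ^ 1/r] are segments at 0 and those of
   [U ^ 1/p * psi ^ 1/r] are segments at infinity, so a test function attached to
   a point near the endpoint of such a segment serves the whole level set; the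
   endpoint is finite, resp. positive, because the measure is non-degenerate. *)
Section integral_necessity.
Hypothesis q1 : q < 1.
Variable psi : TR -> R.
Hypothesis psieE : forall x : R, 0 < x -> psie x = (psi x)%:E.
Hypotheses (mpsi : measurable_fun setT psi) (psi0 : forall x : R, 0 < x -> 0 < psi x).
Hypothesis psi_ni : forall x y : R, 0 < x -> x <= y -> psi y <= psi x.
Hypothesis M_nd : forall x y : R, 0 < x -> x <= y ->
  U x `^ (1 + r) * psi x <= U y `^ (1 + r) * psi y.
Hypothesis Uhalf : forall x : R, 0 < x -> exists2 s : R, 0 < s < x & U x <= 2 * U s.
Hypothesis Udouble : forall x : R, 0 < x -> exists2 s : R, x < s & U s <= 2 * U x.
Hypothesis left_unb : forall K : R, exists2 X : R, 0 < X &
  (K%:E < \int[mu]_(t in `]0%R, X]) (w t)%:E)%E.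
Hypothesis right_unb : forall K : R, exists2 X : R, 0 < X &
  (K%:E < \int[mu]_(t in `[X, +oo[) (U t `^ (- (q / p)) * w t)%:E)%E.

Let Ps (x : TR) := psi x `^ r^-1.
Let mPs : measurable_fun setT Ps. Proof. exact: (measurableT_comp (measurable_powR _)). Qed.
Let Ps0 (x : R) : 0 < x -> 0 < Ps x. Proof. by move=> x0; rewrite powR_gt0 ?psi0. Qed.
Let m (x : TR) := U x `^ p^-1 * Ps x.
Let mUe e : measurable_fun setT (fun x : TR => U x `^ e).
Proof. exact: (measurableT_comp (measurable_powR _)). Qed.
Let mm : measurable_fun setT m. Proof. exact: measurable_funM. Qed.
Let m0 (x : R) : 0 < x -> 0 < m x.
Proof. by move=> x0; exact: mulr_gt0 (powR_gt0 _ (U0 x0)) (Ps0 x0). Qed.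

(** The leading 2 pays for testing at psi(x)/2^r instead of psi(x), which halves psi^(1/r). Inside
    the power, C3 is the constant of the test functions and 2 the loss from choosing x near an
    endpoint. *)
Let nc := 2 * (2 * C3) `^ p^-1.
Let nc0 : 0 <= nc. Proof. by rewrite mulr_ge0 ?powR_ge0. Qed.

(** A test function exists only strictly below [psie x], hence the division by 2^r > 1.
    [average_min] transports its lower bound from [x] to every point of the level set. *)
Lemma select_test (g kap : TR -> R) (l x : R) : 0 < x ->
  (forall t : R, 0 < t -> l <= g t ->
    kap t * l <= (2 * Num.min 1 (U x / U t)) `^ p^-1 * Ps x) ->
  exists h : TR -> R, [/\ measurable_fun setT h, forall z, 0 <= h z,
    (\int[mu]_(z in ray 0%R) (h z * v z)%:E <= 1)%E &
    forall t : R, 0 < t -> l <= g t -> ((kap t * l)%:E <= nc%:E * F h t `^ p^-1)%E].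
Proof.
move=> x0 Hx; have ps := psi0 x0; have r2 : 0 < 2 `^ r :> R by rewrite powR_gt0.
pose y := psi x / 2 `^ r.
have y0 : 0 < y by rewrite divr_gt0.
have yx : (y%:E < psie x)%E.
  by rewrite psieE// lte_fin ltr_pdivrMr// ltr_pMr// powR2_gt1.
have [h [mh h0 hv hx]] := test x0 y0 yx.
exists h; split => // t t0 lt; have Ut := U0 t0; have Ux := U0 x0.
have Fx0 : (0 <= F h x)%E by exact: average_ge0.
have Psx : ((Ps x / 2)%:E <= (C3%:E * F h x) `^ p^-1)%E.
  have -> : (Ps x / 2)%:E = ((y `^ (1 - p))%:E `^ p^-1)%E.
    rewrite poweR_EFin -powRrM (_ : (1 - p) * p^-1 = r^-1); last by rewrite /r /star invf_div.
    by rewrite /y powRM ?invr_ge0 ?(ltW ps) ?(ltW r2)// powRV ?(ltW r2)// -powRrM mulfV ?gt_eqF// powRr1.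
  by apply: (le_poweR _ _ hx); rewrite ?invr_ge0 ?(ltW p0) ?lee_fin ?powR_ge0.
pose mn := Num.min 1 (U x / U t).
have mn0 : 0 <= mn by rewrite le_min ler01 divr_ge0 ?(ltW Ux) ?(ltW Ut).
apply: (@le_trans _ _ ((2 * mn) `^ p^-1 * Ps x)%:E); first by rewrite lee_fin; exact: Hx.
apply: (@le_trans _ _ ((2 * (2 * mn) `^ p^-1)%:E * (C3%:E * F h x) `^ p^-1)%E).
  have -> : (2 * mn) `^ p^-1 * Ps x = (2 * (2 * mn) `^ p^-1) * (Ps x / 2) by field.
  by rewrite EFinM; apply: lee_wpmul2l Psx; rewrite lee_fin mulr_ge0 ?powR_ge0.
have -> : ((2 * (2 * mn) `^ p^-1)%:E * (C3%:E * F h x) `^ p^-1 = nc%:E * (mn%:E * F h x) `^ p^-1)%E.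
  rewrite /nc (poweRM _ _ Fx0) ?lee_fin ?(ltW C30)// (poweRM _ _ Fx0) ?lee_fin// !poweR_EFin.
  rewrite !muleA -!EFinM (powRM _ (ler0n _ 2) mn0) (powRM _ (ler0n _ 2) (ltW C30)).
  by congr (_%:E * _)%E; ring.
apply: lee_wpmul2l; first by rewrite lee_fin.
apply: le_poweR; rewrite ?invr_ge0 ?(ltW p0)//; first by apply: mule_ge0; rewrite ?lee_fin.
exact: average_min.
Qed.

Let K0 := (C3 `^ p^-1 * c) `^ q.

(** The pointwise condition, which follows from the inequality for q < 1 as well. It serves to
    locate the level sets, not to bound the integral. *)
Lemma phi_Psi_le (x : R) : 0 < x -> phi x * Ps x `^ q <= K0.
Proof.
move=> x0; have ph := phi0 x0; have ph' : 0 < phi x `^ q^-1 by rewrite powR_gt0.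
have Cc : 0 <= C3 `^ p^-1 * c by rewrite mulr_ge0 ?powR_ge0.
have := pointwise_necessity x0; rewrite psieE// lee_fin => H.
have H1 : Ps x <= C3 `^ p^-1 * c / phi x `^ q^-1.
  have b0 : 0 <= C3 `^ p^-1 * c / phi x `^ q^-1 by rewrite divr_ge0// ltW.
  have -> : C3 `^ p^-1 * c / phi x `^ q^-1 = ((C3 `^ p^-1 * c / phi x `^ q^-1) `^ r) `^ r^-1.
    by rewrite -powRrM mulfV ?gt_eqF// powRr1.
  by apply: ge0_ler_powR; rewrite ?nnegrE ?invr_ge0 ?(ltW r0) ?powR_ge0 ?(ltW (psi0 _)).
have -> : phi x * Ps x `^ q = (phi x `^ q^-1 * Ps x) `^ q.
  by rewrite powRM ?powR_ge0// -powRrM mulVf ?gt_eqF// powRr1 ?(ltW ph).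
apply: ge0_ler_powR; rewrite ?nnegrE ?(ltW q0) ?mulr_ge0 ?powR_ge0//.
by rewrite mulrC -ler_pdivlMr.
Qed.

Let left_le (x : R) : 0 < x -> (\int[mu]_(t in `]0%R, x]) (w t)%:E <= (2 `^ (q / p) * phi x)%:E)%E.
Proof. exact: (left_mass_le p0 q0 mU U0 ndU mw w0 phiE). Qed.

Let right_le (x : R) : 0 < x -> (\int[mu]_(t in `[x, +oo[) (U t `^ (- (q / p)) * w t)%:E <=
    (2 `^ (q / p) * (U x `^ (- (q / p)) * phi x))%:E)%E.
Proof. exact: (right_mass_le p0 q0 mU U0 ndU mw w0 phiE). Qed.

Let mw2 : measurable_fun setT (fun t : TR => U t `^ (- (q / p)) * w t).
Proof. exact: measurable_funM. Qed.

Let w20 t : 0 <= U t `^ (- (q / p)) * w t. Proof. by rewrite mulr_ge0 ?powR_ge0. Qed.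

Let mq (x : R) : 0 < x -> m x `^ q = U x `^ (q / p) * Ps x `^ q.
Proof.
move=> x0; rewrite /m powRM ?powR_ge0// -powRrM; congr (_ `^ _ * _); exact: mulrC.
Qed.

Let UVq (x : R) : 0 < x -> U x `^ (- (q / p)) * U x `^ (q / p) = 1.
Proof. by move=> x0; rewrite powRN mulVf// gt_eqF// powR_gt0 ?U0. Qed.

Lemma select_left (l : R) : 0 < l -> (exists x : R, 0 < x /\ l <= Ps x) ->
  exists h : TR -> R, [/\ measurable_fun setT h, forall z, 0 <= h z,
    (\int[mu]_(z in ray 0%R) (h z * v z)%:E <= 1)%E &
    forall t : R, 0 < t -> l <= Ps t -> ((cst 1 t * l)%:E <= nc%:E * F h t `^ p^-1)%E].
Proof.
move=> l0 [x0 [x00 lx0]]; have lq : 0 < l `^ q by rewrite powR_gt0.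
pose S := [set x : R | 0 < x /\ l <= Ps x].
(* The number is the bound on the [w]-mass of (0, x] for every [x] in [S]; a point where it is
   exceeded bounds [S] from above. *)
have [X X0 HX] := left_unb (2 `^ (q / p) * (K0 / l `^ q)).
have hS : has_sup S.
  split; first by exists x0.
  exists X => x [x1 lx]; rewrite leNgt; apply/negP => Xx.
  move: HX; apply/negP; rewrite -leNgt.
  apply: (@le_trans _ _ (\int[mu]_(t in `]0%R, x]) (w t)%:E)%E).
    apply: subset_integralT => //; first exact: mfE.
    by move=> t; rewrite /= !in_itv/= => /andP[-> tX]; apply: (le_trans tX); exact: ltW.
  apply: (le_trans (left_le x1)); rewrite lee_fin; apply: ler_wpM2l; first exact: powR_ge0.
  rewrite ler_pdivlMr//; apply: le_trans (phi_Psi_le x1).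
  apply: ler_wpM2l; first exact: ltW (phi0 x1).
  by apply: ge0_ler_powR; rewrite ?nnegrE ?(ltW q0) ?(ltW l0) ?(ltW (Ps0 x1)).
have T0 : 0 < sup S by apply: (lt_le_trans x00); apply: ub_le_sup => //; case: hS.
have [s /andP[s0 sT] Us] := Uhalf T0.
have [|x [x1 lx] sx] := @sup_adherent _ S (sup S - s) _ hS; first by rewrite subr_gt0.
rewrite subKr in sx.
apply: (@select_test _ _ l x) => // t t0 lt; rewrite mul1r.
have Ut := U0 t0; have Ux := U0 x1.
(* The point [x] is so close to the supremum that U at most doubles on the part of the level set
   beyond it. *)
have Utx : U t <= 2 * U x.
  apply: (@le_trans _ _ (U (sup S))); first by apply: ndU => //; apply: ub_le_sup => //; case: hS.
  by apply: (le_trans Us); apply: ler_wpM2l => //; apply: ndU => //; exact: ltW.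
apply: (le_trans lx); rewrite -[leLHS]mul1r; apply: ler_wpM2r; first exact: ltW (Ps0 x1).
apply: powR_ge1; last by rewrite invr_ge0 ltW.
have : 2^-1 <= Num.min 1 (U x / U t).
  by rewrite le_min invf_le1// ler1n/= ler_pdivlMr// mulrC ler_pdivrMr// mulrC.
by rewrite -(ler_pM2l (ltr0Sn R 1)) mulfV ?pnatr_eq0.
Qed.

Let kap2 (t : TR) := U t `^ (- p^-1).

Lemma select_right (l : R) : 0 < l -> (exists x : R, 0 < x /\ l <= m x) ->
  exists h : TR -> R, [/\ measurable_fun setT h, forall z, 0 <= h z,
    (\int[mu]_(z in ray 0%R) (h z * v z)%:E <= 1)%E &
    forall t : R, 0 < t -> l <= m t -> ((kap2 t * l)%:E <= nc%:E * F h t `^ p^-1)%E].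
Proof.
move=> l0 [x0 [x00 lx0]]; have lq : 0 < l `^ q by rewrite powR_gt0.
pose S := [set x : R | 0 < x /\ l <= m x].
(* Symmetric choice: here the excess mass keeps [S] away from 0, so that its infimum is positive. *)
have [X X0 HX] := right_unb (2 `^ (q / p) * (K0 / l `^ q)).
have SX x : S x -> X <= x.
  move=> [x1 lx]; rewrite leNgt; apply/negP => xX.
  move: HX; apply/negP; rewrite -leNgt.
  apply: (@le_trans _ _ (\int[mu]_(t in `[x, +oo[) (U t `^ (- (q / p)) * w t)%:E)%E).
    apply: subset_integralT => //; first exact: mfE.
    by move=> t; rewrite /= !in_itv/= !andbT; apply: le_trans; exact: ltW.
  apply: (le_trans (right_le x1)); rewrite lee_fin; apply: ler_wpM2l; first exact: powR_ge0.
  rewrite ler_pdivlMr//; apply: le_trans (phi_Psi_le x1).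
  apply: (@le_trans _ _ (U x `^ (- (q / p)) * phi x * m x `^ q)).
    apply: ler_wpM2l; first by rewrite mulr_ge0 ?powR_ge0 ?(ltW (phi0 x1)).
    by apply: ge0_ler_powR; rewrite ?nnegrE ?(ltW q0) ?(ltW l0) ?(ltW (m0 x1)).
  rewrite mq// mulrACA UVq// mul1r//.
have hS : has_inf S by split; [exists x0|exists X => x; exact: SX].
have T0 : 0 < inf S by apply: (lt_le_trans X0); apply: lb_le_inf; [exists x0|move=> x; exact: SX].
have [s sT Us] := Udouble T0.
have [|x [x1 lx] sx] := @inf_adherent _ S (s - inf S) _ hS; first by rewrite subr_gt0.
rewrite addrC subrK in sx.
apply: (@select_test _ _ l x) => // t t0 lt.
have Ut := U0 t0; have Ux := U0 x1.
have Uxt : U x <= 2 * U t.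
  apply: (@le_trans _ _ (U s)); first by apply: ndU => //; exact: ltW.
  by apply: (le_trans Us); apply: ler_wpM2l => //; apply: ndU => //; apply: ge_inf => //; case: hS.
apply: (@le_trans _ _ (kap2 t * m x)); first by apply: ler_wpM2l; rewrite ?powR_ge0.
rewrite /m mulrA; apply: ler_wpM2r; first exact: ltW (Ps0 x1).
rewrite /kap2 powRN -powRV ?(ltW Ut)// -powRM ?invr_ge0 ?(ltW Ut) ?(ltW Ux)//.
have rt0 : 0 <= U x / U t by rewrite divr_ge0 ?(ltW Ut) ?(ltW Ux).
have rt2 : U x / U t <= 2 by rewrite ler_pdivrMr.
apply: ge0_ler_powR; rewrite ?nnegrE ?invr_ge0 ?(ltW p0)//.
- by rewrite mulrC.
- by rewrite mulr_ge0// le_min ler01.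
- rewrite mulrC minEle; case: ifPn => _; first by rewrite mulr1.
  by rewrite mulr_natl mulr2n lerDl.
Qed.

(** The second factor is the constant of [level_necessity] with [cc] equal to [nc], and [c] taken
    out. The first is the power 1/k of 2^k, from adding under the power k, times 2, for the two
    families of segments (k = [star q]). *)
Definition nec_const : R := (2 `^ star q * 2) `^ (star q)^-1 *
  (2 * (2 * (2 * C3) `^ p^-1 * (2 `^ (star q + 1) * (2 `^ star q / (2 `^ star q - 1))))).

Lemma integral_necessity : measurable_fun setT phi ->
  (\int[mu]_(x in ray 0%R) ((phi x * Ps x) `^ star q * w x)%:E <=
   ((nec_const * c) `^ star q)%:E)%E.
Proof.
move=> mphi; pose k := star q.
have k0 : 0 < k by rewrite divr_gt0 ?subr_gt0.
have ray0E (x : R) : ray 0%R x -> 0 < x by rewrite /ray/= in_itv/= andbT.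
have segL (x : R) : 0 < x -> ray 0%R `&` segment true x = `]0%R, x]%classic.
  move=> x0; apply/seteqP; split => t; rewrite /ray/= !in_itv/= ?andbT.
    by move=> [-> tx]; rewrite andTb.
  by move=> /andP[-> tx].
have segR (x : R) : 0 < x -> ray 0%R `&` segment false x = `[x, +oo[%classic.
  move=> x0; apply/seteqP; split => t; rewrite /ray/= !in_itv/= ?andbT.
    by move=> [].
  by move=> xt; split => //; exact: lt_le_trans xt.
pose f1 (t : TR) := cst 1 t `^ q * w t.
pose f2 (t : TR) := kap2 t `^ q * w t.
have f1E t : f1 t = w t by rewrite /f1 powR1 mul1r.
have f2E t : f2 t = U t `^ (- (q / p)) * w t.
  by rewrite /f2 /kap2 -powRrM mulNr (mulrC _ q).
have f20 t : 0 <= f2 t by rewrite f2E.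
pose L1 (x : TR) := fine (\int[mu]_(y in ray 0%R `&` segment true x) (f1 y)%:E)%E.
pose L2 (x : TR) := fine (\int[mu]_(y in ray 0%R `&` segment false x) (f2 y)%:E)%E.
have E1 (x : R) : 0 < x -> (\int[mu]_(y in ray 0%R `&` segment true x) (f1 y)%:E = \int[mu]_(t in `]0%R, x]) (w t)%:E)%E.
  by move=> x0; rewrite (segL x x0); apply: eq_integral => t _; congr EFin; exact: f1E.
have E2 (x : R) : 0 < x -> (\int[mu]_(y in ray 0%R `&` segment false x) (f2 y)%:E =
    \int[mu]_(t in `[x, +oo[) (U t `^ (- (q / p)) * w t)%:E)%E.
  by move=> x0; rewrite (segR x x0); apply: eq_integral => t _; congr EFin; exact: f2E.
have fin1 (x : R) : 0 < x -> (\int[mu]_(y in ray 0%R `&` segment true x) (f1 y)%:E < +oo)%E.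
  by move=> x0; rewrite E1//; exact: le_lt_trans (left_le x0) (ltry _).
have fin2 (x : R) : 0 < x -> (\int[mu]_(y in ray 0%R `&` segment false x) (f2 y)%:E < +oo)%E.
  by move=> x0; rewrite E2//; exact: le_lt_trans (right_le x0) (ltry _).
have L1E (x : R) : 0 < x -> (\int[mu]_(t in `]0%R, x]) (w t)%:E = (L1 x)%:E)%E.
  move=> x0; rewrite /L1 fineK ?E1// ge0_fin_numE -?E1// ?fin1//.
  by rewrite E1//; apply: integral_ge0 => t _; rewrite lee_fin.
have L2E (x : R) : 0 < x -> (\int[mu]_(t in `[x, +oo[) (U t `^ (- (q / p)) * w t)%:E = (L2 x)%:E)%E.
  move=> x0; rewrite /L2 fineK ?E2// ge0_fin_numE -?E2// ?fin2//.
  by rewrite E2//; apply: integral_ge0 => t _; rewrite lee_fin.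
have L1le (x : R) : 0 < x -> L1 x <= 2 `^ (q / p) * phi x.
  by move=> x0; rewrite -lee_fin -L1E// left_le.
have L2le (x : R) : 0 < x -> L2 x <= 2 `^ (q / p) * (U x `^ (- (q / p)) * phi x).
  by move=> x0; rewrite -lee_fin -L2E// right_le.
have Lg1 (x : R) : 0 < x -> L1 x * Ps x `^ q <= 2 `^ (q / p) * K0.
  move=> x0; apply: (le_trans (ler_wpM2r (powR_ge0 _ _) (L1le x x0))).
  by rewrite -mulrA; apply: ler_wpM2l; [exact: powR_ge0|exact: phi_Psi_le].
have Lg2 (x : R) : 0 < x -> L2 x * m x `^ q <= 2 `^ (q / p) * K0.
  move=> x0; apply: (le_trans (ler_wpM2r (powR_ge0 _ _) (L2le x x0))).
  by rewrite -mulrA mq// mulrACA UVq// mul1r; apply: ler_wpM2l; [exact: powR_ge0|exact: phi_Psi_le].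
have Ps_mono (x y : R) : 0 < x -> 0 < y -> ord true x y -> Ps y <= Ps x.
  move=> x0 y0 /= xy; apply: ge0_ler_powR; rewrite ?nnegrE ?(ltW (psi0 _)) ?invr_ge0 ?(ltW r0)//.
  exact: psi_ni.
have mE (x : R) : 0 < x -> m x = (U x `^ (1 + r) * psi x) `^ r^-1.
  move=> x0; rewrite /m /Ps powRM ?powR_ge0 ?(ltW (psi0 _))// -powRrM; congr (_ `^ _ * _).
  by rewrite /r /star; field; rewrite subr_eq0 !gt_eqF.
have m_mono (x y : R) : 0 < x -> 0 < y -> ord false x y -> m y <= m x.
  move=> x0 y0 /= yx; rewrite !mE//.
  apply: ge0_ler_powR; rewrite ?nnegrE ?mulr_ge0 ?powR_ge0 ?(ltW (psi0 _)) ?invr_ge0 ?(ltW r0)//.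
  exact: M_nd.
pose B := (2 * (nc * c * (2 `^ (k + 1) * (2 `^ k / (2 `^ k - 1))))) `^ k.
have J1 : (\int[mu]_(x in ray 0%R) ((L1 x * Ps x) `^ k * f1 x)%:E <= B%:E)%E.
  exact: (@level_necessity q1 true (cst 1) Ps _ nc (measurable_cst _) (fun _ => ler01) mPs Ps0 Ps_mono fin1 Lg1 nc0 select_left).
have J2 : (\int[mu]_(x in ray 0%R) ((L2 x * m x) `^ k * f2 x)%:E <= B%:E)%E.
  exact: (@level_necessity q1 false kap2 m _ nc (mUe _) (fun _ => powR_ge0 _ _) mm m0 m_mono fin2 Lg2 nc0 select_right).
have L10 x : 0 <= L1 x by apply: segment_mass_ge0 => y; rewrite f1E.
have L20 x : 0 <= L2 x by apply: segment_mass_ge0.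
have mf1 : measurable_fun setT f1 by rewrite (_ : f1 = w)//; apply/funext => t; exact: f1E.
have mf2 : measurable_fun setT f2.
  by rewrite (_ : f2 = (fun t => U t `^ (- (q / p)) * w t))//; apply/funext => t; exact: f2E.
have mL1 : measurable_fun setT L1 by apply: measurable_segment_mass => // y; rewrite f1E.
have mL2 : measurable_fun setT L2 by exact: measurable_segment_mass.
(* The kernel is at most 1 before [x] and at most (U x / U s)^(q/p) after it, so [phi] is bounded by
   one segment mass of each kind. *)
have phi_le (x : R) : 0 < x -> phi x <= L1 x + U x `^ (q / p) * L2 x.
  move=> x0; have Ux := U0 x0.
  rewrite -lee_fin (EFinD (L1 x)) (EFinM (U x `^ (q / p))).
  rewrite -[X in (_ <= X + _)%E](L1E x x0) -[X in (_ <= _ + _ * X)%E](L2E x x0) -[leLHS](phiE x0).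
  have sp : ray 0%R = `]0%R, x[%classic `|` `[x, +oo[%classic :> set TR.
    apply/seteqP; split => s; rewrite /ray/= !in_itv/= ?andbT.
      by move=> s0; case: (ltP s x) => sx; [left; rewrite s0|right].
    by move=> [/andP[]|xs]//; exact: lt_le_trans xs.
  have dj : [disjoint `]0%R, x[%classic & `[x, +oo[%classic].
    apply/disj_set2P/seteqP; split => // s []; rewrite /= !in_itv/= andbT => /andP[_ st] ts.
    by move: (lt_le_trans st ts); rewrite ltxx.
  have mk : measurable_fun (ray 0%R : set TR) (fun s : TR => ((U x / (U s + U x)) `^ (q / p) * w s)%:E).
    apply/measurable_EFinP; apply: measurable_funM; last exact: measurable_funTS.
    apply: (measurableT_comp (measurable_powR _)); apply: measurable_funM => //.
    apply: ge0_measurable_funV => //.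
      by move=> t /ray0E t0; rewrite addr_ge0 ?ltW ?U0.
    by apply: measurable_funTS; exact: measurable_funD.
  have kE0 (s : TR) : (0 <= ((U x / (U s + U x)) `^ (q / p) * w s)%:E)%E by rewrite lee_fin mulr_ge0 ?powR_ge0.
  have mkA (A : set TR) : measurable A -> A `<=` ray 0%R ->
      measurable_fun A (fun s : TR => ((U x / (U s + U x)) `^ (q / p) * w s)%:E).
    by move=> mA Ar; exact: measurable_funS mk.
  have sub1 : `]0%R, x[%classic `<=` (ray 0%R : set TR).
    by move=> t; rewrite /ray/= !in_itv/= andbT => /andP[].
  have sub2 : `[x, +oo[%classic `<=` (ray 0%R : set TR).
    by move=> t; rewrite /ray/= !in_itv/= !andbT; exact: lt_le_trans.
  rewrite [in leLHS]sp ge0_integral_setU; [|exact: mitv|exact: mitv|by rewrite -sp|by move=> s _; exact: kE0|exact: dj].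
  apply: leeD.
    apply: (@le_trans _ _ (\int[mu]_(t in `]0%R, x[) (w t)%:E)%E).
      apply: ge0_le_integral; [exact: mitv|by move=> s _; exact: kE0|exact: mkA|exact: mfE|].
      move=> s /sub1/ray0E s0; have Us := U0 s0; rewrite lee_fin ler_piMl//.
      have k1 : 0 <= U x / (U s + U x) by rewrite divr_ge0 ?addr_ge0 ?(ltW Us) ?(ltW Ux).
      apply: (@le_trans _ _ (1 `^ (q / p))); last by rewrite powR1.
      apply: ge0_ler_powR; rewrite ?(ltW qp0) ?nnegrE//.
      by rewrite ler_pdivrMr ?addr_gt0// mul1r lerDr ltW.
    apply: subset_integralT; [exact: mitv|exact: mitv|exact: mfE|by move=> s; rewrite lee_fin|].
    by move=> t; rewrite /= !in_itv/= => /andP[-> /ltW].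
  rewrite -integralZT; [|exact: mitv|exact: mfE|by move=> s; rewrite lee_fin|exact: powR_ge0].
  apply: ge0_le_integral; [exact: mitv|by move=> s _; exact: kE0|exact: mkA| |].
    by apply: emeasurable_funM; [exact: measurable_cst|exact: mfE].
  move=> s /sub2/ray0E s0; have Us := U0 s0; rewrite -EFinM lee_fin mulrA; apply: ler_wpM2r => //.
  have k1 : 0 <= U x / (U s + U x) by rewrite divr_ge0 ?addr_ge0 ?(ltW Us) ?(ltW Ux).
  rewrite powRN -powRV ?(ltW Us)// -powRM ?invr_ge0 ?(ltW Us) ?(ltW Ux)//.
  have k2 : 0 <= U x / U s by rewrite divr_ge0 ?(ltW Us) ?(ltW Ux).
  apply: ge0_ler_powR; rewrite ?(ltW qp0) ?nnegrE ?k1 ?k2//.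
  by apply: ler_wpM2l; rewrite ?(ltW Ux)// lef_pV2 ?posrE ?addr_gt0// lerDl ltW.
have mJ (a b f : TR -> R) : measurable_fun setT a -> measurable_fun setT b -> measurable_fun setT f ->
    measurable_fun setT (fun x => (a x * b x) `^ k * f x).
  move=> ma mb mf; apply: measurable_funM => //; apply: (measurableT_comp (measurable_powR _)).
  exact: measurable_funM.
have mJ1 := mJ L1 Ps f1 mL1 mPs mf1.
have mJ2 := mJ L2 m f2 mL2 mm mf2.
have j10 x : 0 <= (L1 x * Ps x) `^ k * f1 x by rewrite f1E mulr_ge0 ?powR_ge0.
have j20 x : 0 <= (L2 x * m x) `^ k * f2 x by exact: mulr_ge0 (powR_ge0 _ _) (f20 x).
have pw (x : TR) : ray 0%R x -> (phi x * Ps x) `^ k * w x <=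
    2 `^ k * ((L1 x * Ps x) `^ k * f1 x + (L2 x * m x) `^ k * f2 x).
  move=> /ray0E x0; have Ux := U0 x0; have ph := ltW (phi0 x0); have Px := ltW (Ps0 x0).
  have UL : 0 <= U x `^ (q / p) * L2 x * Ps x by rewrite (mulr_ge0 (mulr_ge0 (powR_ge0 _ _) (L20 x)) Px).
  have LP : 0 <= L1 x * Ps x by exact: mulr_ge0.
  apply: (@le_trans _ _ ((L1 x * Ps x + U x `^ (q / p) * L2 x * Ps x) `^ k * w x)).
    apply: ler_wpM2r => //; apply: ge0_ler_powR; rewrite ?nnegrE ?(ltW k0) ?(mulr_ge0 ph Px) ?(addr_ge0 LP UL)//.
    by rewrite -mulrDl; apply: ler_wpM2r => //; exact: phi_le.
  have H : (L1 x * Ps x + U x `^ (q / p) * L2 x * Ps x) `^ k <=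
      2 `^ k * ((L1 x * Ps x) `^ k + (U x `^ (q / p) * L2 x * Ps x) `^ k).
    exact: powRD_le.
  apply: (le_trans (ler_wpM2r (w0 x) H)); rewrite -(mulrA (2 `^ k)); apply: ler_wpM2l; first exact: powR_ge0.
  rewrite mulrDl f1E lerD2l le_eqVlt; apply/orP; left; apply/eqP.
  rewrite f2E mulrA; congr (_ * _).
  (* Part of the power of U is absorbed in [m]; the remaining exponent (q-1)/p, multiplied by k, is
     -q/p and turns [w] into the weight [f2]. *)
  have -> : U x `^ (q / p) * L2 x * Ps x = U x `^ ((q - 1) / p) * (L2 x * m x).
    rewrite /m (_ : q / p = (q - 1) / p + p^-1); last by field; rewrite gt_eqF.
    by rewrite powRDgt0//; ring.
  rewrite (powRM _ (powR_ge0 _ _) (mulr_ge0 (L20 x) (ltW (m0 x0)))) -powRrM mulrC; congr (_ * _ `^ _).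
  by rewrite /k /star; field; rewrite subr_eq0 !gt_eqF.
have f0 x : 0 <= (phi x * Ps x) `^ k * w x by exact: mulr_ge0 (powR_ge0 _ _) (w0 x).
apply: (le_trans (integral_le_sum (mray 0) (mJ phi Ps w mphi mPs mw) mJ1 mJ2 f0 j10 j20 (powR_ge0 2 k) pw J1 J2)).
rewrite lee_fin.
have B20 : 0 <= 2 `^ (k + 1) * (2 `^ k / (2 `^ k - 1)) :> R.
  by rewrite !mulr_ge0 ?powR_ge0// invr_ge0 subr_ge0 ltW// powR2_gt1.
have X0 : 0 <= 2 * (nc * (2 `^ (k + 1) * (2 `^ k / (2 `^ k - 1)))).
  by apply: mulr_ge0 => //; exact: mulr_ge0.
rewrite /nec_const -/k -/nc.
rewrite (powRM _ (mulr_ge0 (powR_ge0 _ _) X0) c0) (powRM _ (powR_ge0 _ _) X0) -powRrM mulVf ?gt_eqF// powRr1; last first.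
  by rewrite mulr_ge0 ?powR_ge0.
have -> : B = (2 * (nc * (2 `^ (k + 1) * (2 `^ k / (2 `^ k - 1))))) `^ k * c `^ k.
  by rewrite -powRM// /B; congr (_ `^ _); ring.
by rewrite le_eqVlt; apply/orP; left; apply/eqP; ring.
Qed.

End integral_necessity.

End necessity.

(** * Facts about the weights *)

Section vlow_facts.
Context {R : realType}.
Local Notation TR := (measurableTypeR R).
Local Notation mu := (@lebesgue_measure R).
Variable v : R -> R.
Hypotheses (mv : measurable_fun (ray 0%R : set TR) v) (v0 : forall t, 0 < t -> 0 <= v t).

Let mray (x : R) : measurable (ray x : set TR).
Proof. exact: measurable_itv. Qed.
Let mitv (i : interval R) : measurable ([set` i] : set TR).
Proof. exact: measurable_itv. Qed.

Let v' : TR -> R := v \_ (ray 0%R).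
Let mv' : measurable_fun setT v'.
Proof. by apply/(measurable_restrictT _ _).1. Qed.
Let v'0 z : 0 <= v' z.
Proof. by rewrite /v' patchE; case: ifPn => // /[!inE]; rewrite /ray/= in_itv/= andbT => /v0. Qed.

(** The bump is the normalized indicator of a set where 1/v > k beyond [s]. This set has positive
    measure because [k] is below the essential supremum; intersecting it with a bounded interval
    makes the measure finite without making it null. *)
Lemma exists_bump (s k : R) : 0 < s -> 0 < k -> (k%:E < vlow v (`]s, +oo[))%E ->
  exists g : TR -> R, [/\ measurable_fun setT g, forall z, 0 <= g z,
    (\int[mu]_(z in ray 0%R) (g z * (v \_ (ray 0%R)) z)%:E <= (k^-1)%:E)%E &
    (1 <= \int[mu]_(z in ray s) (g z)%:E)%E].
Proof.
move=> s0 k0 kv.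
have E0 := vlow_gt_measure mv v0 (ltW s0) (ltW k0) kv.
pose E (n : nat) : set TR := `]s, n%:R]%classic `&` [set z : TR | v' z * k < 1].
have mE n : measurable (E n).
  apply: measurableI => //; rewrite -[X in measurable X]setTI.
  by apply: measurable_fun_ltr => //; exact: measurable_funM.
have v'E z : s < z -> v' z = v z.
  by move=> sz; rewrite /v' patchE mem_set// /ray/= in_itv/= andbT (lt_trans s0).
have [n En] : exists n, (0 < mu (E n))%E.
  apply/not_existsP => H; move: E0; apply/negP; rewrite -leNgt.
  have EE : ray s `&` [set z | v z * k < 1] = \bigcup_n E n.
    apply/seteqP; split => [z [+ /= zk]|z [n _ [+ /= zk]]]; rewrite /ray/= !in_itv/= ?andbT.
      move=> sz; exists (Num.truncn z).+1 => //; split => /=; last by rewrite v'E.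
      have /andP[_ h'] := truncn_itv (ltW (lt_trans s0 sz)).
      by rewrite in_itv/= sz ltW.
    by move=> /andP[sz _]; split; rewrite ?in_itv/= ?sz// -v'E.
  rewrite EE -[leLHS]mul1e -(integral_cst mu _ 1%E); last exact: bigcup_measurable.
  apply: integral_bigcup_le => //.
    move=> i j ij; apply/subsetPset => z [+ zk]; rewrite /= in_itv/= => /andP[sz zi].
    by split => //; rewrite /= in_itv/= sz (le_trans zi)// ler_nat.
  by move=> i; rewrite integral_cst// mul1e leNgt; apply/negP; exact: H.
have Efin : (mu (E n) < +oo)%E.
  apply: (@le_lt_trans _ _ (mu `]s, n%:R]%classic)).
    by apply: le_measure; rewrite ?inE// => z [].
  by rewrite lebesgue_measure_itv/=; case: ifPn => _; rewrite ?ltry// -EFinB ltry.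
have mufin : mu (E n) \is a fin_num by rewrite ge0_fin_numE.
pose e := fine (mu (E n)).
have e0 : 0 < e by rewrite fine_gt0// En.
have eE : mu (E n) = e%:E by rewrite fineK.
have ei0 : 0 <= e^-1 by rewrite invr_ge0 ltW.
pose g (z : TR) := e^-1 * \1_(E n) z.
have m1 : measurable_fun setT (fun z : TR => (\1_(E n) z)%:E : \bar R).
  by apply/measurable_EFinP; exact: measurable_indic.
have gE (D : set TR) : measurable D -> E n `<=` D -> (\int[mu]_(z in D) (g z)%:E = 1)%E.
  move=> mD ED; rewrite (eq_integral (fun z => (e^-1)%:E * (\1_(E n) z)%:E)%E); last by move=> z _; rewrite -EFinM.
  rewrite integralZT//.
  rewrite integral_indic// (setIidl ED); transitivity ((e^-1)%:E * e%:E)%E.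
    by congr (_ * _)%E.
  by rewrite -EFinM mulVf// gt_eqF.
have mg : measurable_fun setT g by apply: measurable_funM => //; exact: measurable_indic.
have g0 z : 0 <= g z by rewrite mulr_ge0.
have Er z : E n z -> s < z by move=> [+ _]; rewrite /= in_itv/= => /andP[].
exists g; split => //; last first.
  by rewrite gE// => z /Er sz; rewrite /ray/= in_itv/= sz.
rewrite -/v'; apply: (@le_trans _ _ (\int[mu]_(z in ray 0%R) ((k^-1)%:E * (g z)%:E))%E).
  apply: le_integralT => //.
  - by apply/measurable_EFinP; exact: measurable_funM.
  - by apply: emeasurable_funM => //; exact/measurable_EFinP.
  - by move=> z; rewrite lee_fin mulr_ge0.
  move=> z _; rewrite -EFinM lee_fin /g indicE.
  have [/[!inE] Ez|_] := boolP (z \in E n); last by rewrite !mulr0 mul0r.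
  case: Ez => _ /= /ltW vk; rewrite mulr1 mulrC; apply: ler_wpM2r => //.
  by rewrite -[leRHS]mul1r ler_pdivlMr.
rewrite integralZT//; [|exact/measurable_EFinP|by rewrite invr_ge0 ltW].
by rewrite gE ?mule1// => z /Er sz; rewrite /ray/= in_itv/= (lt_trans s0).
Qed.

Hypothesis vlim : vlow v (`]t, +oo[) @[t --> +oo] --> 0%E.
Hypothesis voo : forall t, 0 < t -> (vlow v (`]t, +oo[) < +oo)%E.

Let vfin (t : R) : 0 < t -> vlow_left v t \is a fin_num.
Proof. exact: vlow_left_fin. Qed.

(** The masses of [a, a + n + 1) increase to that of the tail, and the subtracted boundary value
    tends to 0 because the essential supremum does. *)
Lemma left_stieltjes_tail (r a : R) : 0 < r -> 0 < a ->
  left_stieltjes (vlow_distr v r) `[a, +oo[%classic = (fine (vlow_left v a) `^ r)%:E.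
Proof.
move=> r0 a0; pose F (n : nat) : set TR := `[a, a + n.+1%:R[%classic.
have mF n : measurable (F n) by exact: mitv.
have FE : `[a, +oo[%classic = \bigcup_n F n :> set TR.
  apply/seteqP; split => [z|z [n _]]; rewrite /F/= !in_itv/= ?andbT.
    move=> az; exists (Num.truncn (z - a)) => //; rewrite /= in_itv/= az -ltrBlDl.
    have za : 0 <= z - a by rewrite subr_ge0.
    by have /andP[] := truncn_itv za.
  by move=> /andP[].
have b0 (n : nat) : a < a + n.+1%:R by rewrite ltrDl ltr0n.
have muF n : left_stieltjes (vlow_distr v r) (F n) =
    (fine (vlow_left v a) `^ r - fine (vlow_left v (a + n.+1%:R)) `^ r)%:E.
  rewrite left_stieltjes_itv//; last exact: left_cumulative_vlow_distr.
  by rewrite /vlow_distr opprK addrC.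
have C1 : left_stieltjes (vlow_distr v r) (F n) @[n --> \oo] --> left_stieltjes (vlow_distr v r) (\bigcup_n F n).
  apply: nondecreasing_cvg_mu => //; first by rewrite -FE; exact: mitv.
  move=> i j ij; apply/subsetPset => z; rewrite /F/= !in_itv/= => /andP[-> zi].
  by rewrite (lt_le_trans zi)// lerD2l ler_nat.
rewrite FE; apply: (cvg_unique _ C1) => //.
rewrite (_ : (fun n => _) = (fun n => (fine (vlow_left v a) `^ r - fine (vlow_left v (a + n.+1%:R)) `^ r)%:E)); last first.
  by apply/funext => n; exact: muF.
apply: cvg_EFin; first by apply: nearW.
rewrite -[X in _ --> X]subr0; apply: cvgB; first exact: cvg_cst.
rewrite -(@powR0 _ r) ?gt_eqF//.
pose b (n : nat) : R := fine (vlow_left v (a + n.+1%:R)).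
apply: (@cvg_powR R (b @ \oo) _ id 0 r r0 (lexx 0)).
  suff bn : \forall n \near \oo, 0 <= b n by exact: bn.
  by apply: nearW => n; rewrite /b fine_ge0// vlow_left_ge0// (lt_trans a0).
apply/cvgrPdist_lt => e e0.
have [B B0 HB] := vlow_small vlim e0.
suff bn : \forall n \near \oo, `|0 - b n| < e by exact: bn.
near=> n.
have an : B < a + n.+1%:R.
  apply: (@lt_le_trans _ _ (a + n%:R)); last by rewrite lerD2l ler_nat.
  rewrite -ltrBlDl; apply: (@le_lt_trans _ _ B); first by rewrite gerBl ltW.
  by near: n; exact: nbhs_infty_gtr.
have n0 : 0 < a + n.+1%:R by exact: lt_trans (b0 _).
rewrite /b sub0r normrN ger0_norm ?fine_ge0 ?vlow_left_ge0//.
by rewrite -lte_fin fineK ?vfin// HB.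
Unshelve. all: by end_near. Qed.

End vlow_facts.

Section primitive_facts.
Context {R : realType}.
Local Notation TR := (measurableTypeR R).
Local Notation mu := (@lebesgue_measure R).
Variable u : R -> R.
Hypotheses (wu : weight u) (Upos : forall t, 0 < t -> 0 < Uint u t)
  (adm : admissible_prim (Uint u)).

Let U : TR -> R := Uint u.

(** Extending a weight by 0 off (0, oo) provides the global measurability and sign that the abstract
    sections assume, without affecting any of the integrals. *)
Lemma weight_restrict (w : R -> R) : weight w ->
  measurable_fun setT (w \_ (ray 0%R) : TR -> R) /\ forall x, 0 <= (w \_ (ray 0%R)) x.
Proof.
move=> [[mw _ _] w0]; split.
  by apply/(measurable_restrictT _ _).1 => //; exact: measurable_itv.
by move=> x; rewrite patchE; case: ifPn => // /[!inE]; rewrite /ray/= in_itv/= andbT => /w0.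
Qed.

Lemma restrictE (w : R -> R) (x : R) : 0 < x -> (w \_ (ray 0%R)) x = w x.
Proof. by move=> x0; rewrite patchE mem_set// /ray/= in_itv/= x0. Qed.

Lemma UintE (x : R) : 0 < x ->
  (\int[mu]_(s in `]0%R, x[) ((u \_ (ray 0%R)) s)%:E = (Uint u x)%:E)%E.
Proof.
move=> x0; have := Upos x0; rewrite /Uint /Rintegral => Up.
have -> : (\int[mu]_(s in `]0%R, x[) ((u \_ (ray 0%R)) s)%:E = \int[mu]_(s in `]0%R, x[) (u s)%:E)%E.
  by apply: eq_integral => s /[!inE]; rewrite /= in_itv/= => /andP[s0 _]; rewrite restrictE.
by move: Up; case: (\int[mu]_(s in `]0%R, x[) (u s)%:E)%E => //=; rewrite ltxx.
Qed.

Lemma Uint_le (x y : R) : 0 < x -> x <= y -> Uint u x <= Uint u y.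
Proof.
case: adm => _ nd _ _ x0; rewrite le_eqVlt => /predU1P[->//|xy].
by apply/ltW/nd; rewrite // in_itv/= andbT ?(ltW x0)// (le_trans (ltW x0))// ltW.
Qed.

Lemma measurable_Uint : measurable_fun setT U.
Proof.
have Uneg (x : R) : x <= 0 -> Uint u x = 0.
  by move=> x0; rewrite /Uint set_itv_ge ?Rintegral_set0// bnd_simp -leNgt.
apply/measurable_EFinP; apply: nondecreasing_emeasurable => x y xy; rewrite lee_fin /U.
have [x0|x0] := leP x 0; last exact: Uint_le.
rewrite (Uneg _ x0); have [y0|y0] := leP y 0; first by rewrite Uneg.
exact: ltW (Upos y0).
Qed.

Let Ucont (x : R) : 0 < x -> Uint u y @[y --> x] --> Uint u x.
Proof.
case: adm => /(continuous_within_itvcyP _ _)[+ _] _ _ _ x0; apply.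
by rewrite in_itv/= x0.
Qed.

(** Continuity of U provides a point strictly before [x] that loses at most a factor 2, for use at
    suprema that are not attained; [Uint_double] does the same at infima. *)
Lemma Uint_half (x : R) : 0 < x -> exists2 s : R, 0 < s < x & Uint u x <= 2 * Uint u s.
Proof.
move=> x0; have /cvgrPdist_lt /(_ (Uint u x / 2)) := Ucont x0.
rewrite divr_gt0 ?Upos// => /(_ isT) H.
have : \forall s \near x^'-, 0 < s < x /\ Uint u x <= 2 * Uint u s.
  near=> s; split.
    by apply/andP; split; near: s; [exact: nbhs_left_gt|exact: nbhs_left_lt].
  have : `|Uint u x - Uint u s| < Uint u x / 2 by near: s; exact: cvg_within H.
  by rewrite ltr_norml => /andP[_]; lra.
by move=> /filter_ex[s [? ?]]; exists s.
Unshelve. all: by end_near. Qed.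

Lemma Uint_double (x : R) : 0 < x -> exists2 s : R, x < s & Uint u s <= 2 * Uint u x.
Proof.
move=> x0; have /cvgrPdist_lt /(_ (Uint u x)) := Ucont x0.
rewrite Upos// => /(_ isT) H.
have : \forall s \near x^'+, x < s /\ Uint u s <= 2 * Uint u x.
  near=> s; split; first by near: s; exact: nbhs_right_gt.
  have : `|Uint u x - Uint u s| < Uint u x by near: s; exact: cvg_within H.
  by rewrite ltr_norml => /andP[]; lra.
by move=> /filter_ex[s [? ?]]; exists s.
Unshelve. all: by end_near. Qed.

End primitive_facts.

(** * The two characterizations *)

Section weighted_kernel.
Context {R : realType}.
Local Notation TR := (measurableTypeR R).
Local Notation mu := (@lebesgue_measure R).
Variables (U w : TR -> R) (e : R).
Hypothesis e0 : 0 < e.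
Hypotheses (mU : measurable_fun setT U) (U0 : forall x : R, 0 < x -> 0 < U x).
Hypothesis ndU : forall x y : R, 0 < x -> x <= y -> U x <= U y.
Hypotheses (mw : measurable_fun setT w) (w0 : forall x, 0 <= w x).
Hypothesis nondeg : forall x : R, 0 < x ->
  (\int[mu]_(s in ray 0%R) (w s / (U s `^ e + U x `^ e))%:E < +oo)%E.
Hypothesis nondeg_left : (\int[mu]_(s in `]0%R, 1%R[) (w s / U s `^ e)%:E = +oo)%E.
Hypothesis nondeg_right : (\int[mu]_(s in ray 1) (w s)%:E = +oo)%E.

Let mray (x : R) : measurable (ray x : set TR).
Proof. exact: measurable_itv. Qed.
Let mitv (i : interval R) : measurable ([set` i] : set TR).
Proof. exact: measurable_itv. Qed.
Let ray0E (x : R) : ray 0%R x -> 0 < x. Proof. by rewrite /ray/= in_itv/= andbT. Qed.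
Let mfE (f : TR -> R) A : measurable_fun setT f -> measurable_fun A (fun t => (f t)%:E).
Proof. by move=> mf; apply/measurable_EFinP; exact: measurable_funTS. Qed.
Let mUe e' : measurable_fun setT (fun x : TR => U x `^ e').
Proof. exact: (measurableT_comp (measurable_powR _)). Qed.

Definition kernel_integral (x : R) : \bar R :=
  (\int[mu]_(s in ray 0%R) ((U x / (U s + U x)) `^ e * w s)%:E)%E.

Let mker (x : R) : 0 < x ->
  measurable_fun (ray 0%R : set TR) (fun s : TR => ((U x / (U s + U x)) `^ e * w s)%:E).
Proof.
move=> x0; apply/measurable_EFinP; apply: measurable_funM; last exact: measurable_funTS.
apply: (measurableT_comp (measurable_powR _)); apply: measurable_funM => //.
apply: ge0_measurable_funV => //; first by move=> t /ray0E t0; rewrite addr_ge0 ?ltW ?U0.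
by apply: measurable_funTS; exact: measurable_funD.
Qed.

Let ker0 (x : R) (s : TR) : (0 <= ((U x / (U s + U x)) `^ e * w s)%:E)%E.
Proof. by rewrite lee_fin mulr_ge0 ?powR_ge0. Qed.

(** Both powers U(s)^e and U(x)^e are at most (U(s) + U(x))^e, so the kernel is at most 2 U(x)^e
    times the integrand of the non-degeneracy condition. *)
Lemma kernel_integral_lty (x : R) : 0 < x -> (kernel_integral x < +oo)%E.
Proof.
move=> x0; have H := nondeg x0.
have Ux := U0 x0; have Uq : 0 < U x `^ e by rewrite powR_gt0.
have pos (s : R) : 0 < s -> 0 < U s `^ e + U x `^ e.
  by move=> s0; rewrite addr_gt0 ?powR_gt0 ?U0.
have mg : measurable_fun (ray 0%R : set TR) (fun s => (w s / (U s `^ e + U x `^ e))%:E).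
  apply/measurable_EFinP; apply: measurable_funM; first exact: measurable_funTS.
  apply: ge0_measurable_funV => //; first by move=> t /ray0E t0; rewrite ltW ?pos.
  by apply: measurable_funTS; exact: measurable_funD.
have g0 s : ray 0%R s -> (0 <= (w s / (U s `^ e + U x `^ e))%:E)%E.
  by move=> /ray0E s0; rewrite lee_fin divr_ge0 ?(ltW (pos _ s0)).
apply: (@le_lt_trans _ _ ((2 * U x `^ e)%:E *
   \int[mu]_(s in ray 0%R) (w s / (U s `^ e + U x `^ e))%:E)%E); last first.
  apply: lte_mul_pinfty; rewrite ?lee_fin ?mulr_ge0 ?powR_ge0//.
rewrite -(ge0_integralZl_EFin mu (mray 0) g0 mg); last by rewrite mulr_ge0 ?powR_ge0.
apply: ge0_le_integral; [exact: mray|by move=> s _; exact: ker0|exact: mker| |].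
  by apply: emeasurable_funM.
move=> s /ray0E s0; have Us := U0 s0; rewrite -EFinM lee_fin.
rewrite [leRHS]mulrCA mulrC; apply: ler_wpM2l => //.
have sux : 0 <= U s + U x by rewrite addr_ge0 ?(ltW Us) ?(ltW Ux).
rewrite (powRM _ (ltW Ux)) ?invr_ge0// (powRV _ sux).
have a0 : 0 < (U s + U x) `^ e by rewrite powR_gt0 ?addr_gt0.
rewrite (mulrC 2) -mulrA; apply: ler_wpM2l; first exact: ltW.
rewrite ler_pdivlMr ?pos// ler_pdivrMl// mulr_natr mulr2n.
apply: lerD; apply: ge0_ler_powR; rewrite ?(ltW e0) ?nnegrE ?sux ?(ltW Us) ?(ltW Ux)//.
  by rewrite lerDl ltW.
by rewrite lerDr ltW.
Qed.

(** Divergence of the integral of [w] at infinity makes the masses of the segments at 0 unbounded.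
    In [right_unbounded] the roles are crossed: divergence at 0 concerns the segments at
    infinity. *)
Lemma left_unbounded (K : R) : exists2 X : R, 0 < X & (K%:E < \int[mu]_(t in `]0%R, X]) (w t)%:E)%E.
Proof.
have H := nondeg_right.
suff : exists n : nat, (K%:E < \int[mu]_(t in `]0%R, n.+1%:R]) (w t)%:E)%E.
  by move=> [n Hn]; exists n.+1%:R => //; rewrite ltr0n.
apply/not_existsP => no.
suff : (\int[mu]_(s in ray 1) (w s)%:E <= K%:E)%E by rewrite H.
apply: (@le_trans _ _ (\int[mu]_(s in ray 0%R) (w s)%:E)%E).
  apply: subset_integralT; [exact: mray|exact: mray|exact: mfE|by move=> s; rewrite lee_fin|].
  by move=> s; rewrite /ray/= !in_itv/= !andbT; exact: lt_trans.
have -> : ray 0%R = \bigcup_n `]0%R, n.+1%:R]%classic :> set TR.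
  apply/seteqP; split => [x /ray0E x0|x [n _]]; last first.
    by rewrite /ray/= !in_itv/= andbT => /andP[].
  exists (Num.truncn x) => //; rewrite /= in_itv/= x0/=.
  by have /andP[_ /ltW] := truncn_itv (ltW x0).
apply: integral_bigcup_le.
- move=> i j ij; apply/subsetPset => x; rewrite /= !in_itv/= => /andP[-> xi].
  by rewrite (le_trans xi)// ler_nat.
- by move=> i; exact: mitv.
- exact: mfE.
- by move=> x _; rewrite lee_fin.
- by move=> i; rewrite leNgt; apply/negP; exact: no.
Qed.

Lemma right_unbounded (K : R) : exists2 X : R, 0 < X &
  (K%:E < \int[mu]_(t in `[X, +oo[) (U t `^ (- e) * w t)%:E)%E.
Proof.
have H := nondeg_left.
have mf : measurable_fun setT (fun t : TR => U t `^ (- e) * w t) by exact: measurable_funM.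
have f0 t : (0 <= (U t `^ (- e) * w t)%:E)%E by rewrite lee_fin mulr_ge0 ?powR_ge0.
suff : exists n : nat, (K%:E < \int[mu]_(t in `[(n.+1%:R^-1)%R, +oo[) (U t `^ (- e) * w t)%:E)%E.
  by move=> [n Hn]; exists n.+1%:R^-1 => //; rewrite invr_gt0 ltr0n.
apply/not_existsP => no.
suff : (\int[mu]_(s in `]0%R, 1%R[) (w s / U s `^ e)%:E <= K%:E)%E by rewrite H.
apply: (@le_trans _ _ (\int[mu]_(s in ray 0%R) (U s `^ (- e) * w s)%:E)%E).
  rewrite (eq_integral (fun s => (U s `^ (- e) * w s)%:E)); last first.
    by move=> s /[!inE]; rewrite /= in_itv/= => /andP[s0 _]; rewrite powRN mulrC.
  apply: subset_integralT; [exact: mitv|exact: mray|exact: mfE|exact: f0|].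
  by move=> s; rewrite /ray/= !in_itv/= andbT => /andP[].
have -> : ray 0%R = \bigcup_n `[n.+1%:R^-1, +oo[%classic :> set TR.
  apply/seteqP; split => [x /ray0E x0|x [n _]]; last first.
    by rewrite /ray/= !in_itv/= !andbT; apply: lt_le_trans; rewrite invr_gt0 ltr0n.
  exists (Num.truncn x^-1) => //; rewrite /= in_itv/= andbT.
  rewrite -[leRHS]invrK lef_pV2 ?posrE ?ltr0n ?invr_gt0//.
  have xi : 0 <= x^-1 by rewrite invr_ge0 ltW.
  by have /andP[_ /ltW] := truncn_itv xi.
apply: integral_bigcup_le.
- move=> i j ij; apply/subsetPset => x; rewrite /= !in_itv/= !andbT; apply: le_trans.
  by rewrite lef_pV2 ?posrE ?ltr0n// ler_nat.
- by move=> i; exact: mitv.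
- exact: mfE.
- by move=> x _; exact: f0.
- by move=> i; rewrite leNgt; apply/negP; exact: no.
Qed.

Lemma kernel_integral_gt0 (x : R) : 0 < x -> (0 < kernel_integral x)%E.
Proof.
move=> x0; have Ux := U0 x0; have [X X0 HX] := left_unbounded 0; have UX := U0 X0.
have c0 : 0 < (U x / (U X + U x)) `^ e by rewrite powR_gt0 ?divr_gt0 ?addr_gt0.
apply: (@lt_le_trans _ _ (((U x / (U X + U x)) `^ e)%:E * \int[mu]_(t in `]0%R, X]) (w t)%:E)%E).
  by apply: mule_gt0.
rewrite -integralZT; [|exact: mitv|exact: mfE|by move=> t; rewrite lee_fin|exact: ltW].
have sub : `]0%R, X]%classic `<=` (ray 0%R : set TR).
  by move=> t; rewrite /ray/= !in_itv/= andbT => /andP[].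
apply: (@le_trans _ _ (\int[mu]_(s in `]0%R, X]) ((U x / (U s + U x)) `^ e * w s)%:E)%E); last first.
  apply: ge0_subset_integral; [exact: mitv|exact: mray|exact: mker|by move=> s _; exact: ker0|exact: sub].
apply: ge0_le_integral; [exact: mitv| | | |].
- by move=> t _; rewrite mule_ge0 ?lee_fin ?(ltW c0).
- by apply: emeasurable_funM => //; exact: mfE.
- by apply: measurable_funS (mker x0).
move=> t; rewrite /= in_itv/= => /andP[t0 tX]; have Ut := U0 t0.
rewrite -EFinM lee_fin; apply: ler_wpM2r => //.
apply: ge0_ler_powR; rewrite ?(ltW e0) ?nnegrE ?divr_ge0 ?addr_ge0 ?(ltW UX) ?(ltW Ut) ?(ltW Ux)//.
by apply: ler_wpM2l; rewrite ?(ltW Ux)// lef_pV2 ?posrE ?addr_gt0// lerD2r ndU.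
Qed.

Lemma kernel_integral_ge0 (x : R) : (0 <= kernel_integral x)%E.
Proof. by apply: integral_ge0 => s _; exact: ker0. Qed.

Lemma kernel_integral_le (x y : R) : 0 < x -> x <= y -> (kernel_integral x <= kernel_integral y)%E.
Proof.
move=> x0 xy; have y0 := lt_le_trans x0 xy; have Ux := U0 x0; have Uy := U0 y0.
apply: ge0_le_integral; [exact: mray|by move=> s _; exact: ker0|exact: mker|exact: mker|].
move=> s /ray0E s0; have Us := U0 s0; rewrite lee_fin; apply: ler_wpM2r => //.
apply: ge0_ler_powR; rewrite ?(ltW e0) ?nnegrE ?divr_ge0 ?addr_ge0 ?(ltW Ux) ?(ltW Us) ?(ltW Uy)//.
rewrite ler_pdivrMr ?addr_gt0// mulrAC ler_pdivlMr ?addr_gt0//.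
rewrite !mulrDr (mulrC (U y) (U x)) lerD2r ler_wpM2r ?(ltW Us)//; exact: ndU.
Qed.

End weighted_kernel.

Section stieltjes_kernel.
Context {R : realType}.
Local Notation TR := (measurableTypeR R).
Local Notation mu := (@lebesgue_measure R).
Variables (U : TR -> R) (e : R) (sg : {measure set TR -> \bar R}).
Hypothesis e0 : 0 < e.
Hypotheses (mU : measurable_fun setT U) (U0 : forall x : R, 0 < x -> 0 < U x).

Let mray (x : R) : measurable (ray x : set TR).
Proof. exact: measurable_itv. Qed.
Let ray0E (x : R) : ray 0%R x -> 0 < x. Proof. by rewrite /ray/= in_itv/= andbT. Qed.

(** The kernels at [x] and [y] are comparable with a constant depending on U x / U y. Hence [psi] is
    finite everywhere as soon as it is finite at one point, which is all that a finite [I2] reveals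
    directly. *)
Lemma stieltjes_kernel_lty (x y : R) : 0 < x -> 0 < y ->
  (\int[sg]_(t in ray 0%R) ((U t / (U x + U t)) `^ e)%:E < +oo)%E ->
  (\int[sg]_(t in ray 0%R) ((U t / (U y + U t)) `^ e)%:E < +oo)%E.
Proof.
move=> x0 y0 H; have Ux := U0 x0; have Uy := U0 y0.
have mk (z : R) : 0 < z -> measurable_fun (ray 0%R : set TR) (fun t : TR => ((U t / (U z + U t)) `^ e)%:E).
  move=> z0; apply/measurable_EFinP; apply: (measurableT_comp (measurable_powR _)).
  apply: measurable_funM; first exact: measurable_funTS.
  apply: ge0_measurable_funV => //; first by move=> t /ray0E t0; rewrite addr_ge0 ?ltW ?U0.
  by apply: measurable_funTS; exact: measurable_funD.
pose K := 1 + U x / U y.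
have K0 : 0 < K by rewrite ltr_wpDr// divr_ge0 ?(ltW Ux) ?(ltW Uy).
have f0 (t : TR) : ray 0%R t -> (0 <= ((U t / (U x + U t)) `^ e)%:E)%E by rewrite lee_fin powR_ge0.
apply: (@le_lt_trans _ _ ((K `^ e)%:E * \int[sg]_(t in ray 0%R) ((U t / (U x + U t)) `^ e)%:E)%E); last first.
  by apply: lte_mul_pinfty => //; rewrite lee_fin powR_ge0.
rewrite -(ge0_integralZl_EFin sg (mray 0) f0 (mk x x0)) ?powR_ge0//.
apply: ge0_le_integral; [exact: mray| |exact: mk|by apply: emeasurable_funM => //; exact: mk|].
  by move=> t _; rewrite lee_fin powR_ge0.
move=> t /ray0E t0; have Ut := U0 t0.
have k1 : 0 <= U t / (U x + U t) by rewrite divr_ge0 ?addr_ge0 ?(ltW Ux) ?(ltW Ut).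
have k2 : 0 <= U t / (U y + U t) by rewrite divr_ge0 ?addr_ge0 ?(ltW Uy) ?(ltW Ut).
rewrite -EFinM lee_fin -powRM ?(ltW K0)//.
apply: ge0_ler_powR; rewrite ?(ltW e0) ?nnegrE ?(mulr_ge0 (ltW K0) k1)//.
rewrite mulrCA; apply: ler_wpM2l; first exact: ltW.
rewrite ler_pdivlMr ?addr_gt0// mulrC ler_pdivrMr ?addr_gt0//.
rewrite /K mulrDl mul1r mulrDr divfK ?gt_eqF//.
have : 0 <= U x / U y * U t by rewrite !mulr_ge0 ?invr_ge0 ?(ltW Ux) ?(ltW Uy) ?(ltW Ut).
by move: Uy Ut; lra.
Qed.

End stieltjes_kernel.

(** * The weights of the theorem as an instance of the abstract setting *)

Section instance.
Context {R : realType}.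
Local Notation TR := (measurableTypeR R).
Local Notation mu := (@lebesgue_measure R).
Variables (p q : R) (u v w : R -> R).
Hypotheses (p0 : 0 < p) (p1 : p < 1) (q0 : 0 < q).
Hypotheses (wu : weight u) (wv : weight v) (ww : weight w).
Hypothesis vlim : vlow v (`]t, +oo[) @[t --> +oo] --> 0%E.
Hypothesis Upos : forall t, 0 < t -> 0 < Uint u t.
Hypothesis adm : admissible_prim (Uint u).
Hypothesis nondeg : nondegenerate_wrt (Uint u) (q / p) w.

Let r := star p.
Let r0 : 0 < r. Proof. by rewrite divr_gt0 ?subr_gt0. Qed.
Let qp0 : 0 < q / p. Proof. exact: divr_gt0. Qed.
Let mray (x : R) : measurable (ray x : set TR).
Proof. exact: measurable_itv. Qed.
Let mitv (i : interval R) : measurable ([set` i] : set TR).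
Proof. exact: measurable_itv. Qed.
Let ray0E (x : R) : ray 0%R x -> 0 < x. Proof. by rewrite /ray/= in_itv/= andbT. Qed.

Let U : TR -> R := Uint u.
Let u' : TR -> R := u \_ (ray 0%R).
Let v' : TR -> R := v \_ (ray 0%R).
Let w' : TR -> R := w \_ (ray 0%R).
Let mu' : measurable_fun setT u'. Proof. by case: (weight_restrict wu). Qed.
Let u'0 x : 0 <= u' x. Proof. by case: (weight_restrict wu) => _; exact. Qed.
Let mv' : measurable_fun setT v'. Proof. by case: (weight_restrict wv). Qed.
Let v'0 x : 0 <= v' x. Proof. by case: (weight_restrict wv) => _; exact. Qed.
Let mw' : measurable_fun setT w'. Proof. by case: (weight_restrict ww). Qed.
Let w'0 x : 0 <= w' x. Proof. by case: (weight_restrict ww) => _; exact. Qed.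
Let mU : measurable_fun setT U. Proof. exact: measurable_Uint. Qed.
Let U0 (x : R) : 0 < x -> 0 < U x. Proof. exact: Upos. Qed.
Let ndU (x y : R) : 0 < x -> x <= y -> U x <= U y. Proof. exact: Uint_le. Qed.
Let UE (x : R) : 0 < x -> (\int[mu]_(s in `]0%R, x[) (u' s)%:E = (U x)%:E)%E.
Proof. exact: UintE. Qed.
Let mfE (f : TR -> R) A : measurable_fun setT f -> measurable_fun A (fun t => (f t)%:E).
Proof. by move=> mf; apply/measurable_EFinP; exact: measurable_funTS. Qed.
Let mUe e : measurable_fun setT (fun x : TR => U x `^ e).
Proof. exact: (measurableT_comp (measurable_powR _)). Qed.


Let nd1 (x : R) : 0 < x -> (\int[mu]_(s in ray 0%R) (w' s / (U s `^ (q / p) + U x `^ (q / p)))%:E < +oo)%E.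
Proof.
case: nondeg => H _ _ /H; congr (_ < _)%E; apply: eq_integral => s /[!inE] /ray0E s0.
by rewrite /w' restrictE.
Qed.

Let nd2 : (\int[mu]_(s in `]0%R, 1%R[) (w' s / U s `^ (q / p))%:E = +oo)%E.
Proof.
case: nondeg => _ <- _; apply: eq_integral => s /[!inE]; rewrite /= in_itv/= => /andP[s0 _].
by rewrite /w' restrictE.
Qed.

Let nd3 : (\int[mu]_(s in ray 1) (w' s)%:E = +oo)%E.
Proof.
case: nondeg => _ _ <-; apply: eq_integral => s /[!inE]; rewrite /ray/= in_itv/= andbT => s1.
by rewrite /w' restrictE// (lt_trans ltr01).
Qed.

Lemma wintE (x : R) : wint p q u w x = kernel_integral U w' (q / p) x.
Proof. by apply: eq_integral => s /[!inE] /ray0E s0; rewrite /w' restrictE. Qed.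

(** The default for x <= 0 extends the function monotonically to the whole line, whence
    measurability: 0 here, and an infinite value for the nonincreasing [V_fun] and [psi_fun]. It is
    chosen inside [fine], where monotonicity is meaningful. *)
Definition phi_fun (x : TR) : R := fine (if 0 < x then wint p q u w x else 0%E).

Let wint_fin (x : R) : 0 < x -> (0 < wint p q u w x)%E /\ (wint p q u w x < +oo)%E.
Proof.
rewrite wintE => x0; split.
  exact: (kernel_integral_gt0 qp0 mU U0 ndU mw' w'0 nd3).
exact: (kernel_integral_lty qp0 mU U0 mw' w'0 nd1).
Qed.

Lemma phi_funE (x : R) : 0 < x -> wint p q u w x = (phi_fun x)%:E.
Proof.
move=> x0; have [h1 h2] := wint_fin x0; rewrite /phi_fun x0 fineK// ge0_fin_numE//.
exact: ltW.
Qed.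

Lemma phi_fun_gt0 (x : R) : 0 < x -> 0 < phi_fun x.
Proof. by move=> x0; rewrite -lte_fin -phi_funE//; case: (wint_fin x0). Qed.

Lemma measurable_phi_fun : measurable_fun setT phi_fun.
Proof.
apply: measurableT_comp => //; apply: nondecreasing_emeasurable => x y xy.
case: (ltP 0 x) => x0; last first.
  by case: (ltP 0 y) => y0; [rewrite wintE; exact: kernel_integral_ge0|exact: lexx].
rewrite (lt_le_trans x0 xy) !wintE.
exact: (kernel_integral_le qp0 mU U0 ndU mw' w'0).
Qed.

Let phiE (x : R) : 0 < x ->
  (\int[mu]_(s in ray 0%R) ((U x / (U s + U x)) `^ (q / p) * w' s)%:E = (phi_fun x)%:E)%E.
Proof. by move=> x0; rewrite -phi_funE// wintE. Qed.

Lemma hardy_lhsE (h h' : R -> \bar R) : (forall z, 0 < z -> h z = h' z) ->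
  hardy_lhs p q u w h =
  ((\int[mu]_(t in ray 0%R) (core_avg p u' U h' t `^ (q / p) * (w' t)%:E)) `^ q^-1)%E.
Proof.
move=> hh'; rewrite /hardy_lhs; congr (_ `^ _)%E.
apply: eq_integral => t /[!inE] /ray0E t0; congr ((_ * _) `^ _ * _%:E)%E; last by rewrite /w' restrictE.
apply: eq_integral => s /[!inE]; rewrite /= in_itv/= => /andP[s0 _].
congr (_ `^ _ * _%:E)%E; last by rewrite /u' restrictE.
apply: eq_integral => z /[!inE]; rewrite /ray/= in_itv/= andbT => sz.
by rewrite hh'// (lt_trans s0).
Qed.

Lemma hardy_rhsE (h h' : R -> \bar R) : (forall z, 0 < z -> h z = h' z) ->
  (\int[mu]_(z in ray 0%R) (h z * (v z)%:E) = \int[mu]_(z in ray 0%R) (h' z * (v' z)%:E))%E.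
Proof.
by move=> hh'; apply: eq_integral => z /[!inE] /ray0E z0; rewrite hh'// /v' restrictE.
Qed.

Definition V_fun (t : TR) : R := fine (if 0 < t then vlow_left v t else +oo%E).

Let v0 (t : R) : 0 < t -> 0 <= v t. Proof. by case: wv => _; exact. Qed.
Let mv : measurable_fun (ray 0%R : set TR) v. Proof. by case: wv => -[]. Qed.

Lemma measurable_V_fun : measurable_fun setT V_fun.
Proof.
apply: measurableT_comp => //; apply: nonincreasing_emeasurable => x y xy.
case: (ltP 0 x) => x0; last exact: leey.
by rewrite (lt_le_trans x0 xy); exact: le_vlow_left.
Qed.

Let sg := left_stieltjes (vlow_distr v r).

Let rE : star p / p = 1 + r.
Proof. by rewrite /r /star; field; rewrite subr_eq0 !gt_eqF. Qed.

Section finite_vlow.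
Hypothesis voo : forall t, 0 < t -> (vlow v (`]t, +oo[) < +oo)%E.

Lemma V_funE (t : R) : 0 < t -> vlow_left v t = (V_fun t)%:E.
Proof. by move=> t0; rewrite /V_fun t0 fineK// vlow_left_fin. Qed.

Lemma V_fun_gt0 (t : R) : 0 < t -> 0 < V_fun t.
Proof. by move=> t0; rewrite -lte_fin -V_funE// vlow_left_pos. Qed.

Lemma V_fun_tail (x : R) : 0 < x -> sg `[x, +oo[%classic = (V_fun x `^ r)%:E.
Proof. by move=> x0; rewrite /sg left_stieltjes_tail// V_funE. Qed.

Lemma V_fun_small (e : R) : 0 < e -> exists2 B : R, 0 < B & forall t, B < t -> V_fun t < e.
Proof.
move=> e0; have [B B0 HB] := vlow_small vlim e0; exists B => // t Bt.
by rewrite -lte_fin -V_funE ?HB// (lt_trans B0).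
Qed.

Lemma vintE (x : R) : 0 < x ->
  vint p u v x = (\int[sg]_(t in ray 0%R) ((U t / (U x + U t)) `^ (1 + r))%:E)%E.
Proof.
move=> x0; rewrite /vint (asboolT voo) rE -/r -/sg.
rewrite integral_mkcond [RHS]integral_mkcond; apply: eq_integral => t _.
rewrite !patchE /Uker -/U; case: (ltgtP t 0) => t0.
- rewrite !memNset//.
    by rewrite /ray/= in_itv/= andbT; apply/negP; rewrite -leNgt ltW.
  by rewrite /= in_itv/= andbT; apply/negP; rewrite -ltNge.
- by rewrite !mem_set// /ray/= in_itv/= ?t0 ?(ltW t0).
(* The endpoint 0 belongs to one domain only, but the integrand vanishes there because U(0) = 0. *)
- rewrite t0 mem_set/= ?in_itv/= ?lexx// memNset; last by rewrite /ray/= in_itv/= ltxx.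
  have -> : U 0 = 0 by case: adm.
  by rewrite mul0r powR0// gt_eqF// addr_gt0.
Qed.

Section finite_vint.
Hypothesis vint_fin : forall x, 0 < x -> (vint p u v x < +oo)%E.

Definition psi_fun (x : TR) : R := fine (if 0 < x then vint p u v x else +oo%E).

Lemma vint_ge0 (x : R) : 0 < x -> (0 <= vint p u v x)%E.
Proof. by move=> x0; rewrite vintE//; apply: integral_ge0 => t _; rewrite lee_fin powR_ge0. Qed.

Lemma psi_funE (x : R) : 0 < x -> vint p u v x = (psi_fun x)%:E.
Proof. by move=> x0; rewrite /psi_fun x0 fineK// ge0_fin_numE ?vint_fin ?vint_ge0. Qed.

Lemma psi_fun_integral (x : R) : 0 < x ->
  (\int[sg]_(t in ray 0%R) ((U t / (U x + U t)) `^ (1 + r))%:E = (psi_fun x)%:E)%E.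
Proof. by move=> x0; rewrite -vintE// psi_funE. Qed.

Lemma psi_fun_gt0 (x : R) : 0 < x -> 0 < psi_fun x.
Proof.
move=> x0; have := core_V_psi p0 p1 mU U0 ndU V_fun_tail psi_fun_integral x0.
have K0 : 0 < 2 `^ (1 + star p) :> R by rewrite powR_gt0.
rewrite -(pmulr_rgt0 _ K0); apply: lt_le_trans; rewrite powR_gt0//; exact: V_fun_gt0.
Qed.

Lemma psi_fun_le (x y : R) : 0 < x -> x <= y -> psi_fun y <= psi_fun x.
Proof. exact: (core_psi_noninc p0 p1 mU U0 ndU psi_fun_integral). Qed.

Lemma measurable_psi_fun : measurable_fun setT psi_fun.
Proof.
apply: measurableT_comp => //; apply: nonincreasing_emeasurable => x y xy.
case: (ltP 0 x) => x0; last exact: leey.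
have y0 := lt_le_trans x0 xy; rewrite y0 (psi_funE x0) (psi_funE y0) lee_fin.
exact: psi_fun_le.
Qed.

End finite_vint.

(** The core estimate has 1/V on the right. Since 1/v <= V almost everywhere, 1/V <= v, and [h] is
    thus integrated against the smaller weight. *)
Lemma hardy_ineq_of_core (K : R) : 0 <= K ->
  (forall h : TR -> \bar R, measurable_fun setT h -> (forall x, (0 <= h x)%E) ->
    ((\int[mu]_(t in ray 0%R) (core_avg p u' U h t `^ (q / p) * (w' t)%:E)) `^ q^-1 <=
      K%:E * \int[mu]_(z in ray 0%R) (h z * (V_fun z)^-1%:E))%E) ->
  hardy_ineq p q u v w K.
Proof.
move=> K0 H h mh h0; pose h' : TR -> \bar R := h \_ (ray 0%R).
have mh' : measurable_fun setT h' by apply/(measurable_restrictT _ _).1.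
have h'0 x : (0 <= h' x)%E.
  by rewrite /h' patchE; case: ifPn => // /[!inE] /ray0E; exact: h0.
have hh' z : 0 < z -> h z = h' z.
  by move=> z0; rewrite /h' patchE mem_set// /ray/= in_itv/= z0.
rewrite (hardy_lhsE hh') (hardy_rhsE hh'); apply: (le_trans (H h' mh' h'0)).
apply: lee_wpmul2l; first by rewrite lee_fin.
have mVi : measurable_fun (ray 0%R : set TR) (fun z => (V_fun z)^-1%:E).
  apply/measurable_EFinP; apply: ge0_measurable_funV => //.
    by move=> z /ray0E z0; exact: ltW (V_fun_gt0 z0).
  by apply: measurable_funTS; exact: measurable_V_fun.
apply: ae_ge0_le_integral.
- exact: mray.
- by move=> z /ray0E z0; rewrite mule_ge0// lee_fin invr_ge0 ltW// V_fun_gt0.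
- by apply: emeasurable_funM => //; exact: measurable_funTS.
- by move=> z _; rewrite mule_ge0// lee_fin.
- by apply: emeasurable_funM; [exact: measurable_funTS|exact: mfE].
case: (ae_inv_le_vlow_left v) => N [mN N0 NP]; exists N; split => // z /= nz; apply: NP => /= Hz.
apply: nz => /ray0E z0.
apply: lee_wpmul2l => //; rewrite lee_fin /v' restrictE//.
have := Hz z0; rewrite V_funE//; have Vz := V_fun_gt0 z0.
(* Where v = 0 its extended inverse is infinite and cannot lie below the finite V, so this case is
   contradictory. *)
have [->|vz] := eqVneq (v z) 0; first by rewrite inver eqxx.
rewrite inver (negbTE vz) lee_fin => vV.
have vz0 : 0 < v z by rewrite lt_def vz v0.
by rewrite -[leRHS]invrK lef_pV2 ?posrE ?invr_gt0.
Qed.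

End finite_vlow.

Lemma vint_infinite : ~ (forall t, 0 < t -> (vlow v (`]t, +oo[) < +oo)%E) ->
  forall x, vint p u v x = +oo%E.
Proof. by move=> H x; rewrite /vint (asboolF H). Qed.

Lemma core_of_hardy_ineq (c : R) : hardy_ineq p q u v w c ->
  forall h : TR -> R, measurable_fun setT h -> (forall z, 0 <= h z) ->
  ((\int[mu]_(t in ray 0%R) (core_avg p u' U (EFin \o h) t `^ (q / p) * (w' t)%:E)) `^ q^-1 <=
    c%:E * \int[mu]_(z in ray 0%R) (h z * v' z)%:E)%E.
Proof.
move=> H h mh h0; have := H (EFin \o h) (@mfE h (ray 0%R) mh).
by rewrite (@hardy_lhsE _ (EFin \o h))// (@hardy_rhsE _ (EFin \o h))//; apply => z _; rewrite lee_fin.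
Qed.

Lemma test_const_gt0 : 0 < test_const p.
Proof.
rewrite /test_const !mulr_gt0 ?powR_gt0 ?mulr_gt0 ?powR_gt0// invr_gt0 subr_gt0 powR2_gt1//.
Qed.

Let test_exists (x y : R) : Prop := exists h : TR -> R, [/\ measurable_fun setT h, forall z, 0 <= h z,
    (\int[mu]_(z in ray 0%R) (h z * v' z)%:E <= 1)%E &
    ((y `^ (1 - p))%:E <= (test_const p)%:E * core_avg p u' U (EFin \o h) x)%E].

Lemma test_of_vint_finite (x y : R) : (forall t, 0 < t -> (vlow v (`]t, +oo[) < +oo)%E) ->
  0 < x -> 0 < y -> (y%:E < vint p u v x)%E -> test_exists x y.
Proof.
move=> voo x0 y0; rewrite vintE// => yx.
apply: (exists_test_function p0 p1 mu' u'0 mU U0 ndU UE (Uint_half Upos adm) measurable_V_fun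
  (V_fun_gt0 voo) (V_fun_tail voo) (V_fun_small voo) mv' v'0 _ x0 y0 yx).
move=> s t k s0 st k0 kV; apply: (exists_bump mv v0 s0 k0).
have t0 := lt_trans s0 st; apply: lt_le_trans (vlow_left_ge v st).
by rewrite (V_funE voo t0) lte_fin.
Qed.

(** Beyond [t0] there are bumps of unit mass and arbitrarily small cost. A large multiple of such a
    bump has cost at most 1, while its tail integral is large on all of (0, t0), so the average at
    [x] exceeds any prescribed value. *)
Lemma test_of_vlow_infinite (t0 x y : R) : 0 < t0 -> vlow v (`]t0, +oo[) = +oo%E ->
  0 < x -> 0 < y -> test_exists x y.
Proof.
move=> t00 voo x0 y0; have C0 := test_const_gt0.
pose m := Num.min t0 x.
have m0 : 0 < m by rewrite lt_min t00.
have Um := U0 m0; have Ux := U0 x0.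
(* Solved from the desired inequality: with k^p = d, the average is at least d U(m) / U(x). *)
pose d := y `^ (1 - p) * U x / (test_const p * U m).
have d0 : 0 < d.
  by apply: divr_gt0; [apply: mulr_gt0 => //; exact: powR_gt0|exact: mulr_gt0].
pose k := d `^ p^-1.
have k0 : 0 < k by exact: powR_gt0.
have [g [mg g0 gv g1]] : exists g : TR -> R, [/\ measurable_fun setT g, forall z, 0 <= g z,
    (\int[mu]_(z in ray 0%R) (g z * v' z)%:E <= (k^-1)%:E)%E &
    (1 <= \int[mu]_(z in ray t0) (g z)%:E)%E].
  by apply: (exists_bump mv v0 t00 k0); rewrite voo ltry.
have k0' := ltW k0.
exists (fun z => k * g z); split.
- exact: measurable_funM.
- by move=> z; exact: mulr_ge0.
- rewrite (eq_integral (fun z => k%:E * (g z * v' z)%:E)%E); last first.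
    by move=> z _; rewrite -EFinM mulrA.
  rewrite integralZT; [|exact: mray|apply: mfE; exact: measurable_funM
    |by move=> z; rewrite lee_fin; exact: mulr_ge0|exact: k0'].
  apply: (@le_trans _ _ (k%:E * (k^-1)%:E)%E); last by rewrite -EFinM mulfV ?gt_eqF.
  by apply: lee_wpmul2l => //; rewrite lee_fin.
have mkg : measurable_fun setT (fun z : TR => (k * g z)%:E).
  by apply: mfE; exact: measurable_funM.
have kg0 z : (0 <= (k * g z)%:E)%E by rewrite lee_fin; exact: mulr_ge0.
pose H s := (\int[mu]_(z in ray s) (k * g z)%:E)%E.
have mH : measurable_fun setT (H : TR -> \bar R).
  apply: nonincreasing_emeasurable => a b ab; apply: subset_integralT => //.
  by move=> z; rewrite /ray/= !in_itv/= !andbT; exact: le_lt_trans.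
have mHu : measurable_fun setT (fun s : TR => H s `^ p * (u' s)%:E)%E.
  by apply: emeasurable_funM; [exact: measurable_fun_poweR|exact: mfE].
have Hk s : s < t0 -> (k%:E <= H s)%E.
  move=> st; apply: (@le_trans _ _ (k%:E * \int[mu]_(z in ray t0) (g z)%:E)%E).
    by rewrite -[leLHS]mule1; apply: lee_wpmul2l => //; rewrite lee_fin.
  rewrite -integralZT; [|exact: mray|exact: mfE|by move=> z; rewrite lee_fin|exact: k0'].
  apply: subset_integralT; [exact: mray|exact: mray| | |].
  - by apply: emeasurable_funM => //; exact: mfE.
  - by move=> z; rewrite -EFinM.
  - by move=> z; rewrite /ray/= !in_itv/= !andbT; exact: lt_trans.
have HU : ((k `^ p * U m)%:E <= \int[mu]_(s in `]0%R, x[) (H s `^ p * (u' s)%:E))%E.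
  rewrite EFinM -(UE m0) -integralZT; [|exact: mitv|exact: mfE|by move=> s; rewrite lee_fin|exact: powR_ge0].
  apply: (@le_trans _ _ (\int[mu]_(s in `]0%R, m[) (H s `^ p * (u' s)%:E))%E).
    apply: ge0_le_integral; [exact: mitv| | |exact: measurable_funTS|].
    - by move=> s _; rewrite mule_ge0 ?lee_fin ?powR_ge0.
    - by apply: emeasurable_funM => //; exact: mfE.
    move=> s; rewrite /= in_itv/= lt_min => /and3P[s0 st _]; apply: lee_wpmul2r; first by rewrite lee_fin.
    by rewrite -poweR_EFin; apply: le_poweR; [exact: ltW|rewrite lee_fin|exact: Hk].
  apply: subset_integralT; [exact: mitv|exact: mitv|exact: mHu| |].
    by move=> s; rewrite mule_ge0 ?poweR_ge0 ?lee_fin.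
  by move=> s; rewrite /= !in_itv/= lt_min => /and3P[-> _ ->].
rewrite /core_avg.
apply: (@le_trans _ _ ((test_const p)%:E * ((U x)^-1%:E * (k `^ p * U m)%:E))%E); last first.
  apply: lee_wpmul2l; first by rewrite lee_fin ltW.
  by apply: lee_wpmul2l => //; rewrite lee_fin invr_ge0 ltW.
rewrite -!EFinM lee_fin /k -powRrM mulVf ?gt_eqF// powRr1 ?(ltW d0)// /d.
by rewrite le_eqVlt; apply/orP; left; apply/eqP; field; rewrite !gt_eqF.
Qed.

Lemma test_of_vint (x y : R) : 0 < x -> 0 < y -> (y%:E < vint p u v x)%E -> test_exists x y.
Proof.
have [voo|/existsNP[t /not_implyP[t0 /negP]]] :=
  pselect (forall t, 0 < t -> (vlow v (`]t, +oo[) < +oo)%E); first exact: test_of_vint_finite.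
rewrite -leNgt leye_eq => /eqP voo x0 y0 _; exact: test_of_vlow_infinite voo x0 y0.
Qed.

Lemma nec_const_ge0 : q < 1 -> 0 <= nec_const p q (test_const p).
Proof.
move=> q1; have k0 : 0 < star q by rewrite divr_gt0 ?subr_gt0.
have h1 : 0 <= 2 `^ star q / (2 `^ star q - 1) :> R.
  by rewrite divr_ge0 ?powR_ge0 ?subr_ge0// ltW// powR2_gt1.
rewrite /nec_const; apply: mulr_ge0; first exact: powR_ge0.
apply: mulr_ge0 => //; apply: mulr_ge0; first by apply: mulr_ge0 => //; exact: powR_ge0.
by apply: mulr_ge0 => //; exact: powR_ge0.
Qed.

Lemma I2_integralE : (forall t, 0 < t -> (vlow v (`]t, +oo[) < +oo)%E) ->
  (forall x, 0 < x -> (vint p u v x < +oo)%E) ->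
  (\int[mu]_(x in ray 0%R) (wint p q u w x `^ star q * vint p u v x `^ (star q / star p) * (w x)%:E) =
   \int[mu]_(x in ray 0%R) ((phi_fun x * psi_fun x `^ r^-1) `^ star q * w' x)%:E)%E.
Proof.
move=> voo vfin; apply: eq_integral => x /[!inE] /ray0E x0.
rewrite (phi_funE x0) (psi_funE voo vfin x0) !poweR_EFin -!EFinM.
congr ((_ * _)%:E); last by rewrite /w' restrictE.
rewrite powRM ?powR_ge0 ?(ltW (phi_fun_gt0 x0))// -powRrM.
by rewrite (mulrC r^-1).
Qed.

Section bounds.
Variable c : R.
Hypotheses (c0 : 0 <= c) (Hc : hardy_ineq p q u v w c).

Lemma vint_le (x : R) : 0 < x ->
  (vint p u v x <= ((test_const p `^ p^-1 * c / phi_fun x `^ q^-1) `^ r)%:E)%E.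
Proof.
exact: (pointwise_necessity p0 p1 q0 c0 test_const_gt0 mu' u'0 mU U0 ndU UE mw' w'0
  phi_fun_gt0 phiE (core_of_hardy_ineq Hc) test_of_vint).
Qed.

Lemma vint_lty (x : R) : 0 < x -> (vint p u v x < +oo)%E.
Proof. by move=> x0; exact: le_lt_trans (vint_le x0) (ltry _). Qed.

(** Otherwise [vint] would be infinite by convention, contradicting [vint_lty]; this is why test
    functions had to be built in the infinite case too. *)
Lemma vlow_lty : forall t, 0 < t -> (vlow v (`]t, +oo[) < +oo)%E.
Proof.
have [//|no] := pselect (forall t, 0 < t -> (vlow v (`]t, +oo[) < +oo)%E).
by have := vint_lty (@ltr01 R); rewrite vint_infinite// ltxx.
Qed.

Lemma I1_le : (I1 p q u v w <= (test_const p `^ p^-1 * c)%:E)%E.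
Proof.
apply: ub_ereal_sup => _ [x /ray0E x0 <-].
have ph := phi_fun_gt0 x0; have ph' : 0 < phi_fun x `^ q^-1 by exact: powR_gt0.
have b0 : 0 <= test_const p `^ p^-1 * c / phi_fun x `^ q^-1.
  by apply: divr_ge0; [apply: mulr_ge0 => //; exact: powR_ge0|exact: powR_ge0].
rewrite phi_funE// poweR_EFin.
apply: (@le_trans _ _ ((phi_fun x `^ q^-1)%:E * (test_const p `^ p^-1 * c / phi_fun x `^ q^-1)%:E)%E).
  apply: lee_wpmul2l; first by rewrite lee_fin ltW.
  rewrite -[leRHS](poweRK _ _ (e := r)) ?gt_eqF ?lee_fin//.
  apply: le_poweR; rewrite ?invr_ge0 ?(ltW r0)//; first exact: (vint_ge0 vlow_lty x0).
  by rewrite poweR_EFin; exact: vint_le.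
by rewrite -EFinM lee_fin mulrC divfK ?gt_eqF.
Qed.

Lemma I2_le : q < 1 -> (I2 p q u v w <= (nec_const p q (test_const p) * c)%:E)%E.
Proof.
move=> q1; have k0 : 0 < star q by rewrite divr_gt0 ?subr_gt0.
have psE := psi_funE vlow_lty vint_lty.
have H := integral_necessity p0 p1 q0 c0 test_const_gt0 mu' u'0 mU U0 ndU UE mv' v'0 mw' w'0
  phi_fun_gt0 phiE (core_of_hardy_ineq Hc) test_of_vint q1 psE (measurable_psi_fun vlow_lty vint_lty)
  (psi_fun_gt0 vlow_lty vint_lty) (psi_fun_le vlow_lty vint_lty)
  (core_M_nondec p0 p1 mU U0 ndU (psi_fun_integral vlow_lty vint_lty))
  (Uint_half Upos adm) (Uint_double Upos adm)
  (left_unbounded mw' w'0 nd3) (right_unbounded mU mw' w'0 nd2) measurable_phi_fun.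
have n0 : 0 <= nec_const p q (test_const p) * c.
  by apply: mulr_ge0 => //; exact: nec_const_ge0 q1.
rewrite /I2 (I2_integralE vlow_lty vint_lty).
rewrite -[leRHS](poweRK _ _ (e := star q)) ?gt_eqF ?lee_fin//.
apply: le_poweR; [by rewrite invr_ge0 ltW| |by rewrite poweR_EFin].
by apply: integral_ge0 => x _; rewrite lee_fin mulr_ge0 ?powR_ge0.
Qed.

End bounds.

Lemma hardy_ineq_of_I1 (i : R) : 1 <= q -> I1 p q u v w = i%:E ->
  hardy_ineq p q u v w (core_const p * 2 `^ p^-1 * i).
Proof.
move=> q1 I1E.
have le_i (x : R) : 0 < x -> (wint p q u w x `^ q^-1 * vint p u v x `^ r^-1 <= i%:E)%E.
  by move=> x0; rewrite -I1E; apply: ereal_sup_ubound; exists x => //; rewrite /ray/= in_itv/= x0.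
(* [wint] is positive by non-degeneracy, so an infinite [vint x] could not be compensated in the
   product. *)
have vfin (x : R) : 0 < x -> (vint p u v x < +oo)%E.
  move=> x0; rewrite ltey; apply/eqP => vx; move: (le_i x x0).
  rewrite vx poweRyr ?invr_eq0 ?gt_eqF// gt0_muley; first by rewrite leye_eq.
  by rewrite phi_funE// poweR_EFin lte_fin powR_gt0// phi_fun_gt0.
have voo : forall t, 0 < t -> (vlow v (`]t, +oo[) < +oo)%E.
  have [//|no] := pselect (forall t, 0 < t -> (vlow v (`]t, +oo[) < +oo)%E).
  by have := vfin _ (@ltr01 R); rewrite vint_infinite// ltxx.
have bnd (x : R) : 0 < x -> phi_fun x `^ q^-1 * psi_fun x `^ r^-1 <= i.
  move=> x0; have := le_i x x0.
  by rewrite phi_funE// (psi_funE voo vfin)// !poweR_EFin -EFinM lee_fin.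
have i0 : 0 < i.
  apply: lt_le_trans (bnd 1 ltr01).
  by rewrite mulr_gt0 ?powR_gt0 ?phi_fun_gt0// (psi_fun_gt0 voo vfin).
apply: (hardy_ineq_of_core voo).
  by rewrite (mulr_ge0 (mulr_ge0 (core_const_ge0 _) (powR_ge0 _ _)) (ltW i0))// p0.
move=> h mh h0.
exact: (sufficiency_ge1 p0 p1 q0 mu' u'0 mU U0 ndU UE measurable_V_fun (V_fun_gt0 voo) (V_fun_tail voo)
  (measurable_psi_fun voo vfin) (psi_fun_gt0 voo vfin) (psi_fun_integral voo vfin) mw' w'0 phiE mh h0 q1 i0 bnd).
Qed.

Lemma hardy_ineq_of_I2 (i : R) : q < 1 -> I2 p q u v w = i%:E ->
  hardy_ineq p q u v w (suf_const p q * i).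
Proof.
move=> q1 I2E; have k0 : 0 < star q by rewrite divr_gt0 ?subr_gt0.
(* Infinite total mass excludes both degenerate cases below: [vint] infinite everywhere, and [I2]
   equal to 0. *)
have wint_infinite : (\int[mu]_(x in ray 0%R) (w' x)%:E = +oo)%E.
  apply/eqP; rewrite -leye_eq -nd3.
  apply: subset_integralT; [exact: mray|exact: mray|exact: mfE|by move=> x; rewrite lee_fin|].
  by move=> x; rewrite /ray/= !in_itv/= !andbT; exact: lt_trans.
(* If [vint] were infinite everywhere, the integrand of [I2] would be infinite wherever w > 0, and
   it would dominate [w]. *)
have [x1 [x10 vx1]] : exists x : R, 0 < x /\ (vint p u v x < +oo)%E.
  apply/not_existsP => no.
  have vy (x : R) : 0 < x -> vint p u v x = +oo%E.
    move=> x0; apply/eqP; rewrite -leye_eq leNgt; apply/negP => vx; apply: (no x); split => //.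
  move: I2E; rewrite /I2.
  have -> : (\int[mu]_(x in ray 0%R) (wint p q u w x `^ star q * vint p u v x `^ (star q / star p) * (w x)%:E) = +oo)%E.
    apply/eqP; rewrite -leye_eq -[leLHS]wint_infinite.
    rewrite (eq_integral (fun x => +oo * (w' x)%:E)%E (fun x => wint p q u w x `^ star q * _ * _)%E); last first.
      move=> x /[!inE] /ray0E x0; have kr : star q / star p != 0 by rewrite gt_eqF// divr_gt0.
      rewrite (vy x x0) (poweRyr kr) gt0_muley; first by rewrite /w' restrictE.
      by rewrite phi_funE// poweR_EFin lte_fin powR_gt0// phi_fun_gt0.
    apply: ge0_le_integral; [exact: mray|by move=> x _; rewrite lee_fin|exact: mfE| |].
      by apply: emeasurable_funM => //; exact: mfE.
    move=> x _; have [->|wx] := eqVneq (w' x) 0; first by rewrite mule0.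
    by rewrite gt0_mulye ?leey// lte_fin lt_def wx w'0.
  by rewrite poweRyr ?invr_eq0 ?gt_eqF.
have voo : forall t, 0 < t -> (vlow v (`]t, +oo[) < +oo)%E.
  have [//|no] := pselect (forall t, 0 < t -> (vlow v (`]t, +oo[) < +oo)%E).
  by move: vx1; rewrite vint_infinite// ltxx.
(* Finiteness at [x1] propagates to every point by comparability of the kernels. *)
have vfin (x : R) : 0 < x -> (vint p u v x < +oo)%E.
  move=> x0; have r10 : 0 < 1 + r by rewrite addr_gt0.
  rewrite (vintE voo x0); apply: (stieltjes_kernel_lty r10 mU U0 x10 x0).
  by rewrite -(vintE voo x10).
have i_ge0 : 0 <= i by rewrite -lee_fin -I2E poweR_ge0.
have ik : (\int[mu]_(x in ray 0%R) ((phi_fun x * psi_fun x `^ r^-1) `^ star q * w' x)%:E = (i `^ star q)%:E)%E.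
  rewrite -(I2_integralE voo vfin) -poweR_EFin -I2E /I2 poweRVK ?gt_eqF//.
  apply: integral_ge0 => x /ray0E x0; rewrite mule_ge0 ?mule_ge0 ?poweR_ge0// lee_fin.
  by case: ww => _; exact.
(* A zero integral would force w = 0 almost everywhere, since the other factors of the integrand are
   positive. *)
have i0 : 0 < i.
  rewrite lt_def i_ge0 andbT; apply/eqP => iz; move: ik; rewrite iz powR0 ?gt_eqF// => J0.
  have ps0 (x : R) : 0 < x -> 0 < (phi_fun x * psi_fun x `^ r^-1) `^ star q.
    move=> x0; apply: powR_gt0; apply: mulr_gt0; first exact: phi_fun_gt0.
    by apply: powR_gt0; exact: (psi_fun_gt0 voo vfin).
  have mJ : measurable_fun (ray 0%R : set TR) (fun x => ((phi_fun x * psi_fun x `^ r^-1) `^ star q * w' x)%:E).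
    apply: mfE; apply: measurable_funM => //; apply: (measurableT_comp (measurable_powR _)).
    apply: measurable_funM; first exact: measurable_phi_fun.
    exact: (measurableT_comp (measurable_powR _) (measurable_psi_fun voo vfin)).
  have J_ge0 x : ray 0%R x -> (0 <= ((phi_fun x * psi_fun x `^ r^-1) `^ star q * w' x)%:E)%E.
    by move=> _; rewrite lee_fin mulr_ge0 ?powR_ge0.
  have ae0 := ge0_integral_eq0_ae (mray 0) mJ J_ge0 J0.
  suff : (\int[mu]_(x in ray 0%R) (w' x)%:E = 0)%E by rewrite wint_infinite.
  apply: ae_eq0_ge0_integral; [exact: mray|exact: mfE|by move=> x _; rewrite lee_fin|].
  case: ae0 => N [mN N0 NP]; exists N; split => // x /= nx; apply: NP => /= Hx.
  apply: nx => rx; have := Hx rx; rewrite EFinM => /eqP; rewrite -EFinM eqe mulf_eq0.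
  by rewrite gt_eqF ?ps0 ?(ray0E rx)//= => /eqP ->.
have sc0 : 0 <= suf_const p q * i.
  apply: mulr_ge0 => //; rewrite /suf_const; apply: mulr_ge0; last exact: powR_ge0.
  by apply: mulr_ge0; [exact: powR_ge0|apply: core_const_ge0; rewrite p0].
apply: (hardy_ineq_of_core voo sc0) => h mh h0.
have ik' : (\int[mu]_(x in ray 0%R) ((phi_fun x * psi_fun x `^ (star p)^-1) `^ star q * w' x)%:E <= (i `^ star q)%:E)%E.
  by rewrite -ik.
exact: (sufficiency_lt1 p0 p1 q0 mu' u'0 mU U0 ndU UE measurable_V_fun (V_fun_gt0 voo) (V_fun_tail voo)
  (measurable_psi_fun voo vfin) (psi_fun_gt0 voo vfin) (psi_fun_integral voo vfin) mw' w'0 phiE mh h0 q1 i0 measurable_phi_fun ik').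
Qed.

(** Common to both ranges of q. A bound of [I] by every admissible constant gives the lower estimate
    of the infimum, and the admissible constant C1 I gives the upper one; if [I] is infinite, no
    constant is admissible and the infimum is infinite as well. *)
Lemma characterization (I : \bar R) (C1 C2 lam : R) : (0 <= I)%E -> 0 <= C1 -> 0 < lam ->
  C1 <= lam -> C2 <= lam ->
  (forall c, 0 <= c -> hardy_ineq p q u v w c -> (I <= (C2 * c)%:E)%E) ->
  (forall i : R, I = i%:E -> hardy_ineq p q u v w (C1 * i)) ->
  ((exists2 c : R, 0 <= c & hardy_ineq p q u v w c) <-> (I < +oo)%E) /\
  approx_by lam I (best_constant p q u v w).
Proof.
move=> I0 C10 lam0 C1l C2l nec suf.
have sufI (i : R) : I = i%:E -> 0 <= C1 * i /\ hardy_ineq p q u v w (C1 * i).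
  by move=> Ii; split; [apply: mulr_ge0 => //; rewrite -lee_fin -Ii|exact: suf].
split; first split.
- by move=> [c c0 /(nec _ c0) H]; exact: le_lt_trans H (ltry _).
- by move: sufI I0; case: I {nec suf} => [i| |]// sufI _ _; have [? ?] := sufI i erefl; exists (C1 * i).
split; last first.
  move: sufI I0; case: I {nec suf} => [i| |]// sufI i0; last by rewrite gt0_muley ?leey ?lte_fin.
  have [ci0 Hi] := sufI i erefl; apply: (@le_trans _ _ (C1 * i)%:E).
    by apply: ereal_inf_lbound; exists (C1 * i).
  by rewrite -EFinM lee_fin; apply: ler_wpM2r; rewrite -?lee_fin.
apply: le_ereal_inf_tmp => _ [c [c0 Hc] <-].
rewrite lee_pdivrMl//; apply: (le_trans (nec c c0 Hc)).
by rewrite -EFinM lee_fin; apply: ler_wpM2r.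
Qed.

End instance.

Theorem theorem4p1 (R : realType) (p q : R) :
  0 < p -> p < 1 -> 0 < q ->
  exists2 lambda : R, 0 < lambda &
  forall u v w : R -> R,
    weight u -> weight v -> weight w ->
    vlow v `]t, +oo[ @[t --> +oo] --> 0%E ->
    (forall t, 0 < t -> 0 < Uint u t) ->
    admissible_prim (Uint u) ->
    nondegenerate_wrt (Uint u) (q / p) w ->
    (1 <= q ->
      ((exists2 c : R, 0 <= c & hardy_ineq p q u v w c) <->
       (I1 p q u v w < +oo)%E) /\
      approx_by lambda (I1 p q u v w) (best_constant p q u v w)) /\
    (q < 1 ->
      ((exists2 c : R, 0 <= c & hardy_ineq p q u v w c) <->
       (I2 p q u v w < +oo)%E) /\
      approx_by lambda (I2 p q u v w) (best_constant p q u v w)).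
Proof.
move=> p0 p1 q0.
have p01 : 0 < p < 1 by rewrite p0.
pose a1 := core_const p * 2 `^ p^-1; pose a2 := suf_const p q.
(* The constants are fixed before q is compared with 1, and [nec_const] is known to be nonnegative
   only for q < 1; hence the absolute value. *)
pose b1 := test_const p `^ p^-1; pose b2 := `|nec_const p q (test_const p)|.
have a10 : 0 <= a1 by apply: mulr_ge0; [exact: core_const_ge0|exact: powR_ge0].
have a20 : 0 <= a2.
  rewrite /a2 /suf_const; apply: mulr_ge0; last exact: powR_ge0.
  by apply: mulr_ge0; [exact: powR_ge0|exact: core_const_ge0].
have b10 : 0 <= b1 by exact: powR_ge0.
have b20 : 0 <= b2 by exact: normr_ge0.
have n2 : nec_const p q (test_const p) <= b2 by exact: ler_norm.
(* A single lambda for both ranges: it dominates all four constants, and the summand 1 makes it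
   positive. *)
exists (1 + a1 + a2 + b1 + b2); first by lra.
move=> u v w wu wv ww vlim Upos adm nondeg; split => q1.
- apply: (@characterization _ p q u v w _ a1 b1) => //; [|lra|lra|lra| |].
  + have x1 : ray (0 : R) 1 by rewrite /ray/= in_itv/= ltr01.
    apply: (@le_trans _ _ (wint p q u w 1 `^ q^-1 * vint p u v 1 `^ (star p)^-1)%E).
      by rewrite mule_ge0 ?poweR_ge0.
    by apply: ereal_sup_ubound; exists 1.
  + by move=> c c0 Hc; apply: I1_le.
  + by move=> i; apply: hardy_ineq_of_I1.
- apply: (@characterization _ p q u v w _ a2 (nec_const p q (test_const p))) => //; [|lra|lra|lra| |].
  + exact: poweR_ge0.
  + by move=> c c0 Hc; apply: I2_le.
  + by move=> i; apply: hardy_ineq_of_I2.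
Qed.
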